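(* Let $(\mathcal{A},\varphi)$ be a non-commutative $\ast$-probability space, let $V\subset\mathcal{A}$ be a (real) linear subspace consisting of selfadjoint elements, write $\mathcal{K}=\mathcal{K}(l^2(\mathbb{N}))$, $\widetilde\varphi=\mathrm{id}_{\mathcal{K}}\otimes\varphi$, and let $\mathfrak{A}\subset\mathcal{K}\otimes\mathcal{A}$ be the algebra of polynomials, with coefficients in $\mathcal{K}$, in elements of $\mathcal{K}\otimes V$. Then the following are equivalent: (i) all elements of $(\mathcal{K}\otimes V)_{SA}$ (the selfadjoint elements of $\mathcal{K}\otimes V$) are $\mathcal{K}$-semicircular in $(\mathcal{K}\otimes\mathcal{A},\widetilde\varphi)$; (ii) there is a real Hilbert space $\mathcal{H}$, unique up to an isometry, together with an isometry $$\psi:(V,\varphi)\to\big(\{G_0(\eta):\eta\in\mathcal{H}\},\langle\Omega,\cdot\,\Omega\rangle\big)$$ which extends to an isometric isomorphism from the closure $\overline{\mathfrak{A}}$ of $\mathfrak{A}$ with respect to $\|\widetilde{\varphi}(x^*x)\|^{1/2}$ onto $L^2(\mathcal{F}(\widetilde{H}))$.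
   Context: $B$-probability spaces. For a C*-algebra $B$, a $\ast$-$B$-probability space is a pair $(\mathcal{C},\Phi)$ of a $\ast$-algebra $\mathcal{C}$ over $B$ (so $\mathcal{C}$ is a $B$-bimodule and contains $B$) and a conditional expectation $\Phi:\mathcal{C}\to B$ (linear, positive, $\Phi(b_1cb_2)=b_1\Phi(c)b_2$, $\Phi|_B=\mathrm{id}_B$). A non-commutative $\ast$-probability space is the case $B=\mathbb{C}$ (with $\mathcal{C}$ a unital $\ast$-algebra, $\Phi(1)=1$). $\mathcal{K}=\mathcal{K}(l^2(\mathbb{N}))$ is the C*-algebra of compact operators; $\mathcal{K}\otimes\mathcal{A}$ is the (algebraic) tensor product $\ast$-algebra with bimodule structure $A(C\otimes x)=AC\otimes x$, $(C\otimes x)A=CA\otimes x$, and $(\mathcal{K}\otimes\mathcal{A},\widetilde{\varphi})$ is regarded as a $\ast$-$\mathcal{K}$-probability space. Cumulants. $NC(n)$ is the set of non-crossing partitions of $\{1,\dots,n\}$. The cumulants $k^{(n)}$, $n\geq 1$, of $(\mathcal{C},\Phi)$ are the $B$-valued $n$-linear, $B$-balanced maps determined recursively by $\Phi(a_1\cdots a_n)=\sum_{\pi\in NC(n)}k_\pi[a_1\otimes\dots\otimes a_n]$, where $k_\pi=k^{(n)}$ if $\pi$ has a single block and, in general, if $V=\{p+1,\dots,p+r\}$ is a block of $\pi$ that is an interval and $\pi'$ is $\pi$ with $V$ removed, then $k_\pi[a_1\otimes\dots\otimes a_n]=k_{\pi'}[a_1\otimes\dots\otimes a_p\otimes k^{(r)}(a_{p+1}\otimes\dots\otimes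 a_{p+r})\,a_{p+r+1}\otimes\dots\otimes a_n]$ if $p+r<n$, and $=k_{\pi'}[a_1\otimes\dots\otimes a_p]\,k^{(r)}(a_{p+1}\otimes\dots\otimes a_n)$ if $p+r=n$, $p\ge1$. A selfadjoint $x\in\mathcal{C}$ is $B$-semicircular if for every $n\ge0$ with $n\ne1$ and all $b_1,\dots,b_n\in B$, $k^{(n+1)}(x\otimes b_1x\otimes\dots\otimes b_nx)=0$. Fock objects. For a real Hilbert space $\mathcal{H}$ with complexification $\mathcal{H}_{\mathbb{C}}$, and $\eta\in\mathcal{H}$, $G_0(\eta)=a_0(\eta)+a_0^*(\eta)$ is the sum of the (free) annihilation and creation operators on the full Fock space $\mathcal{F}(\mathcal{H}_{\mathbb{C}})$ with vacuum vector $\Omega$. $\widetilde{H}=\mathcal{K}\otimes\mathcal{H}_{\mathbb{C}}$ is the $\mathcal{K}$-bimodule with $C(A\otimes x)D=CAD\otimes x$ and $\mathcal{K}$-valued inner product $\langle A\otimes x,B\otimes y\rangle=A^*B\langle x,y\rangle$; $\widetilde{H}^0$ is the set of elements of $\widetilde H$ fixed by the conjugate-linear involution $A\otimes x\mapsto A^*\otimes\bar{x}$. The full Fock bimodule is $\mathcal{F}(\widetilde{H})=\mathcal{K}\widetilde\Omega\oplus\widetilde{H}\oplus(\widetilde{H}\otimes_{\mathcal{K}}\widetilde{H})\oplus\cdots$, with $\langle A\widetilde\Omega,B\widetilde\Omega\rangle=A^*B$ and $\langle \widetilde x_1\otimes\dots\otimes \widetilde x_k,\widetilde y_1\otimes\dots\otimes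 \widetilde y_l\rangle=\delta_{kl}\langle \widetilde x_k,\langle \widetilde x_1\otimes\dots\otimes \widetilde x_{k-1},\widetilde y_1\otimes\dots\otimes \widetilde y_{k-1}\rangle \widetilde y_k\rangle$. For $\widetilde x\in\widetilde H$, $G(\widetilde{x})=a(\widetilde{x})+a^*(\widetilde{x})$, where $a(\widetilde x)$ kills $\mathcal{K}\widetilde\Omega$, $a(\widetilde x)(\widetilde x_1\otimes\dots\otimes \widetilde x_m)=\langle\widetilde x,\widetilde x_1\rangle \widetilde x_2\otimes\dots\otimes \widetilde x_m$, $a^*(\widetilde x)A\widetilde\Omega=\widetilde xA$, $a^*(\widetilde x)(\widetilde x_1\otimes\dots\otimes \widetilde x_m)=\widetilde x\otimes \widetilde x_1\otimes\dots\otimes \widetilde x_m$. With $\mathcal{K}$ acting on $\mathcal{F}(\widetilde H)$ by left multiplication, let $\mathfrak{B}$ be the algebra of polynomials in $\{G(\widetilde{x}):\widetilde{x}\in\widetilde{H}^0\}$ with coefficients in $\mathcal{K}$. For $T\in\mathfrak{B}$, $\langle\widetilde\Omega,T\widetilde\Omega\rangle$ denotes the element $b\in\mathcal{K}$ such that the $\mathcal{K}\widetilde\Omega$-component of $T(A\widetilde\Omega)$ is $bA\widetilde\Omega$ for all $A\in\mathcal{K}$. $L^2(\mathcal{F}(\widetilde{H}))$ is the closure (completion) of $\mathfrak{B}$ in the norm $T\mapsto\|\langle\widetilde\Omega,T^*T\,\widetilde\Omega\rangle\|^{1/2}$. Under the identification $\mathcal{F}(\widetilde H)\cong\mathcal{K}\otimes\mathcal{F}(\mathcal{H}_{\mathbb{C}})$,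 $A\,G_0(\eta)$ denotes the operator $A\otimes G_0(\eta)$; for selfadjoint $A$ it equals $G(A\otimes\eta)$. Meaning of (ii). ''Isometry'' for $\psi$ means a real-linear map with $\varphi(ab)=\langle\Omega,\psi(a)\psi(b)\Omega\rangle$ for all $a,b\in V$ ($V$ carries the possibly degenerate form $\varphi(ab)$). The extension of $\psi$ is the one that is $\mathcal{K}$-linear and multiplicative on $\mathfrak{A}$: it sends $A\otimes v$ to $A\,\psi(v)$, and a polynomial in elements $A\otimes v$ to the corresponding polynomial in the $A\,\psi(v)$. The closure $\overline{\mathfrak{A}}$ is the completion modulo elements of zero seminorm, and ''isometric'' on it refers to the norms $\|\widetilde\varphi(x^*x)\|^{1/2}$ and $\|\langle\widetilde\Omega,T^*T\,\widetilde\Omega\rangle\|^{1/2}$.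
   Formalization: Adds the hypothesis that φ(ab) is real for all a, b in V; without it (i) does not imply (ii), e.g. for V = {z l + z̄ l*} with l the creation operator on F(ℂ) and φ the vacuum state. Condition (ii) itself forces this hypothesis. *)

(* Defs.v *)
From HB Require Import structures.
From mathcomp Require Import all_boot all_order all_algebra complex.
From mathcomp Require Import all_classical all_reals all_analysis.
From mathcomp Require Import ring lra.

Set Implicit Arguments.
Unset Strict Implicit.
Unset Printing Implicit Defensive.

Import Order.TTheory GRing.Theory Num.Theory.
Import numFieldNormedType.Exports.
Import Normc.
Local Open Scope classical_set_scope.
Local Open Scope ring_scope.

Section SquareSummable.
Variable R : realType.
Local Notation C := R[i].

Definition square_summable : {pred (nat -> C^o)} :=
  fun x => `[< cvgn (series (fun k => normc (x k : C) ^+ 2)) >].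

Lemma normc_comb (a u v : C) :
  normc (a * u + v) ^+ 2 <= normc a ^+ 2 * normc u ^+ 2 *+ 2 + normc v ^+ 2 *+ 2.
Proof.
rewrite -exprMn -normcM; move: (a * u) => {a u} [a b]; case: v => c d /=.
rewrite !sqr_sqrtr ?addr_ge0 ?sqr_ge0 //.
have := sqr_ge0 (a - c); have := sqr_ge0 (b - d); rewrite !mulr2n => h1 h2; nra.
Qed.

Lemma square_summable_submod : submod_closed square_summable.
Proof.
split.
  apply/asboolP; rewrite (_ : (fun _ => _) = fun=> 0); last first.
    by apply/funext => k /=; rewrite expr0n /= addr0 sqrtr0 expr0n.
  rewrite (_ : series _ = fun=> 0); first exact: is_cvg_cst.
  by apply/funext => n; rewrite seriesEnat /= big1.
move=> a u v /asboolP su /asboolP sv; apply/asboolP.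
have nd (w : nat -> C) : nondecreasing_seq (series (fun k => normc (w k) ^+ 2)).
  by apply/nondecreasing_seqP => n; rewrite seriesSr lerDl sqr_ge0.
apply: nondecreasing_is_cvgn; first exact: (nd (a *: u + v)).
set su' := limn _ in su; set sv' := limn _ in sv.
exists (normc a ^+ 2 * su' *+ 2 + sv' *+ 2) => _ [n _ <-].
have hu : series (fun k => normc (u k : C) ^+ 2) n <= su'.
  by apply: nondecreasing_cvgn_le; [exact: (nd u)|exact: su].
have hv : series (fun k => normc (v k : C) ^+ 2) n <= sv'.
  by apply: nondecreasing_cvgn_le; [exact: (nd v)|exact: sv].
apply: (@le_trans _ _ (normc a ^+ 2 * series (fun k => normc (u k : C) ^+ 2) n *+ 2
   + series (fun k => normc (v k : C) ^+ 2) n *+ 2)).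
  rewrite !seriesEnat /= mulr_sumr -!sumrMnl -big_split /= ler_sum // => k _.
  exact: normc_comb.
by rewrite lerD // lerMn2r ?ler_wpM2l ?sqr_ge0 ?orbT.
Qed.

HB.instance Definition _ :=
  GRing.isSubmodClosed.Build C (nat -> C^o) square_summable square_summable_submod.

Record l2 := L2 { l2val :> nat -> C^o; l2valP : l2val \in square_summable }.
HB.instance Definition _ := [isSub for l2val].
HB.instance Definition _ := [Choice of l2 by <:].
HB.instance Definition _ := [SubChoice_isSubLmodule of l2 by <:].

Definition l2dot (x y : l2) : C :=
  let z k : C := (x k : C)^* * y k in
  (limn (series (fun k => complex.Re (z k)))
     +i* limn (series (fun k => complex.Im (z k))))%C.

Definition l2norm (x : l2) : R := Num.sqrt (complex.Re (l2dot x x)).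

Lemma l2normE (x : l2) :
  l2norm x = Num.sqrt (limn (series (fun k => normc (x k : C) ^+ 2))).
Proof.
rewrite /l2norm /=; congr (Num.sqrt (limn (series _))); apply/funext => k.
case: (x k : C) => a b /=; rewrite sqr_sqrtr ?addr_ge0 ?sqr_ge0 //; ring.
Qed.

Lemma l2norm_ge0 (x : l2) : 0 <= l2norm x.
Proof. exact: sqrtr_ge0. Qed.

Lemma l2_cvg (x : l2) : cvgn (series (fun k => normc (x k : C) ^+ 2)).
Proof. by have /asboolP := l2valP x. Qed.

Lemma l2norm_comb (a : C) (x y : l2) :
  l2norm (a *: x + y) <= 2 * (normc a * l2norm x + l2norm y).
Proof.
have lim0 (z : l2) : 0 <= limn (series (fun k => normc (z k : C) ^+ 2)).
  apply: limr_ge; first exact: l2_cvg.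
  by near=> n; rewrite seriesEnat sumr_ge0 // => k _; rewrite sqr_ge0.
have nsq (z : l2) : l2norm z ^+ 2 = limn (series (fun k => normc (z k : C) ^+ 2)).
  by rewrite l2normE sqr_sqrtr.
have na : 0 <= normc a by case: a => ? ?; exact: sqrtr_ge0.
rewrite -ler_sqr ?nnegrE ?l2norm_ge0 //; last first.
  by rewrite mulr_ge0 // addr_ge0 ?mulr_ge0 ?l2norm_ge0.
apply: (@le_trans _ _ (normc a ^+ 2 * l2norm x ^+ 2 *+ 2 + l2norm y ^+ 2 *+ 2)); last first.
  have := l2norm_ge0 x; have := l2norm_ge0 y; rewrite !mulr2n => hy hx.
  have : 0 <= normc a * l2norm x by rewrite mulr_ge0.
  by rewrite -!exprMn; move: (normc a * _) => t ht; nra.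
have [sx sy] : cvgn (series (fun k => normc (x k : C) ^+ 2)) /\
   cvgn (series (fun k => normc (y k : C) ^+ 2)).
  by split; exact: l2_cvg.
rewrite !nsq.
apply: (@le_trans _ _ (limn (series ((normc a ^+ 2 *+ 2) *: (fun k => normc (x k : C) ^+ 2)
  + (2 : R) *: (fun k => normc (y k : C) ^+ 2))))).
  apply: lim_series_le.
  - exact: (@l2_cvg (a *: x + y)).
  - by apply: is_cvg_seriesD; exact: is_cvg_seriesZ.
  - move=> k /=; apply: le_trans (normc_comb a (x k) (y k)) _.
    by rewrite -mulrnAl -(mulr_natl (normc (y k) ^+ 2)).
rewrite lim_seriesD; [|exact: is_cvg_seriesZ..].
rewrite !lim_seriesZ // -[_ *: _]/(_ * _) -[2 *: _]/(2 * _).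
by apply: lerD; rewrite ?mulrnAl ?mul1r.
Unshelve. all: by end_near. Qed.

Definition compact_operator : {pred (l2 -> l2)} := fun T => `[<
  [/\ linear T,
      exists M : R, forall x, l2norm (T x) <= M * l2norm x
    & forall x : nat -> l2, (exists M : R, forall n, l2norm (x n) <= M) ->
      exists (s : nat -> nat) (y : l2), {homo s : m n / (m < n)%N} /\
        l2norm (T (x (s n)) - y) @[n --> \oo] --> 0] >].

Lemma homo_ge (s : nat -> nat) : {homo s : m n / (m < n)%N} -> forall n, (n <= s n)%N.
Proof. by move=> h; elim=> // n IH; apply: leq_ltn_trans IH (h _ _ _). Qed.

Lemma subseq_cvg (u : nat -> R) (l : R) (s : nat -> nat) :
  {homo s : m n / (m < n)%N} -> u n @[n --> \oo] --> l -> u (s n) @[n --> \oo] --> l.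
Proof.
move=> hs ul; apply: (@cvg_comp _ _ _ s u \oo \oo) => // A [N _ hN].
by exists N => // n /= Nn; apply: hN; apply: leq_trans Nn (homo_ge hs n).
Qed.

Lemma squeeze0 (u v : nat -> R) : (forall n, 0 <= u n <= v n) ->
  v @ \oo --> 0 -> u @ \oo --> 0.
Proof.
move=> uv v0; apply: (@squeeze_cvgr _ _ _ _ (fun=> 0) v) => //; last exact: cvg_cst.
by near=> n; apply: uv.
Unshelve. all: by end_near. Qed.

Lemma compact_operator_submod : submod_closed compact_operator.
Proof.
have n0 : l2norm 0 = 0.
  rewrite l2normE (_ : (fun _ => _) = fun=> 0); last first.
    by apply/funext => k /=; rewrite expr0n /= addr0 sqrtr0 expr0n.
  rewrite (_ : series _ = fun=> 0); first by rewrite lim_cst ?sqrtr0.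
  by apply/funext => n; rewrite seriesEnat /= big1.
split.
  apply/asboolP; split.
  - by move=> a x y; rewrite scaler0 addr0.
  - by exists 0 => x; rewrite n0 mul0r.
  - move=> x _; exists id, 0; split=> //.
    rewrite (_ : (fun _ => _) = fun=> 0); first exact: cvg_cst.
    by apply/funext => n /=; rewrite subr0 n0.
move=> a S T /asboolP[lS [MS bS] cS] /asboolP[lT [MT bT] cT]; apply/asboolP.
have na : 0 <= normc a by case: (a) => ? ?; exact: sqrtr_ge0.
split.
- move=> c x y; rewrite !fctE lS lT /= !scalerDr !scalerA (mulrC a c).
  by rewrite -!addrA; congr (_ + _); rewrite addrCA.
- exists (2 * (normc a * MS + MT)) => x.
  apply: le_trans (l2norm_comb _ _ _) _.
  rewrite -mulrA ler_pM2l // mulrDl lerD // -mulrA ler_wpM2l //.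
- move=> x bx; have [s [y [hs Sy]]] := cS x bx.
  have [|t [z [ht Tz]]] := cT (x \o s).
    by case: bx => M hM; exists M => n; apply: hM.
  exists (s \o t), (a *: y + z); split; first by move=> m n mn /=; apply/hs/ht.
  apply: (@squeeze0 _ (fun n => 2 * (normc a * l2norm (S (x (s (t n))) - y)
      + l2norm (T (x (s (t n))) - z)))).
    move=> n; rewrite l2norm_ge0 /=.
    rewrite !fctE /= (_ : _ + _ - _ =
       a *: (S (x (s (t n))) - y) + (T (x (s (t n))) - z)); last first.
      by rewrite scalerBr opprD -!addrA; congr (_ + _); rewrite addrCA.
    exact: l2norm_comb.
  rewrite -[X in _ --> X](mulr0 2) -[X in _ * X](addr0 0) -[X in X + _](mulr0 (normc a)).
  apply: cvgM; first exact: cvg_cst.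
  apply: cvgD; last exact: Tz.
  by apply: cvgM; [exact: cvg_cst|exact: (subseq_cvg ht Sy)].
Qed.

HB.instance Definition _ := GRing.isSubmodClosed.Build C (l2 -> l2)
  compact_operator compact_operator_submod.

Record compacts := Compacts { opval :> l2 -> l2; opvalP : opval \in compact_operator }.
HB.instance Definition _ := [isSub for opval].
HB.instance Definition _ := [Choice of compacts by <:].
HB.instance Definition _ := [SubChoice_isSubLmodule of compacts by <:].

Lemma compact_operator_comp (S T : compacts) : S \o T \in compact_operator.
Proof.
have /asboolP[lS [MS bS] cS] := opvalP S; have /asboolP[lT [MT bT] cT] := opvalP T.
have hM x : MS * l2norm x <= `|MS| * l2norm x.
  by rewrite ler_wpM2r ?l2norm_ge0 ?ler_norm.
apply/asboolP; split.
- by move=> a x y /=; rewrite lT lS.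
- exists (`|MS| * MT) => x /=; apply: le_trans (bS _) _; apply: le_trans (hM _) _.
  by rewrite -mulrA ler_wpM2l.
- move=> x bx; have [s [y [hs Ty]]] := cT x bx; exists s, (S y); split=> //.
  apply: (@squeeze0 _ (fun n => `|MS| * l2norm (T (x (s n)) - y))); last first.
    by rewrite -[X in _ --> X](mulr0 `|MS|); apply: cvgM => //; exact: cvg_cst.
  move=> n /=; rewrite l2norm_ge0 /=.
  rewrite (_ : S (T (x (s n))) - S y = S (T (x (s n)) - y)).
    exact: le_trans (bS _) (hM _).
  by rewrite -scaleN1r addrC -lS scaleN1r addrC.
Qed.

End SquareSummable.

Section Compacts.
Variable R : realType.
Local Notation C := R[i].
Local Notation K := (compacts R).

Definition opmul (A B : K) : K := Compacts (compact_operator_comp A B).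

(* The adjoint of a compact operator exists in K and is unique; [xget] selects it. *)
Definition opadj (A : K) : K :=
  xget 0 [set B : K | forall x y : l2 R, l2dot (A x) y = l2dot x (B y)].

Definition opnorm (A : K) : R :=
  sup [set l2norm (A x) | x in [set x : l2 R | l2norm x <= 1]].

End Compacts.

(* The complex vector space with generators W subject to every linear relation  *)
(* that is satisfied by all functionals f : W -> C with T f.  It is realised as *)
(* the span of the evaluations at the elements of W, inside the functions on T  *)
(* (Ryan's construction of the algebraic tensor product, where T is the set of  *)
(* bilinear forms).  If T is the set of the f whose linear extension to the     *)
(* free vector space on W kills a subspace N, this is the quotient by N.        *)
Section PresentedModule.
Variables (R : realType) (W : Type) (T : set (W -> R[i])).
Local Notation C := R[i].

Definition combination (s : seq (C * W)) : {f : W -> C | T f} -> C^o :=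
  fun f => \sum_(p <- s) p.1 * sval f p.2.

Definition is_combination : {pred ({f : W -> C | T f} -> C^o)} :=
  fun F => `[< exists s, F = combination s >].

Lemma is_combination_submod : submod_closed is_combination.
Proof.
split.
  by apply/asboolP; exists [::]; apply/funext => f; rewrite /combination big_nil.
move=> a F G /asboolP[s ->] /asboolP[t ->]; apply/asboolP.
exists ([seq (a * p.1, p.2) | p <- s] ++ t); apply/funext => f.
rewrite /combination fctE big_cat big_map /=; congr (_ + _).
rewrite [LHS]mulr_sumr; by apply: eq_bigr => p _; rewrite mulrA.
Qed.

HB.instance Definition _ := GRing.isSubmodClosed.Build C
  ({f : W -> C | T f} -> C^o) is_combination is_combination_submod.

Record presented := Presented {
  presented_val :> {f : W -> C | T f} -> C^o;
  presentedP : presented_val \in is_combination }.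
HB.instance Definition _ := [isSub for presented_val].
HB.instance Definition _ := [Choice of presented by <:].
HB.instance Definition _ := [SubChoice_isSubLmodule of presented by <:].

Lemma generator_subproof (w : W) : combination [:: (1, w)] \in is_combination.
Proof. by apply/asboolP; exists [:: (1, w)]. Qed.

Definition generator (w : W) : presented := Presented (generator_subproof w).

Definition expression (z : presented) : seq (C * W) :=
  projT1 (cid (asboolW (presentedP z))).

(* Linear extension of h, computed on a chosen expression of z in the generators; *)
(* independent of the choice when h satisfies the defining relations.             *)
Definition lin_ext (M : lmodType C) (h : W -> M) (z : presented) : M :=
  \sum_(p <- expression z) p.1 *: h p.2.

Definition antilin_ext (M : lmodType C) (h : W -> M) (z : presented) : M :=
  \sum_(p <- expression z) (p.1)^* *: h p.2.

End PresentedModule.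

(* When h turns admissible functionals into admissible functionals, lin_ext h is *)
(* the transpose of that operation, so it does not depend on any choice.         *)
Lemma lin_extE (R : realType) (W W' : Type) (T : set (W -> R[i])) (T' : set (W' -> R[i]))
    (h : W -> presented T') (f : {f | T' f}) (hf : T (fun w => h w f)) (z : presented T) :
  lin_ext h z f = z (exist _ _ hf).
Proof.
have e : presented_val z = combination (expression z).
  by rewrite /expression; case: cid.
rewrite [RHS](congr1 (fun F => F _) e) /lin_ext /combination.
by elim/big_rec2: _ => // p y x _ <-.
Qed.

Section Tensor.
Variables (R : realType) (U V : lmodType R[i]).
Local Notation C := R[i].

Definition bilinear_form (f : U * V -> C) : Prop :=
  (forall v a u u', f (a *: u + u', v) = a * f (u, v) + f (u', v)) /\
  (forall u a v v', f (u, a *: v + v') = a * f (u, v) + f (u, v')).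

Definition tensor := presented bilinear_form.
HB.instance Definition _ := GRing.Lmodule.on tensor.

Definition tens (u : U) (v : V) : tensor := generator bilinear_form (u, v).

Definition tens_ext (M : lmodType C) (h : U -> V -> M) : tensor -> M :=
  lin_ext (fun p => h p.1 p.2).

Definition tens_antiext (M : lmodType C) (h : U -> V -> M) : tensor -> M :=
  antilin_ext (fun p => h p.1 p.2).

End Tensor.

Record starProbSpace (R : realType) := StarProbSpace {
  spsort :> algType R[i];
  star : spsort -> spsort;
  phi : {scalar spsort};
  star_antilinear : forall (a : R[i]) x y, star (a *: x + y) = a^* *: star x + star y;
  starM : forall x y, star (x * y) = star y * star x;
  starK : involutive star;
  phi1 : phi 1 = 1;
  phi_ge0 : forall x, 0 <= phi (star x * x) }.

Arguments phi {R s}.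

Record realHilbert (R : realType) := RealHilbert {
  hilbert_sort :> completeNormedModType R;
  hdot : hilbert_sort -> hilbert_sort -> R;
  hdotC : forall x y, hdot x y = hdot y x;
  hdot_linear : forall y a x x', hdot (a *: x + x') y = a * hdot x y + hdot x' y;
  hdot_norm : forall x, hdot x x = `|x| ^+ 2 }.

Section Complexification.
Variables (R : realType) (H : realHilbert R).
Local Notation C := R[i].

(* (x, y) stands for x + i y *)
Definition complexification : Type := (H * H)%type.
HB.instance Definition _ := GRing.Zmodule.on complexification.

Definition cscale (c : C) (z : complexification) : complexification :=
  let: (a +i* b)%C := c in (a *: z.1 - b *: z.2, a *: z.2 + b *: z.1).

Lemma cscaleA a b z : cscale a (cscale b z) = cscale (a * b) z.
Proof.
case: a b z => [a a'] [b b'] [x y]; rewrite /cscale /=.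
rewrite !scalerDr !scalerN !scalerA !scalerDl !scaleNr !opprD -!addrA.
by congr ((_ + _, _ + _)); rewrite [RHS]addrC -addrA.
Qed.

Lemma cscale1 : left_id 1 cscale.
Proof. by case=> x y; rewrite /cscale /= !scale1r !scale0r subr0 addr0. Qed.

Lemma cscaleDr : right_distributive cscale +%R.
Proof.
case=> a b [x y] [x' y'] /=; congr pair; rewrite !scalerDr ?opprD.
  by rewrite addrACA.
by rewrite addrACA.
Qed.

Lemma cscaleDl z : {morph cscale^~ z : a b / a + b}.
Proof.
case: z => x y [a a'] [b b'] /=; congr pair; rewrite !scalerDl ?opprD.
  by rewrite addrACA.
by rewrite addrACA.
Qed.

HB.instance Definition _ := GRing.Zmodule_isLmodule.Build C complexification
  cscaleA cscale1 cscaleDr cscaleDl.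

Definition to_complex (x : H) : complexification := (x, 0).

Definition cconj (z : complexification) : complexification := (z.1, - z.2).

Definition cdot (z w : complexification) : C :=
  ((hdot z.1 w.1 + hdot z.2 w.2) +i* (hdot z.1 w.2 - hdot z.2 w.1))%C.

End Complexification.

(* The operations of an algebra B and of a B-bimodule with a B-valued inner      *)
(* product; no axiom is needed to define the full Fock bimodule. It is used with *)
(* B = C and with B = K.                                                         *)
Record fockData (R : realType) := FockData {
  coef : lmodType R[i];
  onep : lmodType R[i];
  cmul : coef -> coef -> coef;
  cadj : coef -> coef;
  lact : coef -> onep -> onep;
  ract : onep -> coef -> onep;
  bdot : onep -> onep -> coef }.

Section Fock.
Variables (R : realType) (D : fockData R).
Local Notation C := R[i].
Local Notation B := (coef D).
Local Notation X := (onep D).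

(* Vac b is b Omega; Tens x s is x (x) s_1 (x) ... (x) s_m. *)
Inductive word := Vac of B | Tens of X & seq X.

(* the word s_1 (x) ... (x) s_k (x) x (x) t_1 (x) ... (x) t_m *)
Definition insert (s : seq X) (x : X) (t : seq X) : word :=
  if s is y :: s' then Tens y (s' ++ x :: t) else Tens x t.

Definition balanced_multilinear (f : word -> C) : Prop :=
  [/\ forall a b b', f (Vac (a *: b + b')) = a * f (Vac b) + f (Vac b'),
      forall s t a x x', f (insert s (a *: x + x') t) =
                         a * f (insert s x t) + f (insert s x' t)
    & forall s t x b y, f (insert s (ract x b) (y :: t)) =
                        f (insert s x (lact b y :: t))].

(* B Omega + X + X (x)_B X + ... , an algebraic direct sum *)
Definition fock := presented balanced_multilinear.
HB.instance Definition _ := GRing.Lmodule.on fock.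

Definition vac (b : B) : fock := generator balanced_multilinear (Vac b).
Definition tensor_word (x : X) (s : seq X) : fock :=
  generator balanced_multilinear (Tens x s).

Definition vac_component : fock -> B :=
  lin_ext (fun w => if w is Vac b then b else 0).

Definition fock_lact (b : B) : fock -> fock :=
  lin_ext (fun w => match w with
    | Vac c => vac (cmul b c)
    | Tens x s => tensor_word (lact b x) s
    end).

Definition creation (x : X) : fock -> fock :=
  lin_ext (fun w => match w with
    | Vac b => tensor_word (ract x b) [::]
    | Tens y s => tensor_word x (y :: s)
    end).

Definition annihilation (x : X) : fock -> fock :=
  lin_ext (fun w => match w with
    | Vac _ => 0
    | Tens y [::] => vac (bdot x y)
    | Tens y (z :: s) => tensor_word (lact (bdot x y) z) s
    end).

Definition gaussian (x : X) : fock -> fock := annihilation x + creation x.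

(* s and t list the factors from right to left and have the same length *)
Fixpoint rev_dot (s t : seq X) : B :=
  match s, t with
  | [:: x], y :: _ => bdot x y
  | x :: s', y :: t' => bdot x (lact (rev_dot s' t') y)
  | _, _ => 0
  end.

Definition word_dot (w w' : word) : B :=
  match w, w' with
  | Vac a, Vac b => cmul (cadj a) b
  | Tens x s, Tens y t =>
      if size s == size t then rev_dot (rev (x :: s)) (rev (y :: t)) else 0
  | _, _ => 0
  end.

Definition fock_dot (z z' : fock) : B :=
  antilin_ext (fun w => lin_ext (fun w' => word_dot w w') z') z.

(* the adjoint, when it exists; it is unique if fock_dot is nondegenerate *)
Definition fock_adj (T : fock -> fock) : fock -> fock :=
  xget 0 [set S : fock -> fock |
    forall z z', fock_dot (S z) z' = fock_dot z (T z')].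

(* <Omega, T Omega>: B need not have a unit, and then Omega is not in the module *)
Definition vac_exp (T : fock -> fock) : B :=
  xget 0 [set b : B | forall c, vac_component (T (vac c)) = cmul b c].

End Fock.

Section Cumulants.
Variables (Calg : Type) (B : zmodType).
Variables (mulC : Calg -> Calg -> Calg) (mulB : B -> B -> B).
Variables (lactC : B -> Calg -> Calg) (Phi : Calg -> B).

Definition noncrossing n (P : {set {set 'I_n}}) : bool :=
  [forall V in P, forall W in P, forall a in V, forall b in W,
   forall c in V, forall d in W, [&& a < b, b < c & c < d]%N ==> (V == W)].

Definition NC n : {set {set {set 'I_n}}} :=
  [set P : {set {set 'I_n}} | finset.partition P [set: 'I_n]%SET & noncrossing P]%SET.

(* V occupies consecutive positions in l *)
Definition is_interval (I : finType) (l : seq I) (V : {set I}) : bool :=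
  all (mem V) (take #|V| (drop (find (mem V) l) l)).

(* k_P evaluated on the labelled list s, whose labels, listed in increasing     *)
(* order, form the union of P; P is reduced by one of its interval blocks, and  *)
(* m bounds the number of blocks.                                               *)
Fixpoint nc_eval (k : seq Calg -> B) (I : finType) (m : nat)
    (P : {set {set I}}) (s : seq (I * Calg)) : B :=
  if m is m'.+1 then
    if (#|P| <= 1)%N then k (map snd s) else
    if [pick V in P | is_interval (map fst s) V] is Some V then
      let p := find (mem V) (map fst s) in
      let b := k (map snd (take #|V| (drop p s))) in
      if drop (p + #|V|) s is (j, a) :: s' then
        nc_eval k m' (P :\ V) (take p s ++ (j, lactC b a) :: s')
      else mulB (nc_eval k m' (P :\ V) (take p s)) b
    else 0
  else 0.

Definition k_part (k : seq Calg -> B) n (P : {set {set 'I_n}}) (s : seq Calg) : B :=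
  nc_eval k #|P| P (zip (enum 'I_n) s).

Definition moment (s : seq Calg) : B :=
  if s is a :: s' then Phi (foldl mulC a s') else 0.

Fixpoint cumulant_upto (N : nat) (s : seq Calg) : B :=
  if N is N'.+1 then
    moment s - \sum_(P in NC (size s) | (1 < #|P|)%N) k_part (cumulant_upto N') P s
  else 0.

Definition cumulant (s : seq Calg) : B := cumulant_upto (size s) s.

Definition semicircular (starC : Calg -> Calg) (x : Calg) : Prop :=
  starC x = x /\
  forall bs : seq B, size bs <> 1%N ->
    cumulant (x :: [seq lactC b x | b <- bs]) = 0.

End Cumulants.

Section MomentCumulant.
Variables (Calg : Type) (B : zmodType).
Variables (mulC : Calg -> Calg -> Calg) (mulB : B -> B -> B).
Variables (lactC : B -> Calg -> Calg) (Phi : Calg -> B).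
Local Notation nc_eval := (nc_eval mulB lactC).
Local Notation k_part := (k_part mulB lactC).
Local Notation cumulant_upto := (cumulant_upto mulC mulB lactC Phi).
Local Notation cumulant := (cumulant mulC mulB lactC Phi).

Lemma nc_eval_ext (k1 k2 : seq Calg -> B) (I : finType) m (P : {set {set I}}) s :
  (forall t, (size t <= size s)%N -> k1 t = k2 t) ->
  nc_eval k1 m P s = nc_eval k2 m P s.
Proof.
elim: m P s => // m IH P s k12 /=; case: ifP => _; first by rewrite k12 ?size_map.
case: pickP => // V _; set p := find _ _.
have e : k1 [seq i.2 | i <- take #|V| (drop p s)] = k2 [seq i.2 | i <- take #|V| (drop p s)].
  rewrite k12 // size_map size_take size_drop; case: ifP => // h; last exact: leq_subr.
  exact: leq_trans (ltnW h) (leq_subr _ _).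
have sz : (size (drop (p + #|V|) s) <= size s - p)%N.
  by rewrite size_drop leq_sub2l ?leq_addr.
case E: (drop (p + #|V|) s) sz => [|[j a] s'] /= sz; rewrite e.
  congr mulB; apply: IH => t ht; apply: k12; apply: leq_trans ht _.
  by rewrite size_take; case: ifP => // /ltnW.
apply: IH => t; rewrite size_cat size_take /= => ht; apply: k12.
apply: leq_trans ht _; case: ltnP => h; first by rewrite -leq_subRL // ltnW.
by move: sz; rewrite (eqP h).
Qed.

Lemma k_part_ext (k1 k2 : seq Calg -> B) (s : seq Calg) (P : {set {set 'I_(size s)}}) :
  P \in NC (size s) -> (1 < #|P|)%N ->
  (forall t, (size t < size s)%N -> k1 t = k2 t) -> k_part k1 P s = k_part k2 P s.
Proof.
rewrite inE => /andP[partP _] P1 k12; rewrite /k_part.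
have szs : size (zip (enum 'I_(size s)) s) = size s by rewrite size_zip size_enum_ord minnn.
case: #|P| (P1) => // m _ /=; rewrite leqNgt P1 /=.
rewrite -/(unzip1 _) unzip1_zip ?size_enum_ord //.
case: pickP => // V /andP[VP _]; set p := find _ _.
have [cov triv n0] := and3P partP.
have V0 : V != finset.set0 by apply: contraNneq n0 => <-.
have plt : (p < size s)%N.
  have /finset.set0Pn[x xV] := V0.
  rewrite -[X in (_ < X)%N](size_enum_ord (size s)) -has_find; apply/hasP; exists x => //.
  by rewrite mem_enum.
have Vlt : (#|V| < size s)%N.
  have [W WP WV] : exists2 W, W \in P & W != V.
    have : (0 < #|P :\ V|)%N by have := cardsD1 V P; rewrite VP => e; rewrite e in P1.
    by rewrite card_gt0 => /finset.set0Pn[W]; rewrite !inE => /andP[? ?]; exists W.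
  have /finset.set0Pn[x xW] : W != finset.set0 by apply: contraNneq n0 => <-.
  rewrite -[X in (_ < X)%N]card_ord -cardsT; apply: proper_card.
  rewrite finset.properT; apply: contraTneq xW => VT.
  have /finset.trivIsetP/(_ _ _ WP VP WV) := triv.
  by rewrite VT disjoint_sym disjoint_subset => /fintype.subsetP/(_ x (finset.in_setT _)).
have V1 : (0 < #|V|)%N by rewrite card_gt0.
have -> : k1 [seq i.2 | i <- take #|V| (drop p (zip (enum 'I_(size s)) s))]
        = k2 [seq i.2 | i <- take #|V| (drop p (zip (enum 'I_(size s)) s))].
  apply: k12; rewrite size_map size_take; case: ifP => // /negbT; rewrite -leqNgt => h.
  exact: leq_ltn_trans h Vlt.
case E: (drop (p + #|V|) _) => [|[j a] s'].
  congr mulB; apply: nc_eval_ext => t ht; apply: k12; apply: leq_ltn_trans ht _.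
  by rewrite size_take szs plt.
apply: nc_eval_ext => t ht; apply: k12; apply: leq_ltn_trans ht _.
rewrite size_cat size_take szs plt.
have := congr1 size E; rewrite size_drop szs /= => <-; rewrite subnDA.
have : (size s - p - #|V| < size s - p)%N by rewrite ltn_subrL V1 subn_gt0.
by rewrite -(ltn_add2l p) => /leq_trans; apply; rewrite subnKC // ltnW.
Qed.

Lemma cumulant_upto_stable N M s : (size s <= N)%N -> (size s <= M)%N ->
  cumulant_upto N s = cumulant_upto M s.
Proof.
have nil0 L : cumulant_upto L [::] = 0.
  case: L => //= L; rewrite sub0r big1 ?oppr0 // => P /andP[_].
  rewrite ltnNge (leq_trans (max_card _)) //.
  by rewrite -cardsT -powersetT card_powerset cardsT card_ord.
elim: N M s => [|N IH] M s; first by rewrite leqn0 => /nilP ->; rewrite !nil0.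
case: M => [|M]; first by rewrite leqn0 => _ /nilP ->; rewrite !nil0.
move=> hN hM /=; congr (_ - _); apply: eq_bigr => P /andP[PNC P1].
apply: k_part_ext => // t ht.
by apply: IH; rewrite -ltnS; [exact: leq_trans ht hN|exact: leq_trans ht hM].
Qed.

(* the moment-cumulant formula, which determines the cumulants *)
Lemma moment_cumulant (s : seq Calg) : (0 < size s)%N ->
  moment mulC Phi s = \sum_(P in NC (size s)) k_part cumulant P s.
Proof.
move=> s0; have [n E] : exists n, size s = n.+1 by exists (size s).-1; rewrite prednK.
have hT : [set [set: 'I_(size s)]]%SET \in NC (size s).
  rewrite inE; apply/andP; split.
    rewrite /finset.partition /finset.cover big_set1 eqxx finset.trivIset1 inE /=.
    by rewrite eq_sym -card_gt0 cardsT card_ord E.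
  apply/forall_inP => V /finset.set1P VT; apply/forall_inP => W /finset.set1P WT.
  apply/forall_inP => a _; apply/forall_inP => b _.
  apply/forall_inP => c _; apply/forall_inP => d _.
  by rewrite VT WT eqxx implybT.
rewrite (bigD1 _ hT) /=.
have -> : k_part cumulant [set [set: 'I_(size s)]]%SET s = cumulant s.
  by rewrite /k_part cards1 /= cards1 /= -/(unzip2 _) unzip2_zip // size_enum_ord.
have -> : cumulant s = moment mulC Phi s
    - \sum_(P in NC (size s) | (1 < #|P|)%N) k_part cumulant P s.
  rewrite {1}/cumulant [X in cumulant_upto X]E /=; congr (_ - _).
  apply: eq_bigr => P /andP[PNC P1]; apply: k_part_ext => // t.
  by rewrite E ltnS => ht; exact: cumulant_upto_stable.
rewrite -[LHS]addr0 -addrA; congr (_ + _); apply/esym/eqP; rewrite addrC subr_eq0.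
rewrite [X in X == _]big_mkcondr [X in _ == X]big_mkcondr /=.
apply/eqP/eq_bigr => P PNC.
have : P \in NC (size s) by exact: PNC.
rewrite inE => /andP[/and3P[/eqP cov _ _] _].
have P0 : (0 < #|P|)%N.
  rewrite card_gt0; apply: contra_eq_neq cov => ->.
  by rewrite /finset.cover big_set0 eq_sym -card_gt0 cardsT card_ord E.
have -> : (1 < #|P|)%N = (#|P| != 1%N) by rewrite ltn_neqAle P0 andbT eq_sym.
suff -> : (P == [set [set: 'I_(size s)]]%SET) = (#|P| == 1%N) by [].
apply/eqP/cards1P.
  by move=> ->; exists [set: 'I_(size s)]%SET.
by case=> W PW; move: cov; rewrite PW /finset.cover big_set1 => ->.
Qed.

End MomentCumulant.

Section CompactTensor.
Variables (R : realType) (A : starProbSpace R) (V : set A).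
Local Notation C := R[i].
Local Notation K := (compacts R).

Definition KA := tensor K A.
HB.instance Definition _ := GRing.Lmodule.on KA.

Definition ka_mul (X Y : KA) : KA :=
  tens_ext (fun S x => tens_ext (fun T y => tens (opmul S T) (x * y)) Y) X.

Definition ka_star : KA -> KA := tens_antiext (fun (S : K) (x : A) => tens (opadj S) (star x)).

Definition ka_lact (S : K) : KA -> KA := tens_ext (fun (T : K) (x : A) => tens (opmul S T) x).

Definition ka_phi : KA -> K := tens_ext (fun (S : K) (x : A) => phi x *: S).

Definition K_semicircular (X : KA) : Prop :=
  semicircular ka_mul (@opmul R) ka_lact ka_phi ka_star X.

Definition KV : set KA := [set X | exists s : seq (K * A),
  {in s, forall p, V p.2} /\ X = \sum_(p <- s) tens p.1 p.2].

(* Coefficients S in K are embedded in K (x) A as S (x) 1. *)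
Inductive polyKV : KA -> Prop :=
| polyKV_coef S : polyKV (tens S 1)
| polyKV_var X : KV X -> polyKV X
| polyKV_lin a X Y : polyKV X -> polyKV Y -> polyKV (a *: X + Y)
| polyKV_mul X Y : polyKV X -> polyKV Y -> polyKV (ka_mul X Y).

Definition is_polyKV : {pred KA} := fun X => `[< polyKV X >].

Lemma is_polyKV_submod : submod_closed is_polyKV.
Proof.
split; last first.
  by move=> a X Y /asboolP hX /asboolP hY; apply/asboolP; exact: polyKV_lin.
apply/asboolP; apply: polyKV_var; exists [::]; split=> //.
by rewrite big_nil.
Qed.

HB.instance Definition _ := GRing.isSubmodClosed.Build C KA is_polyKV is_polyKV_submod.

Record frakA := FrakA { frakA_val :> KA; frakAP : frakA_val \in is_polyKV }.
HB.instance Definition _ := [isSub for frakA_val].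
HB.instance Definition _ := [Choice of frakA by <:].
HB.instance Definition _ := [SubChoice_isSubLmodule of frakA by <:].

Definition frakA_coef (S : K) : frakA := FrakA (asboolT (polyKV_coef S)).

Definition frakA_mul (X Y : frakA) : frakA :=
  FrakA (asboolT (polyKV_mul (asboolW (frakAP X)) (asboolW (frakAP Y)))).

Definition normA (X : frakA) : R :=
  Num.sqrt (opnorm (ka_phi (ka_mul (ka_star X) X))).

End CompactTensor.

Section FockOverCompacts.
Variables (R : realType) (H : realHilbert R).
Local Notation C := R[i].
Local Notation K := (compacts R).
Local Notation HC := (complexification H).

Definition scalar_data : fockData R :=
  @FockData R C^o HC (fun a b : C => a * b) (fun a : C => a^*)
    (fun a x => a *: x) (fun x a => a *: x) (@cdot R H).

(* G_0(eta) on the algebraic full Fock space; its bounded extension to the Hilbert *)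
(* space completion is determined by it.                                           *)
Definition G0 (eta : H) : fock scalar_data -> fock scalar_data :=
  @gaussian R scalar_data (to_complex eta).

Definition Omega : fock scalar_data := @vac R scalar_data (1 : C).

Definition Ht := tensor K HC.
HB.instance Definition _ := GRing.Lmodule.on Ht.

Definition ht_dot (x y : Ht) : K :=
  tens_antiext (fun S e =>
    tens_ext (fun T f => cdot e f *: opmul (opadj S) T) y) x.

Definition compact_data : fockData R :=
  @FockData R K Ht (@opmul R) (@opadj R)
    (fun S => tens_ext (fun T e => tens (opmul S T) e))
    (fun x S => tens_ext (fun T e => tens (opmul T S) e) x) ht_dot.

Definition Ht0 : set Ht :=
  [set x | tens_antiext (fun S e => tens (opadj S) (cconj e)) x = x].

Local Notation F := (fock compact_data).

Inductive polyG : (F -> F) -> Prop :=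
| polyG_coef (S : K) : polyG (@fock_lact R compact_data S)
| polyG_var (x : Ht) : Ht0 x -> polyG (@gaussian R compact_data x)
| polyG_lin (a : C) T T' : polyG T -> polyG T' -> polyG (a *: T + T')
| polyG_mul T T' : polyG T -> polyG T' -> polyG (T \o T').

Definition is_polyG : {pred (F -> F)} := fun T => `[< polyG T >].

Lemma is_polyG_submod : submod_closed is_polyG.
Proof.
split; last first.
  by move=> a X Y /asboolP hX /asboolP hY; apply/asboolP; exact: polyG_lin.
apply/asboolP; have := polyG_lin (-1) (polyG_coef 0) (polyG_coef 0).
by rewrite scaleN1r addNr.
Qed.

HB.instance Definition _ := GRing.isSubmodClosed.Build C (F -> F) is_polyG is_polyG_submod.

Record frakB := FrakB { frakB_val :> F -> F; frakBP : frakB_val \in is_polyG }.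
HB.instance Definition _ := [isSub for frakB_val].
HB.instance Definition _ := [Choice of frakB by <:].
HB.instance Definition _ := [SubChoice_isSubLmodule of frakB by <:].

Definition normB (T : frakB) : R :=
  Num.sqrt (opnorm (vac_exp (fock_adj T \o T))).

(* The identification of F(K (x) H_C) with K (x) F(H_C):                        *)
(* (S_1 (x) e_1) (x) ... (x) (S_m (x) e_m) |-> S_1 ... S_m (x) e_1 (x) ... (x) e_m *)
Fixpoint ident_word (x : Ht) (s : seq Ht) : tensor K (fock scalar_data) :=
  if s is y :: s' then
    tens_ext (fun S e => tens_ext (fun T xi =>
      tens (opmul S T) (@creation R scalar_data e xi)) (ident_word y s')) x
  else tens_ext (fun S e => tens S (@tensor_word R scalar_data e [::])) x.

Definition ident : F -> tensor K (fock scalar_data) :=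
  lin_ext (fun w : word compact_data => match w with
    | Vac b => tens (b : K) Omega
    | Tens x s => ident_word x s
    end).

(* T is S (x) g under this identification *)
Definition amplifies (S : K) (g : fock scalar_data -> fock scalar_data)
    (T : F -> F) : Prop :=
  forall z : F, ident (T z) = tens_ext (fun S' xi => tens (opmul S S') (g xi)) (ident z).

End FockOverCompacts.

(* The completion of U modulo the elements of seminorm 0. *)
Record completion (R : realType) (U : lmodType R[i]) (p : U -> R) := Completion {
  completion_sort :> completeNormedModType R[i];
  completion_map : {linear U -> completion_sort};
  completion_norm : forall u, `|completion_map u| = (p u)%:C%C;
  completion_dense : closure (range completion_map) = setT }.

Section Representation.
Variables (R : realType) (A : starProbSpace R) (V : set A).
Local Notation C := R[i].
Local Notation K := (compacts R).

Definition real_subspace : Prop :=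
  V 0 /\ forall (r : R) a b, V a -> V b -> V (r%:C%C *: a + b).

Section Psi.
Variables (H : realHilbert R) (psi : A -> fock (scalar_data H) -> fock (scalar_data H)).

(* psi is only relevant on V *)
Definition isometry_on_V : Prop :=
  [/\ forall (r : R) a b, V a -> V b ->
        psi (r%:C%C *: a + b) = (r%:C%C : C) *: psi a + psi b,
      forall a, V a -> exists eta : H, psi a = G0 eta
    & forall a b, V a -> V b ->
        phi (a * b) = fock_dot (Omega H) (psi a (psi b (Omega H)))].

(* Being multiplicative and fixing coefficients makes Psi K-bilinear; the three *)
(* conditions determine Psi on polynomials.                                      *)
Definition extends_psi (Psi : {linear frakA V -> frakB H}) : Prop :=
  [/\ forall x y, frakB_val (Psi (frakA_mul x y)) = Psi x \o Psi y,
      forall S, frakB_val (Psi (frakA_coef V S)) = @fock_lact R (compact_data H) S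
    & forall (x : frakA V) S v, V v -> frakA_val x = tens S v ->
        amplifies S (psi v) (Psi x)].

End Psi.

(* U is the isometric isomorphism of completions induced by Psi. *)
Definition represented_in (H : realHilbert R) : Prop :=
  exists (psi : A -> fock (scalar_data H) -> fock (scalar_data H))
         (Psi : {linear frakA V -> frakB H})
         (Abar : completion (@normA R A V)) (L2 : completion (@normB R H))
         (U : {linear Abar -> L2}),
    [/\ isometry_on_V psi, extends_psi psi Psi,
        bijective U, forall z, `|U z| = `|z|
      & forall x, U (completion_map Abar x) = completion_map L2 (Psi x)].

End Representation.

Definition isometric (R : realType) (H H' : realHilbert R) : Prop :=
  exists f : {linear H -> H'}, bijective f /\ forall x, `|f x| = `|x|.

(* Main.v *)
(** Both conditions are equivalent to the scalar Wick formula
      phi (v_1 ... v_n) = <Omega, G0(eta v_1) ... G0(eta v_n) Omega>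
    for a map eta from V to a real Hilbert space with phi (v w) = <eta v, eta w>.

    Expanding a product of operators creation + annihilation at the vacuum gives a
    sum over non-crossing pairings, so the formula says that all elements of K (x) V
    have the moments of a K-semicircular element; conversely, for the semicircular
    X = sum_j (E_jj (x) v_j), the (K-valued) moment with coefficients E_(j-1,j)
    isolates the scalar moment phi (v_1 ... v_n).

    Products of coefficients map F(K (x) H_C) to K (x) F(H_C); since any two compact
    operators factor through a common injective compact operator, S (x) x_1 ... x_n
    comes from a tensor (S_1 (x) x_1) ... (S_n (x) x_n), unique up to K-balancing, and
    the map is bijective. Under this identification the Wick formula makes the K-linear
    multiplicative extension of v |-> G0(eta v) isometric; it is onto when H is the
    Hilbert space completion of V.

    An isometric extension, tested on E_00 (x) w for words w and polarized, gives
    back the Wick formula. Finally surjectivity, compressed by E_00 and to the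
    degree-one part of Fock space, forces eta (V) to be dense, so the Gram matrix
    determines H. *)

From HB Require Import structures.
From mathcomp Require Import all_boot all_order all_algebra complex.
From mathcomp Require Import all_classical all_reals all_analysis.
From mathcomp Require Import zify ring lra.
Require Import Defs.

Set Implicit Arguments.
Unset Strict Implicit.
Unset Printing Implicit Defensive.

Import Order.TTheory GRing.Theory Num.Theory.
Import numFieldNormedType.Exports.
Import Normc.
Local Open Scope classical_set_scope.
Local Open Scope ring_scope.

(** * Tensor products presented by generators and relations *)

(** Linear extensions from [presented] are computed on a chosen expression, so each one is first
    shown independent of the choice by testing against functionals, which separate points by Zorn. A
    polynomial in K (x) V can be written in many ways, and the Wick formula controls only what the
    operators do to the vacuum. Right creation and annihilation operators close this gap: their real
    Gaussian combinations commute with every G_0 and generate the whole Fock space from the vacuum,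
    so an operator of the left Gaussian algebra that kills the vacuum is 0, and the extension of
    [psi] is well defined. As T Omega is not a vector when K has no unit, it is replaced by a symbol
    z in K (x) F(H_C) with T (c Omega) = z c, and all norms are computed on symbols. Positivity of
    the K-valued form is reduced to the scalar kernels <u, <z, w> u> and to the Schur product
    theorem. Completions are spaces of uniform limits of bounded functions, built once for both
    fields. *)

Section LinearMaps.
Variables (F : fieldType) (U V : lmodType F) (f : U -> V).
Hypothesis fl : linear f.

Lemma linear_lf0 : f 0 = 0.
Proof. by have := fl (-1) 0 0; rewrite scaler0 addr0 scaleN1r addNr. Qed.

Lemma linear_lfD x y : f (x + y) = f x + f y.
Proof. by have := fl 1 x y; rewrite !scale1r. Qed.

Lemma linear_lfZ a x : f (a *: x) = a *: f x.
Proof. by have := fl a x 0; rewrite linear_lf0 !addr0. Qed.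

Lemma linear_lfN x : f (- x) = - f x.
Proof. by rewrite -scaleN1r linear_lfZ scaleN1r. Qed.

Lemma linear_lfB x y : f (x - y) = f x - f y.
Proof. by rewrite linear_lfD linear_lfN. Qed.

Lemma linear_lf_sum (I : Type) (r : seq I) (P : pred I) (G : I -> U) :
  f (\sum_(i <- r | P i) G i) = \sum_(i <- r | P i) f (G i).
Proof. by apply: (big_morph f linear_lfD linear_lf0). Qed.
End LinearMaps.

Lemma linear_comp (F : fieldType) (U V W : lmodType F) (f : V -> W) (g : U -> V) :
  linear f -> linear g -> linear (f \o g).
Proof. by move=> fl gl a x y /=; rewrite gl fl. Qed.

(* Zorn: the functional is read off a maximal subspace that avoids m. *)
Lemma linear_functional_separates (F : fieldType) (M : lmodType F) (m : M) :
  m != 0 -> exists2 l : M -> F^o, linear l & l m != 0.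
Proof.
move=> m0.
pose P (W : set M) := (forall a x y, W x -> W y -> W (a *: x + y)) /\ ~ W m.
have [A [[Al Am] Amax]] : exists A, P A /\ forall B, A `<` B -> ~ P B.
  apply: Zorn_bigcup => G GP tot; split; last by case=> W GW; have [_] := GP _ GW.
  move=> a x y [W GW Wx] [W' GW' Wy]; have [WW'|WW'] := tot _ _ GW GW'.
    by exists W' => //; have [h _] := GP _ GW'; apply: h => //; exact: WW'.
  by exists W => //; have [h _] := GP _ GW; apply: h => //; exact: WW'.
(* [P] does not ask for 0, because the union of the empty chain is empty; [A0] adjoins it. *)
pose A0 x := A x \/ x = 0.
have A0Z a x : A0 x -> A0 (a *: x).
  case=> [Ax|->]; last by right; rewrite scaler0.
  by left; have := Al (a - 1) _ _ Ax Ax; rewrite scalerBl scale1r subrK.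
have A0l a x y : A0 x -> A0 y -> A0 (a *: x + y).
  move=> /(A0Z a) [Ax|->]; last by rewrite add0r.
  case=> [Ay|->]; last by left; rewrite addr0.
  by left; rewrite -[a *: x]scale1r; exact: Al.
have A0m : ~ A0 m by case=> // e; rewrite e eqxx in m0.
(* The span of [A0] and a vector x outside it is too large to avoid m, so m = c x + w, which is
   solved for x. Hence [A0] is a complement of the line through m, and the coefficient of m is the
   functional. *)
have ex x : exists c, A0 (x - c *: m).
  have [Ax|Ax] := pselect (A0 x); first by exists 0; rewrite scale0r subr0.
  have [[c [w [Aw mE]]]|Bm] := pselect (exists c w, A0 w /\ m = c *: x + w).
    have c0 : c != 0 by apply: contra_notN A0m => /eqP c0; rewrite mE c0 scale0r add0r.
    exists c^-1; rewrite mE scalerDr scalerA mulVf // scale1r opprD addrA subrr add0r.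
    by rewrite -scaleNr; exact: A0Z.
  pose B : set M := fun y => exists c w, A0 w /\ y = c *: x + w.
  exfalso; apply: (Amax B); last split; last by [].
    split; first by move=> y Ay; exists 0, y; rewrite scale0r add0r; split=> //; left.
    by move=> h; apply: Ax; left; apply: h; exists 1, 0; split; [right|rewrite scale1r addr0].
  move=> a y z [c [w [Aw ->]]] [d [v [Av ->]]]; exists (a * c + d), (a *: w + v).
  by split; [exact: A0l|rewrite scalerDr scalerA scalerDl addrACA].
have uniq c d x : A0 (x - c *: m) -> A0 (x - d *: m) -> c = d.
  move=> hc hd; have := A0l (-1) _ _ hc hd.
  rewrite scaleN1r opprB addrA subrK -scalerBl => h.
  apply/eqP; rewrite -subr_eq0; apply: contra_notT A0m => cd.
  by have := A0Z (c - d)^-1 _ h; rewrite scalerA mulVf // scale1r.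
pose l x := projT1 (cid (ex x)); have lP x : A0 (x - l x *: m) := projT2 (cid (ex x)).
exists l.
  move=> a x y; apply: (uniq _ _ (a *: x + y)) => //.
  have := A0l a _ _ (lP x) (lP y); rewrite scalerBr scalerDl opprD addrACA.
  by rewrite scalerA.
apply/eqP => h; have := lP m; rewrite h scale0r subr0; exact: A0m.
Qed.

Lemma functional_ext (F : fieldType) (M : lmodType F) (x y : M) :
  (forall l : M -> F^o, linear l -> l x = l y) -> x = y.
Proof.
move=> h; apply/eqP; rewrite -subr_eq0; apply: contraT => /linear_functional_separates[l ll].
by rewrite linear_lfB // h // subrr eqxx.
Qed.

Section Presented.
Variables (R : realType) (W : Type) (T : set (W -> R[i])).
Local Notation C := R[i].
Implicit Types z : presented T.

Lemma generatorE w f : generator T w f = sval f w.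
Proof. by rewrite /= /combination big_seq1 /= mul1r. Qed.

Lemma presented_comb a z z' f : (a *: z + z') f = a * z f + z' f.
Proof. by []. Qed.

Lemma presented_ext z z' : (forall f, z f = z' f) -> z = z'.
Proof. by move=> h; apply: val_inj; apply/funext. Qed.

Lemma combination_generator (s : seq (C * W)) :
  combination s = presented_val (\sum_(p <- s) p.1 *: generator T p.2).
Proof.
apply/funext => f; elim: s => [|p s IH].
  by rewrite big_nil /combination big_nil.
rewrite big_cons /combination big_cons; congr (_ + _); last exact: IH.
rewrite -[RHS]/(p.1 * combination _ f) /combination big_seq1 /=; congr (_ * _).
by rewrite mul1r.
Qed.

Lemma expressionE z : z = \sum_(p <- expression z) p.1 *: generator T p.2.
Proof.
by apply: val_inj; rewrite /= -combination_generator /expression; case: cid.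
Qed.

Lemma presented_ind (P : presented T -> Prop) :
  P 0 -> (forall a z z', P z -> P z' -> P (a *: z + z')) ->
  (forall w, P (generator T w)) -> forall z, P z.
Proof.
move=> P0 Pl Pg z; rewrite (expressionE z); elim: (expression z) => [|p s IH].
  by rewrite big_nil.
by rewrite big_cons; exact: Pl.
Qed.

Section Ext.
Variables (M : lmodType C) (h : W -> M).

(** The condition under which [lin_ext h] does not depend on the chosen expression: followed by any
    functional, h satisfies the relations encoded in T. *)
Definition admissible := forall l : M -> C^o, linear l -> T (fun w => l (h w)).

Hypothesis hadm : admissible.

(** An element of [presented T] is itself a function on T, so following [lin_ext h] by l amounts to
    evaluating at l o h. The chosen expression has disappeared; linearity and the value on
    generators then follow by [functional_ext]. *)
Lemma lin_ext_functional (l : M -> C^o) (ll : linear l) z :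
  l (lin_ext h z) = presented_val z (exist _ _ (hadm ll)).
Proof.
rewrite {2}(expressionE z) -combination_generator /lin_ext linear_lf_sum //.
by apply: eq_bigr => p _; rewrite linear_lfZ.
Qed.

Lemma lin_ext_linear : linear (lin_ext h : presented T -> M).
Proof.
move=> a x y; apply: functional_ext => l ll.
by rewrite lin_ext_functional ll !lin_ext_functional.
Qed.

Lemma lin_ext_generator w : lin_ext h (generator T w) = h w.
Proof.
apply: functional_ext => l ll; rewrite lin_ext_functional /= /combination.
by rewrite big_seq1 /= mul1r.
Qed.
End Ext.

Section AntiExt.
Variables (M : lmodType C) (h : W -> M).

(** The relations in T are linear, so the antilinear functional l o h is conjugated before it is
    tested. *)
Definition anti_admissible := forall l : M -> C^o, linear l -> T (fun w => (l (h w))^*).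

Hypothesis hadm : anti_admissible.

Lemma antilin_ext_functional (l : M -> C^o) (ll : linear l) z :
  l (antilin_ext h z) = (presented_val z (exist _ _ (hadm ll)))^*.
Proof.
rewrite {2}(expressionE z) -combination_generator /antilin_ext linear_lf_sum //.
rewrite /combination rmorph_sum; apply: eq_bigr => p _.
by rewrite linear_lfZ // rmorphM /= conjCK.
Qed.

Lemma antilin_ext_linear a (x y : presented T) :
  antilin_ext h (a *: x + y) = a^* *: antilin_ext h x + antilin_ext h y.
Proof.
apply: functional_ext => l ll.
rewrite ll !antilin_ext_functional -[X in _ = X + _]/(_ * _) -rmorphM -rmorphD.
by [].
Qed.

Lemma antilin_ext_generator w : antilin_ext h (generator T w) = h w.
Proof.
apply: functional_ext => l ll; rewrite antilin_ext_functional /= /combination.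
by rewrite big_seq1 /= mul1r conjCK.
Qed.
End AntiExt.
End Presented.

Section TensorTheory.
Variables (R : realType) (U V : lmodType R[i]).
Local Notation C := R[i].

Lemma tens_linl v : linear (fun u : U => tens u v : tensor U V).
Proof.
move=> a x y; apply: presented_ext => -[f [fl fr]].
by rewrite [RHS]presented_comb !generatorE /= fl.
Qed.

Lemma tens_linr u : linear (fun v : V => tens u v : tensor U V).
Proof.
move=> a x y; apply: presented_ext => -[f [fl fr]].
by rewrite [RHS]presented_comb !generatorE /= fr.
Qed.

Lemma tensor_ind (P : tensor U V -> Prop) :
  (forall a z z', P z -> P z' -> P (a *: z + z')) ->
  (forall u v, P (tens u v)) -> forall z, P z.
Proof.
move=> Pl Pt; apply: presented_ind => //; last by case.
by have := Pl (-1) _ _ (Pt 0 0) (Pt 0 0); rewrite scaleN1r addNr.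
Qed.

Lemma tensorE (z : tensor U V) : exists s : seq (U * V), z = \sum_(p <- s) tens p.1 p.2.
Proof.
elim/tensor_ind: z => [a z z' [s ->] [t ->]|u v]; last by exists [:: (u, v)]; rewrite big_seq1.
exists ([seq (a *: p.1, p.2) | p <- s] ++ t).
rewrite big_cat big_map scaler_sumr; congr (_ + _); apply: eq_bigr => p _ /=.
by rewrite (linear_lfZ (tens_linl _)).
Qed.

Section Ext.
Variables (M : lmodType C) (h : U -> V -> M).
Hypothesis hl : forall v, linear (fun u => h u v).
Hypothesis hr : forall u, linear (h u).

Lemma bilinear_admissible : admissible (@bilinear_form R U V) (fun p => h p.1 p.2).
Proof. by move=> l ll; split=> [v a u u'|u a v v'] /=; rewrite ?hl ?hr ll. Qed.

Lemma tens_ext_linear : linear (tens_ext h : tensor U V -> M).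
Proof. exact/lin_ext_linear/bilinear_admissible. Qed.

Lemma tens_extE u v : tens_ext h (tens u v) = h u v.
Proof. by rewrite /tens_ext /tens lin_ext_generator //; exact: bilinear_admissible. Qed.
End Ext.

Section AntiExt.
Variables (M : lmodType C) (h : U -> V -> M).
Hypothesis hl : forall v a u u', h (a *: u + u') v = a^* *: h u v + h u' v.
Hypothesis hr : forall u a v v', h u (a *: v + v') = a^* *: h u v + h u v'.

Lemma antibilinear_admissible : anti_admissible (@bilinear_form R U V) (fun p => h p.1 p.2).
Proof.
by move=> l ll; split=> [v a u u'|u a v v'] /=; rewrite ?hl ?hr ll rmorphD rmorphM /= conjCK.
Qed.

Lemma tens_antiext_linear a (x y : tensor U V) :
  tens_antiext h (a *: x + y) = a^* *: tens_antiext h x + tens_antiext h y.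
Proof. exact/antilin_ext_linear/antibilinear_admissible. Qed.

Lemma tens_antiextE u v : tens_antiext h (tens u v) = h u v.
Proof. by rewrite /tens_antiext /tens antilin_ext_generator //; exact: antibilinear_admissible. Qed.
End AntiExt.
End TensorTheory.

(** * Positive semidefinite kernels *)

Section PositiveKernels.
Variable R : realType.
Local Notation C := R[i].

Lemma conjcE (a b : R) : ((a +i* b)%C : C)^* = (a -i* b)%C.
Proof. by []. Qed.

Lemma ge0_complexE (z : C) : (0 <= z) = (complex.Im z == 0) && (0 <= complex.Re z).
Proof. by case: z => a b; rewrite lecE /=. Qed.

Lemma conj_ge0 (z : C) : 0 <= z -> z^* = z.
Proof. by case: z => a b; rewrite ge0_complexE conjcE /= => /andP[/eqP -> _]; rewrite oppr0. Qed.

Lemma conjcM (a b : C) : (a * b)^* = a^* * b^*. Proof. exact: rmorphM. Qed.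
Lemma conjcD (a b : C) : (a + b)^* = a^* + b^*. Proof. exact: rmorphD. Qed.
Lemma conjcN (a : C) : (- a)^* = - a^*. Proof. exact: rmorphN. Qed.
Lemma conjcV (a : C) : (a^-1)^* = (a^*)^-1. Proof. exact: fmorphV. Qed.
Lemma conjc0 : (0 : C)^* = 0. Proof. exact: rmorph0. Qed.
Lemma conjc1 : (1 : C)^* = 1. Proof. exact: rmorph1. Qed.
Lemma conjc_sum (I : Type) (r : seq I) (f : I -> C) :
  (\sum_(i <- r) f i)^* = \sum_(i <- r) (f i)^*.
Proof. exact: rmorph_sum. Qed.

Section Kernel.
Variable W : Type.
Implicit Types (k : W -> W -> C) (s : seq (C * W)).

Definition kernel_form k s : C := \sum_(p <- s) \sum_(q <- s) p.1^* * q.1 * k p.2 q.2.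

Definition psd k := forall s, 0 <= kernel_form k s.

Lemma kernel_form_cons k p s :
  kernel_form k (p :: s) = p.1^* * p.1 * k p.2 p.2
    + p.1^* * (\sum_(q <- s) q.1 * k p.2 q.2)
    + p.1 * (\sum_(q <- s) q.1^* * k q.2 p.2) + kernel_form k s.
Proof.
rewrite /kernel_form big_cons big_cons -!addrA; congr (_ + _).
rewrite mulr_sumr; congr (_ + _); first by apply: eq_bigr => q _; rewrite mulrA.
rewrite mulr_sumr -big_split /=; apply: eq_bigr => q _.
by rewrite big_cons; congr (_ + _); rewrite mulrA (mulrC p.1).
Qed.

Lemma kernel_form1 k a x : kernel_form k [:: (a, x)] = a^* * a * k x x.
Proof. by rewrite /kernel_form !big_seq1. Qed.

Lemma kernel_form2 k a b x y : kernel_form k [:: (a, x); (b, y)] =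
  a^* * a * k x x + a^* * b * k x y + a * b^* * k y x + b^* * b * k y y.
Proof. by rewrite kernel_form_cons kernel_form1 !big_seq1 /= !mulrA. Qed.

Lemma psd_diag k x : psd k -> 0 <= k x x.
Proof. by move=> /(_ [:: (1, x)]); rewrite kernel_form1 conjc1 !mul1r. Qed.

(** Positive numbers are real. The coefficients (1, 1) make the imaginary parts of k x y and k y x
    opposite, and the coefficients (1, i) make the real parts equal. *)
Lemma psd_herm k x y : psd k -> k y x = (k x y)^*.
Proof.
move=> kp; have h1 := kp [:: (1, x); (1, y)]; have h2 := kp [:: (1, x); ('i%C, y)].
have := psd_diag x kp; have := psd_diag y kp.
rewrite !kernel_form2 in h1 h2; move: h1 h2.
case: (k x x) => a a'; case: (k y y) => b b'; case: (k x y) => c c'; case: (k y x) => d d'.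
rewrite !ge0_complexE conjcE /= => /andP[/eqP e1 _] /andP[/eqP e2 _] /andP[/eqP e3 _] /andP[/eqP e4 _].
by congr (_ +i* _)%C; lra.
Qed.

Lemma psd_cauchy_schwarz k x y : psd k -> k x y * (k x y)^* <= k x x * k y y.
Proof.
move=> kp; have kx := psd_diag x kp; have ky := psd_diag y kp.
(* The form on x and y with the coefficients 1 and - t times the conjugate of k x y. *)
have key (t : C) : 0 <= t ->
    0 <= k x x - 2 * t * (k x y * (k x y)^*) + t ^+ 2 * (k x y * (k x y)^*) * k y y.
  move=> t0; have := kp [:: (1, x); (- t * (k x y)^*, y)].
  rewrite kernel_form2 conjc1 conjcM conjcN conjCK (conj_ge0 t0) (psd_herm x y kp).
  by congr (0 <= _); ring.
have n0 : 0 <= k x y * (k x y)^* by exact: mul_conjC_ge0.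
have [ky0|ky0] := eqVneq (k y y) 0.
  rewrite ky0 mulr0; have [/eqP ->//|np] := boolP (k x y * (k x y)^* == 0).
  (* With k y y = 0 the bound is affine in t; the value t = (k x x + 1) / |k x y|^2 turns it into -
     (k x x + 2), which is negative. *)
  have := key _ (divr_ge0 (addr_ge0 kx ler01) n0); rewrite ky0 mulr0 addr0 -mulrA divfK //.
  rewrite (_ : _ - _ = - (k x x + 2)); last by ring.
  by rewrite oppr_ge0 => /(lt_le_trans (ltr_wpDl kx (ltr0Sn C 1))); rewrite ltxx.
have kyp : 0 < k y y by rewrite lt0r ky0.
have := key (k y y)^-1; rewrite invr_ge0 => /(_ ky).
rewrite -(ler_pM2r kyp) mul0r => h; rewrite -subr_ge0; apply: le_trans h _.
by rewrite le_eqVlt; apply/orP; left; apply/eqP; field.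
Qed.

Lemma psd_isotropic k x y : psd k -> k x x = 0 -> k x y = 0.
Proof.
move=> kp x0; have := psd_cauchy_schwarz x y kp; rewrite x0 mul0r => h.
have /eqP : k x y * (k x y)^* = 0 by apply/eqP; rewrite eq_le h mul_conjC_ge0.
by rewrite mul_conjC_eq0 => /eqP.
Qed.

Lemma kernel_form_rank1 (f : W -> C) s :
  kernel_form (fun x y => (f x)^* * f y) s =
  (\sum_(p <- s) p.1 * f p.2)^* * (\sum_(p <- s) p.1 * f p.2).
Proof.
rewrite conjc_sum mulr_suml; apply: eq_bigr => p _; rewrite mulr_sumr.
by apply: eq_bigr => q _; rewrite conjcM /=; ring.
Qed.

(* One step of the Cholesky decomposition. *)
Lemma psd_schur_complement k x0 : psd k -> k x0 x0 != 0 ->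
  psd (fun x y => k x y - k x x0 * k x0 y / k x0 x0).
Proof.
move=> kp k0 s; set S := \sum_(q <- s) q.1 * k x0 q.2.
have -> : kernel_form (fun x y => k x y - k x x0 * k x0 y / k x0 x0) s
        = kernel_form k s - S^* * S / k x0 x0.
  rewrite -kernel_form_rank1 /kernel_form mulr_suml -sumrB; apply: eq_bigr => p _.
  rewrite mulr_suml -sumrB; apply: eq_bigr => q _.
  by rewrite (psd_herm x0 p.2 kp); ring.
(* The coefficient of x0 that minimises the form once the other coefficients are fixed. *)
have := kp ((- S / k x0 x0, x0) :: s); rewrite kernel_form_cons /=.
have -> : \sum_(q <- s) q.1^* * k q.2 x0 = S^*.
  by rewrite conjc_sum; apply: eq_bigr => q _; rewrite conjcM /= -psd_herm.
rewrite -/S conjcM conjcN conjcV (conj_ge0 (psd_diag x0 kp)); congr (0 <= _).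
by move: (S^*) => S'; field.
Qed.

(** Schur's product theorem, by induction on the support. The rank-one part of k1 at the first point
    x0 contributes a rescaled form of k2; the rest of k1 vanishes on the row and the column of x0,
    so that x0 drops out. It yields the positivity of the Fock inner product and of the K-valued
    form. *)
Lemma psd_mul k1 k2 : psd k1 -> psd k2 -> psd (fun x y => k1 x y * k2 x y).
Proof.
move=> h1 h2 s; elim: s k1 h1 => [|[c x0] s IH] k1 h1.
  by rewrite /kernel_form big_nil.
have red k : psd k -> (forall y, k x0 y = 0) ->
    0 <= kernel_form (fun x y => k x y * k2 x y) ((c, x0) :: s).
  move=> kp k0; rewrite kernel_form_cons /= k0 mul0r mulr0 add0r.
  rewrite big1 => [|q _]; last by rewrite k0 mul0r mulr0.
  rewrite big1 => [|q _]; last by rewrite (psd_herm x0 _ kp) k0 conjc0 mul0r mulr0.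
  by rewrite !mulr0 !add0r; exact: IH.
have [k0|k0] := eqVneq (k1 x0 x0) 0.
  by apply: red => // y; exact: psd_isotropic.
pose k1' x y := k1 x y - k1 x x0 * k1 x0 y / k1 x0 x0.
set t := _ :: s.
have -> : kernel_form (fun x y => k1 x y * k2 x y) t =
  kernel_form (fun x y => k1' x y * k2 x y) t +
  (k1 x0 x0)^-1 * kernel_form k2 [seq (p.1 * k1 x0 p.2, p.2) | p <- t].
  rewrite /kernel_form big_map mulr_sumr -big_split; apply: eq_bigr => p _.
  rewrite big_map mulr_sumr -big_split; apply: eq_bigr => q _ /=.
  by rewrite /k1' conjcM /= -(psd_herm x0 p.2 h1); field.
apply: addr_ge0; last by rewrite mulr_ge0 // invr_ge0 psd_diag.
apply: red; first exact: psd_schur_complement.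
by move=> y; rewrite /k1' mulrAC divff // mul1r subrr.
Qed.
End Kernel.

Lemma psd_comp (W W' : Type) (f : W -> W') (k : W' -> W' -> C) :
  psd k -> psd (fun x y => k (f x) (f y)).
Proof.
move=> kp s; have := kp [seq (p.1, f p.2) | p <- s].
by rewrite /kernel_form big_map; congr (0 <= _); apply: eq_bigr => p _; rewrite big_map.
Qed.

Lemma psd_sesquilinear (M : lmodType C) (k : M -> M -> C) :
  (forall y a x x', k (a *: x + x') y = a^* * k x y + k x' y) ->
  (forall x a y y', k x (a *: y + y') = a * k x y + k x y') ->
  (forall x, 0 <= k x x) -> psd k.
Proof.
move=> kl kr kp s.
suff -> : kernel_form k s = k (\sum_(p <- s) p.1 *: p.2) (\sum_(p <- s) p.1 *: p.2) by [].
have sr x t : k x (\sum_(q <- t) q.1 *: q.2) = \sum_(q <- t) q.1 * k x q.2.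
  elim: t => [|q t IH]; last by rewrite !big_cons kr IH.
  by rewrite !big_nil; have := kr x (-1) 0 0; rewrite scaler0 addr0 mulN1r addNr.
have sl y t : k (\sum_(q <- t) q.1 *: q.2) y = \sum_(q <- t) q.1^* * k q.2 y.
  elim: t => [|q t IH]; last by rewrite !big_cons kl IH.
  by rewrite !big_nil; have := kl y (-1) 0 0; rewrite scaler0 addr0 conjcN conjc1 mulN1r addNr.
rewrite sl /kernel_form; apply: eq_bigr => p _; rewrite sr mulr_sumr.
by apply: eq_bigr => q _; rewrite mulrA.
Qed.

(* Gaussian elimination on the left factors. *)
Lemma bilinear_sum_eq0 (U Z M : lmodType C) (L : set (U -> C)) (b : U -> Z -> M)
    (s : seq (U * Z)) :
  (forall l, L l -> forall a u v, l (a *: u + v) = a * l u + l v) ->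
  (forall u, u != 0 -> exists2 l, L l & l u != 0) ->
  (forall z, linear (b^~ z)) -> (forall u, linear (b u)) ->
  (forall l, L l -> \sum_(p <- s) l p.1 *: p.2 = 0) ->
  \sum_(p <- s) b p.1 p.2 = 0.
Proof.
move=> Ll Lsep bl br; elim: s {-2}s (erefl (size s)) => [|a0 s0 IH] s.
  by move=> /size0nil -> _; rewrite big_nil.
case: s => // -[u z] s [sz] h.
have [u0|u0] := eqVneq u 0.
  rewrite big_cons /= u0 (linear_lf0 (bl z)) add0r; apply: IH => // l Pl.
  by have := h l Pl; rewrite big_cons /= u0 (@linear_lf0 _ U C^o l (Ll l Pl)) scale0r add0r.
have [l Pl lu] := Lsep _ u0.
(* The relation given by l is solved for z. After substitution each left factor is projected along u
   onto the kernel of l, and the list is one term shorter. *)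
have zE : z = - \sum_(p <- s) (l p.1 / l u) *: p.2.
  have := h l Pl; rewrite big_cons /= => /eqP; rewrite addr_eq0 => /eqP e.
  rewrite -[LHS](scalerK lu) e scalerN scaler_sumr; congr (- _).
  by apply: eq_bigr => p _; rewrite scalerA mulrC.
have -> : \sum_(p <- (u, z) :: s) b p.1 p.2 =
  \sum_(p <- [seq (p.1 - (l p.1 / l u) *: u, p.2) | p <- s]) b p.1 p.2.
  rewrite big_cons big_map /= {1}zE (linear_lfN (br u)) (linear_lf_sum (br u)) addrC.
  rewrite -sumrB; apply: eq_bigr => p _.
  by rewrite (linear_lfB (bl _)) (linear_lfZ (bl _)) (linear_lfZ (br _)).
apply: IH; first by rewrite size_map.
move=> m Pm; have h0 := h m Pm; rewrite -[RHS]h0 big_cons /= zE.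
rewrite big_map scalerN scaler_sumr [RHS]addrC -sumrB; apply: eq_bigr => p _ /=.
rewrite (@linear_lfB _ U C^o m (Ll m Pm)) (@linear_lfZ _ U C^o m (Ll m Pm)) scalerBl scalerA.
by rewrite -[(l p.1 / l u) *: m u]/(l p.1 / l u * m u) (mulrC (m u)).
Qed.
End PositiveKernels.

(** * Square-summable sequences *)

Section SquareSummableSequences.
Variable R : realType.
Local Notation C := R[i].
Local Notation l2 := (l2 R).
Implicit Types x y z : l2.

Lemma normc_ge0 (a : C) : 0 <= normc a.
Proof. by case: a => a b; exact: sqrtr_ge0. Qed.

Lemma sqr_normc (a : C) : normc a ^+ 2 = complex.Re a ^+ 2 + complex.Im a ^+ 2.
Proof. by case: a => a b /=; rewrite sqr_sqrtr // addr_ge0 ?sqr_ge0. Qed.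

Lemma conjc_mul_self (a : C) : a^* * a = (normc a ^+ 2)%:C%C.
Proof. by rewrite sqr_normc; case: a => a b; apply/eqP; rewrite eq_complex /=; apply/andP; split; apply/eqP; ring. Qed.

Lemma normc_conj (a : C) : normc a^* = normc a.
Proof. by case: a => a b; rewrite conjcE /= sqrrN. Qed.

Lemma Re_le_normc (a : C) : `|complex.Re a| <= normc a.
Proof. by rewrite -sqrtr_sqr -(ger0_norm (normc_ge0 a)) -(sqrtr_sqr (normc a)) ler_sqrt ?sqr_ge0 // sqr_normc lerDl sqr_ge0. Qed.

Lemma Im_le_normc (a : C) : `|complex.Im a| <= normc a.
Proof. by rewrite -sqrtr_sqr -(ger0_norm (normc_ge0 a)) -(sqrtr_sqr (normc a)) ler_sqrt ?sqr_ge0 // sqr_normc lerDr sqr_ge0. Qed.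

Lemma normc_real (a : R) : normc a%:C%C = `|a|.
Proof. by rewrite /= expr0n addr0 sqrtr_sqr. Qed.

Lemma normcE (a : C) : (normc a)%:C%C = `|a|.
Proof. by []. Qed.

Lemma ReD (a b : C) : complex.Re (a + b) = complex.Re a + complex.Re b.
Proof. by case: a => a a'; case: b. Qed.
Lemma ImD (a b : C) : complex.Im (a + b) = complex.Im a + complex.Im b.
Proof. by case: a => a a'; case: b. Qed.
Lemma ReM (a b : C) :
  complex.Re (a * b) = complex.Re a * complex.Re b - complex.Im a * complex.Im b.
Proof. by case: a => a a'; case: b. Qed.
Lemma ImM (a b : C) :
  complex.Im (a * b) = complex.Re a * complex.Im b + complex.Im a * complex.Re b.
Proof. by case: a => a a'; case: b. Qed.

Lemma Re_sum (I : Type) (r : seq I) (f : I -> C) :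
  complex.Re (\sum_(i <- r) f i) = \sum_(i <- r) complex.Re (f i).
Proof. by apply: (big_morph (fun z : C => complex.Re z)) => // -[a b] [c d]. Qed.

Lemma Im_sum (I : Type) (r : seq I) (f : I -> C) :
  complex.Im (\sum_(i <- r) f i) = \sum_(i <- r) complex.Im (f i).
Proof. by apply: (big_morph (fun z : C => complex.Im z)) => // -[a b] [c d]. Qed.

Lemma l2_ext x y : (forall k, x k = y k) -> x = y.
Proof. by move=> h; apply: val_inj; apply/funext. Qed.
Lemma l2_addE x y k : (x + y) k = x k + y k. Proof. by []. Qed.
Lemma l2_oppE x k : (- x) k = - x k. Proof. by []. Qed.
Lemma l2_scaleE a x k : (a *: x) k = a * x k. Proof. by []. Qed.
Lemma l2_0E k : (0 : l2) k = 0. Proof. by []. Qed.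
Lemma l2_sumE (I : Type) (r : seq I) (f : I -> l2) k :
  (\sum_(i <- r) f i) k = \sum_(i <- r) f i k.
Proof. by elim: r => [|i r IH]; rewrite ?big_nil // !big_cons l2_addE IH. Qed.

Definition square_partial (x : nat -> C) n : R := \sum_(0 <= k < n) normc (x k) ^+ 2.

Lemma square_partial_nd (x : nat -> C) : nondecreasing_seq (square_partial x).
Proof. by apply/nondecreasing_seqP => n; rewrite /square_partial big_nat_recr //= lerDl sqr_ge0. Qed.

Lemma square_partial_series (x : nat -> C^o) :
  series (fun k => normc (x k : C) ^+ 2) = square_partial x.
Proof. by apply/funext => n; rewrite seriesEnat. Qed.

Lemma square_summable_bounded (x : nat -> C^o) (M : R) :
  (forall n, square_partial x n <= M) -> x \in @square_summable R.
Proof.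
move=> h; apply/asboolP; rewrite square_partial_series; apply: nondecreasing_is_cvgn.
  exact: square_partial_nd.
by exists M => _ [n _ <-].
Qed.

Lemma l2norm_sqr x : l2norm x ^+ 2 = limn (square_partial x).
Proof.
rewrite l2normE square_partial_series sqr_sqrtr // limr_ge //.
  by have := @l2_cvg R x; rewrite square_partial_series.
by apply: nearW => n; rewrite sumr_ge0 // => k _; exact: sqr_ge0.
Qed.

Lemma square_partial_cvg x : square_partial x @ \oo --> l2norm x ^+ 2.
Proof. by rewrite l2norm_sqr; have := @l2_cvg R x; rewrite square_partial_series. Qed.

Lemma square_partial_le x n : square_partial x n <= l2norm x ^+ 2.
Proof.
rewrite l2norm_sqr; apply: nondecreasing_cvgn_le; first exact: square_partial_nd.
by have := @l2_cvg R x; rewrite square_partial_series.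
Qed.

Lemma l2norm_sqr_le x (M : R) : (forall n, square_partial x n <= M) -> l2norm x ^+ 2 <= M.
Proof.
move=> h; rewrite l2norm_sqr; apply: limr_le; last by apply: nearW.
by have := @l2_cvg R x; rewrite square_partial_series.
Qed.

Lemma normc_coord_le x k : normc (x k) <= l2norm x.
Proof.
rewrite -ler_sqr ?nnegrE ?normc_ge0 ?l2norm_ge0 //.
apply: le_trans (square_partial_le x k.+1).
by rewrite /square_partial big_nat_recr //= lerDr sumr_ge0 // => i _; exact: sqr_ge0.
Qed.

Definition dot_partial x y n : C := \sum_(0 <= k < n) (x k)^* * y k.

Lemma dot_partialP x y :
  (fun n => complex.Re (dot_partial x y n)) @ \oo --> complex.Re (l2dot x y) /\
  (fun n => complex.Im (dot_partial x y n)) @ \oo --> complex.Im (l2dot x y).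
Proof.
have key (g : C -> R) : (forall c, `|g c| <= normc c) ->
    cvgn (series (fun k => g ((x k : C)^* * y k))).
  move=> gz; apply: normed_cvg.
  apply: (@series_le_cvg _ _ (fun k => normc (x k : C) ^+ 2 + normc (y k : C) ^+ 2)).
  - by move=> n /=.
  - by move=> n; rewrite addr_ge0 ?sqr_ge0.
  - move=> n /=; apply: le_trans (gz _) _; rewrite normcM normc_conj.
    by have := sqr_ge0 (normc (x n : C) - normc (y n : C));
       have := normc_ge0 (x n : C); have := normc_ge0 (y n : C); nra.
  - by apply: is_cvg_seriesD; exact: l2_cvg.
split.
- rewrite (_ : (fun _ => _) = series (fun k => complex.Re ((x k : C)^* * y k))).
    exact: key Re_le_normc.
  by apply/funext => n; rewrite seriesEnat Re_sum.
- rewrite (_ : (fun _ => _) = series (fun k => complex.Im ((x k : C)^* * y k))).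
    exact: key Im_le_normc.
  by apply/funext => n; rewrite seriesEnat Im_sum.
Qed.

Lemma l2dot_unique x y (d : C) :
  (fun n => complex.Re (dot_partial x y n)) @ \oo --> complex.Re d ->
  (fun n => complex.Im (dot_partial x y n)) @ \oo --> complex.Im d -> l2dot x y = d.
Proof.
move=> h1 h2; have [h3 h4] := dot_partialP x y.
apply/eqP; rewrite eq_complex; apply/andP; split; apply/eqP.
  exact: (cvg_unique _ h3 h1).
exact: (cvg_unique _ h4 h2).
Qed.

Lemma l2dot_herm x y : l2dot y x = (l2dot x y)^*.
Proof.
have e n : dot_partial y x n = (dot_partial x y n)^*.
  by rewrite /dot_partial conjc_sum; apply: eq_bigr => k _; rewrite conjcM conjCK mulrC.
have [h1 h2] := dot_partialP x y.
apply: l2dot_unique.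
  rewrite (_ : (fun _ => _) = (fun n => complex.Re (dot_partial x y n))).
    by case: (l2dot x y) h1.
  by apply/funext => n; rewrite e; case: (dot_partial x y n).
rewrite (_ : (fun _ => _) = (fun n => - complex.Im (dot_partial x y n))).
  by move/cvgN: h2; case: (l2dot x y).
by apply/funext => n; rewrite e; case: (dot_partial x y n).
Qed.

Lemma l2dot_combr x a y z : l2dot x (a *: y + z) = a * l2dot x y + l2dot x z.
Proof.
have e n : dot_partial x (a *: y + z) n = a * dot_partial x y n + dot_partial x z n.
  rewrite /dot_partial mulr_sumr -big_split; apply: eq_bigr => k _.
  by rewrite l2_addE l2_scaleE /=; ring.
have [h1 h2] := dot_partialP x y; have [h3 h4] := dot_partialP x z.
apply: l2dot_unique.
  rewrite (_ : (fun _ => _) = (fun n => complex.Re a * complex.Re (dot_partial x y n)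
     - complex.Im a * complex.Im (dot_partial x y n) + complex.Re (dot_partial x z n))).
    rewrite ReD ReM; apply: cvgD => //.
    by apply: cvgB; apply: cvgM => //; exact: cvg_cst.
  by apply/funext => n; rewrite e ReD ReM.
rewrite (_ : (fun _ => _) = (fun n => complex.Re a * complex.Im (dot_partial x y n)
     + complex.Im a * complex.Re (dot_partial x y n) + complex.Im (dot_partial x z n))).
  rewrite ImD ImM; apply: cvgD => //.
  by apply: cvgD; apply: cvgM => //; exact: cvg_cst.
by apply/funext => n; rewrite e ImD ImM.
Qed.

Lemma l2dot_combl x a y z : l2dot (a *: y + z) x = a^* * l2dot y x + l2dot z x.
Proof. by rewrite l2dot_herm l2dot_combr conjcD conjcM -!l2dot_herm. Qed.

Lemma l2dotxx x : l2dot x x = (l2norm x ^+ 2)%:C%C.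
Proof.
have e n : dot_partial x x n = (square_partial x n)%:C%C.
  rewrite /dot_partial (@big_morph _ _ (fun r : R => r%:C%C) 0 +%R 0 +%R) //.
    by apply: eq_bigr => k _; exact: conjc_mul_self.
  by move=> a b; apply/eqP; rewrite eq_complex /= addr0 !eqxx.
apply: l2dot_unique.
  rewrite (_ : (fun _ => _) = square_partial x); first exact: square_partial_cvg.
  by apply/funext => n; rewrite e.
by rewrite (_ : (fun _ => _) = fun=> 0); [exact: cvg_cst|apply/funext => n; rewrite e].
Qed.

Lemma l2dot_psd : psd (@l2dot R).
Proof.
apply: psd_sesquilinear => [y a x x'|x a y y'|x].
- exact: l2dot_combl.
- exact: l2dot_combr.
- by rewrite l2dotxx ge0_complexE /= eqxx sqr_ge0.
Qed.

Lemma l2dot0r x : l2dot x 0 = 0.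
Proof. by have := l2dot_combr x (-1) 0 0; rewrite scaler0 addr0 mulN1r addNr. Qed.
Lemma l2dot0l x : l2dot 0 x = 0.
Proof. by rewrite l2dot_herm l2dot0r conjc0. Qed.
Lemma l2dotZr x a y : l2dot x (a *: y) = a * l2dot x y.
Proof. by have := l2dot_combr x a y 0; rewrite !addr0 l2dot0r addr0. Qed.
Lemma l2dotZl x a y : l2dot (a *: y) x = a^* * l2dot y x.
Proof. by rewrite l2dot_herm l2dotZr conjcM -l2dot_herm. Qed.
Lemma l2dotDr x y z : l2dot x (y + z) = l2dot x y + l2dot x z.
Proof. by have := l2dot_combr x 1 y z; rewrite scale1r mul1r. Qed.
Lemma l2dotDl x y z : l2dot (y + z) x = l2dot y x + l2dot z x.
Proof. by have := l2dot_combl x 1 y z; rewrite scale1r conjc1 mul1r. Qed.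
Lemma l2dotNr x y : l2dot x (- y) = - l2dot x y.
Proof. by rewrite -scaleN1r l2dotZr mulN1r. Qed.
Lemma l2dot_sumr x (I : Type) (r : seq I) (f : I -> l2) :
  l2dot x (\sum_(i <- r) f i) = \sum_(i <- r) l2dot x (f i).
Proof. by apply: (big_morph _ (l2dotDr x) (l2dot0r x)). Qed.
Lemma l2dot_suml x (I : Type) (r : seq I) (f : I -> l2) :
  l2dot (\sum_(i <- r) f i) x = \sum_(i <- r) l2dot (f i) x.
Proof. by apply: (big_morph _ (l2dotDl x) (l2dot0l x)). Qed.

Lemma l2_cauchy_schwarz x y : normc (l2dot x y) <= l2norm x * l2norm y.
Proof.
rewrite -ler_sqr ?nnegrE ?normc_ge0 ?mulr_ge0 ?l2norm_ge0 // exprMn.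
have := psd_cauchy_schwarz x y l2dot_psd.
by rewrite mulrC conjc_mul_self !l2dotxx -rmorphM lecR.
Qed.

Lemma l2normZ a x : l2norm (a *: x) = normc a * l2norm x.
Proof.
apply/eqP; rewrite -(@eqrXn2 _ 2) ?mulr_ge0 ?l2norm_ge0 ?normc_ge0 // exprMn.
have := l2dotxx (a *: x); rewrite l2dotZl l2dotZr mulrA conjc_mul_self l2dotxx -rmorphM.
by case=> <-.
Qed.

Lemma l2normN x : l2norm (- x) = l2norm x.
Proof. by rewrite -scaleN1r l2normZ normcN normc1 mul1r. Qed.

Lemma l2normD x y : l2norm (x + y) <= l2norm x + l2norm y.
Proof.
rewrite -ler_sqr ?nnegrE ?addr_ge0 ?l2norm_ge0 //.
have := l2dotxx (x + y); rewrite l2dotDl !l2dotDr !l2dotxx (l2dot_herm x y).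
have := le_trans (ler_norm _) (le_trans (Re_le_normc _) (l2_cauchy_schwarz x y)).
case: (l2dot x y) => p q /= h; rewrite conjcE => -[<- _].
by move: h; rewrite sqrrD; lra.
Qed.

Lemma l2normB x y : l2norm (x - y) <= l2norm x + l2norm y.
Proof. by rewrite -(l2normN y); exact: l2normD. Qed.

Lemma l2norm0 : l2norm (0 : l2) = 0.
Proof. by have := l2normZ 0 0; rewrite scaler0 normc0 mul0r. Qed.

Lemma l2norm_sum (I : Type) (r : seq I) (f : I -> l2) :
  l2norm (\sum_(i <- r) f i) <= \sum_(i <- r) l2norm (f i).
Proof.
elim: r => [|i r IH]; first by rewrite !big_nil l2norm0.
by rewrite !big_cons; apply: le_trans (l2normD _ _) _; rewrite lerD2l.
Qed.

Lemma l2norm_eq0 x : l2norm x = 0 -> x = 0.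
Proof.
move=> x0; apply: l2_ext => k; apply: eq0_normc; apply/eqP.
by rewrite eq_le normc_ge0 andbT -x0 normc_coord_le.
Qed.

Lemma l2dot_eq0 x : (forall y, l2dot y x = 0) -> x = 0.
Proof.
move=> h; apply: l2norm_eq0; apply/eqP; rewrite -sqrf_eq0; apply/eqP.
by have := l2dotxx x; rewrite h => -[].
Qed.

Definition trunc n (x : nat -> C^o) : nat -> C^o := fun k => if (k < n)%N then x k else 0.

Lemma trunc_square_summable n (x : nat -> C^o) : trunc n x \in @square_summable R.
Proof.
apply: (@square_summable_bounded _ (square_partial x n)) => m.
have [mn|nm] := leqP m n.
  apply: le_trans (square_partial_nd x mn); rewrite le_eqVlt; apply/orP; left; apply/eqP.
  by apply: eq_big_nat => k /andP[_ km]; rewrite /trunc (leq_trans km mn).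
rewrite /square_partial (big_cat_nat (n := n)) //=; last exact: ltnW.
rewrite [X in _ + X]big1_seq ?addr0; last first.
  by move=> k; rewrite mem_index_iota /trunc => /andP[_ /andP[nk _]]; rewrite ltnNge nk normc0 expr0n.
rewrite le_eqVlt; apply/orP; left; apply/eqP.
by apply: eq_big_nat => k /andP[_ km]; rewrite /trunc km.
Qed.

Definition l2trunc n (x : nat -> C^o) : l2 := L2 (trunc_square_summable n x).

Lemma l2truncE n x k : l2trunc n x k = if (k < n)%N then x k else 0.
Proof. by []. Qed.

Definition l2tail n x : l2 := x - l2trunc n x.

Lemma l2tailE n x k : l2tail n x k = if (k < n)%N then 0 else x k.
Proof.
rewrite l2_addE l2_oppE l2truncE; case: ifP => _; first exact: subrr.
by rewrite subr0.
Qed.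

Lemma l2trunc_linear n : linear (fun x => l2trunc n x).
Proof.
move=> a x y; apply: l2_ext => k; rewrite l2_addE l2_scaleE !l2truncE l2_addE l2_scaleE.
by case: ifP; rewrite ?mulr0 ?addr0.
Qed.

Lemma l2tail_linear n : linear (l2tail n).
Proof.
by move=> a x y; rewrite /l2tail l2trunc_linear scalerBr opprD addrACA.
Qed.

Definition l2delta j : l2 := L2 (trunc_square_summable j.+1 (fun k => (k == j)%:R)).

Lemma l2deltaE j k : l2delta j k = (k == j)%:R.
Proof.
rewrite /= /trunc; case: ifP => // /negbT; rewrite -leqNgt => jk.
by rewrite gtn_eqF.
Qed.

Lemma l2trunc_sum n (x : nat -> C^o) : l2trunc n x = \sum_(0 <= k < n) x k *: l2delta k.
Proof.
apply: l2_ext => k; rewrite [RHS]l2_sumE [LHS]/= /trunc.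
under eq_bigr do rewrite l2_scaleE l2deltaE.
case: ifP => kn.
  rewrite (bigD1_seq k) ?mem_index_iota ?iota_uniq //= eqxx mulr1 big1 ?addr0 // => i ik.
  by rewrite eq_sym (negbTE ik) mulr0.
rewrite big1_seq // => i; rewrite mem_index_iota => /andP[_ /andP[_ lt_in]].
by case: eqP kn => [->|]; rewrite ?lt_in ?mulr0.
Qed.

Lemma l2dot_delta j x : l2dot (l2delta j) x = x j.
Proof.
have e n : (j < n)%N -> dot_partial (l2delta j) x n = x j.
  move=> jn; rewrite /dot_partial (bigD1_seq j) ?mem_index_iota ?iota_uniq //=.
  rewrite -[X in X^*]/(l2delta j j) l2deltaE eqxx conjc1 mul1r big1 ?addr0 // => i ij.
  by rewrite -[X in X^*]/(l2delta j i) l2deltaE (negbTE ij) conjc0 mul0r.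
have near_cst (g : C -> R) : (fun n => g (dot_partial (l2delta j) x n)) @ \oo --> g (x j).
  apply: (@cvg_trans _ ((fun=> g (x j)) @ \oo)); last exact: cvg_cst.
  by apply: near_eq_cvg; exists j.+1 => // n /= jn; rewrite e.
by apply: l2dot_unique; exact: near_cst.
Qed.

Lemma l2norm_delta j : l2norm (l2delta j) = 1.
Proof.
have := l2dotxx (l2delta j); rewrite l2dot_delta l2deltaE eqxx => -[/esym/eqP].
by rewrite sqrp_eq1 ?l2norm_ge0 // => /eqP.
Qed.

Lemma l2norm_trunc n (x : nat -> C^o) : l2norm (l2trunc n x) ^+ 2 = square_partial x n.
Proof.
apply/eqP; rewrite eq_le; apply/andP; split.
  apply: l2norm_sqr_le => m; have [mn|nm] := leqP m n.
    apply: le_trans (square_partial_nd x mn); rewrite le_eqVlt; apply/orP; left; apply/eqP.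
    by apply: eq_big_nat => k /andP[_ km]; rewrite /= /trunc (leq_trans km mn).
  rewrite /square_partial (big_cat_nat (n := n)) //=; last exact: ltnW.
  rewrite [X in _ + X]big1_seq ?addr0; last first.
    by move=> k; rewrite mem_index_iota /trunc => /andP[_ /andP[nk _]]; rewrite ltnNge nk normc0 expr0n.
  rewrite le_eqVlt; apply/orP; left; apply/eqP.
  by apply: eq_big_nat => k /andP[_ km]; rewrite /trunc km.
apply: le_trans (square_partial_le _ n); rewrite le_eqVlt; apply/orP; left; apply/eqP.
by apply: eq_big_nat => k /andP[_ km]; rewrite /= /trunc km.
Qed.

Lemma l2dot_trunc_tail n x : l2dot (l2trunc n x) (l2tail n x) = 0.
Proof.
rewrite l2trunc_sum l2dot_suml big1_seq // => k; rewrite mem_index_iota => /andP[_ /andP[_ kn]].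
by rewrite l2dotZl l2dot_delta l2tailE kn mulr0.
Qed.

Lemma l2norm_tail n x : l2norm (l2tail n x) ^+ 2 = l2norm x ^+ 2 - square_partial x n.
Proof.
have xE : x = l2trunc n x + l2tail n x by rewrite addrC subrK.
move: xE (l2dot_trunc_tail n x) (l2norm_trunc n x).
move: (l2trunc n x) (l2tail n x) => t u xE tu <-.
have := l2dotxx x; rewrite {1 2}xE l2dotDl !l2dotDr (l2dot_herm t u) tu conjc0 addr0 add0r.
by rewrite !l2dotxx => -[<- _]; ring.
Qed.

Lemma l2norm_tail_le n x : l2norm (l2tail n x) <= l2norm x.
Proof.
rewrite -ler_sqr ?nnegrE ?l2norm_ge0 // l2norm_tail gerBl sumr_ge0 // => k _.
exact: sqr_ge0.
Qed.

Lemma l2norm_tail_nincr n m x : (n <= m)%N -> l2norm (l2tail m x) <= l2norm (l2tail n x).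
Proof.
move=> nm; rewrite -ler_sqr ?nnegrE ?l2norm_ge0 // (l2norm_tail n x) (l2norm_tail m x) lerD2l lerN2.
exact: (@square_partial_nd x _ _ nm).
Qed.

(** Prepares the telescoping sum in [compact_factorization]. *)
Lemma normc_coord_tail n x :
  normc (x n) ^+ 2 = l2norm (l2tail n x) ^+ 2 - l2norm (l2tail n.+1 x) ^+ 2.
Proof. by rewrite (l2norm_tail n x) (l2norm_tail n.+1 x) /square_partial big_nat_recr //=; ring. Qed.

Lemma l2norm_tail_cvg x (e : R) : 0 < e -> exists N, l2norm (l2tail N x) <= e.
Proof.
move=> e0; have /cvgrPdist_lt/(_ _ (exprn_gt0 2 e0)) := @square_partial_cvg x.
case=> N _ /(_ N (leqnn N)) /= h; exists N.
rewrite -ler_sqr ?nnegrE ?l2norm_ge0 ?(ltW e0) // l2norm_tail.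
exact: le_trans (ler_norm _) (ltW h).
Qed.

(** Closed balls are closed under coordinatewise convergence, since every finite block of
    coordinates passes to the limit. With w = 0 this puts the limit in l2; with w a term of a Cauchy
    sequence it gives convergence in norm. *)
Lemma l2_limit (z : nat -> l2) (p : nat -> C) w (e : R) N :
  (forall k d, 0 < d -> exists M, forall m, (M <= m)%N -> normc (z m k - p k) <= d) ->
  (forall m, (N <= m)%N -> l2norm (z m - w) <= e) ->
  exists2 q : l2, (forall k, q k = p k) & l2norm (q - w) <= e.
Proof.
move=> zp zw; have e0 : 0 <= e by exact: le_trans (l2norm_ge0 _) (zw _ (leqnn N)).
have key n : square_partial (fun k => p k - w k) n <= e ^+ 2.
  rewrite -l2norm_trunc ler_sqr ?nnegrE ?l2norm_ge0 //; apply/ler_addgt0Pr => d d0.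
  (* An error of at most d' in each of the first n coordinates adds up to at most d. *)
  pose d' := d / n.+1%:R; have d'0 : 0 < d' by rewrite divr_gt0.
  have [M hM] : exists M, forall m k, (M <= m)%N -> (k < n)%N -> normc (z m k - p k) <= d'.
    have ex k := projT2 (cid (zp k d' d'0)).
    exists (\max_(k < n) projT1 (cid (zp k d' d'0))) => m k Mm kn; apply: ex.
    by apply: leq_trans Mm; exact: (leq_bigmax (Ordinal kn)).
  pose m := maxn M N.
  have -> : l2trunc n (fun k => p k - w k) =
     l2trunc n (fun k => p k - z m k) + (l2trunc n (z m - w)).
    apply: l2_ext => k; rewrite [RHS]l2_addE /= /trunc; case: ifP => _; last by rewrite addr0.
    by rewrite -[l2val (z m) - l2val w]/(l2val (z m - w)) l2_addE l2_oppE addrA subrK.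
  apply: le_trans (l2normD _ _) _; rewrite addrC lerD //.
    apply: le_trans (zw m (leq_maxr _ _)).
    by rewrite -ler_sqr ?nnegrE ?l2norm_ge0 // l2norm_trunc square_partial_le.
  rewrite l2trunc_sum; apply: le_trans (l2norm_sum _ _) _.
  apply: (@le_trans _ _ (\sum_(0 <= k < n) d')).
    rewrite big_seq [X in _ <= X]big_seq ler_sum // => k; rewrite mem_index_iota => kn.
    by rewrite l2normZ l2norm_delta mulr1 -normcN opprB hM ?leq_maxl.
  by rewrite sumr_const_nat subn0 -[d' *+ n]mulr_natr /d' mulrAC ler_pdivrMr // ler_pM2l // ler_nat.
have pw : (fun k => p k - w k : C^o) \in @square_summable R by exact: square_summable_bounded key.
exists (L2 pw + w) => [k|]; first by rewrite l2_addE /= subrK.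
by rewrite addrK -ler_sqr ?nnegrE ?l2norm_ge0 //; apply: l2norm_sqr_le => n; exact: key.
Qed.

(** The real and imaginary parts of the coordinates of a bounded sequence live in a product of
    intervals, compact by Tychonoff. A cluster point supplies p, and the indices are picked
    recursively so that the first n coordinates of the n-th choice are within 1/(n+1) of it. *)
Lemma l2_subsequence (z : nat -> l2) (B : R) : (forall n, l2norm (z n) <= B) ->
  exists (s : nat -> nat) (p : nat -> C), {homo s : m n / (m < n)%N} /\
   forall k d, 0 < d -> exists M, forall m, (M <= m)%N -> normc (z (s m) k - p k) <= d.
Proof.
move=> zB; pose f n (kb : nat * bool) : R :=
  if kb.2 then complex.Re (z n kb.1) else complex.Im (z n kb.1).
have fB n kb : f n kb \in `[- B, B].
  rewrite in_itv /= -ler_norml /f; case: ifP => _.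
    exact: le_trans (Re_le_normc _) (le_trans (normc_coord_le _ _) (zB n)).
  exact: le_trans (Im_le_normc _) (le_trans (normc_coord_le _ _) (zB n)).
have cpt := @tychonoff (nat * bool)%type (fun=> R) (fun=> `[- B, B]%classic) (fun=> @segment_compact R (- B) B).
have [|g [gB gcl]] := cpt (f @ \oo).
  by exists 0%N => // n _ i; exact: fB.
have near_g n d : 0 < d -> forall N, exists m, (N <= m)%N /\ forall k b, (k < n)%N -> `|f m (k, b) - g (k, b)| < d.
  move=> d0 N.
  have [||h [[m Nm mh] hB]] := gcl [set f m | m in [set m | (N <= m)%N]]
      [set h | forall kb : 'I_n * bool, `|h (nat_of_ord kb.1, kb.2) - g (nat_of_ord kb.1, kb.2)| < d].
  - by exists N => // m /= Nm; exists m.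
  - have nbs : \forall h \near nbhs (g : prod_topology (fun _ : nat * bool => R)),
       forall kb : 'I_n * bool, `|h (nat_of_ord kb.1, kb.2) - g (nat_of_ord kb.1, kb.2)| < d.
      apply: filter_forall => -[k b] /=.
      have nb : nbhs (g (nat_of_ord k, b)) [set y : R | `|y - g (nat_of_ord k, b)| < d].
        by apply/nbhs_ballP; exists d => // y; rewrite /ball /= distrC.
      exact: (@proj_continuous _ (fun _ : nat * bool => R) (nat_of_ord k, b) g _ nb).
    exact: nbs.
  by exists m; split=> // k b kn; rewrite mh; exact: (hB (Ordinal kn, b)).
have ex n N : exists m, (N <= m)%N /\ forall k b, (k < n)%N -> `|f m (k, b) - g (k, b)| < n.+1%:R^-1.
  by apply: near_g; rewrite invr_gt0.
pose step n N := projT1 (cid (ex n N)); have stepP n N := projT2 (cid (ex n N)).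
pose s := fix s n := if n is n'.+1 then step n (s n').+1 else step 0%N 0%N.
have sP n : forall k b, (k < n)%N -> `|f (s n) (k, b) - g (k, b)| < n.+1%:R^-1.
  by case: n => [|n] //; exact: (stepP _ _).2.
exists s, (fun k => (g (k, true) +i* g (k, false))%C); split.
  apply: homo_ltn => [//|n]; first exact: ltn_trans.
  exact: (stepP n.+1 (s n).+1).1.
move=> k d d0; have d20 : 0 < d / 2 by rewrite divr_gt0.
have [M0 _ hM0] := near_infty_natSinv_lt (PosNum d20).
exists (maxn M0 k.+1) => m; rewrite geq_max => /andP[M0m km].
have ht := sP m k true km; have hf := sP m k false km.
have dm : m.+1%:R^-1 < d / 2 by exact: (hM0 m M0m).
have : normc (z (s m) k - (g (k, true) +i* g (k, false))%C) ^+ 2 <= d ^+ 2; last first.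
  by rewrite ler_sqr // nnegrE ?normc_ge0 // ltW.
rewrite sqr_normc; have {ht}ht := ltW (lt_trans ht dm); have {hf}hf := ltW (lt_trans hf dm).
move: ht hf; rewrite /f /=; case: (z (s m) k) => a b /= ht hf.
rewrite -[(a - _) ^+ 2]real_normK ?num_real // -[(b - _) ^+ 2]real_normK ?num_real //.
have := normr_ge0 (a - g (k, true)); have := normr_ge0 (b - g (k, false)).
by nra.
Qed.
End SquareSummableSequences.

(** * Compact operators *)

Section CompactOperators.
Variable R : realType.
Local Notation C := R[i].
Local Notation l2 := (l2 R).
Local Notation K := (compacts R).
Implicit Types (x y z : l2) (A B S : K).

Lemma sqr_normr (r : R) : `|r| ^+ 2 = r ^+ 2.
Proof. by rewrite real_normK // num_real. Qed.

Lemma op_linear A : linear A.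
Proof. by have /asboolP[] := opvalP A. Qed.

Lemma op_ext A B : (forall x, A x = B x) -> A = B.
Proof. by move=> h; apply: val_inj; apply/funext. Qed.
Lemma op_addE A B x : (A + B) x = A x + B x. Proof. by []. Qed.
Lemma op_scaleE a A x : (a *: A) x = a *: A x. Proof. by []. Qed.
Lemma op_0E x : (0 : K) x = 0. Proof. by []. Qed.
Lemma op_sumE (I : Type) (r : seq I) (f : I -> K) x :
  (\sum_(i <- r) f i) x = \sum_(i <- r) f i x.
Proof. by elim: r => [|i r IH]; rewrite ?big_nil // !big_cons op_addE IH. Qed.
Lemma opmulE A B x : opmul A B x = A (B x). Proof. by []. Qed.

Lemma op_bounded A : exists2 M : R, 0 <= M & forall x, l2norm (A x) <= M * l2norm x.
Proof.
have /asboolP[_ [M hM] _] := opvalP A; exists `|M| => // x.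
by apply: le_trans (hM x) _; rewrite ler_wpM2r ?l2norm_ge0 ?ler_norm.
Qed.

Lemma opmulA A B S : opmul A (opmul B S) = opmul (opmul A B) S.
Proof. exact: op_ext. Qed.

Lemma opmul_linearl B : linear (fun A => opmul A B).
Proof. by move=> a A A'; apply: op_ext. Qed.

Lemma opmul_linearr A : linear (opmul A).
Proof. by move=> a B B'; apply: op_ext => x; rewrite opmulE op_linear. Qed.

Lemma l2_scaled_le (f : l2 -> R) (c : R) :
  (forall (r : R) x, 0 <= r -> f (r%:C%C *: x) = r * f x) ->
  (forall x, l2norm x <= 1 -> f x <= c) -> forall x, f x <= c * l2norm x.
Proof.
move=> fh fc x; have [x0|x0] := eqVneq (l2norm x) 0.
  have := fh 0 x (lexx _); rewrite x0 mul0r mulr0 (l2norm_eq0 x0) scaler0 => ->.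
  by [].
have n0 : 0 < l2norm x by rewrite lt0r x0 l2norm_ge0.
have := fc ((l2norm x)^-1%:C%C *: x); rewrite fh ?invr_ge0 ?l2norm_ge0 //.
rewrite l2normZ normc_real ger0_norm ?invr_ge0 ?l2norm_ge0 // mulVf // lexx => /(_ isT).
by rewrite mulrC ler_pdivrMr.
Qed.

(** Otherwise there are unit vectors x_N whose images have N-th tails above e. These images converge
    along a subsequence, and the tails of the limit are small from some point on. *)
Lemma op_tail A (e : R) : 0 < e ->
  exists N, forall x, l2norm x <= 1 -> l2norm (l2tail N (A x)) <= e.
Proof.
move=> e0; apply: contrapT => /forallNP h.
have ex N : exists x, l2norm x <= 1 /\ e < l2norm (l2tail N (A x)).
  have /existsNP[x /not_implyP[x1 /negP]] := h N; rewrite -ltNge => ex.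
  by exists x.
pose x N := projT1 (cid (ex N)); have xP N : l2norm (x N) <= 1 /\ e < l2norm (l2tail N (A (x N))) := projT2 (cid (ex N)).
have /asboolP[_ _ /(_ x)[|s [y [hs sy]]]] := opvalP A.
  by exists 1 => n; case: (xP n).
have e4 : 0 < e / 4 by rewrite divr_gt0.
have [M hM] := l2norm_tail_cvg y e4.
have /cvgrPdist_lt/(_ _ e4)[N _ hN] := sy.
pose n := maxn M N; have := hN n (leq_maxr _ _); rewrite /= sub0r normrN ger0_norm ?l2norm_ge0 // => hn.
have [_] := xP (s n); apply/negP; rewrite -leNgt.
have -> : l2tail (s n) (A (x (s n))) = l2tail (s n) (A (x (s n)) - y) + l2tail (s n) y.
  by rewrite (linear_lfB (@l2tail_linear R _)) subrK.
apply: le_trans (l2normD _ _) _.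
have h1 := le_trans (l2norm_tail_le (s n) (A (x (s n)) - y)) (ltW hn).
have h2 := le_trans (l2norm_tail_nincr y (leq_trans (leq_maxl M N) (homo_ge hs n))) hM.
by apply: le_trans (lerD h1 h2) _; lra.
Qed.

(** Coordinatewise convergence controls a finite block, and the uniform bound on tails controls the
    rest. It is the converse tool to [op_tail]: uniformly small tails give compactness. *)
Lemma l2_cvg_of_tail (z : nat -> l2) (p : nat -> C) (B : R) :
  (forall n, l2norm (z n) <= B) ->
  (forall k d, 0 < d -> exists M, forall m, (M <= m)%N -> normc (z m k - p k) <= d) ->
  (forall e, 0 < e -> exists N, forall n, l2norm (l2tail N (z n)) <= e) ->
  exists q : l2, l2norm (z n - q) @[n --> \oo] --> 0.
Proof.
move=> zB zp zt; have [|q qp _] := @l2_limit R z p 0 B 0 zp.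
  by move=> m _; rewrite subr0.
exists q; apply/cvgrPdist_le => e e0.
have e3 : 0 < e / 3 by rewrite divr_gt0.
have [N hN] := zt _ e3.
have tq : l2norm (l2tail N q) <= e / 3.
  have [||q' q'p] := @l2_limit R (fun m => l2tail N (z m)) (fun k => if (k < N)%N then 0 else p k) 0 (e / 3) 0.
  - move=> k d d0; have [M hM] := zp k d d0; exists M => m Mm; rewrite l2tailE.
    by case: ifP => _; [rewrite subrr normc0 ltW|exact: hM].
  - by move=> m _; rewrite subr0.
  rewrite subr0; congr (l2norm _ <= _); apply: l2_ext => k.
  by rewrite q'p l2tailE qp.
have N0 : 0 < e / 3 / N.+1%:R by rewrite divr_gt0.
have [M hM] : exists M, forall m k, (M <= m)%N -> (k < N)%N -> normc (z m k - p k) <= e / 3 / N.+1%:R.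
  exists (\max_(k < N) projT1 (cid (zp k _ N0))) => m k Mm kn.
  apply: (projT2 (cid (zp k _ N0))); apply: leq_trans Mm.
  exact: (leq_bigmax (Ordinal kn)).
exists M => // m /= Mm; rewrite sub0r normrN ger0_norm ?l2norm_ge0 //.
have -> : z m - q = l2trunc N (z m - q) + (l2tail N (z m) - l2tail N q).
  by rewrite -(linear_lfB (@l2tail_linear R _)) [RHS]addrC /l2tail subrK.
apply: le_trans (l2normD _ _) _.
have h1 : l2norm (l2trunc N (z m - q)) <= e / 3.
  rewrite l2trunc_sum; apply: le_trans (l2norm_sum _ _) _.
  apply: (@le_trans _ _ (\sum_(0 <= k < N) (e / 3 / N.+1%:R))).
    rewrite big_seq [X in _ <= X]big_seq ler_sum // => k; rewrite mem_index_iota => kn.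
    by rewrite l2normZ l2norm_delta mulr1 l2_addE l2_oppE qp hM.
  by rewrite sumr_const_nat subn0 -[_ *+ N]mulr_natr mulrAC ler_pdivrMr // ler_pM2l // ler_nat.
have h2 := le_trans (l2normB (l2tail N (z m)) (l2tail N q)) (lerD (hN m) tq).
by apply: le_trans (lerD h1 h2) _; lra.
Qed.

(** The recipe by which matrix units and the diagonal and quotient operators of
    [compact_factorization] become elements of K: the bounds c N make the tails of the image of a
    bounded set uniformly small. *)
Lemma compact_of_coordinates (F : l2 -> nat -> C^o) (c : nat -> R) :
  (forall a x y k, F (a *: x + y) k = a * F x k + F y k) ->
  (forall N m x, \sum_(N <= k < m) normc (F x k) ^+ 2 <= c N * l2norm x ^+ 2) ->
  (forall e, 0 < e -> exists N, c N <= e) ->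
  exists T : K, forall x k, T x k = F x k.
Proof.
move=> Fl Fc c0.
have Fs x : F x \in @square_summable R.
  by apply: (@square_summable_bounded _ _ (c 0%N * l2norm x ^+ 2)) => n; exact: Fc.
pose T x := L2 (Fs x).
have Tt N x : l2norm (l2tail N (T x)) ^+ 2 <= c N * l2norm x ^+ 2.
  apply: l2norm_sqr_le => m; apply: le_trans (Fc N m x).
  rewrite /square_partial; under eq_bigr do rewrite l2tailE.
  have [mN|Nm] := leqP m N.
    rewrite big1_seq ?sumr_ge0 // => [k _|k]; first exact: sqr_ge0.
    rewrite mem_index_iota => /andP[_ /andP[_ km]].
    by rewrite (leq_trans km mN) normc0 expr0n.
  rewrite (big_cat_nat (n := N)) //=; last exact: ltnW.
  rewrite big1_seq ?add0r => [|k]; last first.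
    by rewrite mem_index_iota => /andP[_ /andP[_ km]]; rewrite km normc0 expr0n.
  by apply: ler_sum_nat => k /andP[Nk _]; rewrite ltnNge Nk.
have Tl : linear T by move=> a x y; apply: l2_ext => k; rewrite l2_addE l2_scaleE /= Fl.
have T0 x : l2tail 0 x = x by apply: l2_ext => k; rewrite l2tailE.
have cge N : 0 <= c N.
  have := Tt N (l2delta R 0); rewrite l2norm_delta expr1n mulr1; apply: le_trans.
  exact: sqr_ge0.
have Tn N x : l2norm (l2tail N (T x)) <= Num.sqrt (c N) * l2norm x.
  have := Tt N x; rewrite -[c N in X in X -> _](sqr_sqrtr (cge N)) -exprMn.
  by rewrite ler_sqr ?nnegrE ?mulr_ge0 ?sqrtr_ge0 ?l2norm_ge0.
have Tc : T \in @compact_operator R.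
  apply/asboolP; split=> //; first by exists (Num.sqrt (c 0%N)) => x; rewrite -{1}[T x]T0 Tn.
  move=> x [M hM]; have M0 : 0 <= M by exact: le_trans (l2norm_ge0 _) (hM 0%N).
  have xB n : l2norm (T (x n)) <= Num.sqrt (c 0%N) * M.
    by rewrite -[T _]T0; apply: le_trans (Tn _ _) _; rewrite ler_wpM2l ?sqrtr_ge0.
  have [s [p [hs sp]]] := l2_subsequence xB.
  have [|q hq] := @l2_cvg_of_tail (fun n => T (x (s n))) p _ (fun n => xB (s n)) sp.
    (* The N-th tail of the image of a vector of norm at most M is at most sqrt (c N) M, so c N has
       to be below (e / (M + 1))^2. *)
    move=> e e0; have [|N hN] := c0 ((e / (M + 1)) ^+ 2).
      by rewrite exprn_gt0 // divr_gt0 // ltr_wpDl.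
    exists N => n; apply: le_trans (Tn _ _) _.
    apply: (@le_trans _ _ (e / (M + 1) * M)).
      rewrite ler_pM ?sqrtr_ge0 ?l2norm_ge0 //.
      rewrite -(ger0_norm (_ : 0 <= e / (M + 1))) -?sqrtr_sqr ?ler_sqrt ?sqr_ge0 //.
      by rewrite divr_ge0 ?addr_ge0 // ltW.
    rewrite mulrAC ler_pdivrMr ?ltr_wpDl // ler_pM2l //; lra.
  by exists s, q.
by exists (Compacts Tc).
Qed.

Lemma l2dot_ext x y : (forall z, l2dot z x = l2dot z y) -> x = y.
Proof.
move=> h; apply/eqP; rewrite -subr_eq0; apply/eqP/l2dot_eq0 => z.
by rewrite l2dotDr l2dotNr h subrr.
Qed.

(** The k-th coordinate of the adjoint at y has to be <A delta_k, y>. Applying A to the truncation w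
    of this sequence gives |w|^2 = <A w, y>, at most M |w| |y|, hence square summability. For
    compactness, |B v|^2 = <A B v, v> shows that B y_n is Cauchy along a subsequence on which A B
    y_n converges. *)
Lemma adjoint_exists A : exists B : K, forall x y, l2dot (A x) y = l2dot x (B y).
Proof.
have [M M0 hM] := op_bounded A.
pose F y : nat -> C^o := fun k => l2dot (A (l2delta R k)) y.
have Fs y n : square_partial (F y) n <= M ^+ 2 * l2norm y ^+ 2.
  set s := square_partial _ n; have s0 : 0 <= s by apply: sumr_ge0 => k _; exact: sqr_ge0.
  pose w := l2trunc n (F y).
  have sw : l2norm w ^+ 2 = s by rewrite l2norm_trunc.
  have se : l2dot (A w) y = s%:C%C.
    rewrite /w l2trunc_sum (linear_lf_sum (op_linear A)) l2dot_suml.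
    rewrite /s /square_partial rmorph_sum; apply: eq_bigr => k _.
    by rewrite (linear_lfZ (op_linear A)) l2dotZl conjc_mul_self.
  have := l2_cauchy_schwarz (A w) y; rewrite se normc_real ger0_norm // => h.
  have h2 : s <= M * l2norm w * l2norm y.
    by apply: le_trans h _; rewrite ler_wpM2r ?l2norm_ge0.
  have [->|sn] := eqVneq s 0; first by rewrite mulr_ge0 ?sqr_ge0.
  have sp : 0 < s by rewrite lt0r sn.
  have : s ^+ 2 <= M ^+ 2 * s * l2norm y ^+ 2.
    by rewrite -{2}sw -!exprMn ler_sqr ?nnegrE ?mulr_ge0 ?l2norm_ge0.
  by rewrite mulrAC expr2 ler_pM2r.
have Fss y : F y \in @square_summable R by exact: square_summable_bounded (Fs y).
pose B y := L2 (Fss y).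
have BE x y : l2dot (A x) y = l2dot x (B y).
  apply/eqP; rewrite -subr_eq0; apply: contraT => /eqP d0.
  set d := _ - _ in d0; have dp : 0 < normc d.
    by rewrite lt0r normc_ge0 andbT; apply: contra_notN d0 => /eqP; exact: eq0_normc.
  pose c := M * l2norm y + l2norm (B y) + 1.
  have cp : 0 < c by rewrite ltr_wpDl // addr_ge0 ?mulr_ge0 ?l2norm_ge0.
  have [N hN] := l2norm_tail_cvg x (divr_gt0 dp (mulr_gt0 (ltr0Sn _ 1) cp)).
  (* Both sides agree on finite combinations of basis vectors, so d depends only on a tail of x and
     is as small as this tail. *)
  have de : d = l2dot (A (l2tail N x)) y - l2dot (l2tail N x) (B y).
    rewrite /d -{1 2}[x](subrK (l2trunc N x)) -/(l2tail N x) (linear_lfD (op_linear A)) !l2dotDl.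
    have -> : l2dot (A (l2trunc N x)) y = l2dot (l2trunc N x) (B y).
      rewrite l2trunc_sum (linear_lf_sum (op_linear A)) !l2dot_suml.
      apply: eq_bigr => k _; rewrite (linear_lfZ (op_linear A)) !l2dotZl l2dot_delta.
      by [].
    by rewrite opprD addrACA subrr addr0.
  have : normc d <= c * l2norm (l2tail N x).
    rewrite de; apply: le_trans (le_normcD _ _) _; rewrite normcN.
    apply: (@le_trans _ _ (M * l2norm (l2tail N x) * l2norm y + l2norm (l2tail N x) * l2norm (B y))).
      apply: lerD; last exact: l2_cauchy_schwarz.
      by apply: le_trans (l2_cauchy_schwarz _ _) _; rewrite ler_wpM2r ?l2norm_ge0.
    by have := l2norm_ge0 (l2tail N x); rewrite /c; nra.
  move=> h; have := le_trans h (ler_wpM2l (ltW cp) hN).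
  have -> : c * (normc d / (2 * c)) = normc d / 2 by field; rewrite gt_eqF.
  by move: dp; lra.
have Bl : linear B.
  move=> a x y; apply: l2dot_ext => z.
  by rewrite l2dot_combr -!BE l2dot_combr.
have Bb y : l2norm (B y) <= M * l2norm y.
  rewrite -ler_sqr ?nnegrE ?mulr_ge0 ?l2norm_ge0 // exprMn; apply: l2norm_sqr_le => n.
  exact: Fs.
have Bc : B \in @compact_operator R.
  apply/asboolP; split=> //; first by exists M.
  move=> y [L hL].
  have /asboolP[_ _ /(_ (B \o y))[|s [u [hs su]]]] := opvalP A.
    by exists (M * L) => n; apply: le_trans (Bb _) _; rewrite ler_wpM2l.
  (* A coordinatewise limit along a further subsequence names the limit of the Cauchy sequence B
     y_n. *)
  have [|t [p [ht tp]]] := @l2_subsequence R (fun n => B (y (s n))) (M * L).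
    by move=> n; apply: le_trans (Bb _) _; rewrite ler_wpM2l.
  have cau e : 0 < e -> exists N, forall m n, (N <= m)%N -> (N <= n)%N ->
      l2norm (B (y (s (t n))) - B (y (s (t m)))) <= e.
    move=> e0; pose d := e ^+ 2 / (4 * (L + 1)).
    have L0 : 0 <= L by exact: le_trans (l2norm_ge0 _) (hL 0%N).
    have d0 : 0 < d by rewrite divr_gt0 ?exprn_gt0 // mulr_gt0 // ltr_wpDl.
    have /cvgrPdist_le/(_ _ d0)[N _ hN] := subseq_cvg ht su.
    exists N => m n Nm Nn.
    have nr k : (N <= k)%N -> l2norm (A (B (y (s (t k)))) - u) <= d.
      by move=> /hN /=; rewrite sub0r normrN ger0_norm ?l2norm_ge0.
    set v := y (s (t n)) - y (s (t m)).
    have vB : l2norm v <= 2 * L.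
      by apply: le_trans (l2normB _ _) _; have := hL (s (t n)); have := hL (s (t m)); lra.
    have -> : B (y (s (t n))) - B (y (s (t m))) = B v by rewrite (linear_lfB Bl).
    have ABv : l2norm (A (B v)) <= 2 * d.
      rewrite (linear_lfB Bl) (linear_lfB (op_linear A)).
      have -> : A (B (y (s (t n)))) - A (B (y (s (t m)))) =
         (A (B (y (s (t n)))) - u) - (A (B (y (s (t m)))) - u) by rewrite opprB addrA subrK.
      by apply: le_trans (l2normB _ _) _; rewrite mulr_natl mulr2n lerD ?nr.
    rewrite -ler_sqr ?nnegrE ?l2norm_ge0 ?(ltW e0) //.
    have := l2_cauchy_schwarz (A (B v)) v; rewrite BE l2dotxx normc_real ger0_norm ?sqr_ge0 //.
    move/le_trans; apply.
    apply: (@le_trans _ _ (2 * d * (2 * L))); first by rewrite ler_pM ?l2norm_ge0.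
    have -> : 2 * d * (2 * L) = e ^+ 2 * (L / (L + 1)) by rewrite /d; field; rewrite gt_eqF // ltr_wpDl.
    by rewrite ger_pMr ?exprn_gt0 // ler_pdivrMr ?ltr_wpDl // mul1r lerDl.
  (* Any finite bound on the distance to a fixed term puts the coordinatewise limit in l2; 1 is an
     arbitrary choice. *)
  have [N1 hN1] := cau 1 ltr01.
  have [|q qp _] := @l2_limit R (fun n => B (y (s (t n)))) p (B (y (s (t N1)))) 1 N1 tp.
    by move=> m Nm; apply: hN1.
  exists (s \o t), q; split; first by move=> m n mn /=; apply/hs/ht.
  apply/cvgrPdist_le => e e0; have [N hN] := cau e e0; exists N => // m /= Nm.
  rewrite sub0r normrN ger0_norm ?l2norm_ge0 //.
  have [|q' q'p] := @l2_limit R (fun n => B (y (s (t n)))) p (B (y (s (t m)))) e N tp.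
    by move=> n Nn; apply: hN.
  have -> : q' = q by apply: l2_ext => k; rewrite qp q'p.
  by rewrite -l2normN opprB.
by exists (Compacts Bc).
Qed.

Lemma opadjP A x y : l2dot (A x) y = l2dot x (opadj A y).
Proof.
rewrite /opadj; have [B hB] := adjoint_exists A.
exact: (@xgetPex _ 0 _ (ex_intro (fun B : K => forall x y, l2dot (A x) y = l2dot x (B y)) B hB)).
Qed.

Lemma opadjP' A x y : l2dot (opadj A x) y = l2dot x (A y).
Proof. by rewrite l2dot_herm -opadjP -l2dot_herm. Qed.

Lemma opadj_linear a A B : opadj (a *: A + B) = a^* *: opadj A + opadj B.
Proof.
apply: op_ext => y; apply: l2dot_ext => z.
rewrite -opadjP op_addE op_scaleE op_addE op_scaleE l2dot_combl l2dot_combr.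
by rewrite !opadjP.
Qed.

Lemma opadj_mul A B : opadj (opmul A B) = opmul (opadj B) (opadj A).
Proof. by apply: op_ext => y; apply: l2dot_ext => z; rewrite -opadjP !opmulE !opadjP. Qed.

Lemma opadjK A : opadj (opadj A) = A.
Proof. by apply: op_ext => y; apply: l2dot_ext => z; rewrite -opadjP opadjP'. Qed.

Lemma matrix_unit_exists i j : exists T : K, forall x k, T x k = x j * l2delta R i k.
Proof.
apply: (@compact_of_coordinates (fun x k => x j * l2delta R i k)
   (fun N => if (i < N)%N then 0 else 1)).
- by move=> a x y k; rewrite l2_addE l2_scaleE; ring.
- move=> N m x; have z k : k != i -> normc (x j * l2delta R i k) ^+ 2 = 0.
    by move=> ki; rewrite l2deltaE (negbTE ki) mulr0 normc0 expr0n.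
  case: ifP => [iN|_].
    rewrite mul0r big1_seq // => k; rewrite mem_index_iota => /andP[_ /andP[Nk _]].
    by apply: z; rewrite gtn_eqF // (leq_trans iN Nk).
  rewrite mul1r; have [im|im] := boolP (i \in index_iota N m).
    rewrite (bigD1_seq i) ?iota_uniq //= [X in _ + X]big1 ?addr0 => [|k]; last exact: z.
    by rewrite /trunc ltnSn eqxx mulr1 ler_sqr ?nnegrE ?normc_ge0 ?l2norm_ge0 ?normc_coord_le.
  rewrite big1_seq ?sqr_ge0 // => k /andP[_ kN]; apply: z.
  by apply: contraNneq im => <-.
- by move=> e e0; exists i.+1; rewrite ltnSn ltW.
Qed.

Definition matrix_unit i j : K := projT1 (cid (matrix_unit_exists i j)).

Lemma matrix_unitE i j x : matrix_unit i j x = x j *: l2delta R i.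
Proof. by apply: l2_ext => k; rewrite (projT2 (cid (matrix_unit_exists i j))). Qed.

Lemma matrix_unit_mul i j k : opmul (matrix_unit i j) (matrix_unit j k) = matrix_unit i k.
Proof.
by apply: op_ext => x; rewrite opmulE !matrix_unitE l2_scaleE l2deltaE eqxx mulr1.
Qed.

Lemma matrix_unit_mul0 i j k l : j != k -> opmul (matrix_unit i j) (matrix_unit k l) = 0.
Proof.
move=> jk; apply: op_ext => x; rewrite opmulE !matrix_unitE l2_scaleE l2deltaE.
by rewrite (negbTE jk) mulr0 scale0r.
Qed.

Lemma matrix_unit_adj i j : opadj (matrix_unit i j) = matrix_unit j i.
Proof.
apply: op_ext => y; apply: l2dot_ext => z; rewrite -opadjP !matrix_unitE.
by rewrite l2dotZl l2dotZr l2dot_delta l2dot_herm l2dot_delta mulrC.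
Qed.

(** A substitute for multiplying by a unit of K: the diagonal matrix units give A and B the same
    values on the basis vectors, and the adjoints carry this over to all vectors. *)
Lemma opmul_cancelr A B : (forall S, opmul A S = opmul B S) -> A = B.
Proof.
move=> h; apply: op_ext => x; apply: l2dot_ext => z; rewrite -!opadjP'.
have hd k : A (l2delta R k) = B (l2delta R k).
  have := congr1 (fun T : K => T (l2delta R k)) (h (matrix_unit k k)).
  by rewrite !opmulE matrix_unitE l2deltaE eqxx scale1r.
congr (l2dot _ x); apply: l2_ext => k.
by rewrite -!l2dot_delta -!opadjP hd.
Qed.

(* With t_k decreasing to 0 and |(1 - P_k) S x| <= t_k |x|, both S and S' factor
   through diag (sqrt t_k): sum_k |(S x)_k|^2 / t_k telescopes. *)
Lemma compact_factorization S S' : exists D T T' : K,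
  [/\ forall x, D x = 0 -> x = 0, S = opmul D T & S' = opmul D T'].
Proof.
have supP (A : K) k : exists2 t : R, forall x, l2norm (l2tail k (A x)) <= t * l2norm x &
    forall e, (forall x, l2norm x <= 1 -> l2norm (l2tail k (A x)) <= e) -> t <= e.
  have [M M0 hM] := op_bounded A.
  pose X := [set l2norm (l2tail k (A x)) | x in [set x : l2 | l2norm x <= 1]].
  have hs : has_sup X.
    split; first by exists (l2norm (l2tail k (A 0))); exists 0 => //=; rewrite l2norm0 ler01.
    exists M => _ [x /= x1 <-]; apply: le_trans (l2norm_tail_le _ _) _.
    by apply: le_trans (hM _) _; rewrite ler_piMr.
  exists (sup X).
    apply: l2_scaled_le => [r x r0|x x1]; last by apply: sup_upper_bound => //; exists x.
    rewrite (linear_lfZ (op_linear A)) (linear_lfZ (@l2tail_linear R k)) l2normZ normc_real.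
    by rewrite ger0_norm.
  by move=> e he; apply: ge_sup => [|_ [x /= x1 <-]]; [case: hs|exact: he].
pose t (A : K) k := s2val (cid2 (supP A k)).
have tP A k : forall x, l2norm (l2tail k (A x)) <= t A k * l2norm x := s2valP (cid2 (supP A k)).
have tle A k : forall e, (forall x, l2norm x <= 1 -> l2norm (l2tail k (A x)) <= e) -> t A k <= e :=
  s2valP' (cid2 (supP A k)).
have t0 A k : 0 <= t A k.
  by have := tP A k (l2delta R 0); rewrite l2norm_delta mulr1; apply: le_trans (l2norm_ge0 _).
(* The summand 1/(k+1) keeps the entries positive, which makes the diagonal operator injective, and
   d still tends to 0. *)
pose d k := t S k + t S' k + k.+1%:R^-1.
have d0 k : 0 < d k by rewrite ltr_wpDl ?addr_ge0 // invr_gt0.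
have tS A e : 0 < e -> exists N, forall k, (N <= k)%N -> t A k <= e.
  move=> e0; have [N hN] := op_tail A e0; exists N => k Nk; apply: tle => x x1.
  exact: le_trans (l2norm_tail_nincr _ Nk) (hN x x1).
have dto e : 0 < e -> exists N, forall k, (N <= k)%N -> d k <= e.
  move=> e0; have e3 : 0 < e / 3 by rewrite divr_gt0.
  have [N1 h1] := tS S _ e3; have [N2 h2] := tS S' _ e3.
  have [N3 _ h3] := near_infty_natSinv_lt (PosNum e3).
  exists (maxn N1 (maxn N2 N3)) => k; rewrite !geq_max => /and3P[k1 k2 k3].
  have h3k : k.+1%:R^-1 < e / 3 := h3 k k3.
  by have := h1 k k1; have := h2 k k2; rewrite /d; move: h3k; move: (_^-1) (t S k) (t S' k) => *; lra.
have [dM hdM] : exists dM : R, forall k, d k <= dM.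
  exists (t S 0 + t S' 0 + 1) => k; rewrite /d; apply: lerD; last by rewrite invf_le1 // ler1n.
  apply: lerD; apply: tle => x x1; apply: le_trans (l2norm_tail_nincr _ (leq0n k)) _;
    by apply: le_trans (tP _ _ _) _; rewrite ler_piMr.
have [D hD] : exists D : K, forall x k, D x k = (Num.sqrt (d k))%:C%C * x k.
  pose c N := sup [set d k | k in [set k | (N <= k)%N]].
  have hc N k : (N <= k)%N -> d k <= c N.
    move=> Nk; apply: sup_upper_bound; last by exists k.
    by split; [exists (d k); exists k|exists dM => _ [j _ <-]].
  apply: (@compact_of_coordinates _ c).
  - by move=> a x y k; rewrite l2_addE l2_scaleE; ring.
  - move=> N m x; apply: (@le_trans _ _ (\sum_(N <= k < m) c N * normc (x k) ^+ 2)).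
      apply: ler_sum_nat => k /andP[Nk _]; rewrite normcM exprMn normc_real sqr_normr.
      by rewrite sqr_sqrtr ?ler_wpM2r ?sqr_ge0 ?hc // ltW.
    rewrite -mulr_sumr ler_wpM2l ?(le_trans (ltW (d0 N)) (hc N N _)) //.
    have [mN|Nm] := leqP m N; first by rewrite big_geq ?sqr_ge0.
    apply: le_trans (square_partial_le x m); rewrite /square_partial.
    rewrite [X in _ <= X](big_cat_nat (n := N)) //=; last exact: ltnW.
    by rewrite lerDr sumr_ge0 // => k _; exact: sqr_ge0.
  - move=> e e0; have [N hN] := dto e e0; exists N; apply: ge_sup; first by exists (d N); exists N => /=.
    by move=> _ [k /= Nk <-]; exact: hN.
have quot (A : K) : (forall k, t A k <= d k) -> exists T : K, forall x k, T x k = (Num.sqrt (d k))^-1%:C%C * A x k.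
  move=> tA; apply: (@compact_of_coordinates _ (fun N => 2 * d N)).
  - by move=> a x y k; rewrite op_linear l2_addE l2_scaleE; ring.
  - move=> N m x; pose r k := l2norm (l2tail k (A x)).
    have rN : r N <= d N * l2norm x.
      by apply: le_trans (tP _ _ _) _; rewrite ler_wpM2r ?l2norm_ge0.
    have [mN|Nm] := leqP m N; first by rewrite big_geq // mulr_ge0 ?sqr_ge0 // mulr_ge0 // ltW.
    (* With r_k decreasing and r_k <= d_k |x|, the square of the k-th coordinate is r_k^2 -
       r_(k+1)^2 <= 2 r_k (r_k - r_(k+1)). Division by d_k leaves 2 |x| (r_k - r_(k+1)), and the sum
       is at most 2 d_N |x|^2; this is the origin of the bound 2 d N. *)
    apply: (@le_trans _ _ (\sum_(N <= k < m) (2 * l2norm x * r k - 2 * l2norm x * r k.+1))).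
      apply: ler_sum_nat => k _; rewrite normcM exprMn normc_real sqr_normr exprVn.
      rewrite sqr_sqrtr ?(ltW (d0 _)) // mulrC ler_pdivrMr // normc_coord_tail -/(r k) -/(r k.+1).
      have r1 : r k.+1 <= r k by exact: l2norm_tail_nincr.
      have r2 : r k <= d k * l2norm x.
        by apply: le_trans (tP _ _ _) _; rewrite ler_wpM2r ?l2norm_ge0.
      have r3 : 0 <= r k.+1 by exact: l2norm_ge0.
      have -> : r k ^+ 2 - r k.+1 ^+ 2 = (r k - r k.+1) * (r k + r k.+1) by ring.
      have -> : (2 * l2norm x * r k - 2 * l2norm x * r k.+1) * d k =
         (r k - r k.+1) * (2 * (d k * l2norm x)) by ring.
      by apply: ler_wpM2l; lra.
    have -> : \sum_(N <= k < m) (2 * l2norm x * r k - 2 * l2norm x * r k.+1) =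
       2 * l2norm x * r N - 2 * l2norm x * r m.
      have := @telescope_sumr _ N m (fun k => - (2 * l2norm x * r k)) (ltnW Nm).
      rewrite /= opprK addrC => <-; apply: eq_bigr => k _.
      by rewrite opprK addrC.
    have := l2norm_ge0 x; have : 0 <= r m by exact: l2norm_ge0.
    by move=> rm nx; have := mulr_ge0 nx rm; have := ler_wpM2l nx rN; rewrite expr2; nra.
  - move=> e e0; have e2 : 0 < e / 2 by rewrite divr_gt0.
    by have [N hN] := dto _ e2; exists N; have := hN N (leqnn N); lra.
have sq k : Num.sqrt (d k) != 0 by rewrite sqrtr_eq0 -ltNge.
have [T hT] : exists T : K, forall x k, T x k = (Num.sqrt (d k))^-1%:C%C * S x k.
  by apply: quot => k; rewrite /d -addrA lerDl addr_ge0 // invr_ge0.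
have [T' hT'] : exists T : K, forall x k, T x k = (Num.sqrt (d k))^-1%:C%C * S' x k.
  by apply: quot => k; rewrite /d -addrA addrCA lerDl addr_ge0 // invr_ge0.
exists D, T, T'; split.
- move=> x Dx; apply: l2_ext => k; have := hD x k; rewrite Dx l2_0E => /esym/eqP.
  by rewrite mulf_eq0 => /orP[/eqP[/eqP]|/eqP //]; rewrite (negbTE (sq k)).
- by apply: op_ext => x; apply: l2_ext => k; rewrite opmulE hD hT mulrA -rmorphM divff // mul1r.
- by apply: op_ext => x; apply: l2_ext => k; rewrite opmulE hD hT' mulrA -rmorphM divff // mul1r.
Qed.

Lemma opmul_injl (D S S' : K) : (forall x, D x = 0 -> x = 0) -> opmul D S = opmul D S' -> S = S'.
Proof.
move=> Dinj e; apply: op_ext => x; apply/eqP; rewrite -subr_eq0; apply/eqP/Dinj.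
by rewrite (linear_lfB (op_linear D)) -!opmulE e subrr.
Qed.

Lemma opnorm_has_sup A :
  has_sup [set l2norm (A x) | x in [set x : l2 | l2norm x <= 1]].
Proof.
have [M M0 hM] := op_bounded A; split.
  by exists (l2norm (A 0)); exists 0 => //=; rewrite l2norm0 ler01.
by exists M => _ [x /= x1 <-]; apply: le_trans (hM _) _; rewrite ler_piMr.
Qed.

Lemma opnorm_ub A x : l2norm x <= 1 -> l2norm (A x) <= opnorm A.
Proof. by move=> x1; apply: sup_upper_bound; [exact: opnorm_has_sup|exists x]. Qed.

Lemma opnorm_le A (c : R) : (forall x, l2norm x <= 1 -> l2norm (A x) <= c) -> opnorm A <= c.
Proof.
move=> h; apply: ge_sup => [|_ [x /= x1 <-]]; last exact: h.
by case: (opnorm_has_sup A).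
Qed.

Lemma opnorm_ge0 A : 0 <= opnorm A.
Proof. by apply: le_trans (l2norm_ge0 (A 0)) (opnorm_ub _ _); rewrite l2norm0. Qed.

Lemma opnorm_form_ub A x : l2norm x <= 1 -> complex.Re (l2dot x (A x)) <= opnorm A.
Proof.
move=> x1; apply: le_trans (ler_norm _) _; apply: le_trans (Re_le_normc _) _.
apply: le_trans (l2_cauchy_schwarz _ _) _; rewrite -[X in _ <= X]mul1r.
by apply: ler_pM; rewrite ?l2norm_ge0 //; exact: opnorm_ub.
Qed.

(** Cauchy-Schwarz for the positive form <u, A v> at A x and x: |A x|^4 <= <A x, A A x> <x, A x> <=
    c |A x|^2 c. *)
Lemma opnorm_form_le A (c : R) : 0 <= c -> (forall x, 0 <= l2dot x (A x)) ->
  (forall x, l2norm x <= 1 -> complex.Re (l2dot x (A x)) <= c) -> opnorm A <= c.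
Proof.
move=> c0 Ap Ac; apply: opnorm_le => x x1.
have kp : psd (fun u v => l2dot u (A v)).
  apply: psd_sesquilinear => //; first by move=> u a v w; exact: l2dot_combl.
  by move=> u a v w; rewrite op_linear l2dot_combr.
have form (u : l2) : l2dot u (A u) = (complex.Re (l2dot u (A u)))%:C%C.
  by have := Ap u; case: (l2dot u (A u)) => p q; rewrite ge0_complexE /= => /andP[/eqP -> _].
have Acs u : complex.Re (l2dot u (A u)) <= c * l2norm u ^+ 2.
  have [u0|u0] := eqVneq (l2norm u) 0.
    by rewrite u0 expr0n mulr0 (l2norm_eq0 u0) l2dot0l.
  have n0 : 0 < l2norm u by rewrite lt0r u0 l2norm_ge0.
  have := Ac ((l2norm u)^-1%:C%C *: u); rewrite l2normZ normc_real.
  rewrite ger0_norm ?invr_ge0 ?l2norm_ge0 // mulVf // lexx => /(_ isT).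
  rewrite (linear_lfZ (op_linear A)) l2dotZl l2dotZr mulrA form conjc_mul_self -rmorphM.
  rewrite -[X in X <= _]/(normc (l2norm u)^-1%:C%C ^+ 2 * complex.Re (l2dot u (A u))).
  by rewrite normc_real sqr_normr exprVn mulrC ler_pdivrMr ?exprn_gt0.
have := psd_cauchy_schwarz (A x) x kp.
rewrite mulrC conjc_mul_self l2dotxx normc_real form (form x) -rmorphM lecR.
rewrite ger0_norm ?sqr_ge0 // => h.
have [/eqP|n0] := boolP (l2norm (A x) == 0); first by move=> ->.
have np : 0 < l2norm (A x) by rewrite lt0r n0 l2norm_ge0.
rewrite -ler_sqr ?nnegrE ?l2norm_ge0 //.
rewrite -(ler_pM2l (exprn_gt0 2 np)) -expr2; apply: le_trans h _.
have := Acs (A x); have := Ac x x1.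
have : 0 <= complex.Re (l2dot x (A x)) by have := Ap x; rewrite ge0_complexE => /andP[].
have : 0 <= complex.Re (l2dot (A x) (A (A x))) by have := Ap (A x); rewrite ge0_complexE => /andP[].
move: (complex.Re (l2dot (A x) (A (A x)))) (complex.Re (l2dot x (A x))) (l2norm (A x) ^+ 2).
move=> p q n p0 q0 qc pc.
by apply: le_trans (ler_pM p0 q0 pc qc) _; rewrite expr2 mulrA (mulrC c).
Qed.

Lemma opnorm_matrix_unit a : opnorm (a *: matrix_unit 0 0) = normc a.
Proof.
apply/eqP; rewrite eq_le; apply/andP; split.
  apply: opnorm_le => x x1; rewrite op_scaleE matrix_unitE !l2normZ l2norm_delta mulr1.
  by rewrite ler_piMr ?normc_ge0 // (le_trans (normc_coord_le _ _)).
have := @opnorm_ub (a *: matrix_unit 0 0) (l2delta R 0).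
rewrite l2norm_delta op_scaleE matrix_unitE l2deltaE scale1r l2normZ l2norm_delta mulr1.
exact.
Qed.
End CompactOperators.

(** * Fock bimodules *)

Section FockTheory.
Variables (R : realType) (D : fockData R).
Local Notation C := R[i].
Local Notation B := (coef D).
Local Notation X := (onep D).

(** What a bimodule with inner product over a *-algebra satisfies; it holds both for B = C and for B
    = K, and therefore contains no unit. *)
Record fock_laws : Prop := {
  cmul_linearl : forall b : B, linear (fun a : B => cmul a b);
  cmul_linearr : forall a : B, linear (fun b : B => cmul a b);
  cmulA : forall a b c : B, cmul a (cmul b c) = cmul (cmul a b) c;
  cadj_antilinear : forall a (b c : B), cadj (a *: b + c) = a^* *: cadj b + cadj c;
  cadjM : forall b c : B, cadj (cmul b c) = cmul (cadj c) (cadj b);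
  cadjK : forall b : B, cadj (cadj b) = b;
  lact_linearl : forall x : X, linear (fun b : B => lact b x);
  lact_linearr : forall b : B, linear (fun x : X => lact b x);
  lactA : forall (b c : B) (x : X), lact (cmul b c) x = lact b (lact c x);
  ract_linearl : forall b : B, linear (fun x : X => ract x b);
  ract_linearr : forall x : X, linear (fun b : B => ract x b);
  lact_ract : forall (b c : B) (x : X), lact b (ract x c) = ract (lact b x) c;
  bdot_linear : forall x : X, linear (fun y : X => bdot x y);
  bdot_herm : forall x y : X, bdot y x = cadj (bdot x y);
  bdot_ract : forall (x y : X) (b : B), bdot x (ract y b) = cmul (bdot x y) b;
  bdot_lact : forall (b : B) (x y : X), bdot (lact b x) y = bdot x (lact (cadj b) y) }.

Hypothesis laws : fock_laws.
Implicit Types (x y : X) (b c : B) (s t : seq X) (w : word D) (z : fock D).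

Definition word_linear (M : lmodType C) (h : word D -> M) : Prop :=
  [/\ forall a b b', h (Vac (a *: b + b')) = a *: h (Vac b) + h (Vac b'),
      forall s t a x x', h (insert s (a *: x + x') t) = a *: h (insert s x t) + h (insert s x' t)
    & forall s t x b y, h (insert s (ract x b) (y :: t)) = h (insert s x (lact b y :: t))].

Definition word_antilinear (M : lmodType C) (h : word D -> M) : Prop :=
  [/\ forall a b b', h (Vac (a *: b + b')) = a^* *: h (Vac b) + h (Vac b'),
      forall s t a x x', h (insert s (a *: x + x') t) = a^* *: h (insert s x t) + h (insert s x' t)
    & forall s t x b y, h (insert s (ract x b) (y :: t)) = h (insert s x (lact b y :: t))].

Local Notation gen := (generator (@balanced_multilinear R D)).

Lemma word_linear_generator : word_linear (gen : word D -> fock D).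
Proof.
split=> [a b b'|s t a x x'|s t x b y]; apply: presented_ext => -[f [f1 f2 f3]].
- by rewrite [RHS]presented_comb !generatorE /= f1.
- by rewrite [RHS]presented_comb !generatorE /= f2.
- by rewrite !generatorE /= f3.
Qed.

Lemma word_linear_comp (M : lmodType C) (L : fock D -> M) :
  linear L -> word_linear (fun w => L (gen w)).
Proof.
move=> Ll; have [h1 h2 h3] := word_linear_generator.
by split=> [a b b'|s t a x x'|s t x b y]; rewrite ?h1 ?h2 ?h3 ?Ll.
Qed.

Section Ext.
Variables (M : lmodType C) (h : word D -> M).

Lemma word_linear_admissible : word_linear h -> admissible (@balanced_multilinear R D) h.
Proof.
case=> h1 h2 h3 l ll; split=> [a b b'|s t a x x'|s t x b y] /=.
- by rewrite h1 ll.
- by rewrite h2 ll.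
- by rewrite h3.
Qed.

Lemma word_antilinear_admissible :
  word_antilinear h -> anti_admissible (@balanced_multilinear R D) h.
Proof.
case=> h1 h2 h3 l ll; split=> [a b b'|s t a x x'|s t x b y] /=.
- by rewrite h1 ll conjcD conjcM conjCK.
- by rewrite h2 ll conjcD conjcM conjCK.
- by rewrite h3.
Qed.

Lemma fock_ext_linear : word_linear h -> linear (lin_ext h : fock D -> M).
Proof. by move=> hh; apply: lin_ext_linear; exact: word_linear_admissible. Qed.

Lemma fock_ext_generator w : word_linear h -> lin_ext h (gen w : fock D) = h w.
Proof. by move=> hh; apply: lin_ext_generator; exact: word_linear_admissible. Qed.
End Ext.

Lemma fock_ind (P : fock D -> Prop) :
  (forall a z z', P z -> P z' -> P (a *: z + z')) ->
  (forall b, P (vac b)) -> (forall x s, P (tensor_word x s)) -> forall z, P z.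
Proof.
move=> Pl Pv Pt; apply: presented_ind => //; last by case.
by have := Pl (-1) _ _ (Pv 0) (Pv 0); rewrite scaleN1r addNr.
Qed.

Lemma fock_eq (M : lmodType C) (f g : fock D -> M) : linear f -> linear g ->
  (forall b, f (vac b) = g (vac b)) ->
  (forall x s, f (tensor_word x s) = g (tensor_word x s)) -> forall z, f z = g z.
Proof.
move=> fl gl hv ht; apply: fock_ind => // a z z' e e'.
by rewrite fl gl e e'.
Qed.

Lemma vac_linear : linear (@vac R D).
Proof. by case: word_linear_generator. Qed.

Lemma tensor_word_linear s : linear (fun x => tensor_word x s).
Proof. by case: word_linear_generator => _ /(_ [::] s). Qed.

Lemma creation_word_linear x : word_linear (fun w => match w with
    | Vac b => tensor_word (ract x b) [::]
    | Tens y s => tensor_word x (y :: s)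
    end).
Proof.
have [h1 h2 h3] := word_linear_generator.
split=> [a b b'|[|z s] t a y y'|[|z s] t y b y'] /=.
- by rewrite (ract_linearr laws) tensor_word_linear.
- exact: (h2 [:: x]).
- exact: (h2 [:: x, z & s]).
- exact: (h3 [:: x]).
- exact: (h3 [:: x, z & s]).
Qed.

Lemma creation_linear x : linear (@creation R D x).
Proof. exact/fock_ext_linear/creation_word_linear. Qed.
Lemma creation_vac x b : creation x (vac b) = tensor_word (ract x b) [::].
Proof. exact: (fock_ext_generator _ (creation_word_linear x)). Qed.
Lemma creation_tens x y s : creation x (tensor_word y s) = tensor_word x (y :: s).
Proof. exact: (fock_ext_generator _ (creation_word_linear x)). Qed.

Lemma annihilation_word_linear x : word_linear (fun w => match w with
    | Vac _ => 0
    | Tens y [::] => vac (bdot x y)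
    | Tens y (z :: s) => tensor_word (lact (bdot x y) z) s
    end).
Proof.
have [h1 h2 h3] := word_linear_generator.
split=> [a b b'|[|z [|z' s]] t a y y'|[|z [|z' s]] t y b y'] /=.
- by rewrite scaler0 addr0.
- case: t => [|z t]; first by rewrite (bdot_linear laws) vac_linear.
  by rewrite (bdot_linear laws) (lact_linearl laws) tensor_word_linear.
- by rewrite (lact_linearr laws) tensor_word_linear.
- exact: (h2 (lact (bdot x z) z' :: s)).
- by rewrite (bdot_ract laws) (lactA laws).
- by rewrite (lact_ract laws); exact: (h3 [::]).
- exact: (h3 (lact (bdot x z) z' :: s)).
Qed.

Lemma annihilation_linear x : linear (@annihilation R D x).
Proof. exact/fock_ext_linear/annihilation_word_linear. Qed.
Lemma annihilation_vac x b : annihilation x (vac b) = 0.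
Proof. exact: (fock_ext_generator _ (annihilation_word_linear x)). Qed.
Lemma annihilation_tens1 x y : annihilation x (tensor_word y [::]) = vac (bdot x y).
Proof. exact: (fock_ext_generator _ (annihilation_word_linear x)). Qed.
Lemma annihilation_tens2 x y y' s :
  annihilation x (tensor_word y (y' :: s)) = tensor_word (lact (bdot x y) y') s.
Proof. exact: (fock_ext_generator _ (annihilation_word_linear x)). Qed.

Lemma fock_lact_word_linear b : word_linear (fun w => match w with
    | Vac c => vac (cmul b c)
    | Tens x s => tensor_word (lact b x) s
    end).
Proof.
have [h1 h2 h3] := word_linear_generator.
split=> [a c c'|[|z s] t a y y'|[|z s] t y c y'] /=.
- by rewrite (cmul_linearr laws) vac_linear.
- by rewrite (lact_linearr laws) tensor_word_linear.
- exact: (h2 (lact b z :: s)).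
- by rewrite (lact_ract laws); exact: (h3 [::]).
- exact: (h3 (lact b z :: s)).
Qed.

Lemma fock_lact_linear b : linear (@fock_lact R D b).
Proof. exact/fock_ext_linear/fock_lact_word_linear. Qed.
Lemma fock_lact_vac b c : fock_lact b (vac c) = vac (cmul b c).
Proof. exact: (fock_ext_generator _ (fock_lact_word_linear b)). Qed.
Lemma fock_lact_tens b x s : fock_lact b (tensor_word x s) = tensor_word (lact b x) s.
Proof. exact: (fock_ext_generator _ (fock_lact_word_linear b)). Qed.

Lemma vac_component_word_linear : word_linear (fun w => if w is Vac b then b else 0 : B).
Proof.
by split=> [a b b'|[|z s] t a y y'|[|z s] t y b y'] //=; rewrite scaler0 addr0.
Qed.

Lemma vac_component_linear : linear (@vac_component R D).
Proof. exact/fock_ext_linear/vac_component_word_linear. Qed.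
Lemma vac_component_vac b : vac_component (vac b) = b.
Proof. exact: (fock_ext_generator _ vac_component_word_linear). Qed.
Lemma vac_component_tens x s : vac_component (tensor_word x s) = 0.
Proof. exact: (fock_ext_generator _ vac_component_word_linear). Qed.

Lemma vac_component_creation x z : vac_component (creation x z) = 0.
Proof.
apply: (@fock_eq _ (fun z => vac_component (creation x z)) (fun=> 0)) => [||b|y s].
- exact: (linear_comp vac_component_linear (creation_linear x)).
- by move=> a u v; rewrite scaler0 addr0.
- by rewrite creation_vac vac_component_tens.
- by rewrite creation_tens vac_component_tens.
Qed.

Lemma annihilation_creation x y z : annihilation x (creation y z) = fock_lact (bdot x y) z.
Proof.
apply: (@fock_eq _ (fun z => annihilation x (creation y z))) => [||b|u s].
- exact: (linear_comp (annihilation_linear x) (creation_linear y)).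
- exact: fock_lact_linear.
- by rewrite creation_vac annihilation_tens1 (bdot_ract laws) fock_lact_vac.
- by rewrite creation_tens annihilation_tens2 fock_lact_tens.
Qed.

Lemma creation_linear_arg z : linear (fun x => creation x z).
Proof.
move=> a x x'; have [h1 h2 h3] := word_linear_generator.
apply: (@fock_eq _ (fun z => creation (a *: x + x') z) (fun z => a *: creation x z + creation x' z)) => [||b|u s].
- exact: creation_linear.
- move=> c u v; rewrite !creation_linear !scalerDr !scalerA -!addrA (mulrC a c).
  by congr (_ + _); rewrite addrCA.
- by rewrite !creation_vac (ract_linearl laws) tensor_word_linear.
- by rewrite !creation_tens tensor_word_linear.
Qed.

Lemma bdot_antilinear y a x x' : bdot (a *: x + x') y = a^* *: bdot x y + bdot x' y.
Proof.
by rewrite (bdot_herm laws) (bdot_linear laws) (cadj_antilinear laws) -!(bdot_herm laws).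
Qed.

Lemma annihilation_antilinear_arg z a x x' :
  annihilation (a *: x + x') z = a^* *: annihilation x z + annihilation x' z.
Proof.
apply: (@fock_eq _ (fun z => annihilation (a *: x + x') z)
   (fun z => a^* *: annihilation x z + annihilation x' z)) => [||b|u [|v s]].
- exact: annihilation_linear.
- move=> c u v; rewrite !annihilation_linear !scalerDr !scalerA -!addrA (mulrC a^* c).
  by congr (_ + _); rewrite addrCA.
- by rewrite !annihilation_vac scaler0 addr0.
- by rewrite !annihilation_tens1 bdot_antilinear vac_linear.
- by rewrite !annihilation_tens2 bdot_antilinear (lact_linearl laws) tensor_word_linear.
Qed.

Lemma annihilation_ract x b z : annihilation (ract x b) z = fock_lact (cadj b) (annihilation x z).
Proof.
have e y : bdot (ract x b) y = cmul (cadj b) (bdot x y).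
  by rewrite (bdot_herm laws) (bdot_ract laws) (cadjM laws) -(bdot_herm laws).
apply: (@fock_eq _ _ (fun z => fock_lact (cadj b) (annihilation x z))) => [||c|u [|v s]].
- exact: annihilation_linear.
- exact: (linear_comp (fock_lact_linear _) (annihilation_linear x)).
- by rewrite !annihilation_vac (linear_lf0 (fock_lact_linear _)).
- by rewrite !annihilation_tens1 fock_lact_vac e.
- by rewrite !annihilation_tens2 fock_lact_tens e (lactA laws).
Qed.

Lemma annihilation_lact x b z : annihilation (lact b x) z = annihilation x (fock_lact (cadj b) z).
Proof.
apply: (@fock_eq _ _ (fun z => annihilation x (fock_lact (cadj b) z))) => [||c|u [|v s]].
- exact: annihilation_linear.
- exact: (linear_comp (annihilation_linear x) (fock_lact_linear _)).
- by rewrite fock_lact_vac !annihilation_vac.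
- by rewrite fock_lact_tens !annihilation_tens1 (bdot_lact laws).
- by rewrite fock_lact_tens !annihilation_tens2 (bdot_lact laws).
Qed.

Lemma fock_lact_creation b x z : fock_lact b (creation x z) = creation (lact b x) z.
Proof.
apply: (@fock_eq _ (fun z => fock_lact b (creation x z))) => [||c|u s].
- exact: (linear_comp (fock_lact_linear b) (creation_linear x)).
- exact: creation_linear.
- by rewrite !creation_vac fock_lact_tens (lact_ract laws).
- by rewrite !creation_tens fock_lact_tens.
Qed.

Definition annihilations z s : fock D := foldl (fun z x => annihilation x z) z s.

Lemma annihilations_linear s : linear (annihilations^~ s).
Proof.
elim: s => [|x s IH] a z z' //=.
by rewrite /annihilations /= annihilation_linear; exact: IH.
Qed.

(** The inner product with a word, computed by annihilating its letters from left to right and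
    taking the vacuum component. In this form the adjointness of creation and annihilation is
    immediate. *)
Definition word_form w : fock D -> B := match w with
  | Vac a => fun z => cmul (cadj a) (vac_component z)
  | Tens x s => fun z => vac_component (annihilations z (x :: s)) end.

Lemma word_form_linear w : linear (word_form w).
Proof.
case: w => [a|x s].
  exact: (linear_comp (cmul_linearr laws _) vac_component_linear).
exact: (linear_comp vac_component_linear (annihilations_linear _)).
Qed.

(** [rev_dot] starts from the last tensor factor, annihilation from the first. In the reversed lists
    the first factors stand last, and their inner product is absorbed as a coefficient by the
    neighbouring letter. *)
Lemma rev_dot_peel s t x x' y y' : size s = size t ->
  rev_dot (s ++ [:: x'; x]) (t ++ [:: y'; y]) =
  rev_dot (s ++ [:: x']) (t ++ [:: lact (bdot x y) y']).
Proof.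
elim: s t => [|u s IH] [|v t] //= [st].
by rewrite (IH _ st); case: s {IH st}.
Qed.

Lemma annihilations0 s : annihilations 0 s = 0.
Proof. by have := linear_lf0 (annihilations_linear s). Qed.

Lemma word_dotE w w' : word_dot w w' = word_form w (gen w').
Proof.
case: w w' => [a|x s] [b|y t] /=.
- by rewrite -[gen _]/(vac b) vac_component_vac.
- rewrite -[gen _]/(tensor_word y t) vac_component_tens.
  by rewrite (linear_lf0 (cmul_linearr laws _)).
- rewrite -[gen _]/(vac b) annihilation_vac annihilations0.
  by rewrite (linear_lf0 vac_component_linear).
rewrite -[gen _]/(tensor_word y t).
elim: s x y t => [|x' s IH] x y [|y' t] /=.
- by rewrite /rev /= annihilation_tens1 vac_component_vac.
- by rewrite annihilation_tens2 vac_component_tens.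
- rewrite annihilation_tens1 annihilation_vac annihilations0.
  by rewrite (linear_lf0 vac_component_linear).
rewrite annihilation_tens2 -IH eqSS; case: eqP => // st.
rewrite !rev_cons -!cats1 -!catA /= rev_dot_peel ?size_rev //.
Qed.

Lemma word_form_antilinear z : word_antilinear (fun w => word_form w z).
Proof.
have E s x t : word_form (insert s x t) z = vac_component (annihilations (annihilation x (annihilations z s)) t).
  by case: s => [|y s]; rewrite /= /annihilations /= ?foldl_cat.
split=> [a b b'|s t a x x'|s t x b y] /=.
- by rewrite (cadj_antilinear laws) (cmul_linearl laws).
- by rewrite !E annihilation_antilinear_arg annihilations_linear vac_component_linear.
- rewrite !E /annihilations /= -!/(annihilations _ _).
  by rewrite annihilation_ract -annihilation_lact.
Qed.

Lemma lin_ext_word_dot w z : lin_ext (word_dot w) z = word_form w z.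
Proof.
have -> : word_dot w = fun w' => word_form w (gen w') by apply/funext => w'; exact: word_dotE.
have h := word_linear_comp (word_form_linear w).
apply: (@fock_eq _ (lin_ext _)) => [||b|u s].
- exact: fock_ext_linear.
- exact: word_form_linear.
- exact: (fock_ext_generator (Vac b)).
- exact: (fock_ext_generator (Tens u s)).
Qed.

Lemma fock_dotE z z' : fock_dot z z' = antilin_ext (fun w => word_form w z') z.
Proof.
by congr antilin_ext; apply/funext => w; exact: lin_ext_word_dot.
Qed.

Lemma fock_dot_generator w z : fock_dot (gen w) z = word_form w z.
Proof.
rewrite fock_dotE antilin_ext_generator //.
exact/word_antilinear_admissible/word_form_antilinear.
Qed.

Lemma fock_dot_antilinear z' a u v : fock_dot (a *: u + v) z' = a^* *: fock_dot u z' + fock_dot v z'.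
Proof.
by rewrite !fock_dotE antilin_ext_linear //; exact/word_antilinear_admissible/word_form_antilinear.
Qed.

Lemma fock_dot_linear z : linear (fock_dot z : fock D -> B).
Proof.
elim/fock_ind: z => [a z z' h h'|b|x s] c u v.
- rewrite !fock_dot_antilinear h h' !scalerDr !scalerA -!addrA (mulrC c).
  by congr (_ + _); rewrite addrCA.
- by rewrite !fock_dot_generator word_form_linear.
- by rewrite !fock_dot_generator word_form_linear.
Qed.

Lemma fock_dot_vac b z : fock_dot (vac b) z = cmul (cadj b) (vac_component z).
Proof. by rewrite fock_dot_generator. Qed.

Lemma cadj0 : cadj (0 : B) = 0.
Proof.
have := cadj_antilinear laws (-1) 0 0.
by rewrite scaler0 addr0 conjcN conjc1 scaleN1r addNr.
Qed.

Lemma antilinear_form_eq (f g : fock D -> B) :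
  (forall a u v, f (a *: u + v) = a^* *: f u + f v) ->
  (forall a u v, g (a *: u + v) = a^* *: g u + g v) ->
  (forall b, f (vac b) = g (vac b)) ->
  (forall x s, f (tensor_word x s) = g (tensor_word x s)) -> forall z, f z = g z.
Proof.
by move=> fl gl hv ht; apply: fock_ind => // a z z' e e'; rewrite fl gl e e'.
Qed.

Lemma fock_dot_creation x z z' : fock_dot (creation x z) z' = fock_dot z (annihilation x z').
Proof.
apply: (@antilinear_form_eq (fun z => fock_dot (creation x z) z') (fun z => fock_dot z (annihilation x z'))) => [a u v|a u v|b|y s].
- by rewrite creation_linear fock_dot_antilinear.
- exact: fock_dot_antilinear.
- rewrite creation_vac !fock_dot_generator /= /annihilations /= annihilation_ract.
  elim/fock_ind: (annihilation x z') => [a u v e e'|c|y s].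
  + by rewrite fock_lact_linear !vac_component_linear e e' (cmul_linearr laws).
  + by rewrite fock_lact_vac !vac_component_vac.
  + by rewrite fock_lact_tens !vac_component_tens (linear_lf0 (cmul_linearr laws _)).
- by rewrite creation_tens !fock_dot_generator.
Qed.

Lemma rev_dot_herm s t : size s = size t -> rev_dot t s = cadj (rev_dot s t).
Proof.
elim: s t => [|x s IH] [|y t] //=; first by rewrite cadj0.
move=> [st]; case: s IH st => [|x' s] IH st; case: t IH st => [|y' t] IH // st.
  by rewrite (bdot_herm laws).
rewrite (IH (y' :: t)) ?st // -(bdot_herm laws) [RHS](bdot_lact laws).
by [].
Qed.

(** On words, reversing the roles moves every inner coefficient to the other side of [bdot] as its
    adjoint; both sides are then extended one variable at a time. *)
Lemma fock_dot_herm z z' : fock_dot z' z = cadj (fock_dot z z').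
Proof.
have wh w w' : word_dot w' w = cadj (word_dot w w').
  case: w w' => [a|x s] [b|y t] /=; rewrite ?cadj0 ?(cadjM laws) ?(cadjK laws) //.
  rewrite eq_sym; case: eqP => st; last by rewrite cadj0.
  by rewrite rev_dot_herm // !size_rev /= st.
have gl w w' : fock_dot (gen w') (gen w) = cadj (fock_dot (gen w) (gen w')).
  by rewrite !fock_dot_generator -!word_dotE wh.
have e1 w : fock_dot z' (gen w) = cadj (fock_dot (gen w) z').
  elim/fock_ind: z' => [a u v e e'|b|y t]; [|exact: gl|exact: gl].
  by rewrite fock_dot_antilinear fock_dot_linear (cadj_antilinear laws) e e'.
elim/fock_ind: z => [a u v e e'|b|y t]; [|exact: e1|exact: e1].
by rewrite fock_dot_antilinear fock_dot_linear (cadj_antilinear laws) conjCK e e'.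
Qed.

Lemma fock_dot_annihilation x z z' : fock_dot (annihilation x z) z' = fock_dot z (creation x z').
Proof. by rewrite fock_dot_herm -fock_dot_creation -fock_dot_herm. Qed.

Lemma gaussian_linear x : linear (@gaussian R D x).
Proof.
move=> a u v; rewrite /gaussian !fctE annihilation_linear creation_linear scalerDr.
by rewrite addrACA.
Qed.

Lemma fock_dot_gaussian x z z' : fock_dot (gaussian x z) z' = fock_dot z (gaussian x z').
Proof.
rewrite /gaussian !fctE (linear_lfD (fock_dot_linear z)).
have := fock_dot_antilinear z' 1 (annihilation x z) (creation x z).
by rewrite conjc1 !scale1r => ->; rewrite fock_dot_creation fock_dot_annihilation addrC.
Qed.

End FockTheory.

(** * The scalar Fock space *)

Section SesquilinearForms.
Variables (R : realType) (M : lmodType R[i]) (k : M -> M -> R[i]).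
Local Notation C := R[i].
Hypothesis kl : forall y a x x', k (a *: x + x') y = a^* * k x y + k x' y.
Hypothesis kr : forall x a y y', k x (a *: y + y') = a * k x y + k x y'.
Hypothesis kp : forall x, 0 <= k x x.

Definition form_norm x : R := Num.sqrt (complex.Re (k x x)).

Let kpsd : psd k.
Proof. exact: psd_sesquilinear. Qed.

Lemma form_norm_ge0 x : 0 <= form_norm x.
Proof. exact: sqrtr_ge0. Qed.

Lemma form_norm_sqr x : k x x = (form_norm x ^+ 2)%:C%C.
Proof.
rewrite /form_norm; have := kp x; case: (k x x) => a b.
by rewrite ge0_complexE /= => /andP[/eqP -> a0]; rewrite sqr_sqrtr.
Qed.

Lemma form_cauchy_schwarz x y : normc (k x y) <= form_norm x * form_norm y.
Proof.
rewrite -ler_sqr ?nnegrE ?normc_ge0 ?mulr_ge0 ?form_norm_ge0 // exprMn.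
have := psd_cauchy_schwarz x y kpsd.
by rewrite mulrC conjc_mul_self !form_norm_sqr -rmorphM lecR.
Qed.

Let k0r x : k x 0 = 0.
Proof. by have := kr x (-1) 0 0; rewrite scaler0 addr0 mulN1r addNr. Qed.
Let k0l x : k 0 x = 0.
Proof. by rewrite (psd_herm x 0 kpsd) k0r conjc0. Qed.

Lemma form_normZ a x : form_norm (a *: x) = normc a * form_norm x.
Proof.
apply/eqP; rewrite -(@eqrXn2 _ 2) ?mulr_ge0 ?form_norm_ge0 ?normc_ge0 // exprMn.
have := form_norm_sqr (a *: x); rewrite -[a *: x]addr0 kl kr k0r k0l !addr0.
by rewrite mulrA conjc_mul_self form_norm_sqr -rmorphM => -[<-].
Qed.

Lemma form_normD x y : form_norm (x + y) <= form_norm x + form_norm y.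
Proof.
rewrite -ler_sqr ?nnegrE ?addr_ge0 ?form_norm_ge0 //.
have := form_norm_sqr (x + y); rewrite -[x]scale1r !kl !kr scale1r conjc1 !mul1r.
rewrite !form_norm_sqr (psd_herm x y kpsd).
have := le_trans (ler_norm _) (le_trans (Re_le_normc _) (form_cauchy_schwarz x y)).
case: (k x y) => p q /= h; rewrite conjcE => -[<- _].
by move: h; rewrite sqrrD; lra.
Qed.

End SesquilinearForms.

Section ScalarFock.
Variables (R : realType) (H : realHilbert R).
Local Notation C := R[i].
Local Notation HC := (complexification H).
Local Notation F := (fock (scalar_data H)).
Implicit Types (x y e f : HC) (z : F) (s : seq HC) (h : H).

Lemma hdotDl (u v w : H) : hdot (u + v) w = hdot u w + hdot v w.
Proof. by have := hdot_linear w 1 u v; rewrite scale1r mul1r. Qed.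
Lemma hdot0l (w : H) : hdot 0 w = 0.
Proof. by have := hdot_linear w (-1) 0 0; rewrite scaler0 addr0 mulN1r addNr. Qed.
Lemma hdotZl a (v w : H) : hdot (a *: v) w = a * hdot v w.
Proof. by have := hdot_linear w a v 0; rewrite !addr0 hdot0l addr0. Qed.
Lemma hdotNl (v w : H) : hdot (- v) w = - hdot v w.
Proof. by rewrite -scaleN1r hdotZl mulN1r. Qed.
Lemma hdotDr (u v w : H) : hdot w (u + v) = hdot w u + hdot w v.
Proof. by rewrite hdotC hdotDl !(hdotC w). Qed.
Lemma hdotZr a (v w : H) : hdot w (a *: v) = a * hdot w v.
Proof. by rewrite hdotC hdotZl (hdotC w). Qed.
Lemma hdotNr (v w : H) : hdot w (- v) = - hdot w v.
Proof. by rewrite hdotC hdotNl (hdotC w). Qed.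
Lemma hdot0r (w : H) : hdot w 0 = 0.
Proof. by rewrite hdotC hdot0l. Qed.
Definition hdotE := (hdotDl, hdotDr, hdotNl, hdotNr, hdotZl, hdotZr, hdot0l, hdot0r).

Lemma cdot_linear x a y y' : cdot x (a *: y + y') = a * cdot x y + cdot x y'.
Proof.
case: a x y y' => p q [x1 x2] [y1 y2] [z1 z2]; apply/eqP; rewrite eq_complex.
by apply/andP; split; apply/eqP; rewrite /= !hdotE; ring.
Qed.

Lemma cdot_herm x y : cdot y x = (cdot x y)^*.
Proof.
case: x y => [x1 x2] [y1 y2]; apply/eqP; rewrite eq_complex /= !(hdotC y1) !(hdotC y2).
by apply/andP; split; apply/eqP; ring.
Qed.

Lemma cdot_antilinear y a x x' : cdot (a *: x + x') y = a^* * cdot x y + cdot x' y.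
Proof. by rewrite cdot_herm cdot_linear conjcD conjcM -!cdot_herm. Qed.

Lemma cdot0r x : cdot x 0 = 0.
Proof. by have := cdot_linear x (-1) 0 0; rewrite scaler0 addr0 mulN1r addNr. Qed.
Lemma cdotZr x a y : cdot x (a *: y) = a * cdot x y.
Proof. by have := cdot_linear x a y 0; rewrite !addr0 cdot0r addr0. Qed.
Lemma cdotZl x a y : cdot (a *: y) x = a^* * cdot y x.
Proof. by rewrite cdot_herm cdotZr conjcM -cdot_herm. Qed.

Lemma cdotxx x : cdot x x = (`|x.1| ^+ 2 + `|x.2| ^+ 2)%:C%C.
Proof.
apply/eqP; rewrite eq_complex /= -!hdot_norm (hdotC x.2) subrr.
by rewrite !eqxx.
Qed.

Lemma cdot_ge0 x : 0 <= cdot x x.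
Proof. by rewrite cdotxx ge0_complexE /= eqxx addr_ge0 ?sqr_ge0. Qed.

Lemma cdot_psd : psd (@cdot R H).
Proof.
by apply: psd_sesquilinear => *; [exact: cdot_antilinear|exact: cdot_linear|exact: cdot_ge0].
Qed.

Lemma cdot_eq0 x : cdot x x = 0 -> x = 0.
Proof.
rewrite cdotxx => -[/eqP]; rewrite paddr_eq0 ?sqr_ge0 // !sqrf_eq0 !normr_eq0.
by case: x => x1 x2 /= /andP[/eqP -> /eqP ->].
Qed.

Lemma cdot_real h h' : cdot (to_complex h) (to_complex h') = (hdot h h')%:C%C.
Proof. by apply/eqP; rewrite eq_complex /= !hdotE addr0 subr0 !eqxx. Qed.

Lemma to_complex_comb (a : R) h h' :
  to_complex (a *: h + h') = a%:C%C *: to_complex h + to_complex h' :> HC.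
Proof. by congr pair; rewrite /= ?scale0r ?subr0 ?scaler0 ?addr0. Qed.

Lemma complex_decomposition x : x = 'i%C *: to_complex x.2 + to_complex x.1 :> HC.
Proof.
by case: x => x1 x2; congr pair; rewrite /= ?scale0r ?scale1r ?scaler0 ?subr0 ?oppr0 ?add0r ?addr0.
Qed.

Lemma scalar_laws : fock_laws (scalar_data H).
Proof.
split=> /=.
- by move=> b a u v; rewrite -[_ *: _]/(a * u) mulrDl -mulrA.
- by move=> b a u v; rewrite -[_ *: u]/(a * u) mulrDr mulrCA.
- exact: mulrA.
- by move=> a b c; rewrite conjcD -[a *: b]/(a * b) conjcM.
- by move=> b c; rewrite conjcM mulrC.
- exact: conjCK.
- by move=> x a b c; rewrite scalerDl -[a *: b]/(a * b) scalerA.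
- by move=> b a x y; rewrite scalerDr !scalerA mulrC.
- by move=> b c x; rewrite scalerA.
- by move=> b a x y; rewrite scalerDr !scalerA mulrC.
- by move=> x a b c; rewrite scalerDl -[a *: b]/(a * b) scalerA.
- by move=> b c x; rewrite !scalerA mulrC.
- by move=> x a y y'; rewrite cdot_linear.
- exact: cdot_herm.
- by move=> x y b; rewrite cdotZr mulrC.
- by move=> b x y; rewrite cdotZr cdotZl.
Qed.

Local Notation vac1 := (@vac R (scalar_data H) 1).
Let laws := scalar_laws.

Lemma scalar_lactE a z : @fock_lact R (scalar_data H) a z = a *: z.
Proof.
apply: (@fock_eq _ _ _ (@fock_lact R (scalar_data H) a) (fun z => a *: z)) => [||b|x s].
- exact: fock_lact_linear.
- by move=> b u v; rewrite scalerDr !scalerA mulrC.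
- by rewrite (fock_lact_vac laws) -[cmul a b]/(a *: b) (linear_lfZ (@vac_linear _ _)).
- by rewrite (fock_lact_tens laws) (linear_lfZ (tensor_word_linear s)).
Qed.

Lemma scalar_annihilation_creation x y z :
  annihilation (D := scalar_data H) x (creation (D := scalar_data H) y z) = cdot x y *: z.
Proof. by rewrite (annihilation_creation laws) scalar_lactE. Qed.

Lemma scalar_vacE (b : C) : @vac R (scalar_data H) b = b *: vac1.
Proof. by rewrite -(linear_lfZ (@vac_linear _ _)) -[b *: 1]/(b * 1) mulr1. Qed.

Lemma scalar_word1 x : tensor_word (D := scalar_data H) x [::] = creation (D := scalar_data H) x vac1.
Proof. by rewrite (creation_vac laws) /= scale1r. Qed.

Lemma scalar_fock_ind (P : F -> Prop) :
  (forall a z z', P z -> P z' -> P (a *: z + z')) -> P vac1 ->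
  (forall x z, P z -> P (creation (D := scalar_data H) x z)) -> forall z, P z.
Proof.
move=> Pl P1 Pc; apply: fock_ind => // [b|x s].
  have P0 : P 0 by have := Pl (-1) _ _ P1 P1; rewrite scaleN1r addNr.
  by rewrite scalar_vacE -[_ *: _]addr0; exact: Pl.
elim: s x => [|y s IH] x; first by rewrite scalar_word1; exact: Pc.
by rewrite -(creation_tens laws); exact/Pc/IH.
Qed.

(** An upper bound for the degree, phrased through creation operators so that induction on it meets
    [annihilation_creation]. *)
Fixpoint depth n z : Prop := match n with
  | 0 => exists c : C, z = c *: vac1
  | n'.+1 => exists (c : C) (s : seq (HC * F)), (forall p, p \in s -> depth n' p.2) /\
      z = c *: vac1 + \sum_(p <- s) creation (D := scalar_data H) p.1 p.2
  end.

Lemma depth_linear n a z z' : depth n z -> depth n z' -> depth n (a *: z + z').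
Proof.
elim: n a z z' => [|n IH] a z z' /=.
  by move=> [c ->] [d ->]; exists (a * c + d); rewrite scalerDl scalerA.
move=> [c [s [sn ->]]] [d [t [tn ->]]].
exists (a * c + d), ([seq (p.1, a *: p.2) | p <- s] ++ t); split.
  move=> p; rewrite mem_cat => /orP[|/tn//] /mapP[q qs ->] /=.
  have dn := sn q qs; have d0 : depth n 0.
    by rewrite -[0](addNr q.2) -scaleN1r; exact: IH.
  by rewrite -[a *: q.2]addr0; exact: IH.
rewrite big_cat big_map /= scalerDr scaler_sumr scalerDl scalerA -!addrA; congr (_ + _).
rewrite addrCA; congr (_ + (_ + _)); apply: eq_bigr => p _.
by rewrite (linear_lfZ (creation_linear laws _)).
Qed.

Lemma depthS n z : depth n z -> depth n.+1 z.
Proof.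
elim: n z => [|n IH] z /=.
  by move=> [c ->]; exists c, [::]; split=> //; rewrite big_nil addr0.
by move=> [c [s [sn ->]]]; exists c, s; split=> // p /sn; exact: IH.
Qed.

Lemma depth_le n m z : (n <= m)%N -> depth n z -> depth m z.
Proof.
move=> /subnK <-; elim: (m - n)%N => // k IH zn; exact/depthS/IH.
Qed.

Lemma depth_exists z : exists n, depth n z.
Proof.
elim/scalar_fock_ind: z => [a z z' [n zn] [m zm]||x z [n zn]].
- exists (maxn n m); apply: depth_linear.
    exact: depth_le (leq_maxl _ _) zn.
  exact: depth_le (leq_maxr _ _) zm.
- by exists 0%N, 1; rewrite scale1r.
- exists n.+1, 0, [:: (x, z)]; rewrite scale0r add0r big_seq1; split=> // p.
  by rewrite inE => /eqP ->.
Qed.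

Local Notation "<| z , w |>" := (@fock_dot R (scalar_data H) z w : C).

Lemma sdot_linear z a u v : <| z, a *: u + v |> = a * <| z, u |> + <| z, v |>.
Proof. exact: (fock_dot_linear laws). Qed.
Lemma sdot_antilinear z a u v : <| a *: u + v, z |> = a^* * <| u, z |> + <| v, z |>.
Proof. exact: (fock_dot_antilinear laws). Qed.
Lemma sdot_herm z w : <| w, z |> = <| z, w |>^*.
Proof. exact: (fock_dot_herm laws). Qed.
Lemma sdot0r z : <| z, 0 |> = 0.
Proof. by have := sdot_linear z (-1) 0 0; rewrite scaler0 addr0 mulN1r addNr. Qed.
Lemma sdot0l z : <| 0, z |> = 0.
Proof. by rewrite sdot_herm sdot0r conjc0. Qed.
Lemma sdotDr z u v : <| z, u + v |> = <| z, u |> + <| z, v |>.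
Proof. by have := sdot_linear z 1 u v; rewrite scale1r mul1r. Qed.
Lemma sdotDl z u v : <| u + v, z |> = <| u, z |> + <| v, z |>.
Proof. by have := sdot_antilinear z 1 u v; rewrite scale1r conjc1 mul1r. Qed.
Lemma sdotZr z a u : <| z, a *: u |> = a * <| z, u |>.
Proof. by have := sdot_linear z a u 0; rewrite !addr0 sdot0r addr0. Qed.
Lemma sdotZl z a u : <| a *: u, z |> = a^* * <| u, z |>.
Proof. by have := sdot_antilinear z a u 0; rewrite !addr0 sdot0l addr0. Qed.
Lemma sdot_sumr z (I : Type) (r : seq I) (f : I -> F) :
  <| z, \sum_(i <- r) f i |> = \sum_(i <- r) <| z, f i |>.
Proof. by apply: (big_morph _ (sdotDr z) (sdot0r z)). Qed.
Lemma sdot_suml z (I : Type) (r : seq I) (f : I -> F) :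
  <| \sum_(i <- r) f i, z |> = \sum_(i <- r) <| f i, z |>.
Proof. by apply: (big_morph _ (fun u v => sdotDl z u v) (sdot0l z)). Qed.

Lemma sdot_vac z : <| vac1, z |> = vac_component z.
Proof. by rewrite (fock_dot_vac laws) /= conjc1 mul1r. Qed.

(** By induction on the depth. A sum of vectors a^*(x_p) z_p is orthogonal to the vacuum and has the
    Gram matrix <x_p, x_q> <z_p, z_q>, a product of two positive kernels, the second one by
    induction. *)
Lemma sdot_ge0 z : 0 <= <| z, z |>.
Proof.
have [n] := depth_exists z; elim: n z => [|n IH] z.
  move=> [c ->]; rewrite sdotZl sdotZr mulrA sdot_vac vac_component_vac mulr1.
  by rewrite mulrC mul_conjC_ge0.
move=> [c [s [sn ->]]].
set S := \sum_(p <- s) _.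
have Sv : <| S, vac1 |> = 0.
  rewrite sdot_suml big1 // => p _.
  by rewrite (fock_dot_creation laws) (annihilation_vac laws) sdot0r.
have vS : <| vac1, S |> = 0 by rewrite sdot_herm Sv conjc0.
rewrite sdotDl !sdotDr !sdotZl !sdotZr Sv vS !mulr0 add0r addr0 sdot_vac vac_component_vac.
rewrite mulr1 mulrC addr_ge0 ?mul_conjC_ge0 //.
(* [psd_mul] asks for kernels that are positive on the whole type, whereas induction covers only
   depth n; f replaces all other vectors by 0. *)
pose f (w : F) : F := if `[< depth n w >] then w else 0.
have n0 : depth n 0.
  by elim: (n) => [|m _]; [exists 0; rewrite scale0r|exists 0, [::]; rewrite scale0r big_nil addr0].
have fn w : depth n (f w) by rewrite /f; case: ifP => // /asboolP.
have fs p : p \in s -> f p.2 = p.2 by move=> /sn h; rewrite /f; case: asboolP.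
have -> : <| S, S |> = kernel_form (fun p q : HC * F => cdot p.1 q.1 * <| f p.2, f q.2 |>) [seq (1, p) | p <- s].
  rewrite /kernel_form big_map sdot_suml big_seq [RHS]big_seq; apply: eq_bigr => p ps.
  rewrite big_map sdot_sumr big_seq [RHS]big_seq; apply: eq_bigr => q qs.
  rewrite (fock_dot_creation laws) scalar_annihilation_creation sdotZr.
  by rewrite !fs // conjc1 !mul1r.
apply: psd_mul; first exact: (psd_comp (fun p : HC * F => p.1) cdot_psd).
move=> t; have -> : kernel_form (fun p q : HC * F => <| f p.2, f q.2 |>) t =
   <| \sum_(p <- t) p.1 *: f p.2.2, \sum_(p <- t) p.1 *: f p.2.2 |>.
  rewrite sdot_suml; apply: eq_bigr => p _; rewrite sdot_sumr; apply: eq_bigr => q _.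
  by rewrite sdotZl sdotZr mulrA.
apply: IH; elim: t => [|p t IHt]; first by rewrite big_nil.
by rewrite big_cons; exact: depth_linear.
Qed.

Lemma sdot_psd : psd (fun z w : F => <| z, w |>).
Proof.
by apply: psd_sesquilinear => *; [exact: sdot_antilinear|exact: sdot_linear|exact: sdot_ge0].
Qed.

(** By induction on the depth. The vacuum detects the scalar part; testing with a^*(f) w shows that
    the sum of <f, x_p> z_p vanishes for every f, and Gaussian elimination over the x_p then kills
    the sum of the a^*(x_p) z_p. *)
Lemma sdot_nondegenerate z : (forall w, <| w, z |> = 0) -> z = 0.
Proof.
have [n] := depth_exists z; elim: n z => [|n IH] z.
  by move=> [c ->] /(_ vac1); rewrite sdotZr sdot_vac vac_component_vac mulr1 => ->; rewrite scale0r.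
move=> [c [s [sn ->]]] h; have c0 : c = 0.
  have := h vac1; rewrite sdotDr sdotZr sdot_vac vac_component_vac mulr1 sdot_sumr big1 ?addr0 // => p _.
  by rewrite sdot_vac (vac_component_creation laws).
move: h; rewrite c0 scale0r add0r => h.
apply: (@bilinear_sum_eq0 R HC F F [set l | exists f, l = cdot f] (fun x z => creation (D := scalar_data H) x z)).
- by move=> _ [f ->] a u v; exact: cdot_linear.
- by move=> u u0; exists (cdot u); [exists u|apply: contraNneq u0 => /cdot_eq0 ->].
- by move=> w; exact: (creation_linear_arg laws).
- by move=> x; exact: (creation_linear laws).
move=> _ [f ->]; apply: IH.
  elim: s sn {h} => [|p s IHs] sn.
    by rewrite big_nil; elim: (n) => [|m _]; [exists 0; rewrite scale0r|exists 0, [::]; rewrite scale0r big_nil addr0].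
  rewrite big_cons; apply: depth_linear; first by apply: sn; rewrite inE eqxx.
  by apply: IHs => q qs; apply: sn; rewrite inE qs orbT.
move=> w; rewrite -[RHS](h (creation (D := scalar_data H) f w)) (fock_dot_creation laws).
rewrite (linear_lf_sum (annihilation_linear laws f)); congr (<| _, _ |>).
by apply: eq_bigr => p _; rewrite scalar_annihilation_creation.
Qed.

Lemma sdot_definite z : <| z, z |> = 0 -> z = 0.
Proof.
move=> z0; apply: sdot_nondegenerate => w.
by rewrite sdot_herm (psd_isotropic w sdot_psd z0) conjc0.
Qed.

Definition fock_norm z : R := form_norm (fun u v : F => <| u, v |>) z.

Lemma fock_norm_sqr z : <| z, z |> = (fock_norm z ^+ 2)%:C%C.
Proof. exact: (form_norm_sqr sdot_ge0). Qed.
Lemma fock_norm_ge0 z : 0 <= fock_norm z.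
Proof. exact: form_norm_ge0. Qed.
Lemma fock_normD z w : fock_norm (z + w) <= fock_norm z + fock_norm w.
Proof. exact: (form_normD sdot_antilinear sdot_linear sdot_ge0). Qed.
Lemma fock_normZ a z : fock_norm (a *: z) = normc a * fock_norm z.
Proof. exact: (form_normZ sdot_antilinear sdot_linear sdot_ge0). Qed.
Lemma fock_cauchy_schwarz z w : normc <| z, w |> <= fock_norm z * fock_norm w.
Proof. exact: (form_cauchy_schwarz sdot_antilinear sdot_linear sdot_ge0). Qed.

Lemma fock_norm_creation h z :
  fock_norm (creation (D := scalar_data H) (to_complex h) z) = `|h| * fock_norm z.
Proof.
apply/eqP; rewrite -(@eqrXn2 _ 2) ?mulr_ge0 ?fock_norm_ge0 // exprMn.
have := fock_norm_sqr (creation (D := scalar_data H) (to_complex h) z).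
rewrite (fock_dot_creation laws) scalar_annihilation_creation sdotZr cdot_real hdot_norm.
by rewrite fock_norm_sqr -rmorphM => -[->].
Qed.

(** For w = a(h) z, |w|^2 = <a^*(h) w, z> <= |h| |w| |z|. *)
Lemma fock_norm_annihilation h z :
  fock_norm (annihilation (D := scalar_data H) (to_complex h) z) <= `|h| * fock_norm z.
Proof.
set w := annihilation _ z; have [w0|w0] := eqVneq (fock_norm w) 0.
  by rewrite w0 mulr_ge0 ?fock_norm_ge0.
have wp : 0 < fock_norm w by rewrite lt0r w0 fock_norm_ge0.
have := fock_cauchy_schwarz (creation (D := scalar_data H) (to_complex h) w) z.
rewrite (fock_dot_creation laws) -/w fock_norm_sqr normc_real (ger0_norm (sqr_ge0 _)).
by rewrite fock_norm_creation mulrAC expr2 ler_pM2r.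
Qed.

Lemma fock_norm_G0 h z : fock_norm (G0 h z) <= 2 * `|h| * fock_norm z.
Proof.
rewrite /G0 /gaussian fctE; apply: le_trans (fock_normD _ _) _.
rewrite fock_norm_creation -mulrA; have := fock_norm_annihilation h z.
by move: (fock_norm _) (_ * _) => p q; lra.
Qed.

Lemma G0_linear h : linear (@G0 R H h).
Proof. exact: (gaussian_linear laws). Qed.

Lemma G0_comb (a : R) h h' z : G0 (a *: h + h') z = a%:C%C *: G0 h z + G0 h' z.
Proof.
rewrite /G0 /gaussian !fctE to_complex_comb (creation_linear_arg laws) (annihilation_antilinear_arg laws).
rewrite conjcE oppr0 scalerDr; exact: addrACA.
Qed.

Lemma sdot_G0 h z w : <| G0 h z, w |> = <| z, G0 h w |>.
Proof. exact: (fock_dot_gaussian laws). Qed.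

Lemma sdot_G0_vac h h' : <| vac1, G0 h (G0 h' vac1) |> = (hdot h h')%:C%C.
Proof.
rewrite -sdot_G0 /G0 /gaussian !fctE !(annihilation_vac laws) !add0r.
rewrite (fock_dot_creation laws) scalar_annihilation_creation sdotZr sdot_vac.
by rewrite vac_component_vac mulr1 cdot_real.
Qed.

(** The vacuum becomes the empty word, which gives left and right operators uniform formulas. *)
Definition word_of_seq s : F := if s is x :: s' then tensor_word (D := scalar_data H) x s' else vac1.

Lemma word_of_seq_linear s a x x' t :
  word_of_seq (s ++ (a *: x + x') :: t) = a *: word_of_seq (s ++ x :: t) + word_of_seq (s ++ x' :: t).
Proof.
have [_ h2 _] := @word_linear_generator R (scalar_data H).
by case: s => [|y s]; [exact: (h2 [::])|exact: (h2 (y :: s))].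
Qed.

(** Over C a balancing coefficient is a scalar, so the third condition follows from
    multilinearity. *)
Lemma scalar_word_linear (M : lmodType C) (f : word (scalar_data H) -> M) :
  (forall a b b', f (Vac (a *: b + b')) = a *: f (Vac b) + f (Vac b')) ->
  (forall (s t : seq (onep (scalar_data H))) a (x x' : onep (scalar_data H)),
    f (insert s (a *: x + x') t) = a *: f (insert s x t) + f (insert s x' t)) ->
  word_linear f.
Proof.
move=> h1 h2; split=> // s t x b y.
have hZ (s' t' : seq (onep (scalar_data H))) (a : C) (u : onep (scalar_data H)) : f (insert s' (a *: u) t') = a *: f (insert s' u t').
  have h0 : f (insert s' 0 t') = 0.
    by have := h2 s' t' (-1) 0 0; rewrite scaler0 addr0 scaleN1r addNr.
  by have := h2 s' t' a u 0; rewrite !addr0 h0 addr0.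
rewrite [LHS]hZ /=; have e u : @insert R (scalar_data H) s x (u :: t) = insert (rcons s x) u t.
  by case: s => //= v s; rewrite cat_rcons.
by rewrite !e hZ.
Qed.

(** Right creation and right annihilation: they add or contract the last letter of a word, while the
    operators of [scalar_data] act on the first one. *)
Definition rcreation_word y (w : word (scalar_data H)) : F := match w with
  | Vac b => tensor_word (D := scalar_data H) ((b : C) *: y) [::]
  | Tens x s => tensor_word (D := scalar_data H) x (rcons s y) end.

Definition rannihilation_word y (w : word (scalar_data H)) : F := match w with
  | Vac b => 0
  | Tens x s => cdot y (last x s) *: word_of_seq (belast x s) end.

Lemma rcreation_word_linear y : word_linear (rcreation_word y).
Proof.
apply: scalar_word_linear => [a b b'|s t a x x'] /=.
  by rewrite scalerDl -(tensor_word_linear [::]) -[a *: b]/(a * b) scalerA.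
have e u : rcreation_word y (insert s u t) = word_of_seq (s ++ u :: rcons t y).
  by case: s => //= v s; rewrite rcons_cat.
by rewrite !e word_of_seq_linear.
Qed.

Lemma rannihilation_word_linear y : word_linear (rannihilation_word y).
Proof.
apply: scalar_word_linear => [a b b'|s t a x x'] /=; first by rewrite scaler0 addr0.
have e u : rannihilation_word y (insert s u t) =
    cdot y (last u t) *: word_of_seq (s ++ belast u t).
  by case: s => //= v s; rewrite last_cat belast_cat /= -cat_rcons -lastI.
rewrite !e; case/lastP: t {e} => [|t z]; first by rewrite /= cdot_linear scalerDl scalerA.
rewrite !last_rcons !belast_rcons word_of_seq_linear scalerDr !scalerA.
by rewrite mulrC.
Qed.

Definition rcreation y : F -> F := lin_ext (rcreation_word y).
Definition rannihilation y : F -> F := lin_ext (rannihilation_word y).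

Lemma rcreation_linear y : linear (rcreation y).
Proof. exact/fock_ext_linear/rcreation_word_linear. Qed.
Lemma rannihilation_linear y : linear (rannihilation y).
Proof. exact/fock_ext_linear/rannihilation_word_linear. Qed.

Lemma rcreation_seq y s : rcreation y (word_of_seq s) = word_of_seq (rcons s y).
Proof.
case: s => [|x s]; rewrite /rcreation [LHS]fock_ext_generator //; try exact: rcreation_word_linear.
by rewrite /= scale1r.
Qed.
Lemma rannihilation_nil y : rannihilation y vac1 = 0.
Proof. by rewrite /rannihilation [LHS]fock_ext_generator //; exact: rannihilation_word_linear. Qed.
Lemma rannihilation_rcons y s x : rannihilation y (word_of_seq (rcons s x)) = cdot y x *: word_of_seq s.
Proof.
rewrite /rannihilation; case: s => [|z s]; rewrite [LHS]fock_ext_generator //=; try exact: rannihilation_word_linear.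
by rewrite last_rcons belast_rcons.
Qed.
Lemma creation_seq x s : creation (D := scalar_data H) x (word_of_seq s) = word_of_seq (x :: s).
Proof. by case: s => [|y s]; [rewrite -scalar_word1|rewrite /= (creation_tens laws)]. Qed.
Lemma annihilation_seq x y s :
  annihilation (D := scalar_data H) x (word_of_seq (y :: s)) = cdot x y *: word_of_seq s.
Proof. by rewrite -creation_seq scalar_annihilation_creation. Qed.

Lemma word_of_seq_span (P : F -> Prop) :
  (forall a z z', P z -> P z' -> P (a *: z + z')) -> (forall s, P (word_of_seq s)) -> forall z, P z.
Proof.
move=> Pl Ps; apply: fock_ind => // [b|x s]; last exact: (Ps (x :: s)).
have P0 : P 0 by have := Pl (-1) _ _ (Ps [::]) (Ps [::]); rewrite scaleN1r addNr.
by rewrite scalar_vacE -[_ *: _]addr0; exact: (Pl _ _ _ (Ps [::])).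
Qed.

Definition rgaussian h : F -> F := rannihilation (to_complex h) + rcreation (to_complex h).

Lemma rgaussian_linear h : linear (rgaussian h).
Proof.
move=> a u v; rewrite /rgaussian !fctE rcreation_linear rannihilation_linear scalerDr.
exact: addrACA.
Qed.

(* Commuting with the left Gaussian operators and having a cyclic vacuum, the right
   ones make the vacuum separating for the left ones. *)
Lemma G0_rgaussian h h' z : G0 h (rgaussian h' z) = rgaussian h' (G0 h z).
Proof.
elim/word_of_seq_span: z => [a z z' e e'|s].
  by rewrite rgaussian_linear !G0_linear rgaussian_linear e e'.
rewrite /G0 /gaussian /rgaussian !fctE rcreation_seq.
rewrite (linear_lfD (annihilation_linear laws _)) (linear_lfD (creation_linear laws _)).
rewrite (linear_lfD (rannihilation_linear _)) (linear_lfD (rcreation_linear _)).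
rewrite !creation_seq rcreation_seq.
(* On the vacuum the two orders produce <h, h'> and <h', h>, which agree because the vectors are
   real. On longer words the left and right operators touch different letters, except for the
   contractions of a single letter, which give the same scalars. *)
case: s => [|x s].
  rewrite /= -[tensor_word _ [::]]/(word_of_seq [:: to_complex h']) annihilation_seq (annihilation_vac laws).
  rewrite rannihilation_nil (linear_lf0 (annihilation_linear laws _)) (linear_lf0 (creation_linear laws _)).
  rewrite (linear_lf0 (rannihilation_linear _)) (linear_lf0 (rcreation_linear _)) !add0r.
  rewrite -[@tensor_word R (scalar_data H) (to_complex h) [::]]/(word_of_seq (rcons [::] (to_complex h))) rannihilation_rcons !cdot_real hdotC.
  by [].
rewrite rcons_cons !annihilation_seq (linear_lfZ (rcreation_linear _)) rcreation_seq.
have -> : rannihilation (to_complex h') (word_of_seq [:: to_complex h, x & s]) =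
    creation (D := scalar_data H) (to_complex h) (rannihilation (to_complex h') (word_of_seq (x :: s))).
  case/lastP: s => [|s y].
    rewrite -[[:: x]]/(rcons [::] x) -[[:: to_complex h; x]]/(rcons [:: to_complex h] x).
    by rewrite !rannihilation_rcons (linear_lfZ (creation_linear laws _)) creation_seq.
  rewrite -!rcons_cons !rannihilation_rcons (linear_lfZ (creation_linear laws _)).
  by rewrite creation_seq.
have -> : annihilation (D := scalar_data H) (to_complex h) (rannihilation (to_complex h') (word_of_seq (x :: s))) =
    rannihilation (to_complex h') (cdot (to_complex h) x *: word_of_seq s).
  rewrite (linear_lfZ (rannihilation_linear _)); case/lastP: s => [|s y].
    rewrite -[[:: x]]/(rcons [::] x) rannihilation_rcons (linear_lfZ (annihilation_linear laws _)).
    by rewrite (annihilation_vac laws) rannihilation_nil !scaler0.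
  rewrite -rcons_cons !rannihilation_rcons (linear_lfZ (annihilation_linear laws _)).
  by rewrite annihilation_seq !scalerA mulrC.
by rewrite -!addrA; congr (_ + _); rewrite addrCA.
Qed.

(** By induction on the length: [rgaussian] applied to a word appends a real letter, up to a right
    annihilation term, which is a shorter word. A complex last letter is split into its real and
    imaginary part. *)
Lemma rgaussian_cyclic (P : F -> Prop) :
  (forall a z z', P z -> P z' -> P (a *: z + z')) -> P vac1 ->
  (forall h z, P z -> P (rgaussian h z)) -> forall z, P z.
Proof.
move=> Pl P1 PR; have P0 : P 0 by have := Pl (-1) _ _ P1 P1; rewrite scaleN1r addNr.
have PZ (a : C) z : P z -> P (a *: z) by move=> Pz; rewrite -[_ *: _]addr0; exact: Pl.
apply: word_of_seq_span => // s.
elim: {s}(size s) {-2}s (leqnn (size s)) => [|n IH] s; first by rewrite leqn0 => /nilP ->.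
case/lastP: s => // s x; rewrite size_rcons ltnS => sn.
have real h : P (word_of_seq (rcons s (to_complex h))).
  rewrite -rcreation_seq; have := PR h _ (IH s sn); rewrite /rgaussian fctE => Ph.
  have Pr : P (rannihilation (to_complex h) (word_of_seq s)).
    case/lastP: s sn {Ph} => [|s y] sn; first by rewrite rannihilation_nil.
    by rewrite rannihilation_rcons; apply/PZ/IH; rewrite size_rcons in sn; exact: ltnW.
  have := Pl (-1) _ _ Pr Ph; rewrite scaleN1r addrA addNr add0r.
  exact.
rewrite (complex_decomposition x) -cats1 word_of_seq_linear !cats1.
by apply: (Pl); exact: real.
Qed.

Definition degree1_word (w : word (scalar_data H)) : HC := if w is Tens x [::] then x else 0.

Lemma degree1_word_linear : word_linear degree1_word.
Proof.
apply: scalar_word_linear => [a b b'|[|y [|y' s]] [|z t] a x x'] //=; by rewrite scaler0 addr0.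
Qed.

Definition degree1 : F -> HC := lin_ext degree1_word.

Lemma degree1_linear : linear degree1.
Proof. exact/fock_ext_linear/degree1_word_linear. Qed.

Lemma degree1_vac : degree1 vac1 = 0.
Proof. by rewrite /degree1 [LHS]fock_ext_generator //; exact: degree1_word_linear. Qed.
Lemma degree1_tens x s : degree1 (tensor_word (D := scalar_data H) x s) = if s is [::] then x else 0.
Proof. by rewrite /degree1 [LHS]fock_ext_generator //; exact: degree1_word_linear. Qed.

Lemma sdot_degree1 x z : <| creation (D := scalar_data H) x vac1, z |> = cdot x (degree1 z).
Proof.
elim/word_of_seq_span: z => [a z z' e e'|[|y s]].
- by rewrite sdot_linear e e' degree1_linear cdot_linear.
- by rewrite (fock_dot_creation laws) (annihilation_vac laws) sdot0r degree1_vac cdot0r.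
rewrite (fock_dot_creation laws) annihilation_seq sdotZr sdot_vac degree1_tens.
case: s => [|y' s]; first by rewrite vac_component_vac mulr1.
by rewrite vac_component_tens mulr0 cdot0r.
Qed.

(** Cauchy-Schwarz of z against the one-letter word y = [degree1 z] gives |y|^2 <= |y| |z|. *)
Lemma degree1_bound z : complex.Re (cdot (degree1 z) (degree1 z)) <= fock_norm z ^+ 2.
Proof.
set y := degree1 z; have := fock_cauchy_schwarz (creation (D := scalar_data H) y vac1) z.
rewrite sdot_degree1 -/y.
have cn : fock_norm (creation (D := scalar_data H) y vac1) ^+ 2 = complex.Re (cdot y y).
  have := fock_norm_sqr (creation (D := scalar_data H) y vac1).
  rewrite (fock_dot_creation laws) scalar_annihilation_creation sdotZr sdot_vac vac_component_vac.
  by rewrite mulr1 => ->.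
have [r r0 rE] : exists2 r, 0 <= r & cdot y y = r%:C%C.
  by exists (`|y.1| ^+ 2 + `|y.2| ^+ 2); [rewrite addr_ge0 ?sqr_ge0|exact: cdotxx].
rewrite rE normc_real (ger0_norm r0) in cn * => h.
have [->|rn] := eqVneq r 0; first exact: sqr_ge0.
have rp : 0 < r by rewrite lt0r rn.
move: (fock_norm (creation _ _)) (fock_norm z) cn h => p q; rewrite /= => cn h.
have := ler_pM r0 r0 h h; rewrite mulrACA -!expr2 cn expr2 ler_pM2l //.
Qed.
End ScalarFock.

(** * Non-crossing pairings *)

Section PairingSigns.
Variable n : nat.
Implicit Types (P : {set {set 'I_n}}) (V W : {set 'I_n}) (l : seq 'I_n) (D : {set 'I_n}).

Lemma partition_mem P D x : finset.partition P D -> x \in D -> exists2 V, V \in P & x \in V.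
Proof.
move=> /and3P[/eqP <- _ _] /finset.bigcupP[V VP xV]; by exists V.
Qed.

Lemma partition_eq P D V W x :
  finset.partition P D -> V \in P -> W \in P -> x \in V -> x \in W -> V = W.
Proof.
move=> /and3P[_ /finset.trivIsetP triv _] VP WP xV xW; apply/eqP; apply: contraT => VW.
by have := triv _ _ VP WP VW; rewrite disjoint_subset => /fintype.subsetP/(_ x xV); rewrite !inE xW.
Qed.

Lemma partition_sub P D V x : finset.partition P D -> V \in P -> x \in V -> x \in D.
Proof. by move=> /and3P[/eqP <- _ _] VP xV; apply/finset.bigcupP; exists V. Qed.

Lemma partition_ne P D V : finset.partition P D -> V \in P -> exists x, x \in V.
Proof.
move=> /and3P[_ _ n0] VP; apply/finset.set0Pn; apply: contraNneq n0 => <-.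
exact: VP.
Qed.

(** In a pairing, i is the right end of its pair. A creation operator stands at a closer and an
    annihilation operator at an opener, since products act from the right. *)
Definition closer P i : bool :=
  [exists V in P, (i \in V) && [exists j in V, (j < i)%N]].

Definition pairing P : bool := [forall V in P, #|V| == 2%N].

Definition increasing l := pairwise (fun i j : 'I_n => (i < j)%N) l.

Definition nc_pairing P l : bool :=
  [&& finset.partition P [set x in l]%SET, noncrossing P & pairing P].

Lemma increasing_uniq l : increasing l -> uniq l.
Proof.
elim: l => //= x l IH /andP[/allP xl /IH ->]; rewrite andbT.
by apply/negP => /xl; rewrite ltnn.
Qed.

Lemma closer_pair P D (i j : 'I_n) : finset.partition P D -> (i < j)%N -> ([set i; j] \in P)%SET ->
  ~~ closer P i && closer P j.
Proof.
move=> pP ij ijP; apply/andP; split.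
  apply/negP => /existsP[V /and3P[VP iV /existsP[k /andP[kV ki]]]].
  have e := partition_eq pP VP ijP iV; rewrite e ?finset.set21 // in kV.
  by move: kV; rewrite !inE => /orP[] /eqP kE; rewrite kE in ki; move: ki ij; lia.
apply/existsP; exists [set i; j]%SET; rewrite ijP finset.set22 /=.
by apply/existsP; exists i; rewrite finset.set21.
Qed.

Lemma opener_partner P D (i : 'I_n) : finset.partition P D -> pairing P -> i \in D -> ~~ closer P i ->
  exists2 k : 'I_n, (i < k)%N & ([set i; k] \in P)%SET.
Proof.
move=> pP /forall_inP p2 iD ci; have [V VP iV] := partition_mem pP iD.
have /cards2P[a [b [ab VE]]] := p2 V VP.
have h y : y \in V -> y != i -> (i < y)%N.
  move=> yV yi; rewrite ltn_neqAle eq_sym yi leqNgt /=; apply: contraNN ci => ltyi.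
  by apply/existsP; exists V; rewrite VP iV /=; apply/existsP; exists y; rewrite yV.
move: iV; rewrite {1}VE !inE => /orP[] /eqP iE.
  exists b; first by apply: h; rewrite ?VE ?finset.set22 // iE eq_sym.
  by rewrite iE -VE.
exists a; first by apply: h; rewrite ?VE ?finset.set21 // iE.
by rewrite iE finset.setUC -VE.
Qed.

Lemma closer_partner P j : pairing P -> closer P j ->
  exists2 k : 'I_n, (k < j)%N & ([set k; j] \in P)%SET.
Proof.
move=> /forall_inP p2 /existsP[V /and3P[VP jV /existsP[k /andP[kV kj]]]].
exists k => //; suff -> : [set k; j]%SET = V by [].
apply/eqP; rewrite eqEcard (eqP (p2 V VP)) finset.cards2.
apply/andP; split; last by case: eqP kj => // ->; rewrite ltnn.
by apply/fintype.subsetP => x; rewrite !inE => /orP[] /eqP ->.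
Qed.

Lemma noncrossingP P V W a b c d : noncrossing P -> V \in P -> W \in P ->
  a \in V -> b \in W -> c \in V -> d \in W -> (a < b)%N -> (b < c)%N -> (c < d)%N -> V = W.
Proof.
move=> nP VP WP aV bW cV dW ab bc cd; apply/eqP.
move/forall_inP: nP => /(_ V VP)/forall_inP/(_ W WP)/forall_inP/(_ a aV)/forall_inP/(_ b bW).
by move=> /forall_inP/(_ c cV)/forall_inP/(_ d dW)/implyP; apply; rewrite ab bc cd.
Qed.

(** If i were paired beyond j and j before i, the two pairs would cross; as i and j are neighbours,
    their partners have no other place. *)
Lemma adjacent_pair P l1 l2 i j : increasing (l1 ++ i :: j :: l2) ->
  nc_pairing P (l1 ++ i :: j :: l2) -> ~~ closer P i -> closer P j -> ([set i; j] \in P)%SET.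
Proof.
move=> inc /and3P[pP nP p2] ci cj.
have iD : i \in [set x in l1 ++ i :: j :: l2]%SET by rewrite inE mem_cat inE eqxx orbT.
have [k ik ikP] := opener_partner pP p2 iD ci.
have [m mj mjP] := closer_partner p2 cj.
have kl : k \in [set x in l1 ++ i :: j :: l2]%SET by apply: partition_sub ikP _ => //; rewrite finset.set22.
have ml : m \in [set x in l1 ++ i :: j :: l2]%SET by apply: partition_sub mjP _ => //; rewrite finset.set21.
move: inc; rewrite /increasing pairwise_cat /= => /and4P[/allrelP al1 _ /andP[ij il2] /andP[jl2 _]].
have jk : k != j -> (j < k)%N.
  move: kl; rewrite inE mem_cat !inE => /or4P[kl1|/eqP kE|/eqP ->|kl2] kj.
  - by have := al1 k i kl1; rewrite inE eqxx => /(_ isT)/(ltn_trans ik); rewrite ltnn.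
  - by rewrite kE ltnn in ik.
  - by rewrite eqxx in kj.
  - exact: (allP jl2).
have mi : m != i -> (m < i)%N.
  move: ml; rewrite inE mem_cat !inE => /or4P[ml1|/eqP ->|/eqP mE|ml2] mi.
  - by apply: al1 => //; rewrite inE eqxx.
  - by rewrite eqxx in mi.
  - by rewrite mE ltnn in mj.
  - by have jm : (j < m)%N := allP jl2 m ml2; have := ltn_trans mj jm; rewrite ltnn.
have [<-//|/jk {}jk] := eqVneq k j; have [<-//|/mi {}mi] := eqVneq m i.
have e := noncrossingP nP mjP ikP (finset.set21 _ _) (finset.set21 _ _) (finset.set22 _ _) (finset.set22 _ _) mi ij jk.
have : k \in [set m; j]%SET by rewrite e finset.set22.
rewrite !inE => /orP[] /eqP kE; last by rewrite kE ltnn in jk.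
by have := ltn_trans mi (ltn_trans ij jk); rewrite kE ltnn.
Qed.

Lemma noncrossing_sub P P' : {subset P' <= P} -> noncrossing P -> noncrossing P'.
Proof.
move=> sP nP; apply/forall_inP => V /sP VP; apply/forall_inP => W /sP WP.
by have /forall_inP/(_ V VP)/forall_inP/(_ W WP) := nP.
Qed.

Lemma pairing_sub P P' : {subset P' <= P} -> pairing P -> pairing P'.
Proof. by move=> sP /forall_inP p2; apply/forall_inP => V /sP; exact: p2. Qed.

Lemma closer_D1 P D V x : finset.partition P D -> V \in P -> x \notin V ->
  closer (P :\ V) x = closer P x.
Proof.
move=> pP VP xV; apply/existsP/existsP => -[W /and3P[WP xW h]]; exists W.
  by move: WP; rewrite !inE => /andP[_ ->]; rewrite xW.
by rewrite !inE WP xW h !andbT; apply: contraNneq xV => <-.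
Qed.

(** With e the pattern of closers, the first two cases have vanishing vacuum expectation: a creation
    operator stands on the far left, or an annihilation operator meets the vacuum. In the third case
    an annihilation operator meets a creation operator, and the pair can be contracted. *)
Lemma first_descent (e : 'I_n -> bool) x l :
  [\/ e x, ~~ e (last x l) |
    exists l1 i j l2, [/\ x :: l = l1 ++ i :: j :: l2, ~~ e i & e j]].
Proof.
elim: l x => [|y l IH] x /=; first by case: (e x); [constructor 1|constructor 2].
have [ex|ex] := boolP (e x); first by constructor 1.
have [ey|h|[l1 [i [j [l2 [lE ei ej]]]]]] := IH y; [| by constructor 2|].
  by constructor 3; exists [::], x, y, l; rewrite ex ey.
by constructor 3; exists (x :: l1), i, j, l2; rewrite lE.
Qed.

Lemma removed_labels l1 l2 i j : increasing (l1 ++ i :: j :: l2) ->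
  ([set x in l1 ++ i :: j :: l2] :\: [set i; j] = [set x in l1 ++ l2])%SET.
Proof.
move=> /increasing_uniq; rewrite uniq_catC /= !inE !mem_cat !negb_or.
move=> /and3P[/and3P[ij il2 il1] /andP[jl2 jl1] _].
apply/finset.setP => x; rewrite !inE !mem_cat !inE.
have [->|xi] := eqVneq x i; first by rewrite (negbTE il1) (negbTE il2).
by have [->|xj] := eqVneq x j; first by rewrite (negbTE jl1) (negbTE jl2).
Qed.

Lemma nc_pairing_remove P l1 l2 i j : increasing (l1 ++ i :: j :: l2) ->
  nc_pairing P (l1 ++ i :: j :: l2) -> ([set i; j] \in P)%SET ->
  nc_pairing (P :\ [set i; j]%SET) (l1 ++ l2).
Proof.
move=> inc /and3P[pP nP p2] ijP; apply/and3P; split.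
- by rewrite -(removed_labels inc); exact: partitionD1.
- by apply: noncrossing_sub nP => V; rewrite !inE => /andP[].
- by apply: pairing_sub p2 => V; rewrite !inE => /andP[].
Qed.

(** No label lies between the neighbours i and j, so the new pair crosses nothing. *)
Lemma nc_pairing_insert P l1 l2 i j : increasing (l1 ++ i :: j :: l2) ->
  nc_pairing P (l1 ++ l2) -> nc_pairing ([set i; j] |: P)%SET (l1 ++ i :: j :: l2).
Proof.
move=> inc /and3P[pP nP p2].
have uij := increasing_uniq inc; rewrite uniq_catC /= !inE !mem_cat !negb_or in uij.
have /and3P[/and3P[ij il2 il1] /andP[jl2 jl1] _] := uij.
have gap x : x \in l1 ++ l2 -> ~~ ((i < x)%N && (x < j)%N).
  rewrite mem_cat; move: inc; rewrite /increasing pairwise_cat /= => /and4P[/allrelP al1 _ /andP[ltij il] /andP[jl _]].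
  move=> /orP[xl1|xl2]; apply/negP => /andP[h1 h2].
    by have := al1 x i xl1; rewrite inE eqxx => /(_ isT)/(ltn_trans h1); rewrite ltnn.
  by have jx : (j < x)%N := allP jl x xl2; have := ltn_trans h2 jx; rewrite ltnn.
have dom : ([set i; j] :|: [set x in l1 ++ l2] = [set x in l1 ++ i :: j :: l2])%SET.
  apply/finset.setP => x; rewrite !inE !mem_cat !inE.
  by case: (x == i); case: (x == j); case: (x \in l1).
have dis : [disjoint [set i; j]%SET & [set x in l1 ++ l2]%SET]%B.
  rewrite disjoint_subset; apply/fintype.subsetP => x; rewrite !inE mem_cat.
  by move=> /orP[] /eqP ->; rewrite negb_or ?il1 ?jl1.
apply/and3P; split.
- rewrite -dom; apply: partitionU1 => //.
  by apply/finset.set0Pn; exists i; rewrite finset.set21.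
- apply/forall_inP => V VP; apply/forall_inP => W WP.
  apply/forall_inP => a aV; apply/forall_inP => b bW; apply/forall_inP => c cV.
  apply/forall_inP => d dW; apply/implyP => /and3P[ab bc cd].
  have inl X x : X \in P -> x \in X -> x \in l1 ++ l2.
    by move=> XP xX; have := partition_sub pP XP xX; rewrite inE.
  have two x y : x \in [set i; j]%SET -> y \in [set i; j]%SET -> (x < y)%N -> (i < j)%N -> x = i /\ y = j.
    by rewrite !inE => /orP[] /eqP -> /orP[] /eqP -> //; rewrite ?ltnn // => h1 h2; move: (ltn_trans h1 h2); rewrite ltnn.
  have ltij : (i < j)%N.
    by move: inc; rewrite /increasing pairwise_cat /= => /and4P[_ _ /andP[]].
  move: VP WP; rewrite !inE => /orP[/eqP VE|VP] /orP[/eqP WE|WP].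
  + by rewrite VE WE.
  + rewrite VE in aV cV; have [ai cj] := two _ _ aV cV (ltn_trans ab bc) ltij.
    by have := gap b (inl W b WP bW); rewrite -ai -cj ab bc.
  + rewrite WE in bW dW; have [bi dj] := two _ _ bW dW (ltn_trans bc cd) ltij.
    by have := gap c (inl V c VP cV); rewrite -bi -dj bc cd.
  + by have := noncrossingP nP VP WP aV bW cV dW ab bc cd => ->.
- apply/forall_inP => V; rewrite !inE => /orP[/eqP ->|VP]; last by move/forall_inP: p2; apply.
  by rewrite finset.cards2 ij.
Qed.
End PairingSigns.

(** * Sums over non-crossing pairings as vacuum expectations in an abstract Fock model *)

Section NonCrossingSum.
Variables (n : nat) (L : Type) (B U X : zmodType).
Variables (mulB : B -> B -> B) (lactL : B -> L -> L) (k : seq L -> B).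
Variables (act : B -> U -> U) (rho : B -> X -> X) (ap : bool -> L -> X -> X).
Variables (Om : U -> X) (E : X -> U).
Hypothesis ap_lact : forall e b a x, ap e (lactL b a) x = rho b (ap e a x).
Hypothesis ap_pair : forall a a' x, ap false a (ap true a' x) = rho (k [:: a; a']) x.
Hypothesis ap_Om : forall a u, ap false a (Om u) = 0.
Hypothesis E_ap : forall a x, E (ap true a x) = 0.
Hypothesis rho_Om : forall b u, rho b (Om u) = Om (act b u).
Hypothesis E_Om : forall u, E (Om u) = u.
Hypothesis act_mul : forall b c u, act (mulB b c) u = act b (act c u).
Hypothesis act0 : forall u, act 0 u = 0.
Hypothesis act_zero : forall b, act b 0 = 0.
Hypothesis rho0 : forall x, rho 0 x = 0.
Hypothesis Om0 : Om 0 = 0.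
Hypothesis E0 : E 0 = 0.
Hypothesis apD : forall e a x y, ap e a (x + y) = ap e a x + ap e a y.
Hypothesis ED : forall x y, E (x + y) = E x + E y.
Hypothesis actD : forall b c u, act (b + c) u = act b u + act c u.
Hypothesis k_size : forall t, size t != 2%N -> k t = 0.
Implicit Types (P : {set {set 'I_n}}) (s : seq ('I_n * L)).

Let ap0 e a : ap e a 0 = 0.
Proof. by apply: (addrI (ap e a 0)); rewrite -apD !addr0. Qed.

(** In the abstract model [ap true] is creation, [ap false] annihilation, [rho] and [act] are the
    actions of coefficients on the Fock space X and on the vacuum space U, [Om] embeds U, and E is
    the vacuum component. The pattern e selects the operator at each label. *)
Definition stack (e : 'I_n -> bool) s x : X := foldr (fun p y => ap (e p.1) p.2 y) x s.

Lemma stack_cat e s t x : stack e (s ++ t) x = stack e s (stack e t x).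
Proof. exact: foldr_cat. Qed.

Lemma stack0 e s : stack e s 0 = 0.
Proof. by elim: s => //= p s ->. Qed.

Lemma stack_ext e e' s x : {in map fst s, e =1 e'} -> stack e s x = stack e' s x.
Proof.
elim: s => //= p s IH h; rewrite IH; first by rewrite h // inE eqxx.
by move=> i hi; apply: h; rewrite inE hi orbT.
Qed.

(** A pattern of openers and closers is reduced by cancelling an opener followed at once by a
    closer; [adjacent_pair] forces these two to be paired. Either the reduction ends with the empty
    list and the pattern has exactly one non-crossing pairing, or it gets stuck and the operator
    product has no vacuum component. *)
Lemma nc_pairing_unique (e : 'I_n -> bool) l : increasing l ->
  (exists P, [/\ nc_pairing P l, {in l, closer P =1 e} &
     forall P', nc_pairing P' l -> {in l, closer P' =1 e} -> P' = P]) \/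
  (forall s u, map fst s = l -> E (stack e s (Om u)) = 0).
Proof.
elim: {l}(size l) {-2}l (leqnn (size l)) => [|m IH] l.
  rewrite leqn0 => /nilP -> _; left; exists finset.set0; split=> //.
    apply/and3P; split.
    - have -> : [set x in [::]]%SET = finset.set0 :> {set 'I_n} by apply/finset.setP => x; rewrite !inE.
      by apply/and3P; split; rewrite ?inE // /finset.cover ?finset.big_set0 //; apply/finset.trivIsetP => A ?; rewrite inE.
    - by apply/forall_inP => V; rewrite inE.
    - by apply/forall_inP => V; rewrite inE.
  move=> P' /and3P[pP' _ _] _; apply/finset.setP => V; rewrite inE; apply/negP => VP.
  have [x xV] := partition_ne pP' VP; have := partition_sub pP' VP xV.
  by rewrite inE.
case: l => [|x l] lm inc; first by apply: (IH [::]).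
have [ex|el|[l1 [i [j [l2 [lE ei ej]]]]]] := first_descent e x l.
- by right=> -[//|[y a] s] u /= [-> _]; rewrite ex E_ap.
- right=> s u sl; case/lastP: s sl => // s [y a]; rewrite map_rcons /= => sl.
  have -> : y = last x l by rewrite -[RHS]/(last x (x :: l)) -sl last_rcons.
  by rewrite -cats1 stack_cat /= (negbTE el) ap_Om stack0 E0.
move: lm inc; rewrite lE => lm inc.
have sub2 : (size (l1 ++ l2) <= m)%N.
  by move: lm; rewrite !size_cat /= !addnS ltnS => /ltnW.
have inc' : increasing (l1 ++ l2).
  move: inc; rewrite /increasing !pairwise_cat /= => /and4P[/allrelP h h1 _ /andP[_ h2]].
  apply/and3P; split=> //; apply/allrelP => a b al bl; apply: h => //.
  by rewrite !inE bl !orbT.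
have [[P0 [nP0 cP0 uP0]]|van] := IH _ sub2 inc'.
  have nP := nc_pairing_insert inc nP0; have /and3P[pP _ _] := nP.
  have ijP : ([set i; j] \in [set i; j] |: P0)%SET by rewrite finset.setU11.
  have ltij : (i < j)%N by move: inc; rewrite /increasing pairwise_cat /= => /and4P[_ _ /andP[]].
  have uij := increasing_uniq inc; rewrite uniq_catC /= !inE !mem_cat !negb_or in uij.
  have /and3P[/and3P[ij il2 il1] /andP[jl2 jl1] _] := uij.
  have ijP0 : ([set i; j] \notin P0)%SET.
    apply/negP => h; have /and3P[pP0 _ _] := nP0.
    by have := partition_sub pP0 h (finset.set21 i j); rewrite inE mem_cat (negbTE il1) (negbTE il2).
  have out y : y \in l1 ++ l2 -> y \notin [set i; j]%SET.
    rewrite mem_cat !inE negb_or => yl; apply/andP; split; apply: contraTneq yl => ->.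
      by rewrite (negbTE il1) (negbTE il2).
    by rewrite (negbTE jl1) (negbTE jl2).
  left; exists ([set i; j] |: P0)%SET; split=> // [y|P' nP' cP'].
    rewrite mem_cat !inE => yl; have /andP[ci cj] := closer_pair pP ltij ijP.
    have [->|yi] := eqVneq y i; first by rewrite (negbTE ci) (negbTE ei).
    have [->|yj] := eqVneq y j; first by rewrite cj ej.
    have yl' : y \in l1 ++ l2 by move: yl; rewrite (negbTE yi) (negbTE yj) mem_cat.
    rewrite -cP0 // -(closer_D1 pP ijP (out y yl')); congr (closer _ y).
    by apply/finset.setP => V; rewrite !inE; case: eqP => //= ->; rewrite (negbTE ijP0).
  have ci : ~~ closer P' i by rewrite cP' // mem_cat inE eqxx orbT.
  have cj : closer P' j by rewrite cP' // mem_cat !inE eqxx !orbT.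
  have ijP' := adjacent_pair inc nP' ci cj.
  rewrite -(finset.setD1K ijP'); congr (_ |: _)%SET; apply: uP0.
    exact: nc_pairing_remove inc nP' ijP'.
  move=> y yl; have /and3P[pP' _ _] := nP'; rewrite (closer_D1 pP' ijP' (out y yl)) cP' //.
  by move: yl; rewrite !mem_cat !inE => /orP[->|->]; rewrite ?orbT.
right=> s u sl.
have : exists s1 a a' s2, [/\ s = s1 ++ (i, a) :: (j, a') :: s2, map fst s1 = l1 & map fst s2 = l2].
  exists (take (size l1) s); move: (congr1 (take (size l1)) sl) (congr1 (drop (size l1)) sl).
  rewrite -map_take -map_drop take_size_cat // drop_size_cat // => h1.
  case: (drop (size l1) s) (cat_take_drop (size l1) s) => [|[i' a] [|[j' a'] s2]] // sE [ii jj h2].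
  by exists a, a', s2; rewrite -{1}sE ii jj.
move=> [s1 [a [a' [s2 [-> s1l s2l]]]]].
rewrite stack_cat /= (negbTE ei) ej ap_pair.
(* The contracted pair leaves a coefficient. It is absorbed by the next letter, or by the vacuum
   vector when no letter follows, and the product becomes one over the reduced labels. *)
case: s2 s2l => [|[j2 a2] s2] s2l.
  by rewrite /= rho_Om; apply: van; rewrite s1l -s2l cats0.
have := van (s1 ++ (j2, lactL (k [:: a; a']) a2) :: s2) u.
rewrite map_cat /= s1l -s2l => /(_ erefl).
by rewrite stack_cat /= ap_lact.
Qed.

Lemma pair_of_segment (V : {set 'I_n}) (i j : 'I_n) : (i < j)%N -> #|V| = 2%N ->
  i \in V -> j \in V -> V = [set i; j]%SET.
Proof.
move=> ij V2 iV jV; apply/esym/eqP; rewrite eqEcard V2 finset.cards2.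
apply/andP; split; last by case: eqP ij => // ->; rewrite ltnn.
by apply/fintype.subsetP => x; rewrite !inE => /orP[] /eqP ->.
Qed.

(** The #|V| consecutive labels from the first element of V onwards all belong to V; being distinct,
    they exhaust V. *)
Lemma interval_split (l : seq 'I_n) (V : {set 'I_n}) : uniq l -> V != finset.set0 ->
  {subset V <= l} -> is_interval l V ->
  exists l1 lv l2, [/\ l = l1 ++ lv ++ l2, size lv = #|V|, find (mem V) l = size l1 & lv =i V].
Proof.
move=> ul V0 Vl iV; set p := find (mem V) l.
have pl : (p <= size l)%N by exact: find_size.
have cV : (#|V| <= size (drop p l))%N.
  rewrite cardE; apply: uniq_leq_size; first exact: enum_uniq.
  move=> x; rewrite mem_enum => xV; have xl := Vl x xV.
  have := xl; rewrite -{1}(cat_take_drop p l) mem_cat => /orP[xt|//].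
  have xi : (index x l < p)%N.
    by rewrite -(cat_take_drop p l) index_cat xt -[X in (_ < X)%N](size_takel pl) index_mem.
  by have := before_find x xi; rewrite nth_index //= xV.
exists (take p l), (take #|V| (drop p l)), (drop #|V| (drop p l)).
rewrite !cat_take_drop size_takel // size_takel //; split=> //.
have sub : {subset take #|V| (drop p l) <= V} by exact/allP.
have u : uniq (take #|V| (drop p l)) by exact/take_uniq/drop_uniq.
have /finset.setP e : [set x in take #|V| (drop p l)]%SET = V.
  apply/eqP; rewrite eqEcard cardsE (card_uniqP u) size_takel // leqnn andbT.
  by apply/fintype.subsetP => x; rewrite inE => /sub.
by move=> x; rewrite -e inE.
Qed.

Lemma increasing_last (x : 'I_n) (l : seq 'I_n) : increasing (x :: l) -> forall y, y \in x :: l -> (y <= last x l)%N.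
Proof.
elim: l x => [|z l IH] x /=; first by move=> _ y; rewrite inE => /eqP ->.
move=> /andP[/andP[xz _] inc] y; rewrite inE => /orP[/eqP ->|]; last exact: IH inc _.
by apply: ltnW; apply: leq_trans xz _; apply: IH inc _ _; rewrite inE eqxx.
Qed.

(** The first label opens and the last one closes, so some opener is followed at once by a closer.
    These two form a block, and the search of [nc_eval] for an interval block succeeds on
    pairings. *)
Lemma pairing_interval P (x : 'I_n) (l : seq 'I_n) : increasing (x :: l) -> nc_pairing P (x :: l) ->
  exists V, (V \in P) && is_interval (x :: l) V.
Proof.
move=> inc nP; have /and3P[pP _ p2] := nP.
have [cx|cl|[l1 [i [j [l2 [lE ci cj]]]]]] := first_descent (closer P) x l.
- have [k' kx kP] := closer_partner p2 cx.
  have : k' \in [set y in x :: l]%SET by apply: (partition_sub pP kP); rewrite finset.set21.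
  move: inc => /= /andP[/allP xl _]; rewrite !inE => /orP[/eqP kE|/xl xk].
    by rewrite kE ltnn in kx.
  by have := ltn_trans kx xk; rewrite ltnn.
- have lD : last x l \in [set y in x :: l]%SET by rewrite inE mem_last.
  have [k' kx kP] := opener_partner pP p2 lD cl.
  have : k' \in [set y in x :: l]%SET by apply: (partition_sub pP kP); rewrite finset.set22.
  by rewrite inE => /(increasing_last inc); rewrite leqNgt kx.
rewrite lE in inc nP *; have ijP := adjacent_pair inc nP ci cj.
exists [set i; j]%SET; rewrite ijP /=.
have := increasing_uniq inc; rewrite uniq_catC /= !inE !mem_cat !negb_or.
move=> /and3P[/and3P[ij _ il1] /andP[_ jl1] _].
rewrite /is_interval finset.cards2 ij find_cat.
have -> : has (mem [set i; j]%SET) l1 = false.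
  apply/hasP => -[y yl1] /=; rewrite !inE => /orP[] /eqP yE.
    by rewrite -yE yl1 in il1.
  by rewrite -yE yl1 in jl1.
have -> : find (mem [set i; j]%SET) [:: i, j & l2] = 0%N by rewrite /= finset.set21.
by rewrite addn0 drop_size_cat //= take0 /= !inE !eqxx orbT.
Qed.

(** Removing an interval block in [nc_eval] and contracting the corresponding adjacent pair of
    operators absorb the same coefficient into the same next letter. A block whose size is not 2
    contributes the coefficient 0. *)
Lemma nc_eval_stack m P s u : increasing (map fst s) ->
  finset.partition P [set x in map fst s]%SET -> noncrossing P -> #|P| = m -> (0 < m)%N ->
  act (nc_eval mulB lactL k m P s) u = if pairing P then E (stack (closer P) s (Om u)) else 0.
Proof.
elim: m P s u => // m IH P s u inc pP nP Pm _ /=.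
have us := increasing_uniq inc.
case: ifP => [P1|/negbT P1].
  have /cards1P[V PV] : #|P| == 1%N by rewrite eqn_leq P1 Pm.
  have VE : V = [set x in map fst s]%SET.
    by case/and3P: pP => /eqP <- _ _; rewrite PV /finset.cover big_set1.
  have sV : #|V| = size s by rewrite VE cardsE (card_uniqP us) size_map.
  have -> : pairing P = (size s == 2%N).
    apply/forall_inP/eqP => [/(_ V)|s2 W]; first by rewrite PV finset.set11 sV => /(_ isT)/eqP.
    by rewrite PV inE => /eqP ->; rewrite sV s2.
  case: eqP => [s2|/eqP s2]; last by rewrite k_size ?size_map // act0.
  case: s s2 inc VE {us sV IH pP P1 Pm} => [|[i a] [|[j a'] []]] //= _ /andP[/andP[ij _] _] VE.
  have pP : finset.partition P [set x in [:: i; j]]%SET.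
    rewrite PV; apply/and3P; split; first by rewrite /finset.cover big_set1 VE.
      by apply/finset.trivIsetP => A A'; rewrite !inE => /eqP -> /eqP ->; rewrite eqxx.
    by rewrite inE eq_sym; apply/finset.set0Pn; exists i; rewrite VE inE inE eqxx.
  have ijP : ([set i; j] \in P)%SET.
    by rewrite PV inE VE; apply/eqP/finset.setP => x; rewrite !inE.
  have /andP[ci cj] := closer_pair pP ij ijP.
  by rewrite /stack /= (negbTE ci) cj ap_pair rho_Om E_Om.
(* Without an interval block [nc_eval] returns 0; for a pairing this cannot occur. *)
case: pickP => [V /andP[VP iV]|none]; last first.
  rewrite act0; case: ifP => // p2; exfalso.
  case: s inc pP none {us IH} => [|[i a] s] inc pP none.
    have : (0 < #|P|)%N by rewrite Pm.
    rewrite card_gt0 => /finset.set0Pn[V VP]; have [x xV] := partition_ne pP VP.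
    by have := partition_sub pP VP xV; rewrite inE.
  have [|V hV] := @pairing_interval P i (map fst s) inc.
    by apply/and3P; split.
  by have := none V; rewrite /= hV.
have V0 : V != finset.set0 by have [x xV] := partition_ne pP VP; apply/finset.set0Pn; exists x.
have Vl : {subset V <= map fst s} by move=> x xV; have := partition_sub pP VP xV; rewrite inE.
have [l1 [lv [l2 [lE lvV fE lvi]]]] := interval_split us V0 Vl iV.
have [s1 [sv [s2 [sE s1l svl s2l]]]] : exists s1 sv s2,
    [/\ s = s1 ++ sv ++ s2, map fst s1 = l1, map fst sv = lv & map fst s2 = l2].
  exists (take (size l1) s), (take (size lv) (drop (size l1) s)), (drop (size lv) (drop (size l1) s)).
  by rewrite !cat_take_drop !(map_take, map_drop) lE take_size_cat // drop_size_cat // take_size_cat // drop_size_cat.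
have s1s : size s1 = size l1 by rewrite -s1l size_map.
have svs : size sv = #|V| by rewrite -lvV -svl size_map.
rewrite fE -s1s addnC -drop_drop.
have -> : drop (size s1) s = sv ++ s2 by rewrite sE drop_size_cat.
have -> : take (size s1) s = s1 by rewrite sE take_size_cat.
rewrite -svs take_size_cat // drop_size_cat //.
have pP' := partitionD1 pP VP.
have incs : increasing (map fst s1 ++ map fst s2).
  move: inc; rewrite sE !map_cat /increasing !pairwise_cat allrel_catr.
  by move=> /andP[/andP[_ ->] /and4P[-> _ _ ->]].
have D' : ([set x in map fst s] :\: V = [set x in map fst s1 ++ map fst s2])%SET.
  move: us; rewrite sE !map_cat svl s1l s2l uniq_catCA cat_uniq => /and3P[_ /hasPn dis _].
  apply/finset.setP => x; rewrite !inE !mem_cat -lvi.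
  case: (boolP (x \in l1 ++ l2)) => [xl|]; last first.
    by rewrite mem_cat negb_or => /andP[/negbTE -> /negbTE ->]; rewrite orbF /= andNb.
  by rewrite (dis x xl) /=; move: xl; rewrite mem_cat => /orP[->|->]; rewrite ?orbT.
have nP' : noncrossing (P :\ V) by apply: noncrossing_sub nP => W; rewrite !inE => /andP[].
have Pm' : #|P :\ V| = m by have := cardsD1 V P; rewrite VP Pm add1n => -[].
have m0 : (0 < m)%N by move: P1; rewrite Pm -ltnNge.
have pairE : pairing P = (#|V| == 2%N) && pairing (P :\ V).
  apply/idP/andP => [p2|[V2 p2]].
    split; first by move/forall_inP: p2; apply.
    by apply: pairing_sub p2 => W; rewrite !inE => /andP[].
  apply/forall_inP => W WP; have [->//|WV] := eqVneq W V.
  by move/forall_inP: p2; apply; rewrite !inE WV.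
have cE x : x \in map fst s1 ++ map fst s2 -> closer (P :\ V) x = closer P x.
  by rewrite -(finset.in_set (fun x => x \in _)) -D' inE => /andP[xV _]; exact: closer_D1 pP VP xV.
have stE t x : {subset map fst t <= map fst s1 ++ map fst s2} -> stack (closer (P :\ V)) t x = stack (closer P) t x.
  by move=> ts; apply: stack_ext => y /ts; exact: cE.
have sub1 : {subset map fst s1 <= map fst s1 ++ map fst s2} by move=> y; rewrite mem_cat => ->.
rewrite pairE; have [V2|V2] := boolP (#|V| == 2%N); last first.
  have -> : k (map snd sv) = 0 by apply: k_size; rewrite size_map svs.
  case: s2 {s2l sE} incs D' cE stE sub1 => [|[j a] s2] incs D' cE stE sub1.
    rewrite act_mul act0; have := IH (P :\ V) s1 0; rewrite -[map fst s1]cats0 -D' => -> //.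
    by rewrite Om0 stack0 E0 if_same.
  rewrite IH //; last by rewrite map_cat /= -D'.
    by rewrite stack_cat /= ap_lact rho0 stack0 E0 if_same.
  by rewrite map_cat.
have [i [j [a [a' [svE ij]]]]] : exists i j a a', sv = [:: (i, a); (j, a')] /\ (i < j)%N.
  move: inc svs; rewrite sE !map_cat (eqP V2) /increasing !pairwise_cat.
  case: (sv) => [|[i a] [|[j a'] []]] //= /and3P[_ _ /andP[_ /andP[/andP[/andP[ij _] _] _]]] _.
  by exists i, j, a, a'.
have ijP : ([set i; j] \in P)%SET.
  rewrite -(@pair_of_segment V) ?(eqP V2) //; rewrite -lvi -svl svE !inE eqxx ?orbT //.
have /andP[ci cj] := closer_pair pP ij ijP.
rewrite sE svE stack_cat /= (negbTE ci) cj ap_pair /=.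
case: s2 {s2l sE} incs D' cE stE sub1 => [|[j2 a2] s2] incs D' cE stE sub1.
  rewrite act_mul; have := IH (P :\ V) s1 (act (k [:: a; a']) u); rewrite -[map fst s1]cats0 -D' => -> //.
  by rewrite rho_Om /= stE.
rewrite IH //; last by rewrite map_cat /= -D'.
  rewrite !stack_cat /= ap_lact !stE //.
    by rewrite cE // mem_cat inE eqxx orbT.
  by move=> y yl; rewrite mem_cat inE yl !orbT.
by rewrite map_cat.
Qed.

Lemma stack_zip (e : 'I_n -> bool) l (t : seq L) x :
  stack e (zip l t) x = foldr (fun p y => ap p.1 p.2 y) x (zip (map e l) t).
Proof. by elim: l t => [|i l IH] [|a t] //=; rewrite -IH. Qed.

Lemma sum_stack m (t : seq L) x : size t = m ->
  \sum_(b : m.-tuple bool) foldr (fun p y => ap p.1 p.2 y) x (zip b t) =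
  foldr (fun a y => ap false a y + ap true a y) x t.
Proof.
elim: m t => [|m IH] [|a t] // => [_|[tm]].
  rewrite (bigD1 [tuple]) //= big1 ?addr0 // => b.
  by rewrite (tuple0 b) => /eqP.
have apS c (I : finType) (f : I -> X) : ap c a (\sum_i f i) = \sum_i ap c a (f i).
  exact: (big_morph _ (apD c a) (ap0 c a)).
rewrite /= -(IH t tm) !apS -big_split /=.
rewrite (reindex (fun p : bool * m.-tuple bool => [tuple of p.1 :: p.2])) /=; last first.
  exists (fun b : m.+1.-tuple bool => (thead b, [tuple of behead b])).
    by move=> [c b] _; congr pair; apply: val_inj.
  by move=> b _; rewrite [RHS]tuple_eta.
rewrite -(pair_big predT predT (fun c (b : m.-tuple bool) => ap c a (foldr (fun p y => ap p.1 p.2 y) x (zip b t)))) /=.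
by rewrite big_bool /= [LHS]addrC -big_split.
Qed.

(** A product of sums annihilation + creation expands into all patterns. Each pattern contributes
    through its unique non-crossing pairing or vanishes, and partitions with a block of another size
    have k_P = 0. *)
Lemma noncrossing_sum (t : seq L) u : size t = n -> (0 < n)%N ->
  act (\sum_(P in NC n) k_part mulB lactL k P t) u =
  E (foldr (fun a y => ap false a y + ap true a y) (Om u) t).
Proof.
move=> tn n0; have actS (I : finType) (Q : pred I) (f : I -> B) : act (\sum_(i | Q i) f i) u = \sum_(i | Q i) act (f i) u.
  exact: (big_morph (act^~ u) (fun b c => actD b c u) (act0 u)).
have ES (I : finType) (f : I -> X) : E (\sum_i f i) = \sum_i E (f i).
  exact: (big_morph _ ED E0).
pose s := zip (enum 'I_n) t.
have sl : map fst s = enum 'I_n by rewrite -/(unzip1 _) unzip1_zip // size_enum_ord tn.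
have inc : increasing (enum 'I_n).
  have := iota_ltn_sorted 0 n; rewrite sorted_pairwise; last exact: ltn_trans.
  by rewrite -val_enum_ord pairwise_map.
have D : [set x in map fst s]%SET = [set: 'I_n]%SET.
  by apply/finset.setP => x; rewrite sl !inE mem_enum.
pose F (e : 'I_n -> bool) := E (stack e s (Om u)).
transitivity (\sum_(P : {set {set 'I_n}} | nc_pairing P (enum 'I_n)) F (closer P)).
  rewrite actS [RHS]big_mkcond [LHS]big_mkcond /=; apply: eq_bigr => P _.
  have -> : nc_pairing P (enum 'I_n) = (P \in NC n) && pairing P.
    by rewrite /nc_pairing -sl D inE andbA.
  case: ifP => //= PNC; have /andP[pP nP] : finset.partition P [set: 'I_n]%SET && noncrossing P.
    by rewrite inE in PNC.
  have incs : increasing (map fst s) by rewrite sl.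
  have P0 : (0 < #|P|)%N.
    rewrite card_gt0; apply: contraTneq pP => ->; rewrite /finset.partition /finset.cover finset.big_set0.
    by rewrite negb_and eq_sym -card_gt0 cardsT card_ord n0.
  by rewrite /k_part (@nc_eval_stack _ P s u) // D.
(* Pairings are grouped by their pattern of closers; each group has at most one member by
   [nc_pairing_unique]. *)
rewrite (partition_big (fun P => [ffun i => closer P i]) predT) //=.
transitivity (\sum_(e : {ffun 'I_n -> bool}) F e).
  apply: eq_bigr => e _.
  have Fe P : [ffun i => closer P i] == e -> F (closer P) = F e.
    by move=> /eqP <-; congr E; apply: stack_ext => i _; rewrite ffunE.
  rewrite (eq_bigr (fun=> F e)) => [|P /andP[_ /Fe //]].
  have [[P0 [nP0 cP0 uP0]]|van] := nc_pairing_unique e inc; last first.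
    by rewrite big1 // /F van.
  rewrite (big_pred1 P0) // => P; apply/andP/eqP => [[nP /eqP eP]|->].
    by apply: uP0 => // i _; rewrite -eP ffunE.
  by split=> //; apply/eqP/ffunP => i; rewrite ffunE cP0 // mem_enum.
rewrite -(sum_stack (Om u) tn) ES.
rewrite (reindex (fun b : n.-tuple bool => [ffun i => tnth b i])) /=; last first.
  exists (fun e : {ffun 'I_n -> bool} => [tuple e i | i < n]) => [b _|e _].
    by apply: eq_from_tnth => i; rewrite tnth_mktuple ffunE.
  by apply/ffunP => i; rewrite ffunE tnth_mktuple.
apply: eq_bigr => b _; rewrite /F stack_zip; congr (E (foldr _ _ (zip _ _))).
rewrite -[RHS]map_tnth_enum; apply: eq_map => i; by rewrite ffunE.
Qed.
End NonCrossingSum.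

(** * Cumulants *)

Section CumulantNaturality.
Variables (L Calg : Type) (B : zmodType).
Variables (mulB : B -> B -> B) (lactL : B -> L -> L) (lactC : B -> Calg -> Calg) (r : L -> Calg).
Hypothesis r_lact : forall b a, r (lactL b a) = lactC b (r a).

(** The operators of the Fock model depend on an expression of an element as a sum of simple
    tensors. This moves the evaluation from elements of the algebra to such expressions, with r
    forgetting the expression. *)
Lemma nc_eval_map (k : seq Calg -> B) (I : finType) m (P : {set {set I}}) (s : seq (I * L)) :
  nc_eval mulB lactC k m P [seq (p.1, r p.2) | p <- s] =
  nc_eval mulB lactL (fun t => k (map r t)) m P s.
Proof.
elim: m P s => //= m IH P s; have e1 : [seq i.1 | i <- [seq (p.1, r p.2) | p <- s]] = map fst s.
  by rewrite -map_comp; apply: eq_map.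
have e2 t : [seq i.2 | i <- [seq (p.1, r p.2) | p <- t]] = map r (map snd t) :> seq Calg.
  by rewrite -!map_comp; apply: eq_map.
rewrite e1 e2; case: ifP => // _; case: pickP => // V _.
rewrite -!map_drop -!map_take e2; case: (drop _ s) => [|[j a] s'] /=; first by rewrite IH.
by rewrite -r_lact -IH map_cat.
Qed.

Lemma k_part_map (k : seq Calg -> B) n (P : {set {set 'I_n}}) (t : seq L) :
  k_part mulB lactC k P (map r t) = k_part mulB lactL (fun t => k (map r t)) P t.
Proof.
rewrite /k_part -nc_eval_map; congr nc_eval.
by elim: (enum 'I_n) t => [|i e IH] [|a t] //=; rewrite IH.
Qed.
Lemma nc_eval_le1 (k : seq L -> B) (I : finType) m (P : {set {set I}}) s :
  (forall b, mulB b 0 = 0) -> (forall t, (size t <= 1)%N -> k t = 0) -> (size s <= 1)%N -> nc_eval mulB lactL k m P s = 0.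
Proof.
move=> mulB0 k1; elim: m P s => //= m IH P s s1; case: ifP => _; first by apply: k1; rewrite size_map.
case: pickP => // V _; set p := find _ _.
have ks : k [seq i.2 | i <- take #|V| (drop p s)] = 0.
  by apply: k1; rewrite size_map size_take size_drop; case: ifP; lia.
case E: (drop _ s) => [|[j a] s']; first by rewrite ks mulB0.
apply: IH; have := congr1 size E; rewrite size_drop /= size_cat size_take /= => e.
by case: ltnP => h; lia.
Qed.

End CumulantNaturality.

Section CumulantLinearity.
Variables (Calg : Type) (B : zmodType).
Variables (mulC : Calg -> Calg -> Calg) (mulB : B -> B -> B).
Variables (lactC : B -> Calg -> Calg) (Phi : Calg -> B).
Hypothesis lactCM : forall b c a, lactC (mulB b c) a = lactC b (lactC c a).
Hypothesis mulBA : forall a b c, mulB a (mulB b c) = mulB (mulB a b) c.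
Hypothesis mulB0 : forall b, mulB b 0 = 0.
Hypothesis mul0B : forall b, mulB 0 b = 0.
Hypothesis mulBB : forall b c d, mulB b (c - d) = mulB b c - mulB b d.

Lemma nc_eval_nil (k : seq Calg -> B) (I : finType) m (P : {set {set I}}) :
  k [::] = 0 -> nc_eval mulB lactC k m P [::] = 0.
Proof. by move=> k0; elim: m P => //= m IH P; case: ifP => // _; case: pickP => // V _; rewrite k0 mulB0. Qed.

Lemma nc_eval_left (k : seq Calg -> B) (I : finType) m (P : {set {set I}}) b i a s :
  k [::] = 0 -> (forall a t, k (lactC b a :: t) = mulB b (k (a :: t))) ->
  nc_eval mulB lactC k m P ((i, lactC b a) :: s) = mulB b (nc_eval mulB lactC k m P ((i, a) :: s)).
Proof.
move=> k0 kb; elim: m P i a s => [|m IH] P i a s; first by rewrite /= mulB0.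
rewrite [LHS]/= [in RHS]/=; case: ifP => _; first exact: kb.
case: pickP => [V _|_]; last by rewrite mulB0.
case: ifP => [iV|_].
  have [v ->] : exists v, #|V| = v.+1.
    by exists #|V|.-1; rewrite prednK // (cardsD1 i) (iV : i \in V).
  rewrite /= kb; case: (drop v s) => [|[j a'] s'] /=; last by rewrite lactCM IH.
  by rewrite nc_eval_nil // !mul0B mulB0.
by rewrite /=; case: (drop _ s) => [|[j a'] s'] /=; rewrite IH // mulBA.
Qed.

Lemma noncrossing_small n (P : {set {set 'I_n}}) : (0 < n)%N -> P \in NC n ->
  (1 < #|P|)%N = (P != [set [set: 'I_n]])%SET.
Proof.
move=> n0; rewrite inE => /andP[/and3P[/eqP cov _ _] _].
have P0 : (0 < #|P|)%N.
  rewrite card_gt0; apply: contra_eq_neq cov => ->.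
  by rewrite /finset.cover finset.big_set0 eq_sym -card_gt0 cardsT card_ord.
rewrite ltn_neqAle P0 andbT eq_sym; congr (~~ _); apply/cards1P/eqP => [[W PW]|->].
  by move: cov; rewrite PW /finset.cover big_set1 => ->.
by exists [set: 'I_n]%SET.
Qed.

Lemma noncrossing_full n : (0 < n)%N -> ([set [set: 'I_n]] \in NC n)%SET.
Proof.
move=> n0; rewrite inE; apply/andP; split.
  rewrite /finset.partition /finset.cover big_set1 eqxx finset.trivIset1 inE /=.
  by rewrite eq_sym -card_gt0 cardsT card_ord.
apply/forall_inP => V /finset.set1P ->; apply/forall_inP => W /finset.set1P ->.
by do 4![apply/forall_inP => ? _]; rewrite eqxx implybT.
Qed.

Lemma k_part_full (k : seq Calg -> B) n s : size s = n ->
  k_part mulB lactC k ([set [set: 'I_n]])%SET s = k s.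
Proof.
by move=> sn; rewrite /k_part cards1 /= cards1 /= -/(unzip2 _) unzip2_zip // size_enum_ord sn.
Qed.

Local Notation cumulant_upto := (cumulant_upto mulC mulB lactC Phi).
Local Notation cumulant := (cumulant mulC mulB lactC Phi).
Local Notation moment := (moment mulC Phi).

Lemma cumulant_upto_nil N : cumulant_upto N [::] = 0.
Proof.
case: N => //= N; rewrite sub0r big1 ?oppr0 // => P /andP[_].
by rewrite ltnNge (leq_trans (max_card _)) // -cardsT -powersetT card_powerset cardsT card_ord.
Qed.

(** Left linearity of the moments passes through the recursion. It is needed because [semicircular]
    speaks of lists whose first entry carries no coefficient. *)
Lemma cumulant_left b a s : (forall a t, moment (lactC b a :: t) = mulB b (moment (a :: t))) ->
  cumulant (lactC b a :: s) = mulB b (cumulant (a :: s)).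
Proof.
move=> mb; rewrite /cumulant [size (_ :: s)]/= [size (a :: s)]/=.
move: (size s).+1 => N; elim: N a s => [|N IH] a s; first by rewrite /= mulB0.
rewrite [LHS]/= -[foldl _ _ _]/(foldl _ _ _) [in RHS]/=.
rewrite -[Phi (foldl mulC (lactC b a) s)]/(moment (lactC b a :: s)) mb mulBB; congr (_ - _).
have sumB (I : finType) (Q : pred I) (f : I -> B) :
    mulB b (\sum_(i | Q i) f i) = \sum_(i | Q i) mulB b (f i).
  apply: (big_morph (mulB b) _ (mulB0 b)) => x y.
  have mulBN z : mulB b (- z) = - mulB b z by rewrite -[- z]sub0r mulBB mulB0 sub0r.
  by rewrite -{1}[y]opprK mulBB mulBN opprK.
rewrite sumB; apply: eq_bigr => P _; rewrite /k_part.
case E: (enum 'I_(size s).+1) => [|i e]; first by have := congr1 size E; rewrite size_enum_ord.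
by rewrite /= nc_eval_left //; exact: cumulant_upto_nil.
Qed.

(** The only other partition of two points consists of singletons, where a first cumulant occurs as
    a factor. *)
Lemma cumulant2 (L : Type) (lactL : B -> L -> L) (r : L -> Calg) a a' :
  (forall b a, r (lactL b a) = lactC b (r a)) ->
  (forall a, cumulant [:: r a] = 0) -> cumulant [:: r a; r a'] = moment [:: r a; r a'].
Proof.
move=> rl c1; have := @moment_cumulant Calg B mulC mulB lactC Phi [:: r a; r a'] isT.
rewrite (bigD1 _ (noncrossing_full (ltn0Sn 1))) /= k_part_full // big1 ?addr0 // => P /andP[PNC PT].
rewrite -[[:: r a; r a']]/(map r [:: a; a']) (k_part_map _ rl) /k_part.
set s := zip _ _; have PNC' : P \in NC 2 := PNC; have := PNC'; rewrite inE => /andP[pP _].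
have : (1 < #|P|)%N by rewrite (noncrossing_small _ PNC').
set k := fun t => _; have k1 t : (size t <= 1)%N -> k t = 0.
  by case: t => [|x [|]] //= _; exact: c1.
case Pm: #|P| => [//|m] P1 /=; rewrite Pm leqNgt P1 /=.
have ss : size s = 2%N by rewrite size_zip size_enum_ord.
have sl : map fst s = enum 'I_2 by rewrite -/(unzip1 _) unzip1_zip // size_enum_ord.
case: pickP => // V /andP[VP _]; set p := find _ _.
have V1 : (0 < #|V|)%N.
  by have [x xV] := partition_ne pP VP; rewrite card_gt0; apply/finset.set0Pn; exists x.
have V2 : (#|V| < 2)%N.
  rewrite -[X in (_ < X)%N](card_ord 2) -cardsT; apply: proper_card; rewrite finset.properT.
  apply/negP => /eqP VT; move: PT => /negP; apply; apply/eqP/finset.setP => W; rewrite inE.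
  apply/idP/eqP => [WP|->]; last by rewrite -VT.
  have [x xW] := partition_ne pP WP; rewrite -VT; apply: (partition_eq pP WP VP xW).
  by rewrite VT inE.
have ks : k [seq i.2 | i <- take #|V| (drop p s)] = 0.
  by apply: k1; rewrite size_map size_take size_drop ss; case: ifP; lia.
case E: (drop _ s) => [|[j x] s']; first by rewrite ks mulB0.
have e := congr1 size E; rewrite size_drop ss /= in e.
apply: nc_eval_le1 => //; rewrite size_cat size_take ss /=.
have h q v : (0 < v)%N -> (2 - (q + v))%N = (size s').+1 -> ((if q < 2 then q else 2) + (size s').+1 <= 1)%N.
  by move=> v0 e'; case: (ltnP q 2) => q2; lia.
exact: (h _ _ V1 e).
Qed.
End CumulantLinearity.

Section MomentStack.
Variables (L Calg : Type) (B U X : zmodType).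
Variables (mulC : Calg -> Calg -> Calg) (mulB : B -> B -> B).
Variables (lactC : B -> Calg -> Calg) (Phi : Calg -> B).
Variables (lactL : B -> L -> L) (r : L -> Calg) (k : seq L -> B).
Variables (act : B -> U -> U) (rho : B -> X -> X) (ap : bool -> L -> X -> X).
Variables (Om : U -> X) (E : X -> U).
Hypothesis r_lact : forall b a, r (lactL b a) = lactC b (r a).
Hypothesis ap_lact : forall e b a x, ap e (lactL b a) x = rho b (ap e a x).
Hypothesis ap_pair : forall a a' x, ap false a (ap true a' x) = rho (k [:: a; a']) x.
Hypothesis ap_Om : forall a u, ap false a (Om u) = 0.
Hypothesis E_ap : forall a x, E (ap true a x) = 0.
Hypothesis rho_Om : forall b u, rho b (Om u) = Om (act b u).
Hypothesis E_Om : forall u, E (Om u) = u.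
Hypothesis act_mul : forall b c u, act (mulB b c) u = act b (act c u).
Hypothesis act0 : forall u, act 0 u = 0.
Hypothesis act_zero : forall b, act b 0 = 0.
Hypothesis rho0 : forall x, rho 0 x = 0.
Hypothesis Om0 : Om 0 = 0.
Hypothesis E0 : E 0 = 0.
Hypothesis apD : forall e a x y, ap e a (x + y) = ap e a x + ap e a y.
Hypothesis ED : forall x y, E (x + y) = E x + E y.
Hypothesis actD : forall b c u, act (b + c) u = act b u + act c u.
Hypothesis k_size : forall t, size t != 2%N -> k t = 0.

Local Notation stacked t u := (E (foldr (fun a y => ap false a y + ap true a y) (Om u) t)).
Local Notation cumulant := (cumulant mulC mulB lactC Phi).
Local Notation moment := (moment mulC Phi).

Lemma moment_stack t u : (0 < size t)%N -> (forall t, cumulant (map r t) = k t) ->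
  act (moment (map r t)) u = stacked t u.
Proof.
move=> t0 ck; rewrite (@moment_cumulant Calg B mulC mulB lactC Phi) ?size_map //.
have : size t = size (map r t) by rewrite size_map.
move: (size (map r t)) => n tn; rewrite -(@noncrossing_sum n L B U X mulB lactL k act rho ap Om E) -?tn //.
congr (act _ u); apply: eq_bigr => P _; rewrite (k_part_map _ r_lact).
by have -> : (fun t => cumulant (map r t)) = k by apply/funext.
Qed.

(** By induction on the length: in the moment-cumulant formula every partition other than the full
    one involves cumulants of shorter lists only. These agree with k, so the one-block terms agree
    as well. *)
Lemma cumulant_of_moment_stack : (forall b c, (forall u, act b u = act c u) -> b = c) ->
  (forall t u, (0 < size t)%N -> act (moment (map r t)) u = stacked t u) ->
  forall t, cumulant (map r t) = k t.
Proof.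
move=> faithful ms t; move: {2}(size t) (leqnn (size t)) => N; elim: N t => [|N IH] t.
  by case: t => // _; rewrite k_size.
case: (posnP (size t)) => [/size0nil -> _|t0 tN]; first by rewrite k_size.
have e : \sum_(P in NC (size t)) k_part mulB lactL (fun t => cumulant (map r t)) P t =
    \sum_(P in NC (size t)) k_part mulB lactL k P t.
  apply: faithful => u; rewrite (@noncrossing_sum (size t) L B U X mulB lactL k act rho ap Om E) //.
  rewrite -ms // (@moment_cumulant Calg B mulC mulB lactC Phi) ?size_map //; congr (act _ u).
  by apply: eq_bigr => P _; rewrite (k_part_map _ r_lact).
move: e; rewrite (bigD1 _ (noncrossing_full t0)) [in X in _ = X](bigD1 _ (noncrossing_full t0)) /=.
rewrite !k_part_full //; set s1 := \sum_(i | _) _; set s2 := (X in _ = _ + X).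
suff -> : s1 = s2 by exact: addIr.
apply: eq_bigr => P /andP[PNC PT]; have PNC' : P \in NC (size t) := PNC.
apply: k_part_ext => //; first by rewrite noncrossing_small.
by move=> t' ht; apply: IH; rewrite -ltnS (leq_trans ht).
Qed.
End MomentStack.

(** * Semicircularity and the Wick formula *)

Section TensorAlgebra.
Variable R : realType.
Local Notation C := R[i].
Local Notation K := (compacts R).

Lemma tens_ext_param (U V P M : lmodType C) (h : P -> U -> V -> M) z :
  (forall p v, linear (fun u => h p u v)) -> (forall p u, linear (h p u)) ->
  (forall u v, linear (fun p => h p u v)) -> linear (fun p => tens_ext (h p) z).
Proof.
move=> hl hr hp a p q; move: z; apply: tensor_ind => [b z z' ez ez'|u v].
  rewrite !(tens_ext_linear (hl _) (hr _)) ez ez'.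
  by rewrite !scalerDr !scalerA [b * a]mulrC -!addrA; congr (_ + _); rewrite addrCA.
have e p' : tens_ext (h p') (tens u v) = h p' u v by exact: tens_extE.
by rewrite !e hp.
Qed.

Variable F : lmodType C.

(** The operator S (x) g, with S acting by left multiplication. *)
Definition amp (S : K) (g : F -> F) : tensor K F -> tensor K F :=
  tens_ext (fun T f => tens (opmul S T) (g f)).

Section Linear.
Variable g : F -> F.
Hypothesis gl : linear g.

Lemma amp_hl S v : linear (fun T : K => tens (opmul S T) (g v)).
Proof. exact: (linear_comp (tens_linl (g v)) (@opmul_linearr R S)). Qed.

Lemma amp_hr S (T : K) : linear (fun f => tens (opmul S T) (g f)).
Proof. exact: (linear_comp (tens_linr _) gl). Qed.

Lemma amp_linear S : linear (amp S g).
Proof. by apply: tens_ext_linear; [exact: amp_hl|exact: amp_hr]. Qed.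

Lemma ampE S T f : amp S g (tens T f) = tens (opmul S T) (g f).
Proof. by apply: tens_extE; [exact: amp_hl|exact: amp_hr]. Qed.

Lemma amp_linear_coef z : linear (fun S => amp S g z).
Proof.
apply: tens_ext_param; [exact: amp_hl|exact: amp_hr|].
by move=> T f; exact: (linear_comp (tens_linl (g f)) (@opmul_linearl R T)).
Qed.
End Linear.

Lemma amp_comp S T (g h : F -> F) z : linear g -> linear h ->
  amp S g (amp T h z) = amp (opmul S T) (g \o h) z.
Proof.
move=> gl hl; have ghl := linear_comp gl hl.
move: z; apply: tensor_ind => [a z z' ez ez'|W f].
  by rewrite (amp_linear hl) (amp_linear gl) (amp_linear ghl) ez ez'.
by rewrite (ampE hl) (ampE gl) (ampE ghl) opmulA.
Qed.

Lemma amp_comb S a (g h : F -> F) z : linear g -> linear h ->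
  amp S (a *: g + h) z = a *: amp S g z + amp S h z.
Proof.
move=> gl hl; have ghl : linear (a *: g + h).
  move=> b x y; rewrite !fctE gl hl !scalerDr !scalerA [b * a]mulrC -!addrA; congr (_ + _).
  by rewrite addrCA.
move: z; apply: tensor_ind => [b z z' ez ez'|W f].
  rewrite (amp_linear gl) (amp_linear hl) (amp_linear ghl) ez ez'.
  by rewrite !scalerDr !scalerA [b * a]mulrC -!addrA; congr (_ + _); rewrite addrCA.
by rewrite (ampE hl) (ampE gl) (ampE ghl) (tens_linr (U := K) (V := F)).
Qed.
End TensorAlgebra.

(** * The algebra K (x) A and its K-valued moments *)

Section CompactTensorAlgebra.
Variables (R : realType) (A : starProbSpace R).
Local Notation C := R[i].
Local Notation K := (compacts R).
Local Notation KA := (KA A).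

Lemma linear_mull (y : A) : linear (fun x : A => x * y).
Proof. by move=> a x x'; rewrite mulrDl scalerAl. Qed.

Lemma linear_mulr (x : A) : linear ( *%R x : A -> A).
Proof. by move=> a y y'; rewrite mulrDr scalerAr. Qed.

Lemma ka_mul_hl (S : K) (x : A) (y : A) : linear (fun T : K => tens (opmul S T) (x * y)).
Proof. exact: (linear_comp (tens_linl (x * y)) (@opmul_linearr R S)). Qed.

Lemma ka_mul_hr (S : K) (x : A) (T : K) : linear (fun y : A => tens (opmul S T) (x * y)).
Proof. exact: (linear_comp (tens_linr (opmul S T)) (@linear_mulr x)). Qed.

Lemma ka_mul_pl (x : A) (Y : KA) :
  linear (fun S : K => tens_ext (fun (T : K) (y : A) => tens (opmul S T) (x * y)) Y).
Proof.
apply: tens_ext_param => [S y|S T|T y]; [exact: ka_mul_hl|exact: ka_mul_hr|].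
exact: (linear_comp (tens_linl (x * y)) (@opmul_linearl R T)).
Qed.

Lemma ka_mul_pr (S : K) (Y : KA) :
  linear (fun x : A => tens_ext (fun (T : K) (y : A) => tens (opmul S T) (x * y)) Y).
Proof.
apply: tens_ext_param => [x y|x T|T y]; [exact: ka_mul_hl|exact: ka_mul_hr|].
exact: (linear_comp (tens_linr _) (@linear_mull y)).
Qed.

Lemma ka_mul_linearl (Y : KA) : linear (fun X => ka_mul X Y).
Proof. exact: tens_ext_linear (ka_mul_pl^~ Y) (ka_mul_pr^~ Y). Qed.

Lemma ka_mul_linearr (X : KA) : linear (ka_mul X).
Proof.
move=> a Y Y'; move: X; apply: tensor_ind => [b z z' ez ez'|S x].
  rewrite !ka_mul_linearl ez ez' !scalerDr !scalerA [b * a]mulrC -!addrA; congr (_ + _).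
  by rewrite addrCA.
have e Y0 : ka_mul (tens S x) Y0 = tens_ext (fun (T : K) (y : A) => tens (opmul S T) (x * y)) Y0.
  by apply: tens_extE => [x'|S']; [exact: ka_mul_pl|exact: ka_mul_pr].
by rewrite !e; apply: tens_ext_linear => [y|T]; [exact: ka_mul_hl|exact: ka_mul_hr].
Qed.

Lemma ka_mulE (S T : K) (x y : A) : ka_mul (tens S x) (tens T y) = tens (opmul S T) (x * y).
Proof.
rewrite /ka_mul tens_extE; [|by move=> ?; exact: ka_mul_pl|by move=> ?; exact: ka_mul_pr].
by apply: tens_extE => [x'|S']; [exact: ka_mul_hl|exact: ka_mul_hr].
Qed.

Lemma ka_star_hl (x : A) a (S S' : K) :
  tens (opadj (a *: S + S')) (star x) = a^* *: tens (opadj S) (star x) + tens (opadj S') (star x).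
Proof. by rewrite opadj_linear (tens_linl (star x)). Qed.

Lemma ka_star_hr (S : K) a (x x' : A) :
  tens (opadj S) (star (a *: x + x')) = a^* *: tens (opadj S) (star x) + tens (opadj S) (star x').
Proof. by rewrite star_antilinear (tens_linr (opadj S)). Qed.

Lemma ka_star_antilinear a (X Y : KA) : ka_star (a *: X + Y) = a^* *: ka_star X + ka_star Y.
Proof. by apply: tens_antiext_linear => [x b S S'|S b x x']; [exact: ka_star_hl|exact: ka_star_hr]. Qed.

Lemma ka_starE (S : K) (x : A) : ka_star (tens S x) = tens (opadj S) (star x).
Proof. by apply: tens_antiextE => [x' b S' S''|S' b x' x'']; [exact: ka_star_hl|exact: ka_star_hr]. Qed.

Lemma ka_lact_hl (S : K) (x : A) : linear (fun T : K => tens (opmul S T) x).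
Proof. exact: (linear_comp (tens_linl x) (@opmul_linearr R S)). Qed.

Lemma ka_lact_hr (S T : K) : linear (fun x : A => tens (opmul S T) x).
Proof. exact: tens_linr. Qed.

Lemma ka_lact_linear (S : K) : linear (ka_lact S : KA -> KA).
Proof. by apply: tens_ext_linear => [x|T]; [exact: ka_lact_hl|exact: ka_lact_hr]. Qed.

Lemma ka_lactE (S T : K) (x : A) : ka_lact S (tens T x) = tens (opmul S T) x.
Proof. by apply: tens_extE => [y|T']; [exact: ka_lact_hl|exact: ka_lact_hr]. Qed.

Lemma ka_phi_hl (x : A) : linear (fun S : K => phi x *: S).
Proof. by move=> a S S'; rewrite scalerDr !scalerA mulrC. Qed.

Lemma ka_phi_hr (S : K) : linear (fun x : A => phi x *: S).
Proof. by move=> a x y; rewrite linearP scalerDl scalerA. Qed.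

Lemma ka_phi_linear : linear (@ka_phi R A).
Proof. by apply: tens_ext_linear => [x|T]; [exact: ka_phi_hl|exact: ka_phi_hr]. Qed.

Lemma ka_phiE (S : K) (x : A) : ka_phi (tens S x) = phi x *: S.
Proof. by apply: tens_extE => [y|T]; [exact: ka_phi_hl|exact: ka_phi_hr]. Qed.

Lemma ka_lactM (S T : K) (X : KA) : ka_lact (opmul S T) X = ka_lact S (ka_lact T X).
Proof.
move: X; apply: tensor_ind => [a X Y eX eY|W x]; first by rewrite !ka_lact_linear eX eY.
by rewrite !ka_lactE opmulA.
Qed.

Lemma ka_lact_mul (S : K) (X Y : KA) : ka_mul (ka_lact S X) Y = ka_lact S (ka_mul X Y).
Proof.
move: X; apply: tensor_ind => [a X X' eX eX'|W x].
  by rewrite !(ka_lact_linear, ka_mul_linearl) eX eX'.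
move: Y; apply: tensor_ind => [a Y Y' eY eY'|W' y].
  by rewrite !(ka_lact_linear, ka_mul_linearr) eY eY'.
by rewrite ka_mulE !ka_lactE ka_mulE opmulA.
Qed.

Lemma ka_phi_lact (S : K) (X : KA) : ka_phi (ka_lact S X) = opmul S (ka_phi X).
Proof.
move: X; apply: tensor_ind => [a X X' eX eX'|W x].
  by rewrite !(ka_lact_linear, ka_phi_linear) eX eX' opmul_linearr.
by rewrite ka_lactE !ka_phiE (linear_lfZ (@opmul_linearr R S)).
Qed.

Lemma ka_moment_left (S : K) (X : KA) s :
  moment (@ka_mul R A) (@ka_phi R A) (ka_lact S X :: s) =
  opmul S (moment (@ka_mul R A) (@ka_phi R A) (X :: s)).
Proof.
by elim: s X => [|Y s IH] X; rewrite /= ?ka_phi_lact //; have := IH (ka_mul X Y); rewrite /= ka_lact_mul.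
Qed.

Lemma star1 : star (1 : A) = 1.
Proof. by rewrite -[LHS]mulr1 -[X in _ * X]starK -starM mulr1 starK. Qed.
End CompactTensorAlgebra.

(** * The Wick formula and K-semicircularity *)

Section Wick.
Variables (R : realType) (A : starProbSpace R) (V : set A) (H : realHilbert R) (eta : A -> H).
Local Notation C := R[i].
Local Notation K := (compacts R).
Local Notation F := (fock (scalar_data H)).
Local Notation vac1 := (@vac R (scalar_data H) 1).

(** Links a polynomial in V to the same polynomial in the Gaussian operators. It is a relation
    because an element of A may have several polynomial expressions. *)
Inductive gpoly : A -> (F -> F) -> Prop :=
| gpoly_one : gpoly 1 id
| gpoly_var v : V v -> gpoly v (G0 (eta v))
| gpoly_lin a x y g h : gpoly x g -> gpoly y h -> gpoly (a *: x + y) (a *: g + h)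
| gpoly_mul x y g h : gpoly x g -> gpoly y h -> gpoly (x * y) (g \o h).

Definition wick : Prop := forall x g, gpoly x g -> phi x = vac_component (g vac1).

Lemma gpoly_linear x g : gpoly x g -> linear g.
Proof.
elim=> {x g} [//|v _|a x y g h _ gl _ hl|x y g h _ gl _ hl]; first exact: G0_linear.
  move=> b z w; rewrite !fctE gl hl !scalerDr !scalerA [b * a]mulrC -!addrA; congr (_ + _).
  by rewrite addrCA.
exact: linear_comp.
Qed.

Lemma gpoly_star x g : (forall v, V v -> star v = v) -> gpoly x g ->
  exists2 g', gpoly (star x) g' &
    forall z w, fock_dot (D := scalar_data H) (g z) w = fock_dot z (g' w).
Proof.
move=> Vsa; elim=> {x g}.
- by exists id => //; rewrite star1; exact: gpoly_one.
- move=> v Vv; exists (G0 (eta v)); first by rewrite Vsa //; exact: gpoly_var.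
  exact: sdot_G0.
- move=> a x y g h gx [g' gx' eg] hy [h' hy' eh]; exists (a^* *: g' + h').
    by rewrite star_antilinear; exact: gpoly_lin.
  by move=> z w; rewrite !fctE sdot_antilinear sdot_linear eg eh.
- move=> x y g h gx [g' gx' eg] hy [h' hy' eh]; exists (h' \o g').
    by rewrite starM; exact: gpoly_mul.
  by move=> z w /=; rewrite eg eh.
Qed.

(** The corresponding relation with coefficients in K. That it is single-valued rests on the Wick
    formula and is shown in [rep_unique]. *)
Inductive rep : KA A -> (tensor K F -> tensor K F) -> Prop :=
| rep_tens S x g : gpoly x g -> rep (tens S x) (amp S g)
| rep_lin a X Y T T' : rep X T -> rep Y T' -> rep (a *: X + Y) (a *: T + T').

Lemma rep_linear X T : rep X T -> linear T.
Proof.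
elim=> {X T} [S x g /gpoly_linear gl|a X Y g h _ gl _ hl]; first exact: amp_linear.
move=> b z w; rewrite !fctE gl hl !scalerDr !scalerA [b * a]mulrC -!addrA; congr (_ + _).
by rewrite addrCA.
Qed.

Lemma rep0 : rep 0 0.
Proof.
have := rep_tens 0 gpoly_one; rewrite (linear_lf0 (tens_linl 1)); congr rep.
by apply/funext => z; rewrite (linear_lf0 (@amp_linear_coef R F id (fun _ _ _ => erefl) z)).
Qed.

Lemma repD X Y T T' : rep X T -> rep Y T' -> rep (X + Y) (T + T').
Proof. by move=> hX hY; have := rep_lin 1 hX hY; rewrite !scale1r. Qed.

Lemma rep_mul X Y T T' : rep X T -> rep Y T' -> rep (ka_mul X Y) (T \o T').
Proof.
move=> hX; elim: hX Y T' => {X T} [S x g gx|a X X' T T' _ IH _ IH'] Y U hY; last first.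
  by rewrite ka_mul_linearl; exact: rep_lin (IH _ _ hY) (IH' _ _ hY).
elim: hY => {Y U} [S' y h hy|a Y Y' U U' hY IH hY' IH'].
  rewrite ka_mulE; have := rep_tens (opmul S S') (gpoly_mul gx hy); congr rep.
  by apply/funext => z /=; rewrite amp_comp //; [exact: gpoly_linear gx|exact: gpoly_linear hy].
rewrite ka_mul_linearr; have := rep_lin a IH IH'; congr rep.
by apply/funext => z /=; rewrite !fctE (amp_linear (gpoly_linear gx)).
Qed.

Definition vac_state : tensor K F -> K := tens_ext (fun S (f : F) => (vac_component f : C) *: S).

Lemma vac_state_hl (f : F) : linear (fun S : K => (vac_component f : C) *: S).
Proof. by move=> a S S'; rewrite scalerDr !scalerA mulrC. Qed.

Lemma vac_state_hr (S : K) : linear (fun f : F => (vac_component f : C) *: S).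
Proof. by move=> a f f'; rewrite vac_component_linear scalerDl scalerA. Qed.

Lemma vac_state_linear : linear vac_state.
Proof. by apply: tens_ext_linear; [exact: vac_state_hl|exact: vac_state_hr]. Qed.

Lemma vac_stateE S f : vac_state (tens S f) = (vac_component f : C) *: S.
Proof. by apply: tens_extE; [exact: vac_state_hl|exact: vac_state_hr]. Qed.

(** The vector u Omega stands in for the vacuum, so the moment is recovered multiplied by u. *)
Lemma rep_state X T u : wick -> rep X T -> vac_state (T (tens u vac1)) = opmul (ka_phi X) u.
Proof.
move=> W; elim=> {X T} [S x g gx|a X Y T T' _ IH _ IH'].
  rewrite (ampE (gpoly_linear gx)) vac_stateE ka_phiE (W _ _ gx).
  by rewrite (linear_lfZ (@opmul_linearl R u)).
by rewrite ka_phi_linear opmul_linearl -IH -IH' !fctE vac_state_linear.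
Qed.

Section Stack.
Hypothesis gram : forall v w, V v -> V w -> phi (v * w) = (hdot (eta v) (eta w))%:C%C.

Local Notation L := (seq (K * {v : A | V v})).

Definition realize (a : L) : KA A := \sum_(p <- a) tens p.1 (sval p.2).

Definition list_lact (b : K) (a : L) : L := [seq (opmul b p.1, p.2) | p <- a].

Definition half (e : bool) (v : A) : F -> F :=
  if e then creation (D := scalar_data H) (to_complex (eta v))
  else annihilation (D := scalar_data H) (to_complex (eta v)).

Definition list_half (e : bool) (a : L) z := \sum_(p <- a) amp p.1 (half e (sval p.2)) z.

(** The cumulants to be expected: those of a centred family whose only nonzero cumulants are the
    second moments. *)
Definition covariance (t : seq L) : K :=
  if t is [:: a; a'] then ka_phi (ka_mul (realize a) (realize a')) else 0.

Lemma half_linear e v : linear (half e v).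
Proof. by case: e; [exact: (creation_linear (scalar_laws H))|exact: (annihilation_linear (scalar_laws H))]. Qed.

Lemma realize_lact b a : realize (list_lact b a) = ka_lact b (realize a).
Proof.
rewrite /realize /list_lact big_map (linear_lf_sum (@ka_lact_linear R A b)).
by apply: eq_bigr => p _; rewrite ka_lactE.
Qed.

Lemma list_half_linear e a : linear (list_half e a).
Proof.
move=> c x y; rewrite /list_half scaler_sumr -big_split; apply: eq_bigr => p _ /=.
by rewrite (amp_linear (@half_linear e _)).
Qed.

Lemma list_half_lact e b a x : list_half e (list_lact b a) x = amp b id (list_half e a x).
Proof.
rewrite /list_half /list_lact big_map.
rewrite (linear_lf_sum (@amp_linear R F id (fun _ _ _ => erefl) b)).
by apply: eq_bigr => p _; rewrite amp_comp //; exact: half_linear.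
Qed.

Lemma list_half_pair a a' x :
  list_half false a (list_half true a' x) = amp (covariance [:: a; a']) id x.
Proof.
have idl : linear (id : F -> F) by [].
rewrite /covariance /realize (linear_lf_sum (@ka_mul_linearl R A _)).
rewrite (linear_lf_sum (@ka_phi_linear R A)) (linear_lf_sum (amp_linear_coef idl x)).
apply: eq_bigr => p _; rewrite (linear_lf_sum (@ka_mul_linearr R A _)).
rewrite (linear_lf_sum (@ka_phi_linear R A)) (linear_lf_sum (amp_linear_coef idl x)).
rewrite (linear_lf_sum (amp_linear (@half_linear false _) p.1)); apply: eq_bigr => q _.
rewrite amp_comp; [|exact: half_linear..].
rewrite ka_mulE ka_phiE (linear_lfZ (amp_linear_coef idl x)) gram; [|exact: svalP..].
have l0 : linear (0 : F -> F).
  by move=> b y z; change ((0 : F) = b *: (0 : F) + 0); rewrite scaler0 addr0.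
rewrite -cdot_real; set c := cdot _ _.
have -> : half false (sval p.2) \o half true (sval q.2) = c *: id + 0 :> (F -> F).
  by apply/funext => z; rewrite /= scalar_annihilation_creation !fctE addr0.
rewrite (amp_comb _ _ _ idl l0).
have -> : amp (opmul p.1 q.1) (0 : F -> F) x = 0; last by rewrite addr0.
move: x; apply: tensor_ind => [b y z ey ez|W f]; first by rewrite (amp_linear l0) ey ez scaler0 addr0.
by rewrite (ampE l0) -[RHS](linear_lf0 (tens_linr (opmul (opmul p.1 q.1) W))).
Qed.

Lemma list_half_vac a u : list_half false a (tens u vac1) = 0.
Proof.
rewrite /list_half big1 // => p _; rewrite (ampE (@half_linear false _)) /half.
by rewrite (annihilation_vac (scalar_laws H)) (linear_lf0 (tens_linr _)).
Qed.

Lemma vac_state_half a x : vac_state (list_half true a x) = 0.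
Proof.
rewrite /list_half (linear_lf_sum vac_state_linear) big1 // => p _.
move: x; apply: tensor_ind => [b y z ey ez|W f].
  by rewrite (amp_linear (@half_linear true _)) vac_state_linear ey ez scaler0 addr0.
by rewrite (ampE (@half_linear true _)) vac_stateE (vac_component_creation (scalar_laws H)) scale0r.
Qed.

Section Machine.
Variables (L' : Type) (lactL' : K -> L' -> L') (emb : L' -> L).
Hypothesis emb_lact : forall b a, emb (lactL' b a) = list_lact b (emb a).

(** Through [emb] the cumulants have to be known only for left multiples of one element X, which is
    all that the semicircularity of X provides. *)
Lemma listed_moment t u :
  (forall t, cumulant (@ka_mul R A) (@opmul R) (@ka_lact R A) (@ka_phi R A) (map (realize \o emb) t)
     = covariance (map emb t)) -> (0 < size t)%N ->
  opmul (moment (@ka_mul R A) (@ka_phi R A) (map (realize \o emb) t)) u =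
  vac_state (foldr (fun a y => list_half false (emb a) y + list_half true (emb a) y) (tens u vac1) t).
Proof.
move=> hc t0.
apply: (@moment_stack L' (KA A) K K (tensor K F) (@ka_mul R A) (@opmul R) (@ka_lact R A) (@ka_phi R A)
  lactL' (realize \o emb) (fun t => covariance (map emb t)) (@opmul R) (fun b => amp b id)
  (fun e a => list_half e (emb a)) (fun u => tens u vac1) vac_state) => //.
- by move=> b a /=; rewrite emb_lact realize_lact.
- by move=> e b a x; rewrite emb_lact list_half_lact.
- by move=> a a' x; rewrite list_half_pair.
- by move=> a v; rewrite list_half_vac.
- by move=> a x; rewrite vac_state_half.
- by move=> b v; rewrite ampE.
- by move=> v; rewrite vac_stateE vac_component_vac scale1r.
- by move=> b c v; rewrite opmulA.
- by move=> v; exact: (linear_lf0 (@opmul_linearl R v)).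
- by move=> x; exact: (linear_lf0 (@amp_linear_coef R F id (fun _ _ _ => erefl) x)).
- exact: (linear_lf0 (tens_linl _)).
- exact: (linear_lf0 vac_state_linear).
- by move=> e a x y; exact: (linear_lfD (@list_half_linear e (emb a))).
- by move=> x y; exact: (linear_lfD vac_state_linear).
- by move=> b c v; exact: (linear_lfD (@opmul_linearl R v)).
- by case=> [|a [|a' [|]]].
Qed.
End Machine.

(** By the Wick formula and [rep_state] the moments are those of the Fock model, and moments
    determine cumulants. *)
Lemma listed_cumulant : wick -> forall t,
  cumulant (@ka_mul R A) (@opmul R) (@ka_lact R A) (@ka_phi R A) (map realize t) = covariance t.
Proof.
move=> W t.
apply: (@cumulant_of_moment_stack L (KA A) K K (tensor K F) (@ka_mul R A) (@opmul R) (@ka_lact R A) (@ka_phi R A)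
  list_lact realize covariance (@opmul R) (fun b => amp b id)
  list_half (fun u => tens u vac1) vac_state) => //.
- exact: realize_lact.
- exact: list_half_lact.
- exact: list_half_pair.
- exact: list_half_vac.
- exact: vac_state_half.
- by move=> b v; rewrite ampE.
- by move=> v; rewrite vac_stateE vac_component_vac scale1r.
- by move=> b c v; rewrite opmulA.
- by move=> v; exact: (linear_lf0 (@opmul_linearl R v)).
- by move=> x; exact: (linear_lf0 (@amp_linear_coef R F id (fun _ _ _ => erefl) x)).
- exact: (linear_lf0 (tens_linl _)).
- exact: (linear_lf0 vac_state_linear).
- by move=> e a x y; exact: (linear_lfD (@list_half_linear e a)).
- by move=> x y; exact: (linear_lfD vac_state_linear).
- by move=> b c v; exact: (linear_lfD (@opmul_linearl R v)).
- by case=> [|a [|a' [|]]].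
- exact: opmul_cancelr.
move=> {}t u t0.
(* Each G_0 is annihilation + creation, so a letter of the stack is the operator that represents the
   realized element. *)
have rep_a a : rep (realize a) (fun y => list_half false a y + list_half true a y).
  elim: a => [|p a IH].
    rewrite /realize big_nil; have := rep0; congr rep.
    by apply/funext => z; rewrite /list_half !big_nil addr0.
  have := repD (rep_tens p.1 (gpoly_var (svalP p.2))) IH.
  rewrite /realize big_cons; congr rep; apply/funext => z.
  rewrite !fctE /list_half !big_cons addrACA; congr (_ + _).
  have -> : G0 (eta (sval p.2)) = 1 *: half false (sval p.2) + half true (sval p.2) :> (F -> F).
    by rewrite scale1r.
  by rewrite amp_comb ?scale1r //; exact: half_linear.
have rep_t s X T : rep X T -> rep (foldl (@ka_mul R A) X (map realize s))
    (fun z => T (foldr (fun a y => list_half false a y + list_half true a y) z s)).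
  elim: s X T => //= a s IH X T hX.
  by have := IH _ _ (rep_mul hX (rep_a a)).
case: t t0 => // a t _ /=.
by rewrite -(rep_state u W (rep_t t _ _ (rep_a a))).
Qed.

Lemma semicircular_of_wick : wick ->
  forall X : KA A, KV V X -> ka_star X = X -> K_semicircular X.
Proof.
move=> W X [s [Vs ->]] sX; split=> // bs bs1.
have [a ->] : exists a, \sum_(p <- s) tens p.1 p.2 = realize a.
  elim: s Vs {sX} => [|p s IH] Vs; first by exists [::]; rewrite /realize !big_nil.
  have [|a ea] := IH; first by move=> q qs; apply: Vs; rewrite inE qs orbT.
  have Vp : V p.2 by apply: Vs; rewrite inE eqxx.
  by exists ((p.1, exist _ _ Vp) :: a); rewrite /realize !big_cons ea.
have -> : [seq ka_lact b (realize a) | b <- bs] = map realize [seq list_lact b a | b <- bs].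
  by rewrite -map_comp; apply: eq_map => b /=; rewrite realize_lact.
rewrite -[realize a :: _]/(map realize (a :: [seq list_lact b a | b <- bs])) listed_cumulant //.
by case: bs bs1 => [|b [|]].
Qed.

Hypothesis Vsemi : forall X : KA A, KV V X -> ka_star X = X -> K_semicircular X.

Lemma matrix_unit_scale_inj (a b : C) i j :
  a *: matrix_unit R i j = b *: matrix_unit R i j -> a = b.
Proof.
move=> /(congr1 (fun T : K => l2val (T (l2delta R j)) i)).
rewrite !op_scaleE !matrix_unitE !l2_scaleE !l2deltaE !eqxx.
by rewrite /= !mulr1.
Qed.

Section Word.
Variables (v : seq {v : A | V v}) (v0 : {v : A | V v}).
Local Notation n := (size v).
Local Notation w j := (sval (nth v0 v j)).

Let diagonal : L := [seq (matrix_unit R j j, nth v0 v j) | j <- iota 0 n].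
(** Since [0.-1] is 0, the first coefficient is E_00. From then on the coefficients compose to E_0j,
    and multiplying the diagonal element by [shift j] keeps only its j-th summand. *)
Let shift j := matrix_unit R j.-1 j.

Lemma sum_diagonal (M : zmodType) i j (f : K -> A -> M) : (j < n)%N ->
  (forall x, f 0 x = 0) ->
  \sum_(p <- list_lact (matrix_unit R i j) diagonal) f p.1 (sval p.2) = f (matrix_unit R i j) (w j).
Proof.
move=> jn f0; rewrite /list_lact /diagonal !big_map /=.
rewrite (bigD1_seq j) ?iota_uniq ?mem_iota //= matrix_unit_mul big1_seq ?addr0 // => l /andP[lj _].
by rewrite matrix_unit_mul0 // eq_sym.
Qed.

Lemma realize_shift i j : (j < n)%N ->
  realize (list_lact (matrix_unit R i j) diagonal) = tens (matrix_unit R i j) (w j).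
Proof.
move=> jn; rewrite /realize (sum_diagonal i (f := fun S x => tens S x : KA A) jn) // => x.
exact: (linear_lf0 (tens_linl x)).
Qed.

Lemma half_shift e i j z : (j < n)%N ->
  list_half e (list_lact (matrix_unit R i j) diagonal) z = amp (matrix_unit R i j) (half e (w j)) z.
Proof.
move=> jn; rewrite /list_half (sum_diagonal i (f := fun S x => amp S (half e x) z) jn) // => x.
exact: (linear_lf0 (amp_linear_coef (@half_linear e x) z)).
Qed.

Lemma diagonal_selfadjoint : (forall v, V v -> star v = v) -> ka_star (realize diagonal) = realize diagonal.
Proof.
move=> Vsa; rewrite /realize /diagonal !big_map.
have st0 : ka_star (0 : KA A) = 0.
  by have := @ka_star_antilinear R A (-1) 0 0; rewrite scaler0 addr0 rmorphN1 scaleN1r addNr.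
have stD (X Y : KA A) : ka_star (X + Y) = ka_star X + ka_star Y.
  by have := ka_star_antilinear 1 X Y; rewrite rmorph1 !scale1r.
rewrite (big_morph (@ka_star R A) stD st0); apply: eq_bigr => j _ /=.
by rewrite ka_starE matrix_unit_adj Vsa //; exact: svalP.
Qed.

Lemma diagonal_KV : KV V (realize diagonal).
Proof.
exists [seq (matrix_unit R j j, w j) | j <- iota 0 n]; split.
  by move=> p /mapP[j _ ->] /=; exact: svalP.
by rewrite /realize /diagonal !big_map.
Qed.

(** Semicircularity covers lists that begin with X itself; [cumulant_left] pulls the first
    coefficient out. For two entries the cumulant is the second moment, because first cumulants
    vanish. *)
Lemma shift_cumulant t : (forall v, V v -> star v = v) ->
  cumulant (@ka_mul R A) (@opmul R) (@ka_lact R A) (@ka_phi R A)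
    (map (realize \o list_lact^~ diagonal) t) = covariance (map (list_lact^~ diagonal) t).
Proof.
move=> Vsa; have [_ semi] := Vsemi diagonal_KV (diagonal_selfadjoint Vsa).
set X := realize diagonal in semi.
have e b : realize (list_lact b diagonal) = ka_lact b X by rewrite realize_lact.
have mulBB (b c d : K) : opmul b (c - d) = opmul b c - opmul b d.
  exact: (linear_lfB (@opmul_linearr R b)).
have mul0 (b : K) : opmul b 0 = 0 by exact: (linear_lf0 (@opmul_linearr R b)).
have left b s : cumulant (@ka_mul R A) (@opmul R) (@ka_lact R A) (@ka_phi R A) (ka_lact b X :: s) =
    opmul b (cumulant (@ka_mul R A) (@opmul R) (@ka_lact R A) (@ka_phi R A) (X :: s)).
  apply: cumulant_left => //.
  - exact: ka_lactM.
  - exact: opmulA.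
  - by move=> c; exact: (linear_lf0 (@opmul_linearl R c)).
  - exact: ka_moment_left.
have zero b bs : size bs <> 1%N -> cumulant (@ka_mul R A) (@opmul R) (@ka_lact R A) (@ka_phi R A)
    (ka_lact b X :: [seq ka_lact b X | b <- bs]) = 0.
  by move=> bs1; rewrite left semi.
have mapE s : map (realize \o list_lact^~ diagonal) s = [seq ka_lact b X | b <- s].
  by apply: eq_map => b /=; rewrite e.
rewrite mapE; case: t => [//|b bs]; case: (eqVneq (size bs) 1%N) => [|/eqP bs1]; last first.
  by rewrite /= zero //; case: bs bs1 => [|b' [|]].
case: bs => [|b' []] // _; rewrite /covariance /= !e.
apply: (@cumulant2 (KA A) K _ _ _ _ _ K (@opmul R) (fun b => ka_lact b X) b b') => //.
- by move=> c d; rewrite ka_lactM.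
- by move=> c; exact: (zero c [::]).
Qed.

(** The factor E_(n-1,u) on the right meets the last shift, and the coefficients telescope. *)
Lemma stack_shift m k u : (m + k = n)%N ->
  foldr (fun b y => list_half false (list_lact b diagonal) y + list_half true (list_lact b diagonal) y)
    (tens (matrix_unit R n.-1 u) vac1) [seq shift j | j <- iota m k] =
  tens (matrix_unit R m.-1 u) (foldr (fun j y => G0 (eta (w j)) y) vac1 (iota m k)).
Proof.
elim: k m => [|k IH] m; first by rewrite addn0 => ->.
move=> mk; have mn : (m < n)%N by rewrite -mk -[X in (X < _)%N]addn0 ltn_add2l.
rewrite /= IH ?addSnnS // !half_shift // !(ampE (@half_linear _ _)) matrix_unit_mul.
by rewrite -(linear_lfD (tens_linr _)).
Qed.

Lemma fold_shift m k i x : (m + k <= n)%N ->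
  foldl (@ka_mul R A) (tens (matrix_unit R i m.-1) x)
    (map (realize \o list_lact^~ diagonal) [seq shift j | j <- iota m k]) =
  tens (matrix_unit R i (m + k).-1) (x * \prod_(j <- iota m k) w j).
Proof.
elim: k m x => [|k IH] m x; first by rewrite addn0 /= big_nil mulr1.
move=> mk; have mn : (m < n)%N by apply: leq_trans mk; rewrite -[X in (X < _)%N]addn0 ltn_add2l.
rewrite /= realize_shift // ka_mulE matrix_unit_mul -[X in matrix_unit R _ X]/(m.+1.-1).
by rewrite IH ?addSnnS // big_cons mulrA.
Qed.

(** The algebra side is the scalar moment times E_(0,n-1), and multiplication by E_(n-1,u) turns it
    into a multiple of E_(0,u), the matrix unit of the operator side; the scalars are compared. *)
Lemma word_moment : (forall v, V v -> star v = v) -> (0 < n)%N ->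
  phi (\prod_(j <- iota 0 n) w j) =
  vac_component (foldr (fun j y => G0 (eta (w j)) y) vac1 (iota 0 n)).
Proof.
move=> Vsa n0; set u := n.-1.
have := @listed_moment K (@opmul R) (list_lact^~ diagonal) _
   [seq shift j | j <- iota 0 n] (matrix_unit R n.-1 u) (fun t => shift_cumulant t Vsa).
rewrite stack_shift // vac_stateE size_map size_iota => /(_ _ n0) h.
have {}h : opmul (moment (@ka_mul R A) (@ka_phi R A)
   [seq (realize \o list_lact^~ diagonal) i | i <- [seq shift j | j <- iota 0 n]]) (matrix_unit R n.-1 u) =
   (vac_component (foldr (fun j y => G0 (eta (w j)) y) vac1 (iota 0 n)) : C) *: matrix_unit R 0 u.
  apply: h => b a; rewrite /list_lact -map_comp; apply: eq_map => p /=.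
  by rewrite opmulA.
move: h; rewrite -[X in iota 0 X](prednK n0).
rewrite [iota _ _]/= [map shift _]/= [map (realize \o _) _]/= [moment _ _ _]/=.
rewrite realize_shift // -[X in tens (matrix_unit R _ X)]/(1.-1).
rewrite fold_shift ?add1n ?prednK // ka_phiE (linear_lfZ (@opmul_linearl R _)) matrix_unit_mul.
by rewrite big_cons => /matrix_unit_scale_inj.
Qed.
End Word.

Lemma gpoly_words x g : gpoly x g -> exists s : seq (C * seq {v : A | V v}),
  x = \sum_(p <- s) p.1 *: \prod_(v <- p.2) sval v /\
  forall z, g z = \sum_(p <- s) p.1 *: foldr (fun v y => G0 (eta (sval v)) y) z p.2.
Proof.
have fl (t : seq {v : A | V v}) : linear (fun z => foldr (fun v y => G0 (eta (sval v)) y) z t).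
  by elim: t => [|v t IH] //= a y z; rewrite IH G0_linear.
elim=> {x g}.
- by exists [:: (1, [::])]; rewrite big_seq1 big_nil scale1r; split=> // z; rewrite big_seq1 scale1r.
- move=> v Vv; exists [:: (1, [:: exist _ v Vv])]; rewrite !big_seq1 scale1r; split=> // z.
  by rewrite big_seq1 scale1r.
- move=> a x y g h _ [s [-> es]] _ [t [-> et]].
  exists ([seq (a * p.1, p.2) | p <- s] ++ t); split=> [|z].
    by rewrite big_cat big_map scaler_sumr; congr (_ + _); apply: eq_bigr => p _; rewrite scalerA.
  rewrite !fctE es et big_cat big_map scaler_sumr; congr (_ + _).
  by apply: eq_bigr => p _; rewrite scalerA.
- move=> x y g h _ [s [-> es]] _ [t [-> et]].
  exists [seq (p.1 * q.1, p.2 ++ q.2) | p <- s, q <- t]; split=> [|z].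
    rewrite big_allpairs_dep mulr_suml; apply: eq_bigr => p _; rewrite mulr_sumr.
    by apply: eq_bigr => q _; rewrite /= big_cat -scalerAl -scalerAr scalerA.
  rewrite /= es big_allpairs_dep; apply: eq_bigr => p _ /=.
  rewrite et (linear_lf_sum (fl p.2)) scaler_sumr; apply: eq_bigr => q _ /=.
  by rewrite (linear_lfZ (fl p.2)) scalerA foldr_cat.
Qed.

Lemma wick_of_semicircular : (forall v, V v -> star v = v) -> V 0 -> wick.
Proof.
move=> Vsa V0 x g /gpoly_words[s [-> ->]]; rewrite linear_sum.
rewrite (linear_lf_sum (@vac_component_linear R (scalar_data H))); apply: eq_bigr => p _.
rewrite linearZ /= (linear_lfZ (@vac_component_linear R (scalar_data H))); congr (_ * _).
case: (posnP (size p.2)) => [/size0nil ->|p0]; first by rewrite big_nil phi1 vac_component_vac.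
(* The element 0 of V serves as the default value of [nth]. *)
have := word_moment (exist _ 0 V0) Vsa p0.
move: p.2 => t h; rewrite -(mkseq_nth (exist V 0 V0) t) big_map foldr_map.
exact: h.
Qed.
End Stack.
End Wick.

(** * The compact Fock bimodule *)

Section OperatorForms.
Variables (R : realType) (M : lmodType R[i]).
Local Notation C := R[i].
Local Notation K := (compacts R).

Lemma linear_comb_comm (U : lmodType C) a b (x y x' y' : U) : 
  a *: (b *: x + y) + (b *: x' + y') = b *: (a *: x + x') + (a *: y + y').
Proof. by rewrite !scalerDr !scalerA [b * a]mulrC addrACA. Qed.

Definition ramp (b : K) : tensor K M -> tensor K M := tens_ext (fun T f => tens (opmul T b) f).

Lemma ramp_hl b (f : M) : linear (fun T : K => tens (opmul T b) f).
Proof. exact: (linear_comp (tens_linl f) (@opmul_linearl R b)). Qed.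

Lemma ramp_hr b (T : K) : linear (fun f : M => tens (opmul T b) f).
Proof. exact: tens_linr. Qed.

Lemma ramp_linear b : linear (ramp b).
Proof. by apply: tens_ext_linear; [exact: ramp_hl|exact: ramp_hr]. Qed.

Lemma rampE b T f : ramp b (tens T f) = tens (opmul T b) f.
Proof. by apply: tens_extE; [exact: ramp_hl|exact: ramp_hr]. Qed.

Lemma ramp_linear_coef z : linear (fun b => ramp b z).
Proof.
apply: tens_ext_param; [exact: ramp_hl|exact: ramp_hr|].
by move=> T f; exact: (linear_comp (tens_linl f) (@opmul_linearr R T)).
Qed.

Lemma rampM b c z : ramp c (ramp b z) = ramp (opmul b c) z.
Proof.
move: z; apply: tensor_ind => [a z z' ez ez'|T f]; first by rewrite !ramp_linear ez ez'.
by rewrite !rampE opmulA.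
Qed.

Lemma amp_ramp S (g : M -> M) b z : linear g -> amp S g (ramp b z) = ramp b (amp S g z).
Proof.
move=> gl; move: z; apply: tensor_ind => [a z z' ez ez'|T f].
  by rewrite !(ramp_linear, amp_linear gl) ez ez'.
by rewrite !(rampE, ampE gl) opmulA.
Qed.

Variable s : M -> M -> C.
Hypothesis sr : forall x a y y', s x (a *: y + y') = a * s x y + s x y'.
Hypothesis sh : forall x y, s y x = (s x y)^*.

Lemma form_antilinear y a x x' : s (a *: x + x') y = a^* * s x y + s x' y.
Proof. by rewrite sh sr conjcD conjcM -!sh. Qed.

(** The K-valued form s(e, f) S^* T on simple tensors. It serves both K (x) H_C, where it is
    [ht_dot], and K (x) F(H_C). *)
Definition kform (x y : tensor K M) : K :=
  tens_antiext (fun S e => tens_ext (fun T f => s e f *: opmul (opadj S) T) y) x.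

Lemma kform_hl S e f : linear (fun T => s e f *: opmul (opadj S) T).
Proof. by move=> a T T'; rewrite opmul_linearr scalerDr !scalerA mulrC. Qed.

Lemma kform_hr S e (T : K) : linear (fun f => s e f *: opmul (opadj S) T).
Proof. by move=> a f f'; rewrite sr scalerDl scalerA. Qed.

Lemma kform_pl y e a S S' :
  tens_ext (fun T f => s e f *: opmul (opadj (a *: S + S')) T) y =
  a^* *: tens_ext (fun T f => s e f *: opmul (opadj S) T) y + tens_ext (fun T f => s e f *: opmul (opadj S') T) y.
Proof.
have l S0 := tens_ext_linear (@kform_hl S0 e) (@kform_hr S0 e).
move: y; apply: tensor_ind => [b y y' ey ey'|T f].
  by rewrite (l (a *: S + S')) (l S) (l S') ey ey' linear_comb_comm.
rewrite !(tens_extE (@kform_hl _ e) (@kform_hr _ e)).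
by rewrite opadj_linear opmul_linearl scalerDr !scalerA mulrC.
Qed.

Lemma kform_pr y S a e e' :
  tens_ext (fun T f => s (a *: e + e') f *: opmul (opadj S) T) y =
  a^* *: tens_ext (fun T f => s e f *: opmul (opadj S) T) y + tens_ext (fun T f => s e' f *: opmul (opadj S) T) y.
Proof.
have l e0 := tens_ext_linear (@kform_hl S e0) (@kform_hr S e0).
move: y; apply: tensor_ind => [b y y' ey ey'|T f].
  by rewrite !l ey ey' linear_comb_comm.
rewrite !(tens_extE (@kform_hl S _) (@kform_hr S _)).
by rewrite form_antilinear scalerDl scalerA.
Qed.

Lemma kform_antilinear y a x x' : kform (a *: x + x') y = a^* *: kform x y + kform x' y.
Proof. exact: (tens_antiext_linear (@kform_pl y) (@kform_pr y)). Qed.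

Lemma kform_tensl S e y : kform (tens S e) y = tens_ext (fun T f => s e f *: opmul (opadj S) T) y.
Proof. exact: (tens_antiextE (@kform_pl y) (@kform_pr y)). Qed.

Lemma kformE S e T f : kform (tens S e) (tens T f) = s e f *: opmul (opadj S) T.
Proof. rewrite kform_tensl; exact: (tens_extE (@kform_hl S e) (@kform_hr S e)). Qed.

Lemma kform_linear x : linear (kform x).
Proof.
move=> a y y'; move: x; apply: tensor_ind => [b x x' ex ex'|S e].
  by rewrite !kform_antilinear ex ex' linear_comb_comm.
by rewrite !kform_tensl (tens_ext_linear (@kform_hl S e) (@kform_hr S e)).
Qed.

Lemma kform_herm x y : kform y x = opadj (kform x y).
Proof.
move: x; apply: tensor_ind => [a x x' ex ex'|S e].
  by rewrite kform_linear kform_antilinear opadj_linear conjCK ex ex'.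
move: y; apply: tensor_ind => [a y y' ey ey'|T f].
  by rewrite kform_linear kform_antilinear opadj_linear ey ey'.
rewrite !kformE -[_ *: opmul (opadj S) T]addr0 opadj_linear opadj_mul opadjK -sh.
have := @opadj_linear R 1 0 0; rewrite scale1r addr0 conjc1 scale1r => /eqP.
by rewrite -[X in X == _]addr0 (inj_eq (addrI _)) => /eqP <-; rewrite addr0.
Qed.

Lemma kform_rampr x b y : kform x (ramp b y) = opmul (kform x y) b.
Proof.
move: x; apply: tensor_ind => [a x x' ex ex'|S e].
  by rewrite !kform_antilinear ex ex' opmul_linearl.
move: y; apply: tensor_ind => [a y y' ey ey'|T f].
  by rewrite ramp_linear !kform_linear ey ey' opmul_linearl.
by rewrite rampE !kformE opmulA (linear_lfZ (@opmul_linearl R b)).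
Qed.

Lemma kform_rampl x b y : kform (ramp b x) y = opmul (opadj b) (kform x y).
Proof. by rewrite kform_herm kform_rampr opadj_mul -kform_herm. Qed.

Lemma kform_amp S (g g' : M -> M) x y : linear g -> linear g' ->
  (forall e f, s (g e) f = s e (g' f)) -> kform (amp S g x) y = kform x (amp (opadj S) g' y).
Proof.
move=> gl gl' gg'; move: x; apply: tensor_ind => [a x x' ex ex'|T e].
  by rewrite amp_linear // !kform_antilinear ex ex'.
move: y; apply: tensor_ind => [a y y' ey ey'|T' f].
  by rewrite amp_linear // !kform_linear ey ey'.
by rewrite !ampE // !kformE gg' opadj_mul opmulA.
Qed.

Definition vector_form (u : l2 R) (x y : tensor K M) : C := l2dot u (kform x y u).

Lemma vector_form_antilinear u y a x x' :
  vector_form u (a *: x + x') y = a^* * vector_form u x y + vector_form u x' y.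
Proof. by rewrite /vector_form kform_antilinear op_addE op_scaleE l2dot_combr. Qed.

Lemma vector_form_linear u x a y y' :
  vector_form u x (a *: y + y') = a * vector_form u x y + vector_form u x y'.
Proof. by rewrite /vector_form kform_linear op_addE op_scaleE l2dot_combr. Qed.

Lemma vector_formE u S e T f : vector_form u (tens S e) (tens T f) = l2dot (S u) (T u) * s e f.
Proof. by rewrite /vector_form kformE op_scaleE l2dotZr opmulE -opadjP mulrC. Qed.

Hypothesis sp : psd s.

(** On simple tensors the form is <S u, T u> s(e, f), a product of two positive kernels. *)
Lemma vector_form_ge0 u x : 0 <= vector_form u x x.
Proof.
have [r ->] := tensorE x.
have -> : vector_form u (\sum_(p <- r) tens p.1 p.2) (\sum_(p <- r) tens p.1 p.2) =
    kernel_form (fun p q : K * M => l2dot (p.1 u) (q.1 u) * s p.2 q.2) [seq (1, p) | p <- r].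
  rewrite /kernel_form /vector_form big_map.
  have sumK (I : Type) (t : seq I) (f : I -> K) v : l2dot v ((\sum_(i <- t) f i) u) = \sum_(i <- t) l2dot v (f i u).
    by rewrite op_sumE l2dot_sumr.
  have lsum (t : seq (K * M)) y : kform (\sum_(p <- t) tens p.1 p.2) y = \sum_(p <- t) kform (tens p.1 p.2) y.
    have k0 : kform 0 y = 0.
      by have := kform_antilinear y (-1) 0 0; rewrite scaler0 addr0 rmorphN1 scaleN1r addNr.
    by apply: (big_morph (kform^~ y) _ k0) => z z'; have := kform_antilinear y 1 z z'; rewrite conjc1 !scale1r.
  rewrite lsum sumK; apply: eq_bigr => p _; rewrite big_map (linear_lf_sum (@kform_linear _)) sumK.
  by apply: eq_bigr => q _; rewrite conjc1 !mul1r -vector_formE.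
apply: psd_mul; last exact: (psd_comp snd sp).
exact: (psd_comp (fun p : K * M => p.1 u) (@l2dot_psd R)).
Qed.

Local Notation vnorm u := (form_norm (vector_form u)).

Definition knorm x : R := Num.sqrt (opnorm (kform x x)).

Lemma knorm_ge0 x : 0 <= knorm x. Proof. exact: sqrtr_ge0. Qed.

Lemma vnorm_sqr u x : vnorm u x ^+ 2 = complex.Re (l2dot u (kform x x u)).
Proof.
have := form_norm_sqr (@vector_form_ge0 u) x => /(congr1 (@complex.Re R)) /= <-; by [].
Qed.

Lemma vnorm_le_knorm u x : l2norm u <= 1 -> vnorm u x <= knorm x.
Proof.
move=> u1; rewrite -ler_sqr ?nnegrE ?form_norm_ge0 ?knorm_ge0 //.
by rewrite vnorm_sqr sqr_sqrtr ?opnorm_ge0 // opnorm_form_ub.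
Qed.

(** [kform x x] is a positive operator, so its norm is the supremum of its quadratic form. Norm
    estimates thereby reduce to scalar forms, one for each u. *)
Lemma knorm_le x c : 0 <= c -> (forall u, l2norm u <= 1 -> vnorm u x <= c) -> knorm x <= c.
Proof.
move=> c0 hc; rewrite -ler_sqr ?nnegrE ?knorm_ge0 // sqr_sqrtr ?opnorm_ge0 //.
apply: opnorm_form_le; first exact: sqr_ge0.
  by move=> u; exact: vector_form_ge0.
move=> u u1; rewrite -vnorm_sqr; have := hc u u1; have := form_norm_ge0 (vector_form u) x.
by move: (vnorm u x) => t t0 tc; rewrite ler_sqr ?nnegrE.
Qed.

Lemma knormZ a x : knorm (a *: x) <= normc a * knorm x.
Proof.
apply: knorm_le => [|u u1]; first by rewrite mulr_ge0 ?normc_ge0 ?knorm_ge0.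
rewrite (form_normZ (@vector_form_antilinear u) (@vector_form_linear u) (@vector_form_ge0 u)).
by apply: ler_wpM2l; [exact: normc_ge0|exact: vnorm_le_knorm].
Qed.

Lemma knormD x y : knorm (x + y) <= knorm x + knorm y.
Proof.
apply: knorm_le => [|u u1]; first by rewrite addr_ge0 ?knorm_ge0.
apply: le_trans (form_normD (@vector_form_antilinear u) (@vector_form_linear u) (@vector_form_ge0 u) x y) _.
exact: lerD (vnorm_le_knorm x u1) (vnorm_le_knorm y u1).
Qed.

Lemma knorm_tens S e : knorm (tens S e) <= opnorm S * form_norm s e.
Proof.
have ge0 f : 0 <= s f f by exact: psd_diag.
apply: knorm_le => [|u u1]; first by rewrite mulr_ge0 ?opnorm_ge0 ?form_norm_ge0.
rewrite -ler_sqr ?nnegrE ?form_norm_ge0 ?mulr_ge0 ?opnorm_ge0 ?form_norm_ge0 //.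
rewrite exprMn -lecR -(form_norm_sqr (@vector_form_ge0 u)) vector_formE l2dotxx (form_norm_sqr ge0) -rmorphM lecR.
rewrite ler_wpM2r ?sqr_ge0 // ler_sqr ?nnegrE ?l2norm_ge0 ?opnorm_ge0 //.
exact: opnorm_ub.
Qed.

(** The (i, j) matrix entry in the K factor. *)
Definition slice i j : tensor K M -> M := tens_ext (fun (S : K) (f : M) => (l2val (S (l2delta R j)) i : C) *: f).

Lemma slice_hl i j (f : M) : linear (fun S : K => (l2val (S (l2delta R j)) i : C) *: f).
Proof. by move=> a S S'; rewrite op_addE op_scaleE l2_addE l2_scaleE scalerDl scalerA. Qed.

Lemma slice_hr i j (S : K) : linear (fun f : M => (l2val (S (l2delta R j)) i : C) *: f).
Proof. by move=> a f f'; rewrite scalerDr !scalerA mulrC. Qed.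

Lemma slice_linear i j : linear (slice i j).
Proof. by apply: tens_ext_linear; [exact: slice_hl|exact: slice_hr]. Qed.

Lemma sliceE i j S f : slice i j (tens S f) = (l2val (S (l2delta R j)) i : C) *: f.
Proof. by apply: tens_extE; [exact: slice_hl|exact: slice_hr]. Qed.

Lemma vector_form_slice i j f z :
  vector_form (l2delta R j) (tens (matrix_unit R i j) f) z = s f (slice i j z).
Proof.
move: z; apply: tensor_ind => [a z z' ez ez'|S g].
  by rewrite vector_form_linear slice_linear sr ez ez'.
rewrite vector_formE sliceE matrix_unitE l2deltaE eqxx scale1r l2dot_delta.
have s0 x : s x 0 = 0 by have := sr x (-1) 0 0; rewrite scaler0 addr0 mulN1r addNr.
by rewrite -[_ *: g]addr0 sr s0 addr0.
Qed.

(** For f = [slice j j z], Cauchy-Schwarz at u = delta_j of E_jj (x) f against z gives |f|^2 <= |f|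
    |z|. *)
Lemma slice_norm j z : form_norm s (slice j j z) <= knorm z.
Proof.
have ge0 f : 0 <= s f f by exact: psd_diag.
set f := slice j j z.
case: (ltrgtP (form_norm s f) 0) => [f0|f0|->]; last exact: knorm_ge0.
  by have := form_norm_ge0 s f; rewrite leNgt f0.
have := form_cauchy_schwarz (@vector_form_antilinear (l2delta R j)) (@vector_form_linear (l2delta R j))
   (@vector_form_ge0 (l2delta R j)) (tens (matrix_unit R j j) f) z.
rewrite vector_form_slice -/f (form_norm_sqr ge0) normc_real ger0_norm ?sqr_ge0 //.
have -> : vnorm (l2delta R j) (tens (matrix_unit R j j) f) = form_norm s f.
  rewrite /form_norm vector_formE matrix_unitE l2deltaE eqxx scale1r l2dotxx l2norm_delta expr1n.
  by rewrite mul1r.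
rewrite expr2 ler_pM2l // => h; apply: le_trans h _.
by apply: vnorm_le_knorm; rewrite l2norm_delta.
Qed.

(** Matrix entries separate compact operators, so they can serve as the functionals of
    [bilinear_sum_eq0]. *)
Lemma slice_separating z : (forall i j, slice i j z = 0) -> z = 0.
Proof.
have [r ->] := tensorE z => h.
pose L : set (K -> C) := [set l | exists i j, l = fun S : K => l2val (S (l2delta R j)) i : C].
apply: (@bilinear_sum_eq0 R K M (tensor K M) L (fun S f => tens S f)).
- by move=> l [i [j ->]] a u v; rewrite op_addE op_scaleE l2_addE l2_scaleE.
- move=> S S0; apply: contrapT => no; move/eqP: S0; apply.
  have z0 i j : l2val (S (l2delta R j)) i = 0.
    by apply/eqP/negPn/negP => nz; apply: no; exists (fun S : K => l2val (S (l2delta R j)) i : C); [exists i, j|].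
  apply: op_ext => x; apply: l2dot_ext => y; rewrite op_0E l2dot0r -opadjP'.
  have -> : opadj S y = 0; last exact: l2dot0l.
  apply: l2_ext => k; rewrite -[LHS]l2dot_delta -opadjP.
  by have -> : S (l2delta R k) = 0; [apply: l2_ext => i; exact: z0|exact: l2dot0l].
- by move=> f; exact: tens_linl.
- by move=> S; exact: tens_linr.
move=> l [i [j ->]]; rewrite -[RHS](h i j) (linear_lf_sum (slice_linear i j)).
by apply: eq_bigr => p _; rewrite sliceE.
Qed.

Lemma kform_definite z : (forall f, s f f = 0 -> f = 0) -> kform z z = 0 -> z = 0.
Proof.
move=> sd z0; apply: slice_separating => i j; apply: sd; rewrite -vector_form_slice.
have q0 : vector_form (l2delta R j) z z = 0 by rewrite /vector_form z0 op_0E l2dot0r.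
have qp := psd_sesquilinear (@vector_form_antilinear (l2delta R j)) (@vector_form_linear (l2delta R j))
   (@vector_form_ge0 (l2delta R j)).
by rewrite (psd_herm _ _ qp) (psd_isotropic _ qp q0) conjc0.
Qed.
End OperatorForms.

(** * The identification of F(K (x) H_C) with K (x) F(H_C) *)

Section CompactFock.
Variables (R : realType) (H : realHilbert R).
Local Notation C := R[i].
Local Notation K := (compacts R).
Local Notation HC := (complexification H).
Local Notation F := (fock (scalar_data H)).
Local Notation D := (compact_data H).
Local Notation vac1 := (@vac R (scalar_data H) 1).
Local Notation cre e := (@creation R (scalar_data H) e).
Local Notation ann e := (@annihilation R (scalar_data H) e).

Lemma id_linear (U : lmodType C) : linear (id : U -> U). Proof. by []. Qed.

Lemma compact_lactE (S T : K) (e : HC) : @lact R D S (tens T e) = tens (opmul S T) e.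
Proof. exact: (ampE (@id_linear HC) S T e). Qed.

Lemma compact_ractE (S T : K) (e : HC) : @ract R D (tens T e) S = tens (opmul T S) e.
Proof. exact: (rampE S T e). Qed.

Lemma compact_ractM (x : Ht H) (b c : K) : @ract R D (@ract R D x b) c = @ract R D x (opmul b c).
Proof. exact: rampM. Qed.

Lemma compact_bdotE (S T : K) (e f : HC) : @bdot R D (tens S e) (tens T f) = cdot e f *: opmul (opadj S) T.
Proof. exact: (kformE (@cdot_linear R H) (@cdot_herm R H)). Qed.

Lemma compact_laws : fock_laws D.
Proof.
have idl := @id_linear HC.
split=> /=.
- exact: opmul_linearl.
- exact: opmul_linearr.
- exact: opmulA.
- exact: opadj_linear.
- exact: opadj_mul.
- exact: opadjK.
- by move=> x; exact: (amp_linear_coef idl x).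
- by move=> b; exact: (amp_linear idl b).
- by move=> b c x; exact: (esym (amp_comp b c x idl idl)).
- exact: ramp_linear.
- exact: ramp_linear_coef.
- by move=> b c x; exact: (amp_ramp b c x idl).
- exact: (kform_linear (@cdot_linear R H) (@cdot_herm R H)).
- exact: (kform_herm (@cdot_linear R H) (@cdot_herm R H)).
- by move=> x y b; exact: (kform_rampr (@cdot_linear R H) (@cdot_herm R H)).
- by move=> b x y; exact: (kform_amp (@cdot_linear R H) (@cdot_herm R H) b x y idl idl (fun _ _ => erefl)).
Qed.

Local Notation laws := compact_laws.
Local Notation kdot := (kform (fun z w : F => @fock_dot R (scalar_data H) z w : C)).

Lemma creation_ract (x : Ht H) (b : K) z :
  creation (D := D) (ract (f := D) x b) z = creation (D := D) x (fock_lact (D := D) b z).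
Proof.
apply: (@fock_eq _ D _ (creation (D := D) (ract (f := D) x b)) (fun z => creation (D := D) x (fock_lact (D := D) b z))).
- exact: (creation_linear laws).
- exact: (linear_comp (creation_linear laws x) (fock_lact_linear laws b)).
- by move=> c; rewrite (fock_lact_vac laws) !(creation_vac laws) compact_ractM.
move=> y s; rewrite (fock_lact_tens laws) !(creation_tens laws).
have [_ _ bal] := @word_linear_generator R D; exact: (bal [::] s x b y).
Qed.

Definition tensor_creation (x : Ht H) (z : tensor K F) : tensor K F :=
  tens_ext (fun S e => amp S (cre e) z) x.

Lemma cre_linear e : linear (cre e). Proof. exact: (creation_linear (scalar_laws H)). Qed.
Lemma ann_linear e : linear (ann e). Proof. exact: (annihilation_linear (scalar_laws H)). Qed.

Lemma tensor_creation_hl z e : linear (fun S => amp S (cre e) z).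
Proof. exact: (amp_linear_coef (cre_linear e) z). Qed.

Lemma tensor_creation_hr z (S : K) : linear (fun e : HC => amp S (cre e) z).
Proof.
move=> a e e'; rewrite -amp_comb; [|exact: cre_linear..].
congr amp; apply/funext => w; rewrite !fctE.
exact: (creation_linear_arg (scalar_laws H) w a e e').
Qed.

Lemma tensor_creation_linear z : linear (tensor_creation^~ z).
Proof. exact: tens_ext_linear (tensor_creation_hl z) (tensor_creation_hr z). Qed.

Lemma tensor_creationE S e z : tensor_creation (tens S e) z = amp S (cre e) z.
Proof. exact: tens_extE (tensor_creation_hl z) (tensor_creation_hr z) S e. Qed.

Lemma tensor_creation_linearr x : linear (tensor_creation x).
Proof.
move=> a z w; move: x; apply: tensor_ind => [b x y ex ey|S e].
  rewrite (tensor_creation_linear (a *: z + w)) (tensor_creation_linear z) (tensor_creation_linear w).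
  by rewrite ex ey; exact: linear_comb_comm.
by rewrite !tensor_creationE (amp_linear (cre_linear e)).
Qed.

Lemma tensor_creation_ract x b z :
  tensor_creation (ract (f := D) x b) z = tensor_creation x (amp b id z).
Proof.
move: x; apply: tensor_ind => [a x y ex ey|S e].
  by rewrite (ract_linearl laws) !tensor_creation_linear ex ey.
by rewrite compact_ractE !tensor_creationE amp_comp //; exact: cre_linear.
Qed.

Lemma amp_tensor_creation b x z :
  amp b id (tensor_creation x z) = tensor_creation (lact (f := D) b x) z.
Proof.
have idl := @id_linear F.
move: x; apply: tensor_ind => [a x y ex ey|S e].
  by rewrite (lact_linearr laws) !tensor_creation_linear (amp_linear idl) ex ey.
by rewrite compact_lactE !tensor_creationE amp_comp //; exact: cre_linear.
Qed.

Definition ident_one (x : Ht H) : tensor K F :=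
  tens_ext (fun S e => tens S (@tensor_word R (scalar_data H) e [::])) x.

Lemma ident_one_hl (e : HC) : linear (fun S : K => tens S (@tensor_word R (scalar_data H) e [::])).
Proof. exact: tens_linl. Qed.

Lemma ident_one_hr (S : K) : linear (fun e : HC => tens S (@tensor_word R (scalar_data H) e [::])).
Proof. exact: (linear_comp (tens_linr S) (@tensor_word_linear R (scalar_data H) [::])). Qed.

Lemma ident_one_linear : linear ident_one.
Proof. exact: tens_ext_linear ident_one_hl ident_one_hr. Qed.

Lemma ident_oneE (S : K) (e : HC) : ident_one (tens S e) = tens S (cre e vac1).
Proof. by rewrite -scalar_word1; exact: tens_extE ident_one_hl ident_one_hr S e. Qed.

Lemma ident_one_ract x b : ident_one (ract (f := D) x b) = tensor_creation x (tens b vac1).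
Proof.
move: x; apply: tensor_ind => [a x y ex ey|S e].
  by rewrite (ract_linearl laws) tensor_creation_linear ident_one_linear ex ey.
by rewrite compact_ractE ident_oneE tensor_creationE (ampE (cre_linear e)).
Qed.

Lemma amp_ident_one b x : amp b id (ident_one x) = ident_one (lact (f := D) b x).
Proof.
have idl := @id_linear F.
move: x; apply: tensor_ind => [a x y ex ey|S e].
  by rewrite (lact_linearr laws) !ident_one_linear (amp_linear idl) ex ey.
by rewrite compact_lactE !ident_oneE (ampE idl).
Qed.

Lemma ident_word_cons x y s : ident_word x (y :: s) = tensor_creation x (ident_word y s).
Proof. by []. Qed.

Lemma ident_word_nil x : ident_word x [::] = ident_one x. Proof. by []. Qed.

Lemma ident_word_linear s : linear (fun x : Ht H => ident_word x s).
Proof.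
case: s => [|y s] a x x'; first by rewrite !ident_word_nil ident_one_linear.
by rewrite !ident_word_cons tensor_creation_linear.
Qed.

Lemma amp_ident_word b x s : amp b id (ident_word x s) = ident_word (lact (f := D) b x) s.
Proof.
by case: s => [|y s]; rewrite ?ident_word_nil ?ident_word_cons ?amp_ident_one ?amp_tensor_creation.
Qed.

Definition ident_fun (w : word D) : tensor K F := match w with
    | Vac b => tens (b : K) (Omega H)
    | Tens x s => ident_word x s end.

Lemma ident_word_insert s x t : ident_fun (insert s x t) =
  if s is y :: s' then ident_word y (s' ++ x :: t) else ident_word x t.
Proof. by case: s. Qed.

(** Balancing is respected because a coefficient on the right of one letter or on the left of the
    next multiplies into the same place of the product of coefficients. *)
Lemma ident_word_linear_family : word_linear ident_fun.
Proof.
split=> [a b b'|s t a x x'|s t x b y] /=; first by rewrite (tens_linl (Omega H)).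
  rewrite !ident_word_insert; case: s => [|y s]; first exact: ident_word_linear.
  elim: s y => [|z s IH] y; first by rewrite !cat0s !ident_word_cons ident_word_linear tensor_creation_linearr.
  by rewrite !cat_cons !ident_word_cons IH tensor_creation_linearr.
have base : ident_word (ract (f := D) x b) (y :: t) = ident_word x (lact (f := D) b y :: t).
  by rewrite !ident_word_cons tensor_creation_ract amp_ident_word.
rewrite !ident_word_insert; case: s => [|z s]; first exact: base.
elim: s z => [|z' s IH] z; first by rewrite !cat0s ident_word_cons base.
by rewrite !cat_cons !ident_word_cons IH.
Qed.

Lemma ident_linear : linear (@ident R H).
Proof. exact: (fock_ext_linear ident_word_linear_family). Qed.

Lemma ident_vac (b : K) : ident (vac (D := D) b) = tens b vac1.
Proof. exact: (@fock_ext_generator R D _ ident_fun (Vac (b : coef D)) ident_word_linear_family). Qed.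

Lemma ident_tens x s : ident (tensor_word (D := D) x s) = ident_word x s.
Proof. exact: (fock_ext_generator (Tens x s : word D) ident_word_linear_family). Qed.

Lemma ident_creation x z : ident (creation (D := D) x z) = tensor_creation x (ident z).
Proof.
move: z; apply: (@fock_eq _ D _ (fun z => ident (creation (D := D) x z)) (fun z => tensor_creation x (ident z))).
- exact: (linear_comp ident_linear (creation_linear laws x)).
- exact: (linear_comp (tensor_creation_linearr x) ident_linear).
- by move=> b; rewrite (creation_vac laws) ident_tens ident_vac ident_word_nil ident_one_ract.
- by move=> y s; rewrite (creation_tens laws) !ident_tens ident_word_cons.
Qed.

Lemma ident_lact b z : ident (fock_lact (D := D) b z) = amp b id (ident z).
Proof.
have idl := @id_linear F.
move: z; apply: (@fock_eq _ D _ (fun z => ident (fock_lact (D := D) b z)) (fun z => amp b id (ident z))).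
- exact: (linear_comp ident_linear (fock_lact_linear laws b)).
- exact: (linear_comp (amp_linear idl b) ident_linear).
- by move=> c; rewrite (fock_lact_vac laws) !ident_vac (ampE idl).
- by move=> y s; rewrite (fock_lact_tens laws) !ident_tens amp_ident_word.
Qed.

Lemma ident_annihilation (S : K) (e : HC) z :
  ident (annihilation (D := D) (tens S e) z) = amp (opadj S) (ann e) (ident z).
Proof.
move: z; apply: (@fock_eq _ D _ (fun z => ident (annihilation (D := D) (tens S e) z))
   (fun z => amp (opadj S) (ann e) (ident z))).
- exact: (linear_comp ident_linear (annihilation_linear laws _)).
- exact: (linear_comp (amp_linear (ann_linear e) _) ident_linear).
- move=> b; rewrite (annihilation_vac laws) (linear_lf0 ident_linear) ident_vac (ampE (ann_linear e)).
  by rewrite (annihilation_vac (scalar_laws H)) (linear_lf0 (tens_linr _)).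
(* Annihilation after creation by y on K (x) F(H_C) is multiplication by the inner product; this
   matches removing the first letter of a word. *)
have key (y : Ht H) w : amp (bdot (f := D) (tens S e) y) id w =
    amp (opadj S) (ann e) (tensor_creation y w).
  have idl := @id_linear F.
  move: y; apply: tensor_ind => [a y y' ey ey'|T f].
    by rewrite (bdot_linear laws) (amp_linear_coef idl) tensor_creation_linear (amp_linear (ann_linear e)) ey ey'.
  rewrite compact_bdotE tensor_creationE amp_comp; [|exact: ann_linear|exact: cre_linear].
  rewrite (linear_lfZ (amp_linear_coef idl w)); move: w.
  apply: tensor_ind => [a w w' ew ew'|W h].
    rewrite (amp_linear idl) (amp_linear (linear_comp (ann_linear e) (cre_linear f))) -ew -ew'.
    by rewrite !scalerDr !scalerA mulrC.
  rewrite (ampE idl) (ampE (linear_comp (ann_linear e) (cre_linear f))) /=.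
  by rewrite scalar_annihilation_creation (linear_lfZ (tens_linr _)).
move=> y [|y' s].
  rewrite (annihilation_tens1 laws) ident_vac ident_tens ident_word_nil.
  move: y; apply: tensor_ind => [a y y' ey ey'|T f].
    by rewrite (bdot_linear laws) (tens_linl vac1) ident_one_linear (amp_linear (ann_linear e)) ey ey'.
  rewrite compact_bdotE ident_oneE (ampE (ann_linear e)) scalar_annihilation_creation.
  by rewrite (linear_lfZ (tens_linl _)) (linear_lfZ (tens_linr _)).
by rewrite (annihilation_tens2 laws) !ident_tens ident_word_cons -amp_ident_word key.
Qed.

(** Some factorization of S in K. Letters of the Fock bimodule carry their own coefficients, so a
    single S has to be split along a word; independence of the choice is in [unfold_word_props]. *)
Definition factor (S : K) : K * K := projT1 (cid (let: ex_intro D' (ex_intro T (ex_intro _ (And3 _ e _))) :=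
   compact_factorization S S in ex_intro (fun p : K * K => S = opmul p.1 p.2) (D', T) e)).

Lemma factorE (S : K) : S = opmul (factor S).1 (factor S).2.
Proof. by rewrite /factor; case: cid. Qed.

Fixpoint unfold_word (S : K) (s : seq HC) : fock D :=
  if s is e :: s' then creation (D := D) (tens (factor S).1 e) (unfold_word (factor S).2 s')
  else vac (D := D) S.

(** The three properties are proved together along the word. Any factorization S' = S T may replace
    the chosen one: its left factor and the chosen left factor pass through a common injective W,
    the cofactors cross the balancing relation, and injectivity of W identifies what remains.
    Linearity in the coefficient follows by factoring two coefficients through one W. *)
Lemma unfold_word_props s :
  [/\ forall S T, unfold_word (opmul S T) s = fock_lact (D := D) S (unfold_word T s),
      linear (unfold_word^~ s)
    & forall e S T, unfold_word (opmul S T) (e :: s) = creation (D := D) (tens S e) (unfold_word T s)].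
Proof.
have cons (t : seq HC) : (forall S T, unfold_word (opmul S T) t = fock_lact (D := D) S (unfold_word T t)) ->
    forall e S T, unfold_word (opmul S T) (e :: t) = creation (D := D) (tens S e) (unfold_word T t).
  move=> hl e S T; rewrite /=; set S' := opmul S T.
  have [W [P [P' [Winj eP eP']]]] := compact_factorization (factor S').1 S.
  have eq : opmul P (factor S').2 = opmul P' T.
    by apply: (opmul_injl Winj); rewrite !opmulA -eP -eP' -factorE.
  rewrite [in LHS]eP [in RHS]eP'.
  rewrite -![tens (opmul W _) e]compact_ractE !creation_ract.
  by congr (creation _ _); rewrite -!hl eq.
elim: s => [|h s [IH1 IH2 IH3]].
  have h1 S T : unfold_word (opmul S T) [::] = fock_lact (D := D) S (unfold_word T [::]).
    by rewrite /= (fock_lact_vac laws).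
  by split=> [||]; [exact: h1|move=> a S T; exact: (@vac_linear R D a S T)|exact: cons].
have h1 S T : unfold_word (opmul S T) (h :: s) = fock_lact (D := D) S (unfold_word T (h :: s)).
  by rewrite {1}(factorE T) opmulA IH3 /= (fock_lact_creation laws) compact_lactE.
split=> //; last exact: cons.
move=> a S S'; have [W [T [T' [_ -> ->]]]] := compact_factorization S S'.
by rewrite -opmul_linearr !IH3 IH2 (creation_linear laws).
Qed.

Lemma unfold_word_linear s : linear (unfold_word^~ s).
Proof. by have [] := unfold_word_props s. Qed.

Lemma unfold_word_cons e S T s :
  unfold_word (opmul S T) (e :: s) = creation (D := D) (tens S e) (unfold_word T s).
Proof. by have [] := unfold_word_props s. Qed.

Lemma unfold_word_letter S s t a x x' : unfold_word S (s ++ (a *: x + x') :: t) =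
  a *: unfold_word S (s ++ x :: t) + unfold_word S (s ++ x' :: t).
Proof.
elim: s S => [|y s IH] S; rewrite (factorE S) !(cat0s, cat_cons) !unfold_word_cons.
  by rewrite (tens_linr (factor S).1) (creation_linear_arg laws).
by rewrite IH (creation_linear laws).
Qed.

Definition unfold_fun (S : K) (w : word (scalar_data H)) : fock D := match w with
  | Vac c => vac (D := D) ((c : C) *: S)
  | Tens e s => unfold_word S (e :: s) end.

Lemma unfold_fun_linear S : word_linear (unfold_fun S).
Proof.
apply: scalar_word_linear => [a b b'|s t a x x'] /=.
  by rewrite scalerDl -scalerA (@vac_linear R D).
have e y : unfold_fun S (insert s y t) = unfold_word S (s ++ y :: t) by case: (s).
by rewrite !e unfold_word_letter.
Qed.

Definition unfold (S : K) : F -> fock D := lin_ext (unfold_fun S).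

Lemma unfold_linear S : linear (unfold S).
Proof. exact: fock_ext_linear (unfold_fun_linear S). Qed.

Lemma unfold_seq S s : unfold S (word_of_seq s) = unfold_word S s.
Proof.
case: s => [|e s].
  have := @fock_ext_generator R (scalar_data H) _ _ (@Vac R (scalar_data H) (1 : C)) (unfold_fun_linear S).
  by rewrite /= scale1r.
exact: (@fock_ext_generator R (scalar_data H) _ _ (@Tens R (scalar_data H) e s) (unfold_fun_linear S)).
Qed.

Lemma unfold_linear_coef f : linear (unfold^~ f).
Proof.
move=> a S S'; move: f; apply: word_of_seq_span => [b f g ef eg|s].
  by rewrite !unfold_linear ef eg; exact: linear_comb_comm.
by rewrite !unfold_seq unfold_word_linear.
Qed.

Definition ident_inv : tensor K F -> fock D := tens_ext unfold.

Lemma ident_inv_linear : linear ident_inv.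
Proof. exact: tens_ext_linear unfold_linear_coef unfold_linear. Qed.

Lemma ident_inv_seq S s : ident_inv (tens S (word_of_seq s)) = unfold_word S s.
Proof. by rewrite -unfold_seq; exact: tens_extE unfold_linear_coef unfold_linear S _. Qed.

Lemma tensor_seq_ind (P : tensor K F -> Prop) :
  (forall a z z', P z -> P z' -> P (a *: z + z')) ->
  (forall S s, P (tens S (word_of_seq s))) -> forall z, P z.
Proof.
move=> hl hs; apply: tensor_ind => // S; apply: word_of_seq_span => // a f g hf hg.
by rewrite (tens_linr S); exact: hl.
Qed.

Lemma ident_inv_creation x z : ident_inv (tensor_creation x z) = creation (D := D) x (ident_inv z).
Proof.
move: x; apply: tensor_ind => [a x y ex ey|S e].
  by rewrite tensor_creation_linear ident_inv_linear (creation_linear_arg laws) ex ey.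
move: z; apply: tensor_seq_ind => [a z z' ez ez'|T s].
  by rewrite tensor_creation_linearr !ident_inv_linear (creation_linear laws) ez ez'.
by rewrite tensor_creationE (ampE (cre_linear e)) creation_seq !ident_inv_seq unfold_word_cons.
Qed.

Lemma identK : cancel (@ident R H) ident_inv.
Proof.
move=> z; move: z; apply: (@fock_eq _ D _ (fun z => ident_inv (ident z)) id).
- exact: linear_comp ident_inv_linear ident_linear.
- by [].
- by move=> b; rewrite ident_vac (ident_inv_seq b [::]).
move=> x s; rewrite ident_tens; elim: s x => [|y s IH] x; last first.
  by rewrite ident_word_cons ident_inv_creation IH (creation_tens laws).
rewrite ident_word_nil; move: x; apply: tensor_ind => [a x y ex ey|S e].
  by rewrite ident_one_linear ident_inv_linear ex ey (@tensor_word_linear R D [::] a x y).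
rewrite ident_oneE -[vac1]/(word_of_seq ([::] : seq HC)) creation_seq ident_inv_seq {1}(factorE S) unfold_word_cons.
by rewrite /= (creation_vac laws) compact_ractE -factorE.
Qed.

Lemma ident_invK : cancel ident_inv (@ident R H).
Proof.
move=> z; move: z; apply: tensor_seq_ind => [a z z' ez ez'|S s].
  by rewrite ident_inv_linear ident_linear ez ez'.
rewrite ident_inv_seq; elim: s S => [|e s IH] S /=; first exact: ident_vac.
rewrite ident_creation IH tensor_creationE (ampE (cre_linear e)) creation_seq -factorE.
by [].
Qed.

Lemma compact_fock_ind (P : fock D -> Prop) :
  (forall a z z', P z -> P z' -> P (a *: z + z')) -> (forall b, P (vac (D := D) b)) ->
  (forall S e z, P z -> P (creation (D := D) (tens S e) z)) -> forall z, P z.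
Proof.
move=> hl hv hc; apply: fock_ind => // x s; elim: s x => [|y s IH] x.
  move: x; apply: tensor_ind => [a x y hx hy|S e].
    by rewrite (@tensor_word_linear R D [::] a x y); exact: hl.
  rewrite (factorE S) -compact_ractE -(creation_vac laws); exact: hc.
move: x; apply: tensor_ind => [a x x' hx hx'|S e].
  by rewrite (@tensor_word_linear R D (y :: s) a x x'); exact: hl.
rewrite -(creation_tens laws); exact: hc.
Qed.

(** Both forms make annihilation the adjoint of creation and agree on coefficient vectors. *)
Lemma fock_dot_ident z z' : fock_dot (D := D) z z' = kdot (ident z) (ident z').
Proof.
have sl := @sdot_linear R H; have sh := @sdot_herm R H.
have adj S e u w : kdot (amp S (cre e) u) w = kdot u (amp (opadj S) (ann e) w).
  apply: (kform_amp sl sh) => [||f g]; [exact: cre_linear|exact: ann_linear|].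
  exact: (fock_dot_creation (scalar_laws H)).
move: z z'; apply: compact_fock_ind => [a z w ez ew z'|b z'|S e z ez z'].
- by rewrite (fock_dot_antilinear laws) ident_linear (kform_antilinear sl sh) ez ew.
- rewrite (fock_dot_vac laws) ident_vac /=.
  move: z'; apply: compact_fock_ind => [a z w ez ew|c|S e z _].
  + rewrite (@vac_component_linear R D a z w) ident_linear (kform_linear sl sh).
    by rewrite -ez -ew; exact: opmul_linearr.
  + rewrite vac_component_vac ident_vac (kformE sl sh) sdot_vac vac_component_vac.
    by rewrite scale1r.
  + rewrite (vac_component_creation laws) ident_creation tensor_creationE.
    rewrite (linear_lf0 (@opmul_linearr R _)) (kform_herm sl sh) adj.
    rewrite (ampE (ann_linear e)) (annihilation_vac (scalar_laws H)) (linear_lf0 (tens_linr _)).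
    by rewrite (linear_lf0 (kform_linear sl sh (ident z))); exact: (esym (@cadj0 R D laws)).
- by rewrite (fock_dot_creation laws) ident_creation tensor_creationE adj -ident_annihilation.
Qed.
End CompactFock.

(** * Gaussian operators on K (x) F(H_C) *)

Definition mk_linear (R : nzRingType) (U V : lmodType R) (f : U -> V) (fl : linear f) :
  {linear U -> V} := HB.pack f (GRing.isLinear.Build R U V *:%R f fl).

Section GaussianAlgebra.
Variables (R : realType) (H : realHilbert R).
Local Notation C := R[i].
Local Notation K := (compacts R).
Local Notation HC := (complexification H).
Local Notation F := (fock (scalar_data H)).
Local Notation TF := (tensor K F).
Local Notation D := (compact_data H).
Local Notation FK := (fock D).
Local Notation vac1 := (@vac R (scalar_data H) 1).
Local Notation sdot := (fun z w : F => @fock_dot R (scalar_data H) z w : C).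
Local Notation kdot := (kform sdot).
Local Notation slin := (@sdot_linear R H).
Local Notation sherm := (@sdot_herm R H).

Inductive galg : (F -> F) -> Prop :=
| galg_one : galg id
| galg_var h : galg (G0 h)
| galg_lin a g h : galg g -> galg h -> galg (a *: g + h)
| galg_mul g h : galg g -> galg h -> galg (g \o h).

Lemma galg_linear g : galg g -> linear g.
Proof.
elim=> {g} [//|h|a g h _ gl _ hl|g h _ gl _ hl]; first exact: G0_linear.
  by move=> b z w; rewrite !fctE gl hl linear_comb_comm.
exact: linear_comp.
Qed.

Lemma galg_adj g : galg g -> exists2 g', galg g' & forall z w, sdot (g z) w = sdot z (g' w).
Proof.
elim=> {g} [|h|a g h _ [g' gg' eg] _ [h' hh' eh]|g h _ [g' gg' eg] _ [h' hh' eh]].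
- by exists id => //; exact: galg_one.
- by exists (G0 h); [exact: galg_var|exact: sdot_G0].
- exists (a^* *: g' + h'); first exact: galg_lin.
  by move=> z w; rewrite !fctE sdot_antilinear sdot_linear eg eh.
- exists (h' \o g'); first exact: galg_mul.
  by move=> z w /=; rewrite eg eh.
Qed.

Lemma galg_rgaussian g h z : galg g -> g (rgaussian h z) = rgaussian h (g z).
Proof.
move=> gg; elim: gg z => {g} [//|h' z|a g k _ eg _ ek z|g k _ eg _ ek z] /=.
- exact: G0_rgaussian.
- by rewrite !fctE eg ek rgaussian_linear.
- by rewrite ek eg.
Qed.

Lemma galg_bounded g : galg g -> exists2 M : R, 0 <= M & forall z, fock_norm (g z) <= M * fock_norm z.
Proof.
elim=> {g} [|h|a g h _ [M M0 eg] _ [N N0 eh]|g h _ [M M0 eg] _ [N N0 eh]].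
- by exists 1 => // z; rewrite mul1r.
- exists (2 * `|h|) => [|z]; last exact: fock_norm_G0.
  by rewrite mulr_ge0.
- exists (normc a * M + N) => [|z]; first by rewrite addr_ge0 ?mulr_ge0 ?normc_ge0.
  rewrite !fctE; apply: le_trans (fock_normD _ _) _; rewrite mulrDl; apply: lerD => //.
  by rewrite fock_normZ -mulrA; apply: ler_wpM2l => //; exact: normc_ge0.
- exists (M * N) => [|z /=]; first exact: mulr_ge0.
  by apply: le_trans (eg _) _; rewrite -mulrA; apply: ler_wpM2l.
Qed.

(* T (c Omega) = z c for every c in K: the vector z is "T Omega", although K has no
   unit and K Omega therefore no vacuum vector. *)
Inductive symb : (TF -> TF) -> TF -> Prop :=
| symb_tens S g : galg g -> symb (amp S g) (tens S (g vac1))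
| symb_lin a T T' z z' : symb T z -> symb T' z' -> symb (a *: T + T') (a *: z + z').

Lemma symb_vac T z c : symb T z -> T (tens c vac1) = ramp c z.
Proof.
elim=> {T z} [S g /galg_linear gl|a T T' z z' _ eT _ eT']; first by rewrite (ampE gl) rampE.
by rewrite !fctE eT eT' ramp_linear.
Qed.

(** Right multiplication by E_jj keeps the j-th column of slices, and slices separate points. *)
Lemma ramp_separating (z : TF) : (forall c, ramp c z = 0) -> z = 0.
Proof.
move=> h; apply: slice_separating => i j; rewrite -[RHS](linear_lf0 (@slice_linear R F i j)).
rewrite -(h (matrix_unit R j j)); move: z {h}; apply: tensor_ind => [a z z' ez ez'|S f].
  by rewrite ramp_linear !slice_linear ez ez'.
by rewrite rampE !sliceE opmulE matrix_unitE l2deltaE eqxx scale1r.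
Qed.

Lemma symb_unique T z z' : symb T z -> symb T z' -> z = z'.
Proof.
move=> h h'; apply/eqP; rewrite -subr_eq0; apply/eqP/ramp_separating => c.
by rewrite (linear_lfB (ramp_linear c)) -(symb_vac c h) -(symb_vac c h') subrr.
Qed.

Lemma symb0 : symb 0 0.
Proof.
have := symb_tens 0 galg_one; rewrite (linear_lf0 (tens_linl _)); congr symb.
by apply/funext => z; exact: (linear_lf0 (amp_linear_coef (@id_linear R F) z)).
Qed.

Lemma symb_comp T T' z z' : symb T z -> symb T' z' -> symb (T \o T') (T z').
Proof.
move=> h; elim: h T' z' => {T z} [S g gg|a T T' z z' _ IH _ IH'] U w hU; last first.
  exact: symb_lin (IH _ _ hU) (IH' _ _ hU).
have gl := galg_linear gg; elim: hU => {U w} [S' h hh|a U U' w w' _ IH _ IH'].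
  rewrite (ampE gl); have := symb_tens (opmul S S') (galg_mul gg hh); congr symb.
  by apply/funext => z; rewrite /= (amp_comp _ _ _ gl (galg_linear hh)).
rewrite (amp_linear gl); have := symb_lin a IH IH'; congr symb.
by apply/funext => z; rewrite /= !fctE (amp_linear gl).
Qed.

Lemma symb_adj T z : symb T z ->
  exists T' z', symb T' z' /\ forall u w, kdot (T u) w = kdot u (T' w).
Proof.
elim=> {T z} [S g gg|a T T' z z' _ [U [w [hU eU]]] _ [U' [w' [hU' eU']]]].
  have [g' gg' eg] := galg_adj gg; exists (amp (opadj S) g'), (tens (opadj S) (g' vac1)).
  split; first exact: symb_tens.
  by move=> u w; apply: (kform_amp slin sherm); [exact: galg_linear|exact: galg_linear|].
exists (a^* *: U + U'), (a^* *: w + w'); split; first exact: symb_lin.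
by move=> u v; rewrite !fctE (kform_antilinear slin sherm) (kform_linear slin sherm) eU eU'.
Qed.

Definition transport (T : TF -> TF) : FK -> FK := fun z => ident_inv (T (ident z)).

Lemma transport_comb a T T' : transport (a *: T + T') = a *: transport T + transport T'.
Proof. by apply/funext => z; rewrite /transport !fctE ident_inv_linear. Qed.

Lemma transport_comp T T' : transport (T \o T') = transport T \o transport T'.
Proof. by apply/funext => z; rewrite /transport /= ident_invK. Qed.

Lemma transport_lact S : transport (amp S id) = @fock_lact R D S.
Proof. by apply/funext => z; rewrite /transport -ident_lact identK. Qed.

Definition ht_conj (x : Ht H) : Ht H := tens_antiext (fun S e => tens (opadj S) (cconj e)) x.

Lemma cconj_antilinear a (e e' : HC) : cconj (a *: e + e') = a^* *: cconj e + cconj e' :> HC.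
Proof.
case: a e e' => [a b] [x y] [x' y']; rewrite conjcE.
apply: (congr2 pair) => /=; first by rewrite scalerN scaleNr opprK.
by rewrite scaleNr scalerN !opprD.
Qed.

Lemma cconj_real (h : H) : cconj (to_complex h) = to_complex h.
Proof. by rewrite /cconj /to_complex /= oppr0. Qed.

Lemma ht_conj_hl (e : HC) a (S S' : K) :
  tens (opadj (a *: S + S')) (cconj e) = a^* *: tens (opadj S) (cconj e) + tens (opadj S') (cconj e).
Proof. by rewrite opadj_linear (tens_linl (cconj e : HC)). Qed.

Lemma ht_conj_hr (S : K) a (e e' : HC) :
  tens (opadj S) (cconj (a *: e + e')) = a^* *: tens (opadj S) (cconj e) + tens (opadj S) (cconj e').
Proof. by rewrite cconj_antilinear (tens_linr (opadj S)). Qed.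

Lemma ht_conj_antilinear a (x y : Ht H) :
  ht_conj (a *: x + y) = a^* *: ht_conj x + ht_conj y.
Proof. exact: (tens_antiext_linear ht_conj_hl ht_conj_hr). Qed.

Lemma ht_conjE (S : K) (e : HC) : ht_conj (tens S e) = tens (opadj S) (cconj e).
Proof. exact: (tens_antiextE ht_conj_hl ht_conj_hr). Qed.

Lemma gaussian_tens (B : K) h : opadj B = B ->
  @gaussian R D (tens B (to_complex h)) = transport (amp B (G0 h)).
Proof.
move=> sB; apply/funext => z; rewrite -[LHS]identK /transport; congr ident_inv.
rewrite /gaussian !fctE (linear_lfD (@ident_linear R H)) ident_annihilation ident_creation.
rewrite tensor_creationE sB.
have := @amp_comb R F B 1 _ _ (ident z) (@ann_linear R H (to_complex h)) (@cre_linear R H (to_complex h)).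
by rewrite !scale1r => <-.
Qed.

Lemma gaussianD x y : @gaussian R D (x + y) = gaussian (D := D) x + gaussian (D := D) y.
Proof.
apply/funext => z; rewrite /gaussian !fctE addrACA; congr (_ + _).
  by have := annihilation_antilinear_arg (compact_laws H) z 1 x y; rewrite conjc1 !scale1r.
exact: (linear_lfD (creation_linear_arg (compact_laws H) z)).
Qed.

Definition represented T := exists T' z, symb T' z /\ T = transport T'.

Lemma represented_lin a T U : represented T -> represented U -> represented (a *: T + U).
Proof.
move=> [T' [z [h ->]]] [U' [w [h' ->]]]; exists (a *: T' + U'), (a *: z + w).
by split; [exact: symb_lin|rewrite transport_comb].
Qed.

Lemma represented_comp T U : represented T -> represented U -> represented (T \o U).
Proof.
move=> [T' [z [h ->]]] [U' [w [h' ->]]]; exists (T' \o U'), (T' w).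
by split; [exact: (symb_comp h h')|rewrite transport_comp].
Qed.

(** A vector x fixed by the involution is half of y plus its conjugate for y = x, so sums of this
    shape suffice. For a real letter h, S (x) h plus its conjugate is B (x) h with B = S + S^*
    selfadjoint, and there the Gaussian operator is B (x) G_0(h). *)
Lemma represented_gaussian x : Ht0 x -> represented (@gaussian R D x).
Proof.
have r0 : represented 0.
  by exists 0, 0; split; [exact: symb0|apply/funext => z; rewrite /transport [LHS]/(0 : FK) -[LHS](linear_lf0 (@ident_inv_linear R H))].
have rD T U : represented T -> represented U -> represented (T + U).
  by move=> h h'; have := represented_lin 1 h h'; rewrite scale1r.
have inv0 : ht_conj 0 = 0.
  by have := ht_conj_antilinear (-1) 0 0; rewrite scaler0 addr0 rmorphN1 scaleN1r addNr.
have invD y y' : ht_conj (y + y') = ht_conj y + ht_conj y'.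
  by have := ht_conj_antilinear 1 y y'; rewrite conjc1 !scale1r.
have rtens (S : K) h : represented (@gaussian R D (tens S (to_complex h) + ht_conj (tens S (to_complex h)))).
  rewrite ht_conjE cconj_real -(linear_lfD (tens_linl _)).
  set B := S + opadj S; have sB : opadj B = B.
    have := @opadj_linear R 1 S (opadj S); rewrite conjc1 !scale1r opadjK /B => ->; exact: addrC.
  exists (amp B (G0 h)), (tens B (G0 h vac1)); rewrite gaussian_tens //; split=> //.
  exact/symb_tens/galg_var.
have rsum y : represented (@gaussian R D (y + ht_conj y)).
  have [s ->] := tensorE y; elim: s => [|[S e] s IH].
    rewrite big_nil inv0 addr0; have := r0; congr represented.
    apply/funext => z; have := gaussianD 0 0; rewrite addr0 => /(congr1 (fun f => f z)).
    by rewrite fctE -[X in X = _]addr0 => /addrI.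
  rewrite big_cons invD addrACA gaussianD; apply: (rD _ _ _ IH) => /=.
  (* The imaginary unit is moved into the coefficient, so that only real letters remain. *)
  rewrite [e]complex_decomposition (tens_linr S) -(linear_lfZ (tens_linl _)) invD addrACA gaussianD.
  exact: (rD _ _ (rtens _ _) (rtens _ _)).
rewrite /Ht0 /= => ex; have := rsum x; rewrite /ht_conj ex gaussianD => h.
have := represented_lin (2^-1) h r0; congr represented.
apply/funext => z; rewrite !fctE addr0; set y := gaussian (D := D) x z.
by rewrite -mulr2n -[y *+ 2]scaler_nat scalerA mulVf ?scale1r.
Qed.

Lemma polyG_represented T : polyG T -> represented T.
Proof.
elim=> {T} [S|x|a T U _ h _ h'|T U _ h _ h'].
- exists (amp S id), (tens S vac1); rewrite transport_lact; split=> //.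
  exact: (symb_tens S galg_one).
- exact: represented_gaussian.
- exact: represented_lin.
- exact: represented_comp.
Qed.

(** Only selfadjoint coefficients give Gaussian operators directly, so S is split into selfadjoint
    parts B1 and B2. A product of operators needs a coefficient for each factor, which [factor]
    supplies. *)
Lemma polyG_transport_amp g S : galg g -> polyG (transport (amp S g)).
Proof.
move=> gg; elim: gg S => {g} [|h|a g h gg IH hh IH'|g h gg IH hh IH'] S.
- by rewrite transport_lact; exact: polyG_coef.
- have sa B : opadj B = B -> polyG (transport (amp B (G0 h))).
    move=> sB; rewrite -gaussian_tens //; apply: polyG_var.
    by rewrite /Ht0 /= -/(ht_conj _) ht_conjE sB cconj_real.
  have adjD (A B : K) : opadj (A + B) = opadj A + opadj B.
    by have := @opadj_linear R 1 A B; rewrite conjc1 !scale1r.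
  have adj0 : opadj 0 = 0 :> K.
    by have := @opadj_linear R (-1) 0 0; rewrite scaler0 addr0 rmorphN1 scaleN1r addNr.
  have adjZ a (A : K) : opadj (a *: A) = a^* *: opadj A.
    by have := @opadj_linear R a A 0; rewrite adj0 !addr0.
  have i2 : ('i%C : C) * 'i%C = -1 by exact: sqr_i.
  have ic : ('i%C : C)^* = - 'i%C by exact: conjCi.
  set B1 := S + opadj S; set B2 := 'i%C *: (opadj S - S).
  have s1 : opadj B1 = B1 by rewrite adjD opadjK addrC.
  have s2 : opadj B2 = B2.
    by rewrite adjZ adjD -scaleN1r adjZ rmorphN1 scaleN1r opadjK ic scaleNr -scalerN opprB.
  (* S = B1/2 + (i/2) B2; the last summand 0 gives both steps the shape of [polyG_lin]. *)
  have -> : amp S (G0 h) = (2^-1 : C) *: amp B1 (G0 h) + ((2^-1 * 'i%C) *: amp B2 (G0 h) + 0).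
    apply/funext => z; rewrite !fctE addr0.
    have al := amp_linear_coef (@G0_linear R H h) z.
    rewrite -!(linear_lfZ al) -(linear_lfD al); congr (amp _ _ z).
    rewrite /B1 /B2 scalerA -mulrA i2 mulrN1 scaleNr -scalerN opprB -scalerDr.
    rewrite addrACA subrr addr0 -mulr2n -[S *+ 2]scaler_nat scalerA mulVf ?scale1r //.
  rewrite !transport_comb; apply: polyG_lin; first exact: sa.
  apply: polyG_lin; first exact: sa.
  have := polyG_lin (-1) (polyG_coef H 0) (polyG_coef H 0).
  rewrite scaleN1r addNr; congr polyG; apply/funext => z.
  by rewrite /transport [LHS]/(0 : FK) -[LHS](linear_lf0 (@ident_inv_linear R H)).
- have -> : amp S (a *: g + h) = a *: amp S g + amp S h.
    by apply/funext => z; rewrite amp_comb //; exact: galg_linear.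
  by rewrite transport_comb; exact: polyG_lin (IH S) (IH' S).
- rewrite {1}(factorE S).
  have -> : amp (opmul (factor S).1 (factor S).2) (g \o h) = amp (factor S).1 g \o amp (factor S).2 h.
    by apply/funext => z; rewrite /= amp_comp //; exact: galg_linear.
  by rewrite transport_comp; exact: polyG_mul.
Qed.

Lemma polyG_transport T z : symb T z -> polyG (transport T).
Proof.
elim=> {T z} [S g|a T T' z z' _ h _ h']; first exact: polyG_transport_amp.
by rewrite transport_comb; exact: polyG_lin.
Qed.

Lemma opmul_cancell (A B : K) : (forall S, opmul S A = opmul S B) -> A = B.
Proof.
move=> h; apply: (can_inj (@opadjK R)); apply: opmul_cancelr => S.
by rewrite -[S]opadjK -!opadj_mul h.
Qed.

(** The transport of the adjoint of T' shows that an adjoint exists. Whichever one [fock_adj]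
    selects, its defining relation gives T^* T (c Omega) the vacuum component [kdot z z] c, and
    [opmul_cancelr] identifies the coefficient. *)
Lemma normBE (T : frakB H) T' z : symb T' z -> frakB_val T = transport T' -> normB T = knorm sdot z.
Proof.
move=> h eT; rewrite /normB /knorm; congr (Num.sqrt (opnorm _)).
have fd := @fock_dot_ident R H; have laws := compact_laws H.
have [U [w [hU eU]]] := symb_adj h.
have ex : exists S : FK -> FK, forall x y, fock_dot (D := D) (S x) y = fock_dot x (T y).
  exists (transport U) => x y; rewrite eT !fd /transport !ident_invK.
  by rewrite (kform_herm slin sherm) -eU -(kform_herm slin sherm).
have hS := xgetPex 0 ex; rewrite -/(fock_adj T) in hS.
have hT c : ident (T (vac (D := D) c)) = ramp c z.
  by rewrite eT /transport ident_invK ident_vac (symb_vac _ h).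
have hb c : vac_component (fock_adj T (T (vac (D := D) c))) = opmul (kdot z z) c.
  apply: opmul_cancell => d; rewrite -[d]opadjK.
  have := fock_dot_vac laws (opadj d) (fock_adj T (T (vac (D := D) c))) => /= <-.
  rewrite (fock_dot_herm laws) hS fd !hT (kform_rampl slin sherm) (kform_rampr slin sherm).
  change (opadj (opmul (opadj c) (opmul (kdot z z) (opadj d))) = opmul (opadj (opadj d)) (opmul (kdot z z) c)).
  by rewrite !opadj_mul !opadjK -(kform_herm slin sherm) opmulA.
have hv := xgetPex 0 (ex_intro (fun b => forall c, vac_component (fock_adj T (T (vac (D := D) c))) = opmul b c) _ hb).
by apply: opmul_cancelr => c; rewrite -hb; exact: (esym (hv c)).
Qed.
End GaussianAlgebra.

(** The values c = 1 and c = i give the sums p + p' and the differences p - p'. *)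
Lemma polarize (R : realType) (s s' p p' q q' : R[i]) : s = s' ->
  (forall c : R[i], c^* * c * s + c * p + c^* * p' + 1 = c^* * c * s' + c * q + c^* * q' + 1) -> p = q.
Proof.
move=> <- key; have e1 := key 1; have e2 := key 'i%C.
have ic : ('i%C : R[i])^* = - 'i%C by exact: conjCi.
have i0 : ('i%C : R[i]) != 0 by exact: neq0Ci.
rewrite conjc1 !mul1r in e1; rewrite ic in e2.
have f1 : p + p' = q + q' by move/addIr: e1; rewrite -!addrA => /addrI.
have f2 : p - p' = q - q'.
  apply: (mulfI i0); move/addIr: e2; rewrite -!addrA => /addrI; rewrite !mulNr !mulrBr.
  by [].
have two : (2 : R[i]) != 0 by rewrite pnatr_eq0.
apply: (mulfI two); rewrite !mulr_natl !mulr2n.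
have -> : p + p = (p + p') + (p - p') by ring.
by rewrite f1 f2; ring.
Qed.

(** * Polynomials represented by Gaussian operators, and the Wick formula recovered from an
    isometric extension *)

Section Realization.
Variables (R : realType) (A : starProbSpace R) (V : set A) (H : realHilbert R) (eta : A -> H).
Local Notation C := R[i].
Local Notation K := (compacts R).
Local Notation F := (fock (scalar_data H)).
Local Notation TF := (tensor K F).
Local Notation D := (compact_data H).
Local Notation vac1 := (@vac R (scalar_data H) 1).
Local Notation sdot := (fun z w : F => @fock_dot R (scalar_data H) z w : C).
Local Notation kdot := (kform sdot).
Local Notation slin := (@sdot_linear R H).
Local Notation sherm := (@sdot_herm R H).
Local Notation gpoly := (gpoly V eta).
Local Notation rep := (rep V eta).
Hypothesis Vsa : forall v, V v -> star v = v.

Lemma gpoly_galg x g : gpoly x g -> galg g.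
Proof.
by elim=> {x g} *; [exact: galg_one|exact: galg_var|exact: galg_lin|exact: galg_mul].
Qed.

(** [rep] together with the symbol of the operator, which carries inner products and norms. *)
Inductive rep_symb : KA A -> (TF -> TF) -> TF -> Prop :=
| rep_symb_tens S x g : gpoly x g -> rep_symb (tens S x) (amp S g) (tens S (g vac1))
| rep_symb_lin a X Y T T' z z' : rep_symb X T z -> rep_symb Y T' z' ->
    rep_symb (a *: X + Y) (a *: T + T') (a *: z + z').

Lemma rep_rep_symb X T : rep X T -> exists z, rep_symb X T z.
Proof.
elim=> {X T} [S x g gx|a X Y T T' _ [z hz] _ [z' hz']].
  by exists (tens S (g vac1)); exact: rep_symb_tens.
by exists (a *: z + z'); exact: rep_symb_lin.
Qed.

Lemma rep_symb_symb X T z : rep_symb X T z -> symb T z.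
Proof.
elim=> {X T z} [S x g /gpoly_galg gx|a X Y T T' z z' _ h _ h']; first exact: symb_tens.
exact: symb_lin.
Qed.

Section FromWick.
Hypothesis W : wick V eta.

Lemma gpoly_inner x y g h : gpoly x g -> gpoly y h -> phi (star x * y) = sdot (g vac1) (h vac1).
Proof.
move=> gx hy; have [g' gx' eg] := gpoly_star Vsa gx.
by rewrite (W (gpoly_mul gx' hy)); exact: etrans (esym (sdot_vac _)) (esym (eg _ _)).
Qed.

Lemma rep_inner X Y T U z w : rep_symb X T z -> rep_symb Y U w ->
  ka_phi (ka_mul (ka_star X) Y) = kdot z w.
Proof.
move=> h; elim: h Y U w => {X T z} [S x g gx|a X X' T T' z z' _ IH _ IH'] Y U w hY; last first.
  rewrite ka_star_antilinear ka_mul_linearl ka_phi_linear (kform_antilinear slin sherm).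
  by rewrite (IH _ _ _ hY) (IH' _ _ _ hY).
elim: hY => {Y U w} [S' y h hy|a Y Y' U U' w w' _ IH _ IH'].
  by rewrite ka_starE ka_mulE ka_phiE (kformE slin sherm) (gpoly_inner gx hy).
by rewrite ka_mul_linearr ka_phi_linear (kform_linear slin sherm) IH IH'.
Qed.

Lemma ka_mul0 X : ka_mul X (0 : KA A) = 0.
Proof. exact: linear_lf0 (@ka_mul_linearr R A X). Qed.

(** Right Gaussian operators act on the K (x) F factor F alone and commute with every G_0. *)
Lemma rep_commutant X T h S f : rep X T ->
  T (tens S (rgaussian h f)) = tens_ext (fun S f => tens S (rgaussian h f)) (T (tens S f)).
Proof.
have hl f' : linear (fun S : K => tens S (rgaussian h f')) by exact: tens_linl.
have hr (S' : K) : linear (fun f => tens S' (rgaussian h f)).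
  exact: linear_comp (tens_linr S') (@rgaussian_linear R H h).
elim=> {X T} [S' x g gx|a X Y T T' _ eT _ eT']; last by rewrite !fctE eT eT' (tens_ext_linear hl hr).
rewrite !(ampE (gpoly_linear gx)) (tens_extE hl hr).
by rewrite (galg_rgaussian h f (gpoly_galg gx)).
Qed.

(** The symbol of T has inner product 0 with itself by [rep_inner], so it vanishes and T kills every
    S Omega. Commuting with the right Gaussian operators, T then kills all of S (x) F(H_C) by
    [rgaussian_cyclic]. *)
Lemma rep_eq0 T : rep 0 T -> T = 0.
Proof.
move=> h; have [z hz] := rep_rep_symb h.
have z0 : z = 0.
  apply: (kform_definite slin sherm (@sdot_psd R H)); first exact: sdot_definite.
  by rewrite -(rep_inner hz hz) ka_mul0 (linear_lf0 (@ka_phi_linear R A)).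
have lT := rep_linear h; apply/funext => y; move: y; apply: tensor_ind => [a x y ex ey|S].
  by rewrite lT ex ey [RHS]/(0 : TF) [(0 : TF -> TF) x]/(0 : TF) [(0 : TF -> TF) y]/(0 : TF) scaler0 addr0.
apply: rgaussian_cyclic => [a f g ef eg||h' f ef].
- by rewrite (tens_linr S) lT ef eg [RHS]/(0 : TF) [(0 : TF -> TF) _]/(0 : TF) scaler0 add0r.
- by rewrite (symb_vac S (rep_symb_symb hz)) z0 (linear_lf0 (ramp_linear S)).
- rewrite (rep_commutant h' S f h) ef.
  have hl f' : linear (fun S : K => tens S (rgaussian h' f')) by exact: tens_linl.
  have hr (S' : K) : linear (fun f => tens S' (rgaussian h' f)).
    exact: linear_comp (tens_linr S') (@rgaussian_linear R H h').
  exact: (linear_lf0 (tens_ext_linear hl hr)).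
Qed.

Lemma rep_unique X T T' : rep X T -> rep X T' -> T = T'.
Proof.
move=> h h'; have := rep_eq0 (T := -1 *: T + T').
have e : -1 *: X + X = 0 by rewrite scaleN1r addNr.
rewrite -{1}e => /(_ (rep_lin _ h h')) /eqP; rewrite scaleN1r addrC subr_eq0 => /eqP -> //.
Qed.

Lemma polyKV_rep X : polyKV V X -> exists T, rep X T.
Proof.
elim=> {X} [S|X [s [Vs ->]]|a X Y _ [T h] _ [T' h']|X Y _ [T h] _ [T' h']].
- by exists (amp S id); exact/rep_tens/gpoly_one.
- elim: s Vs => [|p s IH] Vs; first by exists 0; rewrite big_nil; exact: rep0.
  have [|T hT] := IH; first by move=> q qs; apply: Vs; rewrite inE qs orbT.
  exists (amp p.1 (G0 (eta p.2)) + T); rewrite big_cons; apply: repD => //.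
  by apply/rep_tens/gpoly_var/Vs; rewrite inE eqxx.
- by exists (a *: T + T'); exact: rep_lin.
- by exists (T \o T'); exact: rep_mul.
Qed.

Definition repr_op (x : frakA V) : TF -> TF := projT1 (cid (polyKV_rep (asboolW (frakAP x)))).

Lemma repr_opP x : rep (frakA_val x) (repr_op x).
Proof. by rewrite /repr_op; case: cid. Qed.

Lemma repr_op_polyG x : polyG (transport (repr_op x)).
Proof. by have [z /rep_symb_symb h] := rep_rep_symb (repr_opP x); exact: polyG_transport h. Qed.

Definition repr_fun (x : frakA V) : frakB H := FrakB (asboolT (repr_op_polyG x)).

Lemma repr_fun_linear : linear repr_fun.
Proof.
move=> a x y; apply: val_inj; rewrite /= -[RHS]/(a *: transport (repr_op x) + transport (repr_op y)).
rewrite -transport_comb; congr transport; apply: rep_unique (repr_opP _) _.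
exact: rep_lin (repr_opP x) (repr_opP y).
Qed.

Definition repr : {linear frakA V -> frakB H} := mk_linear repr_fun_linear.

Lemma reprE x : frakB_val (repr x) = transport (repr_op x). Proof. by []. Qed.

Lemma repr_extends : extends_psi (fun a => G0 (eta a)) repr.
Proof.
split=> [x y|S|x S v Vv ex].
- rewrite !reprE -transport_comp; congr transport; apply: rep_unique (repr_opP _) _.
  exact: rep_mul (repr_opP x) (repr_opP y).
- rewrite reprE -transport_lact; congr transport; apply: rep_unique (repr_opP _) _.
  exact/rep_tens/gpoly_one.
- move=> z; rewrite reprE /transport ident_invK.
  rewrite (rep_unique (repr_opP x) (T' := amp S (G0 (eta v)))) //.
  by rewrite ex; exact/rep_tens/gpoly_var.
Qed.

Lemma repr_norm x : normB (repr x) = normA x.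
Proof.
have [z hz] := rep_rep_symb (repr_opP x).
rewrite (normBE (rep_symb_symb hz) (reprE x)) /knorm /normA; congr (Num.sqrt (opnorm _)).
by rewrite (rep_inner hz hz).
Qed.
End FromWick.

Section Isometry.
Hypothesis gram : forall v w, V v -> V w -> phi (v * w) = (hdot (eta v) (eta w))%:C%C.

(** The defect of linearity has inner product 0 with every [eta w]; it is a combination of such
    vectors, hence orthogonal to itself. *)
Lemma eta_linear (r : R) a b : real_subspace V -> V a -> V b ->
  eta (r%:C%C *: a + b) = r *: eta a + eta b.
Proof.
move=> [_ Vsub] Va Vb; set c := r%:C%C *: a + b; have Vc : V c by exact: Vsub.
set d := eta c - (r *: eta a + eta b).
have gr v w : V v -> V w -> hdot (eta v) (eta w) = complex.Re (phi (v * w)) by move=> Vv Vw; rewrite gram.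
have h w : V w -> hdot d (eta w) = 0.
  move=> Vw; rewrite /d !hdotE !gr //.
  have -> : (phi (c * w) : C) = r%:C%C * (phi (a * w) : C) + (phi (b * w) : C).
    by rewrite mulrDl -scalerAl; exact: linearP.
  have Re_comb (x y : C) : complex.Re (r%:C%C * x + y) = r * complex.Re x + complex.Re y.
    by case: x y => [x1 x2] [y1 y2] /=; rewrite mul0r subr0.
  by apply/eqP; rewrite subr_eq0; exact/eqP/Re_comb.
have d0 : hdot d d = 0.
  rewrite {2}/d hdotDr h // hdotNr hdotDr hdotZr !h //; ring.
apply/eqP; rewrite -subr_eq0 -normr_eq0 -sqrf_eq0 -hdot_norm; exact/eqP.
Qed.

Lemma eta_isometry : real_subspace V -> isometry_on_V V (fun a => G0 (eta a)).
Proof.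
move=> Vsub; split=> [r a b Va Vb|a _|a b Va Vb].
- by apply/funext => z; rewrite eta_linear // G0_comb.
- by exists (eta a).
- by rewrite sdot_G0_vac gram.
Qed.
End Isometry.

Section Extension.
Variables (psi : A -> F -> F) (Psi : {linear frakA V -> frakB H}).
Hypothesis psiV : forall v, V v -> psi v = G0 (eta v).
Hypothesis ext : extends_psi psi Psi.

(** The conditions on Psi determine it on every polynomial. For S (x) (x y) the coefficient is
    factored, S = S_1 S_2, so that the element is the product of S_1 (x) x and S_2 (x) y. *)
Lemma rep_extends X T : rep X T ->
  exists a : frakA V, frakA_val a = X /\ forall z, ident (Psi a z) = T (ident z).
Proof.
have [Pmul Pcoef Pvar] := ext.
have lin a X' Y (T' U : TF -> TF) (x y : frakA V) : frakA_val x = X' -> frakA_val y = Y ->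
    (forall z, ident (Psi x z) = T' (ident z)) -> (forall z, ident (Psi y z) = U (ident z)) ->
    frakA_val (a *: x + y) = a *: X' + Y /\
    forall z, ident (Psi (a *: x + y) z) = (a *: T' + U) (ident z).
  move=> <- <- eT eU; split=> // z.
  have -> : frakB_val (Psi (a *: x + y)) = a *: frakB_val (Psi x) + frakB_val (Psi y) by rewrite linearP.
  by rewrite !fctE ident_linear eT eU.
elim=> {X T} [S x g gx|a X Y T T' _ [x [ex hx]] _ [y [ey hy]]]; last first.
  by exists (a *: x + y); exact: lin.
elim: gx S => {x g} [|v Vv|a x y g h gx IH hy IH'|x y g h gx IH hy IH'] S.
- by exists (frakA_coef V S); split=> // z; rewrite Pcoef ident_lact.
- have hv : polyKV V (tens S v).
    apply: polyKV_var; exists [:: (S, v)]; split; last by rewrite big_seq1.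
    by move=> p; rewrite inE => /eqP ->.
  exists (FrakA (asboolT hv)); split=> // z.
  by rewrite (Pvar _ S v) // psiV.
- have [u [eu hu]] := IH S; have [w [ew hw]] := IH' S.
  exists (a *: u + w); have [e1 e2] := lin a _ _ _ _ _ _ eu ew hu hw; split.
    by rewrite e1 (tens_linr S).
  by move=> z; rewrite e2 amp_comb //; [exact: gpoly_linear gx|exact: gpoly_linear hy].
- have [u [eu hu]] := IH (factor S).1; have [w [ew hw]] := IH' (factor S).2.
  exists (frakA_mul u w); split.
    have -> : frakA_val (frakA_mul u w) = ka_mul (frakA_val u) (frakA_val w) by [].
    by rewrite eu ew; rewrite [LHS](ka_mulE (factor S).1 (factor S).2 x y) -factorE.
  move=> z; rewrite Pmul /= hu hw amp_comp -?factorE //.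
  + exact: gpoly_linear gx.
  + exact: gpoly_linear hy.
Qed.

Hypothesis norms : forall x, normA x = normB (Psi x).

Lemma extension_inner x g : gpoly x g -> phi (star x * x) = sdot (g vac1) (g vac1).
Proof.
move=> gx; have [a [ea ha]] := rep_extends (rep_tens (matrix_unit R 0 0) gx).
have eP : frakB_val (Psi a) = transport (amp (matrix_unit R 0 0) g).
  by apply/funext => z; rewrite /transport -ha identK.
have := norms a; rewrite (normBE (symb_tens _ (gpoly_galg gx)) eP) /knorm /normA.
rewrite ea ka_starE ka_mulE ka_phiE (kformE slin sherm) matrix_unit_adj matrix_unit_mul !opnorm_matrix_unit.
move=> /(congr1 (fun t => t ^+ 2)); rewrite !sqr_sqrtr ?normc_ge0 // => e.
have := phi_ge0 x; have := @sdot_ge0 R H (g vac1).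
move=> /ger0_norm <- /ger0_norm <-; rewrite -!normcE; congr (_%:C%C); exact: e.
Qed.

Lemma wick_of_extension : wick V eta.
Proof.
move=> x g gx; rewrite -sdot_vac.
(* The isometry is used on c x + 1 for every c; the term linear in c isolates phi x. *)
have key (c : C) := extension_inner (gpoly_lin c gx (gpoly_one V eta)).
have phiE (c : C) : (phi (star (c *: x + 1) * (c *: x + 1)) : C) =
    c^* * c * (phi (star x * x) : C) + c * (phi x : C) + c^* * (phi (star x) : C) + 1.
  have -> : star (c *: x + 1) * (c *: x + 1) = c^* *: (c *: (star x * x)) + c^* *: star x + (c *: x + 1).
    by rewrite star_antilinear star1 mulrDl !mulrDr !mul1r !mulr1 -!scalerAl -!scalerAr.
  have phiD (u v : A) : (phi (u + v) : C) = (phi u : C) + (phi v : C) by exact: linearD.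
  have phiZ b (u : A) : (phi (b *: u) : C) = b * (phi u : C) by exact: linearZ.
  by rewrite !phiD !phiZ phi1; ring.
have sdotE (c : C) : sdot ((c *: g + id) vac1) ((c *: g + id) vac1) =
    c^* * c * sdot (g vac1) (g vac1) + c * sdot vac1 (g vac1) + c^* * sdot (g vac1) vac1 + 1.
  rewrite !fctE sdot_antilinear !sdot_linear (sdot_vac vac1) vac_component_vac.
  have alg (d e s q q' : C) : e * (d * s + q') + (d * q + 1) = e * d * s + d * q + e * q' + 1 by ring.
  exact: alg.
exact: (polarize (extension_inner gx) (fun c => etrans (esym (phiE c)) (etrans (key c) (sdotE c)))).
Qed.
End Extension.
End Realization.

(** A common interface of R and R[i]: norms of a normed module take values in its field, and [emb]
    and [nrm] translate them to real numbers. *)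
Record valued (R : realType) := Valued {
  vfield :> numFieldType;
  emb : R -> vfield;
  nrm : vfield -> R;
  normE : forall x, `|x| = emb (nrm x);
  embD : forall a b, emb (a + b) = emb a + emb b;
  embM : forall a b, emb (a * b) = emb a * emb b;
  emb_le : forall a b, (emb a <= emb b) = (a <= b);
  nrm_complete : forall u : nat -> vfield,
    (forall e, 0 < e -> exists N, forall m n, (N <= m)%N -> (N <= n)%N -> nrm (u m - u n) <= e) ->
    exists l, forall e, 0 < e -> exists N, forall n, (N <= n)%N -> nrm (u n - l) <= e }.

(** * Completions *)

Section ValuedTheory.
Variables (R : realType) (K : valued R).

Lemma emb0 : emb K 0 = 0.
Proof. by have /eqP := embD K 0 0; rewrite addr0 -[X in X == _]addr0 (inj_eq (addrI _)) => /eqP. Qed.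

Lemma nrm_ge0 (x : K) : 0 <= nrm x.
Proof. by rewrite -(emb_le K) emb0 -normE. Qed.

Lemma nrmD (x y : K) : nrm (x + y) <= nrm x + nrm y.
Proof. by rewrite -(emb_le K) embD -!normE ler_normD. Qed.

Lemma emb_inj : injective (emb K).
Proof. by move=> a b e; apply: le_anti; rewrite -!(emb_le K) e lexx. Qed.

Lemma nrmM (x y : K) : nrm (x * y) = nrm x * nrm y.
Proof. by apply: emb_inj; rewrite embM -!normE normrM. Qed.

Lemma nrmN (x : K) : nrm (- x) = nrm x.
Proof. by apply: emb_inj; rewrite -!normE normrN. Qed.

Lemma nrm0 : nrm (0 : K) = 0.
Proof. by apply: emb_inj; rewrite -normE normr0 emb0. Qed.

Lemma nrm_eq0 (x : K) : nrm x = 0 -> x = 0.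
Proof. by move=> h; apply/eqP; rewrite -normr_eq0 normE h emb0. Qed.

Lemma nrm1 : nrm (1 : K) = 1.
Proof.
have n1 : nrm (1 : K) != 0 by apply/eqP => /nrm_eq0/eqP; rewrite oner_eq0.
by apply: (mulIf n1); rewrite -nrmM !mul1r.
Qed.

Lemma nrm_dist (x y z : K) : nrm (x - z) <= nrm (x - y) + nrm (y - z).
Proof. by apply: le_trans (nrmD _ _); rewrite addrA subrK. Qed.

Lemma nrmC (x y : K) : nrm (x - y) = nrm (y - x).
Proof. by rewrite -opprB nrmN. Qed.
End ValuedTheory.

(** A linear space of bounded functions. A seminormed space takes this form through a norming set of
    functionals, and its completion is then the uniform closure. *)
Record family (R : realType) (K : valued R) := Family {
  index : Type;
  member : set (index -> K);
  member0 : member (fun=> 0);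
  member_comb : forall a f g, member f -> member g -> member (fun i => a * f i + g i);
  member_bounded : forall f, member f -> exists M, forall i, nrm (f i) <= M }.

Arguments member {R K} _ _.
Section UniformClosure.
Variables (R : realType) (K : valued R) (B : family K).
Local Notation I := (index B).

Definition approximable : {pred (I -> (K : numFieldType)^o)} := fun f =>
  `[< forall e : R, 0 < e -> exists g, member B g /\ forall i, nrm (f i - g i) <= e >].

Lemma approximable_submod : submod_closed approximable.
Proof.
split.
  apply/asboolP => e e0; exists (fun=> 0); split=> [|i]; first exact: member0.
  by rewrite subr0 [X in nrm X](_ : _ = 0) // nrm0 ltW.
move=> a f g /asboolP hf /asboolP hg; apply/asboolP => e e0.
have n0 : 0 < nrm a + 1 by rewrite ltr_wpDl ?nrm_ge0.
have [f' [mf ef]] := hf (e / 2 / (nrm a + 1)) (divr_gt0 (divr_gt0 e0 (ltr0Sn _ 1)) n0).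
have [g' [mg eg]] := hg (e / 2) (divr_gt0 e0 (ltr0Sn _ 1)).
exists (fun i => a * f' i + g' i); split=> [|i]; first exact: member_comb.
have -> : (a *: f + g) i - (a * f' i + g' i) = a * (f i - f' i) + (g i - g' i).
  by rewrite mulrBr addrACA -opprD.
apply: le_trans (nrmD _ _) _; rewrite nrmM [e]splitr; apply: lerD => //.
apply: le_trans (ler_wpM2l (nrm_ge0 a) (ef i)) _.
rewrite mulrCA ger_pMr ?divr_gt0 // ler_pdivrMr // mul1r lerDl //.
Qed.

HB.instance Definition _ := GRing.isSubmodClosed.Build K (I -> (K : numFieldType)^o)
  approximable approximable_submod.

Record uniform_closure := UniformClosure {
  uc_val :> I -> (K : numFieldType)^o; uc_valP : uc_val \in approximable }.
HB.instance Definition _ := [isSub for uc_val].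
HB.instance Definition _ := [Choice of uniform_closure by <:].
HB.instance Definition _ := [SubChoice_isSubLmodule of uniform_closure by <:].

Lemma uc_bounded (f : uniform_closure) : exists M, forall i, nrm (f i) <= M.
Proof.
have /asboolP/(_ 1 ltr01)[g [mg eg]] := uc_valP f; have [M hM] := member_bounded mg.
exists (1 + M) => i; rewrite -[f i](subrK (g i)); apply: le_trans (nrmD _ _) _.
exact: lerD.
Qed.

(** The number 0 is adjoined to keep the set inhabited when the index type is empty. *)
Definition supnrm (f : uniform_closure) : R := sup ([set 0] `|` range (fun i => nrm (f i))).

Lemma supnrm_has_sup (f : uniform_closure) : has_sup ([set 0] `|` range (fun i => nrm (f i))).
Proof.
split; first by exists 0; left.
have [M hM] := uc_bounded f; exists `|M| => _ [->|[i _ <-]] //.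
exact: le_trans (hM i) (ler_norm _).
Qed.

Lemma supnrm_ub (f : uniform_closure) i : nrm (f i) <= supnrm f.
Proof. by apply: sup_upper_bound (supnrm_has_sup f) _ _; right; exists i. Qed.

Lemma supnrm_ge0 f : 0 <= supnrm f.
Proof. by apply: sup_upper_bound (supnrm_has_sup f) _ _; left. Qed.

Lemma supnrm_le (f : uniform_closure) c : 0 <= c -> (forall i, nrm (f i) <= c) -> supnrm f <= c.
Proof.
move=> c0 hc; apply: ge_sup; first by exists 0; left.
by move=> _ [->|[i _ <-]].
Qed.

Lemma supnrmD f g : supnrm (f + g) <= supnrm f + supnrm g.
Proof.
apply: supnrm_le => [|i]; first by rewrite addr_ge0 ?supnrm_ge0.
apply: le_trans (nrmD (f i) (g i)) _; exact: lerD (supnrm_ub f i) (supnrm_ub g i).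
Qed.

Lemma supnrmZ a f : supnrm (a *: f) = nrm a * supnrm f.
Proof.
have le b h : supnrm (b *: h) <= nrm b * supnrm h.
  apply: supnrm_le => [|i]; first by rewrite mulr_ge0 ?nrm_ge0 ?supnrm_ge0.
  rewrite -[(b *: h) i]/(b * h i) nrmM; apply: ler_wpM2l; [exact: nrm_ge0|exact: supnrm_ub].
case: (eqVneq a 0) => [->|a0].
  rewrite nrm0 mul0r; apply/eqP; rewrite eq_le supnrm_ge0 andbT.
  by apply: le_trans (le _ _) _; rewrite nrm0 mul0r.
apply/eqP; rewrite eq_le le /=.
have h := le a^-1 (a *: f); rewrite scalerA mulVf // scale1r in h.
apply: le_trans (ler_wpM2l (nrm_ge0 a) h) _; rewrite mulrA -nrmM mulfV //.
by rewrite nrm1 mul1r.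
Qed.

Lemma supnrm_eq0 f : supnrm f = 0 -> f = 0.
Proof.
move=> f0; apply: val_inj; apply/funext => i; apply: nrm_eq0; apply/eqP; rewrite eq_le nrm_ge0 andbT.
by rewrite -f0 supnrm_ub.
Qed.

Lemma emb_supnrmD (f g : uniform_closure) :
  emb K (supnrm (f + g)) <= emb K (supnrm f) + emb K (supnrm g).
Proof. by rewrite -embD emb_le supnrmD. Qed.

Lemma emb_supnrmZ (a : K) (f : uniform_closure) :
  emb K (supnrm (a *: f)) = `|a| * emb K (supnrm f).
Proof. by rewrite supnrmZ embM normE. Qed.

Lemma emb_supnrm_eq0 (f : uniform_closure) : emb K (supnrm f) = 0 -> f = 0.
Proof. by rewrite -(emb0 K) => /emb_inj; exact: supnrm_eq0. Qed.

HB.instance Definition _ := Lmodule_isNormed.Build K uniform_closure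
  emb_supnrmD emb_supnrmZ emb_supnrm_eq0.

Lemma emb_lt a b : (emb K a < emb K b) = (a < b).
Proof. by rewrite !lt_def emb_le (inj_eq (@emb_inj _ K)). Qed.

Lemma uc_normE (f : uniform_closure) : `|f| = emb K (supnrm f). Proof. by []. Qed.

Lemma uc_ballE (f g : uniform_closure) e : ball f (emb K e) g = (supnrm (f - g) < e) :> Prop.
Proof. by rewrite -(emb_lt (supnrm (f - g)) e) -uc_normE -ball_normE. Qed.

Lemma inv_succ_lt (e : R) : 0 < e -> exists n : nat, n.+1%:R^-1 < e.
Proof.
move=> e0; exists (Num.truncn e^-1); rewrite invf_plt ?posrE //.
exact: truncnS_gt.
Qed.

(** The filter is followed along functions x_n whose balls of radius 1/(n+1) belong to it. Their
    pointwise limit is uniform, and it is approximable because each x_n is. *)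
Lemma uc_complete (F : set_system uniform_closure) : ProperFilter F -> cauchy F -> cvg F.
Proof.
move=> PF /cauchyP cF.
have d0 n : (0 : R) < n.+1%:R^-1 by rewrite invr_gt0.
have /choice[x hx] n : exists x, F (ball x (emb K n.+1%:R^-1)).
  by apply: cF; rewrite -(emb0 K) emb_lt.
have xx m n : supnrm (x m - x n) <= m.+1%:R^-1 + n.+1%:R^-1.
  have [y [ym yn]] := filter_ex (filterI (hx m) (hx n)).
  rewrite uc_ballE in ym; rewrite uc_ballE in yn.
  have -> : x m - x n = (x m - y) + (- 1 *: (x n - y)) by rewrite scaleN1r opprB addrA subrK.
  apply: le_trans (supnrmD _ _) _; apply: lerD; first exact: ltW.
  by rewrite supnrmZ nrmN -[nrm 1 * _]supnrmZ scale1r ltW.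
have cau i e : 0 < e -> exists N, forall m n, (N <= m)%N -> (N <= n)%N -> nrm (x m i - x n i) <= e.
  move=> e0; have [N hN] := inv_succ_lt (divr_gt0 e0 (ltr0Sn _ 1)).
  have dN m : (N <= m)%N -> m.+1%:R^-1 <= e / 2.
    by move=> Nm; apply: le_trans (ltW hN); rewrite lef_pV2 ?posrE // ler_nat.
  exists N => m n Nm Nn; apply: le_trans (supnrm_ub (x m - x n) i) _.
  by apply: le_trans (xx m n) _; rewrite [e]splitr; apply: lerD; exact: dN.
have /choice[f hf] i := nrm_complete (cau i).
have xf n i : nrm (x n i - f i) <= n.+1%:R^-1.
  apply/ler_addgt0Pr => e e0; have [N hN] := hf i (e / 2) (divr_gt0 e0 (ltr0Sn _ 1)).
  have [M hM] := inv_succ_lt (divr_gt0 e0 (ltr0Sn _ 1)).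
  set m := maxn N M; apply: le_trans (nrm_dist _ (x m i) _) _.
  have h1 : nrm (x n i - x m i) <= n.+1%:R^-1 + e / 2.
    apply: le_trans (supnrm_ub (x n - x m) i) _; apply: le_trans (xx n m) _; rewrite lerD2l.
    by apply: le_trans (ltW hM); rewrite lef_pV2 ?posrE // ler_nat ltnS leq_maxr.
  have h2 := hN m (leq_maxl _ _).
  by apply: le_trans (lerD h1 h2) _; rewrite -addrA -splitr.
have fa : f \in approximable.
  apply/asboolP => e e0; have [n hn] := inv_succ_lt (divr_gt0 e0 (ltr0Sn _ 1)).
  have /asboolP/(_ (e / 2) (divr_gt0 e0 (ltr0Sn _ 1)))[g [mg eg]] := uc_valP (x n).
  exists g; split=> // i; apply: le_trans (nrm_dist _ (x n i) _) _; rewrite [e]splitr.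
  by apply: lerD => //; rewrite nrmC; apply: le_trans (xf n i) (ltW _).
apply/cvg_ex; exists (UniformClosure fa); apply/cvgrPdist_lt => e e0.
have ee : e = emb K (nrm e) by rewrite -normE ger0_norm // ltW.
have e'0 : 0 < nrm e by rewrite -emb_lt emb0 -ee.
have [n hn] := inv_succ_lt (divr_gt0 e'0 (ltr0Sn _ 1)).
apply: filterS (hx n) => y; rewrite uc_ballE uc_normE ee emb_lt => ny.
have -> : UniformClosure fa - y = (UniformClosure fa - x n) + (x n - y) by rewrite addrA subrK.
apply: le_lt_trans (supnrmD _ _) _; rewrite [nrm e]splitr; apply: ler_ltD; last exact: lt_trans hn.
apply: supnrm_le => [|i]; first by rewrite divr_ge0 ?nrm_ge0.
have -> : (UniformClosure fa - x n) i = f i - x n i by [].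
by rewrite nrmC; apply: le_trans (xf n i) (ltW _).
Qed.

HB.instance Definition _ := Uniform_isComplete.Build uniform_closure uc_complete.

Lemma member_approximable f : member B f -> (f : I -> (K : numFieldType)^o) \in approximable.
Proof.
move=> mf; apply/asboolP => e e0; exists f; split=> // i.
by rewrite subrr nrm0 ltW.
Qed.

Definition uc_of (f : I -> K) (mf : member B f) : uniform_closure :=
  UniformClosure (member_approximable mf).

Lemma uc_dense (f : uniform_closure) e : 0 < e ->
  exists (g : I -> K) (mg : member B g), supnrm (f - uc_of mg) <= e.
Proof.
move=> e0; have /asboolP/(_ e e0)[g [mg eg]] := uc_valP f.
by exists g, mg; apply: supnrm_le => // ; exact: ltW.
Qed.
End UniformClosure.

Definition complete_uniform_closure (R : realType) (K : valued R) (B : family K) :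
  completeNormedModType K := uniform_closure B.

Section RealAndComplex.
Variable R : realType.

Lemma real_cauchy (u : nat -> R) :
  (forall e, 0 < e -> exists N, forall m n, (N <= m)%N -> (N <= n)%N -> `|u m - u n| <= e) ->
  exists l, forall e, 0 < e -> exists N, forall n, (N <= n)%N -> `|u n - l| <= e.
Proof.
move=> cu; have : cauchy (u @ \oo).
  apply/cauchyP => e e0; have [N hN] := cu (e / 2) (divr_gt0 e0 (ltr0Sn _ 1)).
  exists (u N), N => // n /= Nn; rewrite -ball_normE /ball_ /=.
  by apply: le_lt_trans (hN N n (leqnn N) Nn) _; rewrite ltr_pdivrMr // ltr_pMr // ltr1n.
move=> /cauchy_cvgP/cvg_ex[l /cvgrPdist_le ul]; exists l => e e0.
have [N _ hN] := ul e e0; exists N => n Nn; rewrite distrC; exact: hN.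
Qed.

Definition real_valued : valued R := @Valued R R id (fun x => `|x|)
  (fun _ => erefl) (fun _ _ => erefl) (fun _ _ => erefl) (fun _ _ => erefl) real_cauchy.

Lemma complex_cauchy (u : nat -> R[i]) :
  (forall e, 0 < e -> exists N, forall m n, (N <= m)%N -> (N <= n)%N -> normc (u m - u n) <= e) ->
  exists l : R[i], forall e, 0 < e -> exists N, forall n, (N <= n)%N -> normc (u n - l) <= e.
Proof.
move=> cu.
have reB (a b : R[i]) : complex.Re (a - b) = complex.Re a - complex.Re b by case: a b => [? ?] [? ?].
have imB (a b : R[i]) : complex.Im (a - b) = complex.Im a - complex.Im b by case: a b => [? ?] [? ?].
have [p hp] : exists l, forall e, 0 < e -> exists N, forall n, (N <= n)%N -> `|complex.Re (u n) - l| <= e.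
  apply: real_cauchy => e e0; have [N hN] := cu e e0; exists N => m n Nm Nn.
  by rewrite -reB; apply: le_trans (Re_le_normc _) (hN m n Nm Nn).
have [q hq] : exists l, forall e, 0 < e -> exists N, forall n, (N <= n)%N -> `|complex.Im (u n) - l| <= e.
  apply: real_cauchy => e e0; have [N hN] := cu e e0; exists N => m n Nm Nn.
  by rewrite -imB; apply: le_trans (Im_le_normc _) (hN m n Nm Nn).
exists (p +i* q)%C => e e0; have e2 : 0 < e / 2 by rewrite divr_gt0.
have [N hN] := hp _ e2; have [M hM] := hq _ e2; exists (maxn N M) => n.
rewrite geq_max => /andP[/hN h1 /hM h2].
have -> : u n - (p +i* q)%C = (complex.Re (u n) - p)%:C%C + 'i%C * (complex.Im (u n) - q)%:C%C.
  by case: (u n) => a b; apply/eqP; rewrite eq_complex /=; apply/andP; split; apply/eqP; ring.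
apply: le_trans (le_normcD _ _) _; rewrite [e]splitr normcM !normc_real; apply: lerD => //.
by rewrite (_ : normc 'i%C = 1) ?mul1r //= expr0n expr1n add0r sqrtr1.
Qed.

Lemma real_complexD (a b : R) : (a + b)%:C%C = a%:C%C + b%:C%C :> R[i].
Proof. exact: rmorphD. Qed.

Lemma real_complexM (a b : R) : (a * b)%:C%C = a%:C%C * b%:C%C :> R[i].
Proof. exact: rmorphM. Qed.

Lemma real_complex_le (a b : R) : (a%:C%C <= b%:C%C :> R[i]) = (a <= b).
Proof. exact: lecR. Qed.

Definition complex_valued : valued R := @Valued R R[i] (fun a => a%:C%C) (@normc R)
  (fun x => esym (normcE x)) real_complexD real_complexM real_complex_le complex_cauchy.
End RealAndComplex.

Section Density.
Variables (R : realType).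

Lemma dense_range (K : valued R) (M : normedModType K) (U : Type) (f : U -> M) :
  (forall x (e : R), 0 < e -> exists u, `|x - f u| <= emb K e) -> closure (range f) = setT.
Proof.
move=> h; apply/seteqP; split=> // x _ A /nbhs_ballP[e /= e0 eA].
have ee : e = emb K (nrm e) by rewrite -normE ger0_norm // ltW.
have e'0 : 0 < nrm e / 2 by rewrite divr_gt0 // -(emb_lt K) emb0 -ee.
have [u hu] := h x _ e'0; exists (f u); split; first by exists u.
apply: eA; rewrite -ball_normE /ball_ /=; apply: le_lt_trans hu _.
by rewrite [X in _ < X]ee emb_lt; move: e'0; move: (nrm e) => t; lra.
Qed.

Lemma range_dense (K : valued R) (M : normedModType K) (U : Type) (f : U -> M) x (e : R) :
  closure (range f) = setT -> 0 < e -> exists u, `|x - f u| <= emb K e.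
Proof.
move=> h e0; have e'0 : 0 < emb K e by rewrite -(emb0 K) emb_lt.
have cx : closure (range f) x by rewrite h.
have := cx; move=> /(_ (ball x (emb K e)) (nbhsx_ballx x _ e'0))[_ [[u _ <-]]].
by rewrite -ball_normE /ball_ /= => /ltW hu; exists u.
Qed.
End Density.

(** * Completion of a seminormed space through a norming family of functionals *)

Section SeminormCompletion.
Variables (R : realType) (U : lmodType R[i]) (p : U -> R) (I : Type) (f : U -> I -> R[i]).
Hypothesis fl : forall a u v i, f (a *: u + v) i = a * f u i + f v i.
Hypothesis p_ge0 : forall u, 0 <= p u.
Hypothesis fp : forall u i, normc (f u i) <= p u.
Hypothesis pf : forall u c, 0 <= c -> (forall i, normc (f u i) <= c) -> p u <= c.

Lemma seminorm_member0 : range f (fun=> 0).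
Proof.
exists 0 => //; apply/funext => i; have := fl (-1) 0 0 i.
by rewrite scaler0 addr0 mulN1r addNr.
Qed.

Lemma seminorm_member_comb a g h : range f g -> range f h -> range f (fun i => a * g i + h i).
Proof. by move=> [u _ <-] [v _ <-]; exists (a *: u + v) => //; apply/funext => i; rewrite fl. Qed.

Lemma seminorm_member_bounded g : range f g -> exists M, forall i, normc (g i) <= M.
Proof. by move=> [u _ <-]; exists (p u). Qed.

Definition seminorm_family : family (complex_valued R) :=
  @Family R (complex_valued R) I (range f) seminorm_member0 seminorm_member_comb seminorm_member_bounded.

Definition seminorm_space : completeNormedModType R[i] := complete_uniform_closure seminorm_family.

Lemma range_mem u : member seminorm_family (f u). Proof. by exists u. Qed.

Definition seminorm_fun (u : U) : seminorm_space := uc_of (range_mem u).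

Lemma seminorm_fun_linear : linear seminorm_fun.
Proof. by move=> a u v; apply: val_inj; apply/funext => i /=; rewrite fl. Qed.

Lemma seminorm_fun_norm u : `|seminorm_fun u| = (p u)%:C%C.
Proof.
rewrite [LHS](uc_normE (uc_of (range_mem u))); congr (_%:C%C).
apply/eqP; rewrite eq_le; apply/andP; split.
  by apply: supnrm_le => // i; exact: fp.
by apply: pf => [|i]; [exact: supnrm_ge0|exact: (supnrm_ub (uc_of (range_mem u)) i)].
Qed.

Lemma seminorm_fun_dense : closure (range (mk_linear seminorm_fun_linear)) = setT.
Proof.
apply: (@dense_range R (complex_valued R) seminorm_space) => x e e0.
have [g [[u ? ?] hg]] := uc_dense x e0; subst g.
exists u; rewrite [leLHS](uc_normE (x - uc_of (range_mem u))) emb_le.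
by apply: le_trans hg; rewrite (Prop_irrelevance (range_mem u) (ex_intro2 _ _ u _ _)).
Qed.

Definition seminorm_completion : completion p :=
  @Completion R U p seminorm_space (mk_linear seminorm_fun_linear) seminorm_fun_norm seminorm_fun_dense.
End SeminormCompletion.

(** * The space L^2 of the Fock bimodule *)

Section FockCompletion.
Variables (R : realType) (H : realHilbert R).
Local Notation C := R[i].
Local Notation K := (compacts R).
Local Notation F := (fock (scalar_data H)).
Local Notation TF := (tensor K F).
Local Notation sdot := (fun z w : F => @fock_dot R (scalar_data H) z w : C).
Local Notation slin := (@sdot_linear R H).
Local Notation sherm := (@sdot_herm R H).
Local Notation spsd := (@sdot_psd R H).

Lemma frakB_symb (T : frakB H) : exists z, exists2 T', symb T' z & frakB_val T = transport T'.
Proof. by have [T' [z [h e]]] := polyG_represented (asboolW (frakBP T)); exists z, T'. Qed.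

Definition symbol (T : frakB H) : TF := projT1 (cid (frakB_symb T)).

Lemma transport_inj : injective (@transport R H).
Proof.
move=> T T' e; apply/funext => z; have := congr1 (fun f => ident (f (ident_inv z))) e.
by rewrite /transport !ident_invK.
Qed.

Lemma symbolP T T' z : symb T' z -> frakB_val T = transport T' -> symbol T = z.
Proof.
rewrite /symbol; case: cid => w /= [U hU ->] hT /transport_inj eT.
by apply: symb_unique hU _; rewrite eT.
Qed.

Lemma symbol_linear : linear symbol.
Proof.
move=> a T U; have [z [T' hT eT]] := frakB_symb T; have [w [U' hU eU]] := frakB_symb U.
rewrite (symbolP hT eT) (symbolP hU eU); apply: symbolP (symb_lin a hT hU) _.
by rewrite transport_comb -eT -eU.
Qed.

Lemma normB_symbol T : normB T = knorm sdot (symbol T).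
Proof.
by have [z [T' hT eT]] := frakB_symb T; rewrite (normBE hT eT) (symbolP hT eT).
Qed.

(** The pair (x, z) indexes the functional <x, <z, T Omega> x>, with the symbol of T in the place of
    T Omega. *)
Definition fock_index : Type :=
  {p : l2 R * TF | l2norm p.1 <= 1 /\ form_norm (vector_form sdot p.1) p.2 <= 1}.

Definition fock_functional (T : frakB H) (i : fock_index) : C :=
  vector_form sdot (sval i).1 (sval i).2 (symbol T).

Lemma fock_functional_linear a T U i :
  fock_functional (a *: T + U) i = a * fock_functional T i + fock_functional U i.
Proof. by rewrite /fock_functional symbol_linear (vector_form_linear slin sherm). Qed.

Lemma fock_functional_le T i : normc (fock_functional T i) <= normB T.
Proof.
case: i => [[x z] [x1 z1]]; rewrite normB_symbol /fock_functional /= in x1 z1 *.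
apply: le_trans (form_cauchy_schwarz (vector_form_antilinear slin sherm x)
  (vector_form_linear slin sherm x) (vector_form_ge0 slin sherm spsd x) _ _) _.
have h := vnorm_le_knorm slin sherm spsd (symbol T) x1.
by apply: le_trans (ler_wpM2r (form_norm_ge0 _ _) z1) _; rewrite mul1r.
Qed.

(** For a given x the bound is reached by taking for z the symbol of T divided by its norm at x. *)
Lemma fock_functional_norming T c : 0 <= c ->
  (forall i, normc (fock_functional T i) <= c) -> normB T <= c.
Proof.
move=> c0 hc; rewrite normB_symbol; apply: (knorm_le slin sherm spsd) => // x x1.
have fl := vector_form_linear slin sherm x.
have fa := vector_form_antilinear slin sherm x.
have fp := vector_form_ge0 slin sherm spsd x.
set z := symbol T; set n := form_norm _ z.
have n0 : 0 <= n by exact: form_norm_ge0.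
case: (eqVneq n 0) => [->//|nz].
have w1 : form_norm (vector_form sdot x) ((n^-1)%:C%C *: z) <= 1.
  by rewrite (form_normZ fa fl fp) normc_real ger0_norm ?invr_ge0 // -/n mulVf.
have := hc (exist _ (x, (n^-1)%:C%C *: z) (conj x1 w1)).
rewrite -[fock_functional T _]/(vector_form sdot x ((n^-1)%:C%C *: z) z).
rewrite -[_ *: z]addr0 fa.
have -> : vector_form sdot x 0 z = 0.
  by have := fa z (-1) 0 0; rewrite scaler0 addr0 rmorphN1 mulN1r addNr.
rewrite addr0 (form_norm_sqr fp) -/n normcM normc_conj !normc_real ger0_norm ?invr_ge0 //.
by rewrite ger0_norm ?sqr_ge0 // expr2 mulrA mulVf // mul1r.
Qed.

Definition fock_completion : completion (@normB R H) :=
  seminorm_completion fock_functional_linear (fun T => sqrtr_ge0 _) fock_functional_le fock_functional_norming.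
End FockCompletion.

(** * Real Hilbert spaces with a given Gram matrix *)

Section NormedLimits.
Variables (R : realType) (M : normedModType R).

Lemma small_norm_eq0 (x : M) (c : R) : (forall e, 0 < e -> `|x| <= c * e) -> x = 0.
Proof.
move=> h; apply/eqP; rewrite -normr_eq0 eq_le normr_ge0 andbT.
apply/ler_addgt0Pr => e e0; rewrite add0r.
have c0 : 0 < `|c| + 1 by rewrite ltr_wpDl.
apply: le_trans (h (e / (`|c| + 1)) (divr_gt0 e0 c0)) _.
rewrite mulrCA ger_pMr // ler_pdivrMr // mul1r; apply: le_trans (ler_norm _) _.
by rewrite lerDl.
Qed.

Lemma cvg_of_inv_succ (x : nat -> M) (f : M) :
  (forall n, `|f - x n| <= n.+1%:R^-1) -> x @ \oo --> f.
Proof.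
move=> h; apply/cvgrPdist_le => e e0; have [N hN] := inv_succ_lt e0.
exists N => // n /= Nn; apply: le_trans (h n) (le_trans _ (ltW hN)).
by rewrite lef_pV2 ?posrE // ler_nat.
Qed.

Lemma dense_sequence (I : Type) (P : set I) (u : I -> M) (f : M) :
  (forall h e, 0 < e -> exists2 i, P i & `|h - u i| <= e) ->
  exists2 x : nat -> I, (forall n, P (x n)) & (fun n => u (x n)) @ \oo --> f.
Proof.
move=> du; have d0 n : (0 : R) < n.+1%:R^-1 by rewrite invr_gt0.
have /choice[x hx] n : exists i, P i /\ `|f - u i| <= n.+1%:R^-1.
  by have [i Pi hi] := du f _ (d0 n); exists i.
exists x => [n|]; first by have [] := hx n.
by apply: cvg_of_inv_succ => n; have [] := hx n.
Qed.
End NormedLimits.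

Section GramIsometry.
Variables (R : realType) (H H' : realHilbert R) (I : Type) (u : I -> H) (u' : I -> H').
Hypothesis gram : forall i j, hdot (u i) (u j) = hdot (u' i) (u' j).
Hypothesis du : forall h e, 0 < e -> exists i, `|h - u i| <= e.
Hypothesis du' : forall h e, 0 < e -> exists i, `|h - u' i| <= e.

Lemma norm_of_hdot (x : H) (y : H') : hdot x x = hdot y y -> `|x| = `|y|.
Proof. by rewrite !hdot_norm => /eqP; rewrite eqrXn2 // => /eqP. Qed.

Lemma gram_comb (a : R) l i j : `|u l - (a *: u i + u j)| = `|u' l - (a *: u' i + u' j)|.
Proof.
by apply: norm_of_hdot; rewrite !hdotE !gram.
Qed.

Lemma gram_norm i : `|u i| = `|u' i|.
Proof. by apply: norm_of_hdot; rewrite gram. Qed.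

Lemma gram_dist i j : `|u i - u j| = `|u' i - u' j|.
Proof. by apply: norm_of_hdot; rewrite !hdotE !gram. Qed.

(** The map from u i to u' i preserves distances, so a sequence u (x_n) tending to h has a Cauchy
    image. Recording the distances of h' to all u' i characterises it without reference to the
    sequence. *)
Lemma gram_image h : exists h', forall i, `|u' i - h'| = `|u i - h|.
Proof.
have [x _ xh] := @dense_sequence R H I setT u h (fun h e e0 => let: ex_intro i hi := du h e0 in ex_intro2 _ _ i Logic.I hi).
have cx : cauchy ((fun n => u' (x n)) @ \oo).
  apply/cauchyP => e e0; have e2 : 0 < e / 2 by rewrite divr_gt0.
  have /cvgrPdist_lt/(_ _ e2)[N _ hN] := xh; exists (u' (x N)), N => // n /= Nn.
  rewrite -ball_normE /ball_ /= -gram_dist [e]splitr.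
  have -> : u (x N) - u (x n) = - (h - u (x N)) + (h - u (x n)) by rewrite opprB addrA subrK.
  apply: le_lt_trans (ler_normD _ _) _; rewrite normrN; apply: ltrD; apply: hN => //=.
move/cauchy_cvgP/cvg_ex: cx => [h' xh'].
exists h' => i.
have c1 : (fun n => `|u' i - u' (x n)|) @ \oo --> `|u' i - h'|.
  by apply: cvg_norm; apply: cvgB => //; exact: cvg_cst.
have c2 : (fun n => `|u' i - u' (x n)|) @ \oo --> `|u i - h|.
  rewrite (_ : (fun n => _) = (fun n => `|u i - u (x n)|)); last by apply/funext => n; rewrite gram_dist.
  by apply: cvg_norm; apply: cvgB => //; exact: cvg_cst.
exact: norm_cvg_unique c1 c2.
Qed.

Lemma gram_image_unique h h1 h2 : (forall i, `|u' i - h1| = `|u i - h|) ->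
  (forall i, `|u' i - h2| = `|u i - h|) -> h1 = h2.
Proof.
move=> e1 e2; apply/eqP; rewrite -subr_eq0; apply/eqP/(@small_norm_eq0 _ _ _ 2) => e e0.
have [i hi] := du' h1 e0.
have -> : h1 - h2 = (h1 - u' i) + (u' i - h2) by rewrite addrA subrK.
apply: le_trans (ler_normD _ _) _; rewrite e2 -e1 -normrN opprB.
by rewrite mulr_natl mulr2n; apply: lerD; rewrite // -normrN opprB.
Qed.

Definition gram_map (h : H) : H' := projT1 (cid (gram_image h)).

Lemma gram_mapP h i : `|u' i - gram_map h| = `|u i - h|.
Proof. by rewrite /gram_map; case: cid. Qed.

Lemma gram_map_linear : linear gram_map.
Proof.
(* The three estimates below add up to e + (e + |a| e + e) + (|a| e + e), which is 2 (2 + |a|) e. *)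
move=> a h k; apply/eqP; rewrite -subr_eq0; apply/eqP/(@small_norm_eq0 _ _ _ (2 * (2 + `|a|))) => e e0.
have [i hi] := du h e0; have [j hj] := du k e0; have [l hl] := du (a *: h + k) e0.
set P := gram_map (a *: h + k); set p := gram_map h; set q := gram_map k.
set b := a *: u' i + u' j.
have e1 : a *: (u' i - p) + (u' j - q) = b - (a *: p + q) by rewrite scalerBr opprD addrACA.
have -> : P - (a *: p + q) = (P - u' l) + (u' l - b) + (a *: (u' i - p) + (u' j - q)).
  by rewrite e1 [P - u' l + (u' l - b)]addrA subrK addrA subrK.
have b1 : `|P - u' l| <= e by rewrite distrC gram_mapP distrC.
have b2 : `|u' l - b| <= e + (`|a| * e + e).
  rewrite -gram_comb.
  have -> : u l - (a *: u i + u j) = (u l - (a *: h + k)) + (a *: (h - u i) + (k - u j)).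
    have -> : a *: (h - u i) + (k - u j) = (a *: h + k) - (a *: u i + u j) by rewrite scalerBr opprD addrACA.
    by rewrite addrA subrK.
  apply: le_trans (ler_normD _ _) _; apply: lerD; first by rewrite distrC.
  by apply: le_trans (ler_normD _ _) _; apply: lerD => //; rewrite normrZ ler_wpM2l.
have b3 : `|a *: (u' i - p) + (u' j - q)| <= `|a| * e + e.
  apply: le_trans (ler_normD _ _) _; rewrite normrZ !gram_mapP.
  by apply: lerD; [rewrite ler_wpM2l // distrC|rewrite distrC].
apply: le_trans (ler_normD _ _) (le_trans (lerD (le_trans (ler_normD _ _) (lerD b1 b2)) b3) _).
by rewrite le_eqVlt; apply/orP; left; apply/eqP; ring.
Qed.

Lemma gram_map_norm h : `|gram_map h| = `|h|.
Proof.
apply/eqP; rewrite -subr_eq0; apply/eqP/(@small_norm_eq0 R R _ 2) => e e0.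
have [i hi] := du h e0.
have -> : `|gram_map h| - `|h| = (`|gram_map h| - `|u' i|) + (`|u i| - `|h|).
  by rewrite gram_norm addrA subrK.
apply: le_trans (ler_normD _ _) _; rewrite mulr_natl mulr2n; apply: lerD.
  by apply: le_trans (ler_dist_dist _ _) _; rewrite distrC gram_mapP distrC.
by apply: le_trans (ler_dist_dist _ _) _; rewrite distrC.
Qed.
End GramIsometry.

Lemma isometric_of_gram (R : realType) (H H' : realHilbert R) (I : Type) (u : I -> H) (u' : I -> H') :
  (forall i j, hdot (u i) (u j) = hdot (u' i) (u' j)) ->
  (forall h e, 0 < e -> exists i, `|h - u i| <= e) ->
  (forall h e, 0 < e -> exists i, `|h - u' i| <= e) -> isometric H H'.
Proof.
move=> gram du du'; have gram' i j : hdot (u' i) (u' j) = hdot (u i) (u j) by rewrite gram.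
exists (mk_linear (gram_map_linear gram du)); split; last exact: gram_map_norm.
exists (gram_map gram' du') => [h|h'] /=.
  apply: (@gram_image_unique _ _ _ _ u' u du (gram_map gram du h)) => i.
    exact: gram_mapP.
  by rewrite gram_mapP.
apply: (@gram_image_unique _ _ _ _ u u' du' (gram_map gram' du' h')) => i.
  exact: gram_mapP.
by rewrite gram_mapP.
Qed.

(** * The real Hilbert space generated by V *)

Section HilbertCompletion.
Variables (R : realType) (A : starProbSpace R) (V : set A).
Local Notation C := R[i].
Hypothesis V_subspace : real_subspace V.
Hypothesis Vsa : forall v, V v -> star v = v.
Hypothesis V_real : forall a b, V a -> V b -> phi (a * b) \is Num.real.

Definition state_form (x y : A) : C := phi (star x * y).

Lemma state_form_linear x a y y' : state_form x (a *: y + y') = a * state_form x y + state_form x y'.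
Proof. by rewrite /state_form mulrDr -scalerAr; exact: linearP. Qed.

Lemma state_form_antilinear y a x x' :
  state_form (a *: x + x') y = a^* * state_form x y + state_form x' y.
Proof. by rewrite /state_form star_antilinear mulrDl -scalerAl; exact: linearP. Qed.

Lemma state_form_ge0 x : 0 <= state_form x x. Proof. exact: phi_ge0. Qed.

Local Notation snorm := (form_norm state_form).

Definition covar (v w : A) : R := complex.Re (phi (v * w)).

Lemma covarE v w : V v -> covar v w = complex.Re (state_form v w).
Proof. by move=> Vv; rewrite /state_form Vsa. Qed.

Lemma covar_combr v a w w' : covar v (a%:C%C *: w + w') = a * covar v w + covar v w'.
Proof.
rewrite /covar mulrDr -scalerAr (_ : phi _ = a%:C%C * (phi (v * w) : C) + (phi (v * w') : C)); last exact: linearP.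
by case: (phi (v * w)) => x1 x2; case: (phi (v * w')) => y1 y2 /=; rewrite mul0r subr0.
Qed.

Lemma covarC v w : V v -> V w -> covar v w = covar w v.
Proof.
move=> Vv Vw; rewrite !covarE //.
have := psd_herm w v (psd_sesquilinear state_form_antilinear state_form_linear state_form_ge0).
by move=> ->; case: (state_form w v).
Qed.

Lemma phi_covar v w : V v -> V w -> phi (v * w) = (covar v w)%:C%C.
Proof. by move=> Vv Vw; rewrite /covar RRe_real // V_real. Qed.

Lemma covar_self v : V v -> covar v v = snorm v ^+ 2.
Proof. by move=> Vv; rewrite covarE // (form_norm_sqr state_form_ge0). Qed.

Definition unit_ball : Type := {y : A | V y /\ snorm y <= 1}.

Definition covar_member : set (unit_ball -> R) :=
  [set f | exists v, V v /\ f = fun y => covar (sval y) v].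

Lemma covar_member0 : covar_member (fun=> 0).
Proof.
exists 0; split; first by have [] := V_subspace.
by apply/funext => y; rewrite /covar mulr0 linear0.
Qed.

Lemma covar_member_comb a f g : covar_member f -> covar_member g ->
  covar_member (fun i => a * f i + g i).
Proof.
have [_ Vsub] := V_subspace.
move=> [v [Vv ->]] [w [Vw ->]]; exists (a%:C%C *: v + w); split; first exact: Vsub.
by apply/funext => y; rewrite covar_combr.
Qed.

Lemma covar_bound (y : unit_ball) v : `|covar (sval y) v| <= snorm v.
Proof.
case: y => y [Vy y1] /=; rewrite covarE //; apply: le_trans (Re_le_normc _) _.
apply: le_trans (form_cauchy_schwarz state_form_antilinear state_form_linear state_form_ge0 _ _) _.
by apply: le_trans (ler_wpM2r (form_norm_ge0 _ _) y1) _; rewrite mul1r.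
Qed.

Lemma covar_member_bounded f : covar_member f -> exists M, forall i, `|f i| <= M.
Proof. by move=> [v [_ ->]]; exists (snorm v) => y; exact: covar_bound. Qed.

Definition covar_family : family (real_valued R) :=
  @Family R (real_valued R) unit_ball covar_member covar_member0 covar_member_comb covar_member_bounded.

Definition gns_space : completeNormedModType R := complete_uniform_closure covar_family.

Lemma covar_mem v : V v -> member covar_family (fun y => covar (sval y) v).
Proof. by move=> Vv; exists v. Qed.

Definition gns (v : A) : gns_space :=
  match pselect (V v) with left Vv => uc_of (covar_mem Vv) | right _ => 0 end.

Lemma gnsE v y : V v -> (gns v : uniform_closure covar_family) y = covar (sval y) v.
Proof. by move=> Vv; rewrite /gns; case: pselect. Qed.

Lemma gns_linear a v w : V v -> V w -> gns (a%:C%C *: v + w) = a *: gns v + gns w.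
Proof.
have [_ Vsub] := V_subspace; move=> Vv Vw; apply: val_inj; apply/funext => y.
rewrite [LHS](gnsE y (Vsub a _ _ Vv Vw)) covar_combr.
by rewrite -(gnsE y Vv) -(gnsE y Vw).
Qed.

(** The supremum over the unit ball is attained at v divided by its norm. *)
Lemma gns_norm v : V v -> `|gns v| = snorm v.
Proof.
move=> Vv; rewrite [LHS](uc_normE (gns v : uniform_closure covar_family)) /=.
apply/eqP; rewrite eq_le; apply/andP; split.
  apply: supnrm_le => [|y]; first exact: form_norm_ge0.
  by rewrite gnsE //; exact: covar_bound.
set n := snorm v; have n0 : 0 <= n by exact: form_norm_ge0.
case: (eqVneq n 0) => [->|nz]; first exact: supnrm_ge0.
have [V0 Vsub] := V_subspace.
have Vy : V ((n^-1)%:C%C *: v) by have := Vsub n^-1 _ _ Vv V0; rewrite addr0.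
have y1 : snorm ((n^-1)%:C%C *: v) <= 1.
  rewrite (form_normZ state_form_antilinear state_form_linear state_form_ge0).
  by rewrite normc_real ger0_norm ?invr_ge0 // mulVf.
apply: le_trans (supnrm_ub (gns v : uniform_closure covar_family) (exist _ _ (conj Vy y1))).
rewrite gnsE // [sval _]/= covarC // -[_ *: v]addr0 covar_combr.
have -> : covar v 0 = 0 by rewrite /covar mulr0 linear0.
rewrite addr0 covar_self // -/n expr2 mulrA mulVf // mul1r.
exact: ler_norm.
Qed.

Lemma gns_dense (f : gns_space) e : 0 < e -> exists2 v, V v & `|f - gns v| <= e.
Proof.
move=> e0; have [g [mg hg]] := uc_dense (f : uniform_closure covar_family) e0.
have [v [Vv eg]] := mg; exists v => //.
rewrite [leLHS](uc_normE (f - gns v : uniform_closure covar_family)); apply: le_trans hg.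
rewrite le_eqVlt; apply/orP; left; apply/eqP; congr (supnrm (f - _)).
by apply: val_inj; apply/funext => y; rewrite [LHS](gnsE y Vv) /= eg.
Qed.

(** Polarization: the uniform closure carries only a norm. Symmetry is then evident, and linearity
    is inherited from V by density in [gns_dot_linear]. *)
Definition gns_dot (f g : gns_space) : R := (`|f + g| * `|f + g| - `|f - g| * `|f - g|) / 4.

Lemma gns_dotC f g : gns_dot f g = gns_dot g f.
Proof. by rewrite /gns_dot [f + g]addrC [`|f - g|]distrC. Qed.

Lemma gns_dot_norm f : gns_dot f f = `|f| ^+ 2.
Proof. by rewrite /gns_dot subrr normr0 -mulr2n normrMn mulr2n; field. Qed.

Lemma gns_gram v w : V v -> V w -> gns_dot (gns v) (gns w) = covar v w.
Proof.
have [V0 Vsub] := V_subspace; move=> Vv Vw.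
have VD : V (v + w) by have := Vsub 1 _ _ Vv Vw; rewrite scale1r.
have VB : V (v - w) by have := Vsub (-1) _ _ Vw Vv; rewrite rmorphN1 scaleN1r addrC.
have gD : gns v + gns w = gns (v + w) by have := gns_linear 1 Vv Vw; rewrite !scale1r.
have gB : gns v - gns w = gns (v - w).
  by have := gns_linear (-1) Vw Vv; rewrite rmorphN1 !scaleN1r addrC => ->; rewrite addrC.
rewrite /gns_dot gD gB !gns_norm // -!expr2 -!covar_self // /covar.
have -> : (v + w) * (v + w) = v * v + w * w + (v * w + w * v).
  by rewrite mulrDl !mulrDr [X in _ + X]addrC addrACA.
have -> : (v - w) * (v - w) = v * v + w * w - (v * w + w * v).
  by rewrite mulrDl !mulrDr !mulNr !mulrN opprK [X in _ + X]addrC addrACA -opprD.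
have := covarC Vv Vw; rewrite /covar.
have phiD x y : (phi (x + y) : C) = (phi x : C) + (phi y : C) by exact: linearD.
have phiN x : (phi (- x) : C) = - (phi x : C) by exact: linearN.
rewrite !phiD !phiN !phiD.
case: (phi (v * v)) (phi (w * w)) (phi (v * w)) (phi (w * v)) => [a1 a2] [b1 b2] [c1 c2] [d1 d2] /= ->.
by field.
Qed.

Lemma gns_dot_cvg (x y : nat -> gns_space) f g : x @ \oo --> f -> y @ \oo --> g ->
  (fun n => gns_dot (x n) (y n)) @ \oo --> gns_dot f g.
Proof.
move=> xf yg; apply: cvgM; last exact: cvg_cst.
have c1 : (fun n => `|x n + y n|) @ \oo --> `|f + g| by apply: cvg_norm; exact: cvgD.
have c2 : (fun n => `|x n - y n|) @ \oo --> `|f - g| by apply: cvg_norm; exact: cvgB.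
exact: cvgB (cvgM c1 c1) (cvgM c2 c2).
Qed.

Lemma gns_dot_linear g a f f' : gns_dot (a *: f + f') g = a * gns_dot f g + gns_dot f' g.
Proof.
have [_ Vsub] := V_subspace.
have [x Vx xf] := dense_sequence f gns_dense; have [x' Vx' xf'] := dense_sequence f' gns_dense.
have [y Vy yg] := dense_sequence g gns_dense.
have c1 : (fun n => gns_dot (a *: gns (x n) + gns (x' n)) (gns (y n))) @ \oo --> gns_dot (a *: f + f') g.
  apply: gns_dot_cvg => //; apply: cvgD => //; apply: cvgZ => //; exact: cvg_cst.
have c2 : (fun n => a * gns_dot (gns (x n)) (gns (y n)) + gns_dot (gns (x' n)) (gns (y n))) @ \oo
    --> a * gns_dot f g + gns_dot f' g.
  by apply: cvgD; [apply: cvgM; [exact: cvg_cst|exact: gns_dot_cvg]|exact: gns_dot_cvg].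
apply: (@norm_cvg_unique R R _ _ _ _ c1).
rewrite (_ : (fun n => _) = (fun n => a * gns_dot (gns (x n)) (gns (y n)) + gns_dot (gns (x' n)) (gns (y n)))) //.
apply/funext => n; rewrite -gns_linear // !gns_gram //; last exact: Vsub.
by rewrite covarC ?covar_combr //; [congr (_ * _ + _); exact: covarC|exact: Vsub].
Qed.

Definition gns_hilbert : realHilbert R := RealHilbert gns_dotC gns_dot_linear gns_dot_norm.

Lemma gns_hilbert_gram v w : V v -> V w ->
  phi (v * w) = (hdot (gns v : gns_hilbert) (gns w))%:C%C.
Proof. by move=> Vv Vw; rewrite phi_covar // -gns_gram. Qed.
End HilbertCompletion.

(** * The equivalence *)

Section Approximation.
Variables (R : realType) (A : starProbSpace R) (V : set A) (H : realHilbert R) (eta : A -> H).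
Local Notation C := R[i].
Local Notation K := (compacts R).
Local Notation HC := (complexification H).
Local Notation F := (fock (scalar_data H)).
Local Notation TF := (tensor K F).
Local Notation D := (compact_data H).
Local Notation vac1 := (@vac R (scalar_data H) 1).
Local Notation cre e := (@creation R (scalar_data H) e).
Local Notation ann e := (@annihilation R (scalar_data H) e).
Local Notation sdot := (fun z w : F => @fock_dot R (scalar_data H) z w : C).
Local Notation slin := (@sdot_linear R H).
Local Notation sherm := (@sdot_herm R H).
Local Notation spsd := (@sdot_psd R H).
Local Notation gpoly := (gpoly V eta).
Local Notation rep_symb := (rep_symb V eta).

Section Dense.
Hypothesis eta_dense : forall h e, 0 < e -> exists2 v, V v & `|h - eta v| <= e.

Lemma fock_norm0 : fock_norm (0 : F) = 0.
Proof.
have := fock_normZ 0 (0 : F); rewrite scaler0 => ->.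
have -> : normc (0 : C) = 0 by rewrite (normc_real (0 : R)) normr0.
exact: mul0r.
Qed.

(** The trailing factor k, already a polynomial in the vectors [eta v], makes composition tractable:
    h k Omega is approximated by some k1 Omega, then g k1 Omega, and boundedness of g transports the
    first error. *)
Lemma galg_approx g x k e : galg g -> gpoly x k -> 0 < e ->
  exists x' k', gpoly x' k' /\ fock_norm (g (k vac1) - k' vac1) <= e.
Proof.
move=> gg; elim: gg x k e => {g} [|h|a g h gg IH hh IH'|g h gg IH hh IH'] x k e hk e0.
- by exists x, k; split=> //; rewrite subrr; have := fock_norm0 => ->; exact: ltW.
- set N := fock_norm (k vac1); have N0 : 0 <= N by exact: fock_norm_ge0.
  have c0 : 0 < 2 * (N + 1) by rewrite mulr_gt0 // ltr_wpDl.
  have [v Vv hv] := eta_dense h (divr_gt0 e0 c0).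
  exists (v * x), (G0 (eta v) \o k); split; first exact/gpoly_mul/hk/gpoly_var.
  have -> : G0 h (k vac1) - (G0 (eta v) \o k) vac1 = G0 (h - eta v) (k vac1).
    by have := G0_comb (-1) (eta v) h (k vac1); rewrite rmorphN1 !scaleN1r addrC => ->; rewrite addrC.
  apply: le_trans (fock_norm_G0 _ _) _; rewrite -/N.
  apply: le_trans (_ : 2 * (e / (2 * (N + 1))) * N <= e).
    by apply: ler_wpM2r => //; apply: ler_wpM2l.
  have N1 : 0 < N + 1 by rewrite ltr_wpDl.
  rewrite (_ : _ * N = e * (N / (N + 1))); last by field; rewrite gt_eqF.
  by rewrite ger_pMr // ler_pdivrMr // mul1r lerDl.
- have c0 : 0 < normc a + 1 by rewrite ltr_wpDl ?normc_ge0.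
  have [x1 [k1 [h1 b1]]] := IH x k _ hk (divr_gt0 (divr_gt0 e0 (ltr0Sn _ 1)) c0).
  have [x2 [k2 [h2 b2]]] := IH' x k _ hk (divr_gt0 e0 (ltr0Sn _ 1)).
  exists (a *: x1 + x2), (a *: k1 + k2); split; first exact: gpoly_lin.
  have -> : (a *: g + h) (k vac1) - (a *: k1 + k2) vac1 =
      a *: (g (k vac1) - k1 vac1) + (h (k vac1) - k2 vac1).
    by rewrite !fctE scalerBr opprD addrACA.
  apply: le_trans (fock_normD _ _) _; rewrite [e]splitr fock_normZ; apply: lerD => //.
  apply: le_trans (ler_wpM2l (normc_ge0 a) b1) _.
  by rewrite mulrCA ger_pMr ?divr_gt0 // ler_pdivrMr // mul1r lerDl.
- have [M M0 bM] := galg_bounded gg.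
  have c0 : 0 < M + 1 by rewrite ltr_wpDl.
  have [x1 [k1 [h1 b1]]] := IH' x k _ hk (divr_gt0 (divr_gt0 e0 (ltr0Sn _ 1)) c0).
  have [x2 [k2 [h2 b2]]] := IH x1 k1 _ h1 (divr_gt0 e0 (ltr0Sn _ 1)).
  exists x2, k2; split=> //.
  have -> : (g \o h) (k vac1) - k2 vac1 = g (h (k vac1) - k1 vac1) + (g (k1 vac1) - k2 vac1).
    by rewrite /= (linear_lfB (galg_linear gg)) addrA subrK.
  apply: le_trans (fock_normD _ _) _.
  have b3 := le_trans (bM (h (k vac1) - k1 vac1)) (ler_wpM2l M0 b1).
  apply: le_trans (lerD b3 b2) _; rewrite [leRHS]splitr lerD2r.
  by rewrite mulrCA ger_pMr ?divr_gt0 // ler_pdivrMr // mul1r lerDl.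
Qed.

Lemma symb_approx T z e : symb T z -> 0 < e ->
  exists X U w, rep_symb X U w /\ knorm sdot (z - w) <= e.
Proof.
move=> h; elim: h e => {T z} [S g gg|a T T' z z' _ IH _ IH'] e e0.
- have c0 : 0 < opnorm S + 1 by rewrite ltr_wpDl ?opnorm_ge0.
  have [x [k [hk bk]]] := galg_approx gg (gpoly_one V eta) (divr_gt0 e0 c0).
  exists (tens S x), (amp S k), (tens S (k vac1)); split; first exact: rep_symb_tens.
  rewrite -(linear_lfB (tens_linr S)); apply: le_trans (knorm_tens slin sherm spsd _ _) _.
  apply: le_trans (ler_wpM2l (opnorm_ge0 S) bk) _.
  by rewrite mulrCA ger_pMr // ler_pdivrMr // mul1r lerDl.
- have c0 : 0 < normc a + 1 by rewrite ltr_wpDl ?normc_ge0.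
  have [X [U [w [hX b1]]]] := IH _ (divr_gt0 (divr_gt0 e0 (ltr0Sn _ 1)) c0).
  have [Y [U' [w' [hY b2]]]] := IH' _ (divr_gt0 e0 (ltr0Sn _ 1)).
  exists (a *: X + Y), (a *: U + U'), (a *: w + w'); split; first exact: rep_symb_lin.
  have -> : a *: z + z' - (a *: w + w') = a *: (z - w) + (z' - w').
    by rewrite scalerBr opprD addrACA.
  apply: le_trans (knormD slin sherm spsd _ _) _.
  have b3 := le_trans (knormZ slin sherm spsd a (z - w)) (ler_wpM2l (normc_ge0 a) b1).
  apply: le_trans (lerD b3 b2) _; rewrite [leRHS]splitr lerD2r.
  by rewrite mulrCA ger_pMr ?divr_gt0 // ler_pdivrMr // mul1r lerDl.
Qed.

Lemma rep_symb_rep X T z : rep_symb X T z -> rep V eta X T.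
Proof. by elim=> *; [exact: rep_tens|exact: rep_lin]. Qed.

Lemma normB_sub (T : frakB H) T' z (U : frakB H) U' w :
  symb T' z -> frakB_val T = transport T' -> symb U' w -> frakB_val U = transport U' ->
  normB (T - U) = knorm sdot (z - w).
Proof.
move=> hT eT hU eU; have h := symb_lin (-1) hU hT.
have := normBE (T := -1 *: U + T) h; rewrite !scaleN1r ![- _ + _]addrC; apply.
have -> : frakB_val (T - U) = -1 *: frakB_val U + frakB_val T by rewrite scaleN1r addrC.
by rewrite eT eU -transport_comb scaleN1r addrC.
Qed.

Section Represented.
Hypothesis Vsa : forall v, V v -> star v = v.
Hypothesis W : wick V eta.

Lemma repr_dense (T : frakB H) e : 0 < e -> exists x, normB (T - repr Vsa W x) <= e.
Proof.
move=> e0; have [T' [z [hT eT]]] := polyG_represented (asboolW (frakBP T)).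
have [X [U [w [hX b]]]] := symb_approx hT e0.
have [x [ex hx]] := rep_extends (fun v _ => erefl) (repr_extends Vsa W) (rep_symb_rep hX).
exists x; rewrite (normB_sub hT eT (rep_symb_symb hX)) //.
by apply/funext => y; rewrite /transport -hx identK.
Qed.

(** The completion of the polynomial algebra is realized on the space of [fock_completion H] itself,
    through [repr]. Density of the image makes this a completion, and the induced isomorphism is the
    identity. *)
Lemma represented_of_wick : real_subspace V ->
  (forall v w, V v -> V w -> phi (v * w) = (hdot (eta v) (eta w))%:C%C) -> represented_in V H.
Proof.
move=> Vsub gram; pose L := fock_completion H.
pose m : frakA V -> L := fun x => completion_map L (repr Vsa W x).
have ml : linear m by move=> a x y; rewrite /m !linearP.
have mn x : `|mk_linear ml x| = (normA x)%:C%C by rewrite [LHS](completion_norm L) repr_norm.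
have md : closure (range (mk_linear ml)) = setT.
  apply: (@dense_range R (complex_valued R) L) => y e e0; have e2 : 0 < e / 2 by rewrite divr_gt0.
  have [T hT] := range_dense (K := complex_valued R) y (completion_dense L) e2.
  have [x hx] := repr_dense T e2; exists x.
  have -> : y - mk_linear ml x = (y - completion_map L T) + completion_map L (T - repr Vsa W x).
    by rewrite linearB addrA subrK.
  apply: le_trans (ler_normD _ _) _; rewrite [e]splitr embD; apply: lerD; first exact: hT.
  by rewrite completion_norm; rewrite -[emb _ _]/((e / 2)%:C%C) lecR.
pose Abar : completion (@normA R A V) := Completion mn md.
exists (fun a => G0 (eta a)), (repr Vsa W), Abar, L, (mk_linear (@id_linear R L)).
split=> //.
- exact: eta_isometry.
- exact: repr_extends.
- by exists id.
Qed.
End Represented.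
End Dense.

(** The algebraic Fock space over [eta @] V[. Polynomials in the represented variables preserve it,
    so before closure their degree-one parts see only vectors of]eta @[V]. *)
Inductive vspan : F -> Prop :=
| vspan_vac : vspan vac1
| vspan_lin a f g : vspan f -> vspan g -> vspan (a *: f + g)
| vspan_creation v f : V v -> vspan f -> vspan (cre (to_complex (eta v)) f).

Lemma vspan0 : vspan 0.
Proof. by have := vspan_lin (-1) vspan_vac vspan_vac; rewrite scaleN1r addNr. Qed.

Lemma vspan_annihilation v f : vspan f -> vspan (ann (to_complex (eta v)) f).
Proof.
elim=> {f} [|a f g _ hf _ hg|w f _ hf _].
- by rewrite (annihilation_vac (scalar_laws H)); exact: vspan0.
- by rewrite (annihilation_linear (scalar_laws H)); exact: vspan_lin.
- rewrite scalar_annihilation_creation.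
  by have := vspan_lin (cdot (to_complex (eta v)) (to_complex (eta w))) hf vspan0; rewrite addr0.
Qed.

Lemma vspan_gpoly x g f : gpoly x g -> vspan f -> vspan (g f).
Proof.
move=> gx; elim: gx f => {x g} [//|v Vv|a x y g h _ IH _ IH'|x y g h _ IH _ IH'] f hf.
- have := vspan_lin 1 (vspan_annihilation v hf) (vspan_creation Vv hf).
  by rewrite scale1r.
- by rewrite !fctE; exact: vspan_lin (IH _ hf) (IH' _ hf).
- exact/IH/IH'.
Qed.

Lemma vspan_slice X T z : rep_symb X T z -> vspan (slice 0 0 z).
Proof.
elim=> {X T z} [S x g gx|a X Y T T' z z' _ hz _ hz'].
  rewrite sliceE; have := vspan_lin (l2val (S (l2delta R 0)) 0%N) (vspan_gpoly gx vspan_vac) vspan0.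
  by rewrite addr0.
by rewrite (slice_linear 0 0); exact: vspan_lin.
Qed.

Lemma degree1_creation (x : HC) f : degree1 (cre x f) = (vac_component f : C) *: x.
Proof.
move: f; apply: (@fock_eq _ (scalar_data H) _ (fun f => degree1 (cre x f)) (fun f => (vac_component f : C) *: x)).
- exact: linear_comp (@degree1_linear R H) (@cre_linear R H x).
- by move=> a f g; rewrite (@vac_component_linear R (scalar_data H) a f g) scalerDl scalerA.
- by move=> b; rewrite (creation_vac (scalar_laws H)) degree1_tens vac_component_vac.
- by move=> y s; rewrite (creation_tens (scalar_laws H)) degree1_tens vac_component_tens scale0r.
Qed.

Section Gram.
Hypothesis Vsub : real_subspace V.
Hypothesis gram : forall v w, V v -> V w -> phi (v * w) = (hdot (eta v) (eta w))%:C%C.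

Lemma eta_image_comb (a : R) h h' : (eta @` V) h -> (eta @` V) h' -> (eta @` V) (a *: h + h').
Proof.
have [_ Vc] := Vsub; move=> [v Vv <-] [w Vw <-]; exists (a%:C%C *: v + w); first exact: Vc.
by rewrite (eta_linear gram).
Qed.

Lemma eta_image0 : (eta @` V) 0.
Proof.
have [V0 _] := Vsub; have h0 : (eta @` V) (eta 0) by exists 0.
by have := eta_image_comb (-1) h0 h0; rewrite scaleN1r addNr.
Qed.

Lemma vspan_degree1 f : vspan f -> (eta @` V) (degree1 f).1 /\ (eta @` V) (degree1 f).2.
Proof.
have scal c (x : HC) : (eta @` V) x.1 -> (eta @` V) x.2 ->
    (eta @` V) (c *: x).1 /\ (eta @` V) (c *: x).2.
  case: c x => a b [x y] /= hx hy; split.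
    by rewrite -scaleNr; apply: eta_image_comb => //; have := eta_image_comb (- b) hy eta_image0; rewrite addr0.
  by apply: eta_image_comb => //; have := eta_image_comb b hx eta_image0; rewrite addr0.
elim=> {f} [|a f g _ [f1 f2] _ [g1 g2]|v f Vv _ _].
- by rewrite degree1_vac; split; exact: eta_image0.
- rewrite degree1_linear; have [h1 h2] := scal a _ f1 f2.
  by split; have := eta_image_comb 1 _ _; rewrite ?scale1r; [move=> /(_ _ _ h1 g1)|move=> /(_ _ _ h2 g2)]; rewrite scale1r.
- by rewrite degree1_creation; apply: scal; [exists v|exact: eta_image0].
Qed.
End Gram.
End Approximation.

Lemma represented_generators (R : realType) (A : starProbSpace R) (V : set A) (H : realHilbert R) :
  real_subspace V -> (forall v, V v -> star v = v) -> represented_in V H ->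
  exists eta : A -> H,
    [/\ forall v w, V v -> V w -> phi (v * w) = (hdot (eta v) (eta w))%:C%C, wick V eta
      & forall h e, 0 < e -> exists2 v, V v & `|h - eta v| <= e].
Proof.
move=> Vsub Vsa [psi [Psi [Ab [L [U [[_ psiV iso] ext bij Un comm]]]]]].
have /choice[eta heta] a : exists h : H, V a -> psi a = G0 h.
  by case: (pselect (V a)) => [/psiV[h ->]|nVa]; [exists h|exists 0].
have gram v w : V v -> V w -> phi (v * w) = (hdot (eta v) (eta w))%:C%C.
  by move=> Vv Vw; rewrite iso // !heta // -sdot_G0_vac.
have norms x : normA x = normB (Psi x).
  apply: (@emb_inj R (complex_valued R)); have := completion_norm Ab x.
  rewrite -Un comm completion_norm => h; exact: esym h.
have W : wick V eta := wick_of_extension heta ext norms.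
exists eta; split=> // h e e0.
pose E := matrix_unit R 0 0.
(* The operator E_00 (x) G_0(h) has the degree-one vector h in its symbol; surjectivity of U lets
   the polynomial algebra approximate it. *)
have sT : symb (amp E (G0 h)) (tens E (G0 h (@vac R (scalar_data H) 1))) := symb_tens E (galg_var h).
pose T := FrakB (asboolT (polyG_transport sT)).
have [Ui _ UiK] := bij.
have [a ha] := range_dense (K := complex_valued R) (Ui (completion_map L T)) (completion_dense Ab) e0.
have hTa : normB (T - Psi a) <= e.
  have := ha; rewrite -Un linearB UiK comm -linearB completion_norm => h1.
  by rewrite -lecR.
have [T' hT'] := polyKV_rep eta (asboolW (frakAP a)).
have [z hz] := rep_rep_symb hT'.
have [a' [ea ha']] := rep_extends heta ext hT'.
have aa : a' = a by apply: val_inj.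
have eP : frakB_val (Psi a) = transport T'.
  by apply/funext => y; rewrite /transport -ha' aa identK.
rewrite (normB_sub (T := T) sT erefl (rep_symb_symb hz) eP) in hTa.
have slin := @sdot_linear R H; have sherm := @sdot_herm R H.
have := le_trans (slice_norm slin sherm (@sdot_psd R H) 0 _) hTa.
set f := slice 0 0 _ => fe.
have [[v Vv ev] [w Vw ew]] := vspan_degree1 Vsub gram (vspan_slice hz).
have df : degree1 f = to_complex h - degree1 (slice 0 0 z).
  rewrite /f (linear_lfB (slice_linear 0 0)) (linear_lfB (@degree1_linear R H)); congr (_ - _).
  rewrite sliceE matrix_unitE l2deltaE eqxx scale1r l2deltaE eqxx scale1r.
  rewrite /G0 /gaussian fctE (annihilation_vac (scalar_laws H)) add0r degree1_creation.
  by rewrite vac_component_vac scale1r.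
(* As h is real, its distance to the real part [eta v] is at most its distance to the complex
   degree-one vector. *)
exists v => //; have := degree1_bound f; rewrite df cdotxx /= -ev.
move=> hb; rewrite -ler_sqr ?nnegrE //; last exact: ltW.
apply: le_trans (le_trans hb _); first by rewrite lerDl sqr_ge0.
have te : fock_norm f <= e := fe.
have := fock_norm_ge0 f; move: (fock_norm f) te => t te t0.
by rewrite ler_sqr ?nnegrE // ltW.
Qed.

Theorem theorem4p3 (R : realType) (A : starProbSpace R) (V : set A)
    (V_subspace : real_subspace V)
    (V_selfadjoint : forall v, V v -> star v = v)
    (V_real : forall a b, V a -> V b -> phi (a * b) \is Num.real) :
  (forall X : KA A, KV V X -> ka_star X = X -> K_semicircular X)
  <->
  (exists H : realHilbert R, represented_in V H /\
     forall H' : realHilbert R, represented_in V H' -> isometric H H').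
Proof.
split=> [semi|[H [repH _]]].
  pose H := gns_hilbert V_subspace V_selfadjoint.
  pose eta : A -> H := gns V_subspace V_selfadjoint.
  have gram v w : V v -> V w -> phi (v * w) = (hdot (eta v) (eta w))%:C%C.
    exact: gns_hilbert_gram.
  have dense (h : H) e : 0 < e -> exists2 v, V v & `|h - eta v| <= e by exact: gns_dense.
  have [V0 _] := V_subspace; have W := wick_of_semicircular gram semi V_selfadjoint V0.
  exists H; split=> [|H' repH']; first exact: (represented_of_wick dense V_selfadjoint W).
  have [eta' [gram' _ dense']] := represented_generators V_subspace V_selfadjoint repH'.
  apply: (@isometric_of_gram R H H' {v | V v} (fun v => eta (sval v)) (fun v => eta' (sval v))).
  - move=> [v Vv] [w Vw] /=; have := gram v w Vv Vw; rewrite gram' // => -[].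
    by move=> ->.
  - by move=> h e e0; have [v Vv hv] := dense h e e0; exists (exist _ v Vv).
  - by move=> h e e0; have [v Vv hv] := dense' h e e0; exists (exist _ v Vv).
have [eta [gram W _]] := represented_generators V_subspace V_selfadjoint repH.
exact: semicircular_of_wick gram W.
Qed.
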